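(* Let $f:\mathbf U\to\mathbf V$ be a map in the set-up (see context). Then the interior $\mathrm{int}\,\mathcal K_f$ contains no wandering components; that is, there is no component $K$ of $\mathrm{int}\,\mathcal K_f$ with $f^i(K)\cap f^j(K)=\emptyset$ for all $i\ne j\ge0$.
   Context: A map in the set-up: $\mathbf V=\bigsqcup_{i\in I}V_i$ is a disjoint union of finitely many Jordan domains in $\mathbb C$ with pairwise disjoint quasicircle boundaries; $\mathbf U$ is compactly contained in $\mathbf V$ and is a union of finitely many Jordan domains with pairwise disjoint closures; $f:\mathbf U\to\mathbf V$ is a proper holomorphic map all of whose critical points lie in $\mathcal K_f:=\{z\in\mathbf U: f^n(z)\in\mathbf U\ \forall n\ge0\}$, and each component of $\mathbf V$ contains at most one component of $\mathcal K_f$ containing critical points. $f$ maps each component of $\mathrm{int}\,\mathcal K_f$ onto a component of $\mathrm{int}\,\mathcal K_f$. *)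

(* Defs.v *)
From Stdlib Require Import Reals.
From Coquelicot Require Import Coquelicot.

Open Scope R_scope.

Definition cset := C -> Prop.

Definition subset (A B : cset) : Prop := forall z, A z -> B z.
Definition same_set (A B : cset) : Prop := forall z, A z <-> B z.

Definition cdisk (z : C) (r : R) : cset := fun w => Cmod (Cminus w z) < r.

Definition c_open (A : cset) : Prop :=
  forall z, A z -> exists e, 0 < e /\ subset (cdisk z e) A.

Definition c_interior (A : cset) : cset :=
  fun z => exists e, 0 < e /\ subset (cdisk z e) A.

Definition c_closure (A : cset) : cset :=
  fun z => forall e, 0 < e -> exists w, A w /\ Cmod (Cminus w z) < e.

Definition c_boundary (A : cset) : cset :=
  fun z => c_closure A z /\ ~ c_interior A z.

Definition c_bounded (A : cset) : Prop :=
  exists M, forall z, A z -> Cmod z <= M.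

Definition c_compact (K : cset) : Prop :=
  forall (I : Type) (O : I -> cset),
    (forall i, c_open (O i)) ->
    (forall z, K z -> exists i, O i z) ->
    exists l : list I, forall z, K z -> exists i, List.In i l /\ O i z.

Definition c_connected (A : cset) : Prop :=
  forall O1 O2 : cset, c_open O1 -> c_open O2 ->
    subset A (fun z => O1 z \/ O2 z) ->
    (forall z, ~ (A z /\ O1 z /\ O2 z)) ->
    subset A O1 \/ subset A O2.

Definition is_component (A K : cset) : Prop :=
  (exists z, K z) /\ subset K A /\ c_connected K /\
  (forall D, c_connected D -> subset K D -> subset D A -> subset D K).

Definition image (g : C -> C) (A : cset) : cset :=
  fun w => exists z, A z /\ g z = w.

Definition jordan_curve (J : cset) : Prop :=
  exists g : R -> C,
    (forall t e, 0 < e -> exists d, 0 < d /\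
        forall s, Rabs (s - t) < d -> Cmod (Cminus (g s) (g t)) < e) /\
    (forall t, g (t + 1) = g t) /\
    (forall s t, 0 <= s < 1 -> 0 <= t < 1 -> g s = g t -> s = t) /\
    same_set J (fun z => exists t, 0 <= t <= 1 /\ g t = z).

Definition jordan_domain (D : cset) : Prop :=
  exists J, jordan_curve J /\ c_bounded D /\
    is_component (fun z => ~ J z) D.

(* Metric definition of a quasiconformal homeomorphism of the plane:
   a homeomorphism phi with  sup_z limsup_{r->0} L(z,r)/l(z,r) < oo, where
   L(z,r) = max_{|w-z|=r} |phi w - phi z|, l(z,r) = min_{|w-z|=r} |phi w - phi z|. *)
Definition c_continuous (g : C -> C) : Prop :=
  forall z e, 0 < e -> exists d, 0 < d /\
    forall w, Cmod (Cminus w z) < d -> Cmod (Cminus (g w) (g z)) < e.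

Definition qc_homeomorphism (phi : C -> C) : Prop :=
  c_continuous phi /\
  (exists psi : C -> C, c_continuous psi /\
      (forall z, psi (phi z) = z) /\ (forall w, phi (psi w) = w)) /\
  (exists H : R, forall z, exists d, 0 < d /\
     forall r, 0 < r < d -> forall w1 w2,
       Cmod (Cminus w1 z) = r -> Cmod (Cminus w2 z) = r ->
       Cmod (Cminus (phi w1) (phi z)) <= H * Cmod (Cminus (phi w2) (phi z))).

Definition unit_circle : cset := fun z => Cmod z = 1.

Definition quasicircle (Q : cset) : Prop :=
  exists phi, qc_homeomorphism phi /\ same_set Q (image phi unit_circle).

Definition C_deriv (f : C -> C) (z l : C) : Prop :=
  forall e, 0 < e -> exists d, 0 < d /\
    forall w, 0 < Cmod (Cminus w z) < d ->
      Cmod (Cminus (Cdiv (Cminus (f w) (f z)) (Cminus w z)) l) < e.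

Definition holomorphic_on (f : C -> C) (A : cset) : Prop :=
  forall z, A z -> exists l, C_deriv f z l.

Definition critical_point (f : C -> C) (A : cset) (z : C) : Prop :=
  A z /\ C_deriv f z (RtoC 0).

Definition proper_map (f : C -> C) (A B : cset) : Prop :=
  (forall z, A z -> B (f z)) /\
  (forall K, c_compact K -> subset K B ->
     c_compact (fun z => A z /\ K (f z))).

Definition filled_julia (f : C -> C) (U : cset) : cset :=
  fun z => U z /\ forall n : nat, U (Nat.iter n f z).

Definition union_below (n : nat) (W : nat -> cset) : cset :=
  fun z => exists i, (i < n)%nat /\ W i z.

(* Main.v *)
(* The proof replaces quasiconformal deformations by infinitesimal ones. Let [W] be a wandering component.
   After discarding finitely many iterates, [f] has no critical points on the forward orbit of [W]; the components
   are full, so [f] is injective on them by monodromy, and all inverse branches [g_p] of iterates along the grand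
   orbit of a point [w0] of [W] are injective on a common disk [D], with pairwise disjoint images. Koebe distortion
   and disjointness of the images make [sum_p |g_p'(w)|^2] converge for [w] in [D], so that
   [m_w (q) = sum_p g_p'(w)^2 q(g_p(w))] is an [f]-invariant functional on quadratic differentials [q], i.e.
   [m_w (q) = m_w (f_* q)]. The transfer operator [f_*] (corrected at the critical points by division with
   remainder) is compact on holomorphic functions on [U], so finitely many linear conditions force an invariant
   functional to kill all [1/(z-a)] with [a] off the filled Julia set. As [D] contains infinitely many points [w],
   some nontrivial combination [m = sum_i c_i m_{w_i}] satisfies them. The potential [a |-> m (1/(z-a))] then
   vanishes off the filled Julia set; its partial sums are uniformly small on the boundary of [W] but have
   residues [c_i] at the [w_i], contradicting the maximum principle. *)

Require Import Defs.
From Stdlib Require Import Reals Lra Lia Classical ClassicalEpsilon List ZArith FinFun Permutation FunctionalExtensionality PropExtensionality.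
From Coquelicot Require Import Coquelicot.
Open Scope R_scope.

(** * Complex differentiability *)

Bind Scope C_scope with C.
Arguments Cmod _%_C.
Arguments Re _%_C.
Arguments Im _%_C.

(** Point masses at [w], rather than Beltrami differentials spread over a disk, turn integrals into
    absolutely convergent sums and give the potential genuine poles at the chosen points; the
    contradiction lives on these poles. Compactness of [f_*] acts as follows. The image of the unit
    ball has a finite [/ 2]-net, and if [m] vanishes on the net, each use of [m (q) = m (f_* q)]
    halves the bound for [m]. The net depends on [f] alone, so the conditions are fixed before the
    points [w_i] are chosen. This settles differentials holomorphic on [U]; those holomorphic only
    near the filled Julia set are pushed forward until they are of that kind. Tested on [1/(z-a)],
    the sums over the grand orbit must have tails that are small uniformly in [a]. This comes from
    disjoint disks about the orbit points, with radii comparable to [|g_p'(w)|]: a discrete form of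
    the integrability of [1/|z-a|]. The monodromy argument uses fullness in the form that a bounded
    open set with boundary in the component lies in the component. Loops are lattice walks, and the
    squares around which they wind are found by counting crossings modulo 2. *)

Lemma Cmod_tri a b c : Cmod (a - c) <= Cmod (a - b) + Cmod (b - c).
Proof. replace (a - c)%C with ((a - b) + (b - c))%C by ring. apply Cmod_triangle. Qed.

Lemma Cmod_sym a b : Cmod (a - b) = Cmod (b - a).
Proof. rewrite <- (Cmod_opp (a - b)). f_equal. ring. Qed.

Lemma Cmod_sub_le a b : Cmod (a - b) <= Cmod a + Cmod b.
Proof. rewrite <- (Cmod_opp b). apply Cmod_triangle. Qed.

Lemma Cmod_diag a : Cmod (a - a) = 0.
Proof. replace (a - a)%C with (RtoC 0) by ring. apply Cmod_0. Qed.

Lemma Cmod_ge_sub a b : Cmod a - Cmod b <= Cmod (a - b).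
Proof.
  assert (H := Cmod_triangle (a - b) b).
  replace (a - b + b)%C with a in H by ring. lra.
Qed.

Lemma Cmod_pos_neq a b : 0 < Cmod (a - b) -> a <> b.
Proof. intros H ->. rewrite Cmod_diag in H. lra. Qed.

Lemma Cmod_neq_pos a b : a <> b -> 0 < Cmod (a - b).
Proof.
  intros H. apply Cmod_gt_0. intros H0. apply H.
  replace a with ((a - b) + b)%C by ring. rewrite H0. ring.
Qed.

Lemma Cmod_eq_of_small a b : (forall e, 0 < e -> Cmod (a - b) <= e) -> a = b.
Proof.
  intros H. apply NNPP. intros Hn. apply Cmod_neq_pos in Hn.
  specialize (H (Cmod (a - b) / 2)). lra.
Qed.

Lemma Cmod_RtoC_pos r : 0 <= r -> Cmod (RtoC r) = r.
Proof. intros H. rewrite Cmod_R. now apply Rabs_pos_eq. Qed.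

Lemma im_le_Cmod c : Rabs (Im c) <= Cmod c.
Proof. eapply Rle_trans; [apply Rmax_r | apply Rmax_Cmod]. Qed.

Lemma Cmod_le_ReIm c : Cmod c <= Rabs (Re c) + Rabs (Im c).
Proof.
  assert (H : c = (RtoC (Re c) + Ci * RtoC (Im c))%C).
  { destruct c as [x y]. unfold Re, Im, RtoC, Ci, Cplus, Cmult; simpl. f_equal; ring. }
  rewrite H at 1. eapply Rle_trans; [apply Cmod_triangle|].
  rewrite Cmod_mult, Cmod_Ci, !Cmod_R. lra.
Qed.

Lemma C_ext a b : Re a = Re b -> Im a = Im b -> a = b.
Proof. destruct a, b; simpl; intros; subst; reflexivity. Qed.

Definition ccont (F : C -> C) (z : C) : Prop :=
  forall e, 0 < e -> exists d, 0 < d /\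
    forall w, Cmod (w - z) < d -> Cmod (F w - F z) < e.

(** The increment form avoids division and includes [w = z], so sums, products and compositions need
    no case distinction. *)
Definition cder (F : C -> C) (z l : C) : Prop :=
  forall e, 0 < e -> exists d, 0 < d /\
    forall w, Cmod (w - z) < d -> Cmod (F w - F z - l * (w - z)) <= e * Cmod (w - z).

Definition pcont (g : R -> C) (t : R) : Prop :=
  forall e, 0 < e -> exists d, 0 < d /\
    forall s, Rabs (s - t) < d -> Cmod (g s - g t) < e.

Definition pder (g : R -> C) (t : R) (l : C) : Prop :=
  forall e, 0 < e -> exists d, 0 < d /\
    forall s, Rabs (s - t) < d -> Cmod (g s - g t - l * RtoC (s - t)) <= e * Rabs (s - t).

Lemma C_deriv_cder F z l : C_deriv F z l <-> cder F z l.
Proof.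
  split.
  - intros H e He. destruct (H e He) as [d [Hd H1]]. exists d; split; [easy|].
    intros w Hw. destruct (classic (w = z)) as [->|Hn].
    + replace (F z - F z - l * (z - z))%C with (RtoC 0) by ring. rewrite Cmod_diag, Cmod_0. lra.
    + assert (Hp := Cmod_neq_pos _ _ Hn). specialize (H1 w (conj Hp Hw)).
      assert (Hne : (w - z)%C <> 0%C) by (intros E; rewrite E, Cmod_0 in Hp; lra).
      replace (F w - F z - l * (w - z))%C with (((F w - F z) / (w - z) - l) * (w - z))%C
        by (field; exact Hne).
      rewrite Cmod_mult. apply Rmult_le_compat_r; lra.
  - intros H e He. destruct (H (e/2)) as [d [Hd H1]]; [lra|]. exists d; split; [easy|].
    intros w [Hp Hw]. specialize (H1 w Hw).
    assert (Hne : (w - z)%C <> 0%C) by (intros E; rewrite E, Cmod_0 in Hp; lra).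
    apply Rmult_lt_reg_r with (Cmod (w - z)); [easy|].
    rewrite <- Cmod_mult.
    replace (((F w - F z) / (w - z) - l) * (w - z))%C with (F w - F z - l * (w - z))%C
      by (field; exact Hne).
    nra.
Qed.

Lemma cder_lip F z l : cder F z l -> exists d, 0 < d /\
  forall w, Cmod (w - z) < d -> Cmod (F w - F z) <= (Cmod l + 1) * Cmod (w - z).
Proof.
  intros H. destruct (H 1 Rlt_0_1) as [d [Hd H1]]. exists d; split; [easy|].
  intros w Hw. specialize (H1 w Hw).
  assert (H2 := Cmod_triangle (F w - F z - l * (w - z)) (l * (w - z))).
  replace (F w - F z - l * (w - z) + l * (w - z))%C with (F w - F z)%C in H2 by ring.
  rewrite (Cmod_mult l) in H2. lra.
Qed.

Lemma cder_cont F z l : cder F z l -> ccont F z.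
Proof.
  intros H e He. destruct (cder_lip _ _ _ H) as [d [Hd H1]].
  assert (Hl := Cmod_ge_0 l).
  exists (Rmin d (e / (Cmod l + 1))). split.
  - apply Rmin_pos; [easy|]. apply Rdiv_lt_0_compat; lra.
  - intros w Hw. assert (Hw1 := Rlt_le_trans _ _ _ Hw (Rmin_l _ _)).
    assert (Hw2 := Rlt_le_trans _ _ _ Hw (Rmin_r _ _)).
    specialize (H1 w Hw1). eapply Rle_lt_trans; [exact H1|].
    apply Rmult_lt_reg_r with (/ (Cmod l + 1)); [apply Rinv_0_lt_compat; lra|].
    replace ((Cmod l + 1) * Cmod (w - z) * / (Cmod l + 1)) with (Cmod (w-z)) by (field; lra).
    exact Hw2.
Qed.

Lemma cder_ext_loc F G z l : (exists d, 0 < d /\ forall w, Cmod (w - z) < d -> F w = G w) ->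
  cder F z l -> cder G z l.
Proof.
  intros [d0 [Hd0 E]] H e He. destruct (H e He) as [d [Hd H1]].
  exists (Rmin d d0). split; [now apply Rmin_pos|]. intros w Hw.
  assert (Hw1 := Rlt_le_trans _ _ _ Hw (Rmin_l _ _)).
  assert (Hw2 := Rlt_le_trans _ _ _ Hw (Rmin_r _ _)).
  rewrite <- (E w), <- (E z); auto. rewrite Cmod_diag; lra.
Qed.

Lemma cder_ext F G z l : (forall w, F w = G w) -> cder F z l -> cder G z l.
Proof. intros E. apply cder_ext_loc. exists 1; split; [lra|auto]. Qed.

Lemma cder_val F z l l' : l = l' -> cder F z l -> cder F z l'.
Proof. intros ->; auto. Qed.

Lemma cder_unique F z l1 l2 : cder F z l1 -> cder F z l2 -> l1 = l2.
Proof.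
  intros H1 H2. apply Cmod_eq_of_small. intros e He.
  destruct (H1 (e/2)) as [d1 [Hd1 K1]]; [lra|]. destruct (H2 (e/2)) as [d2 [Hd2 K2]]; [lra|].
  set (r := Rmin d1 d2 / 2). assert (Hr : 0 < r) by (unfold r; assert (0 < Rmin d1 d2) by (now apply Rmin_pos); lra).
  assert (Hr1 : r < d1) by (unfold r in *; assert (Rmin d1 d2 <= d1) by apply Rmin_l; lra).
  assert (Hr2 : r < d2) by (unfold r in *; assert (Rmin d1 d2 <= d2) by apply Rmin_r; lra).
  set (w := (z + RtoC r)%C).
  assert (Ew : Cmod (w - z) = r).
  { unfold w. replace (z + RtoC r - z)%C with (RtoC r) by ring. apply Cmod_RtoC_pos; lra. }
  specialize (K1 w). specialize (K2 w). rewrite Ew in *.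
  specialize (K1 Hr1). specialize (K2 Hr2).
  assert (K := Cmod_tri ((l1)*(w-z)) (F w - F z) (l2 * (w-z))).
  rewrite (Cmod_sym (l1 * (w-z)) (F w - F z)) in K.
  replace (l1 * (w - z) - l2 * (w - z))%C with ((l1 - l2) * (w - z))%C in K by ring.
  rewrite Cmod_mult, Ew in K. apply Rmult_le_reg_r with r; [easy|]. lra.
Qed.

Lemma cder_const c z : cder (fun _ => c) z 0.
Proof.
  intros e He. exists 1; split; [lra|]. intros w _.
  replace (c - c - 0 * (w - z))%C with (RtoC 0) by ring. rewrite Cmod_0.
  apply Rmult_le_pos; [lra|apply Cmod_ge_0].
Qed.

Lemma cder_id z : cder (fun w => w) z 1.
Proof.
  intros e He. exists 1; split; [lra|]. intros w _.
  replace (w - z - 1 * (w - z))%C with (RtoC 0) by ring. rewrite Cmod_0.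
  apply Rmult_le_pos; [lra|apply Cmod_ge_0].
Qed.

Lemma cder_plus F G z l m : cder F z l -> cder G z m -> cder (fun w => F w + G w)%C z (l + m).
Proof.
  intros HF HG e He.
  destruct (HF (e/2)) as [d1 [Hd1 K1]]; [lra|]. destruct (HG (e/2)) as [d2 [Hd2 K2]]; [lra|].
  exists (Rmin d1 d2); split; [now apply Rmin_pos|]. intros w Hw.
  assert (Hw1 := Rlt_le_trans _ _ _ Hw (Rmin_l _ _)).
  assert (Hw2 := Rlt_le_trans _ _ _ Hw (Rmin_r _ _)).
  specialize (K1 w Hw1). specialize (K2 w Hw2).
  replace (F w + G w - (F z + G z) - (l + m) * (w - z))%C
    with ((F w - F z - l * (w - z)) + (G w - G z - m * (w - z)))%C by ring.
  eapply Rle_trans; [apply Cmod_triangle|]. lra.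
Qed.

Lemma cder_mult F G z l m : cder F z l -> cder G z m ->
  cder (fun w => F w * G w)%C z (l * G z + F z * m).
Proof.
  intros HF HG e He.
  destruct (cder_lip _ _ _ HF) as [d3 [Hd3 K3]].
  assert (Hl := Cmod_ge_0 l). assert (HGz := Cmod_ge_0 (G z)). assert (HFz := Cmod_ge_0 (F z)).
  destruct (HF (e/3/(Cmod (G z) + 1))) as [d1 [Hd1 K1]].
  { apply Rdiv_lt_0_compat; lra. }
  destruct (HG (e/3/(Cmod (F z) + 1))) as [d2 [Hd2 K2]].
  { apply Rdiv_lt_0_compat; lra. }
  destruct (cder_cont _ _ _ HG (e/3/(Cmod l + 1))) as [d4 [Hd4 K4]].
  { apply Rdiv_lt_0_compat; lra. }
  exists (Rmin (Rmin d1 d2) (Rmin d3 d4)).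
  assert (A1 := Rmin_l d1 d2). assert (A2 := Rmin_r d1 d2).
  assert (A3 := Rmin_l d3 d4). assert (A4 := Rmin_r d3 d4).
  assert (B1 := Rmin_l (Rmin d1 d2) (Rmin d3 d4)).
  assert (B2 := Rmin_r (Rmin d1 d2) (Rmin d3 d4)).
  split; [repeat apply Rmin_pos; easy|]. intros w Hw.
  specialize (K1 w ltac:(lra)). specialize (K2 w ltac:(lra)).
  specialize (K3 w ltac:(lra)). specialize (K4 w ltac:(lra)).
  replace (F w * G w - F z * G z - (l * G z + F z * m) * (w - z))%C
    with ((F w - F z - l * (w - z)) * G z + (F z * (G w - G z - m * (w - z)) + (F w - F z) * (G w - G z)))%C by ring.
  eapply Rle_trans; [apply Cmod_triangle|].
  eapply Rle_trans; [apply Rplus_le_compat_l, Cmod_triangle|].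
  rewrite !Cmod_mult.
  assert (Hh := Cmod_ge_0 (w - z)).
  assert (C1 : Cmod (F w - F z - l * (w - z)) * Cmod (G z) <= e / 3 * Cmod (w - z)).
  { apply Rle_trans with (e / 3 / (Cmod (G z) + 1) * Cmod (w - z) * (Cmod (G z) + 1)).
    - apply Rmult_le_compat; try apply Cmod_ge_0; try lra.
    - right. field. lra. }
  assert (C2 : Cmod (F z) * Cmod (G w - G z - m * (w - z)) <= e / 3 * Cmod (w - z)).
  { apply Rle_trans with ((Cmod (F z) + 1) * (e / 3 / (Cmod (F z) + 1) * Cmod (w - z))).
    - apply Rmult_le_compat; try apply Cmod_ge_0; try lra.
    - right. field. lra. }
  assert (C3 : Cmod (F w - F z) * Cmod (G w - G z) <= e / 3 * Cmod (w - z)).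
  { apply Rle_trans with ((Cmod l + 1) * Cmod (w - z) * (e / 3 / (Cmod l + 1))).
    - apply Rmult_le_compat; try apply Cmod_ge_0; try lra.
    - right. field. lra. }
  lra.
Qed.

Lemma cder_opp F z l : cder F z l -> cder (fun w => - F w)%C z (- l).
Proof.
  intros H e He. destruct (H e He) as [d [Hd K]]. exists d; split; [easy|].
  intros w Hw. specialize (K w Hw). rewrite <- Cmod_opp.
  replace (- (- F w - - F z - - l * (w - z)))%C with (F w - F z - l * (w - z))%C by ring. exact K.
Qed.

Lemma cder_minus F G z l m : cder F z l -> cder G z m -> cder (fun w => F w - G w)%C z (l - m).
Proof. intros HF HG. apply (cder_plus F (fun w => - G w)%C z l (-m)); [easy|now apply cder_opp]. Qed.

Lemma cder_scal c F z l : cder F z l -> cder (fun w => c * F w)%C z (c * l).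
Proof.
  intros H. eapply cder_val; [|apply (cder_mult (fun _ => c) F z 0 l); [apply cder_const|exact H]].
  simpl. ring.
Qed.

Lemma cder_comp F G z l m : cder G z m -> cder F (G z) l -> cder (fun w => F (G w)) z (l * m).
Proof.
  intros HG HF e He.
  destruct (cder_lip _ _ _ HG) as [d1 [Hd1 K1]].
  assert (Hl := Cmod_ge_0 l). assert (Hm := Cmod_ge_0 m).
  destruct (HF (e/2/(Cmod m + 1))) as [d2 [Hd2 K2]]; [apply Rdiv_lt_0_compat; lra|].
  destruct (HG (e/2/(Cmod l + 1))) as [d3 [Hd3 K3]]; [apply Rdiv_lt_0_compat; lra|].
  destruct (cder_cont _ _ _ HG d2 Hd2) as [d4 [Hd4 K4]].
  exists (Rmin d1 (Rmin d3 d4)). split; [repeat apply Rmin_pos; easy|]. intros w Hw.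
  assert (A1 := Rmin_l d1 (Rmin d3 d4)). assert (A2 := Rmin_r d1 (Rmin d3 d4)).
  assert (A3 := Rmin_l d3 d4). assert (A4 := Rmin_r d3 d4).
  specialize (K1 w ltac:(lra)). specialize (K3 w ltac:(lra)). specialize (K4 w ltac:(lra)).
  specialize (K2 _ K4).
  replace (F (G w) - F (G z) - l * m * (w - z))%C
   with ((F (G w) - F (G z) - l * (G w - G z)) + l * (G w - G z - m * (w - z)))%C by ring.
  eapply Rle_trans; [apply Cmod_triangle|]. rewrite (Cmod_mult l).
  assert (Hh := Cmod_ge_0 (w - z)).
  assert (C1 : Cmod (F (G w) - F (G z) - l * (G w - G z)) <= e / 2 * Cmod (w - z)).
  { eapply Rle_trans; [exact K2|].
    apply Rle_trans with (e / 2 / (Cmod m + 1) * ((Cmod m + 1) * Cmod (w - z))).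
    - apply Rmult_le_compat_l; [|easy]. apply Rlt_le, Rdiv_lt_0_compat; lra.
    - right. field. lra. }
  assert (C2 : Cmod l * Cmod (G w - G z - m * (w - z)) <= e / 2 * Cmod (w - z)).
  { apply Rle_trans with ((Cmod l + 1) * (e / 2 / (Cmod l + 1) * Cmod (w - z))).
    - apply Rmult_le_compat; try apply Cmod_ge_0; try lra.
    - right. field. lra. }
  lra.
Qed.

Lemma cder_inv_id (z : C) : z <> 0%C -> cder (fun w => / w)%C z (- / (z * z)).
Proof.
  intros Hz e He. assert (Hp := proj1 (Cmod_gt_0 z) Hz).
  set (A := Cmod z) in *.
  exists (Rmin (A / 2) (e * A ^ 3 / 2)). split.
  { apply Rmin_pos; [lra|]. apply Rdiv_lt_0_compat; [|lra]. apply Rmult_lt_0_compat; [lra|].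
    now apply pow_lt. }
  intros w Hw. assert (Hw1 := Rlt_le_trans _ _ _ Hw (Rmin_l _ _)).
  assert (Hw2 := Rlt_le_trans _ _ _ Hw (Rmin_r _ _)).
  assert (Hwp : A / 2 <= Cmod w).
  { assert (H := Cmod_ge_sub z w). rewrite Cmod_sym in H. fold A in H. lra. }
  assert (Hw0 : w <> 0%C) by (apply Cmod_gt_0; lra).
  replace (/ w - / z - - / (z * z) * (w - z))%C
    with ((w - z) * ((w - z) * / (w * (z * z))))%C by (field; auto).
  rewrite !Cmod_mult, Cmod_inv, !Cmod_mult.
  2:{ apply Cmult_neq_0; [easy|]. now apply Cmult_neq_0. }
  rewrite (Rmult_comm e). apply Rmult_le_compat_l; [apply Cmod_ge_0|]. fold A.
  assert (Hpos : 0 < Cmod w * (A * A)) by (repeat apply Rmult_lt_0_compat; lra).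
  apply Rmult_le_reg_r with (Cmod w * (A * A)); [easy|].
  rewrite Rmult_assoc, Rinv_l, Rmult_1_r; [|lra].
  apply Rle_trans with (e * A ^ 3 / 2); [lra|].
  replace (e * A ^ 3 / 2) with (e * ((A / 2) * (A * A))) by field.
  apply Rmult_le_compat_l; [lra|]. apply Rmult_le_compat_r; [|easy]. nra.
Qed.

Lemma cder_inv F z l : cder F z l -> F z <> 0%C -> cder (fun w => / F w)%C z (- l / (F z * F z)).
Proof.
  intros H Hz. eapply cder_val; [|apply (cder_comp (fun w => / w)%C F z (- / (F z * F z)) l H)].
  - field. easy.
  - now apply cder_inv_id.
Qed.

Lemma ccont_const c z : ccont (fun _ => c) z.
Proof. eapply cder_cont, cder_const. Qed.
Lemma ccont_id z : ccont (fun w => w) z.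
Proof. eapply cder_cont, cder_id. Qed.

Lemma ccont_plus F G z : ccont F z -> ccont G z -> ccont (fun w => F w + G w)%C z.
Proof.
  intros HF HG e He. destruct (HF (e/2)) as [d1 [Hd1 K1]]; [lra|].
  destruct (HG (e/2)) as [d2 [Hd2 K2]]; [lra|].
  exists (Rmin d1 d2); split; [now apply Rmin_pos|]. intros w Hw.
  specialize (K1 w (Rlt_le_trans _ _ _ Hw (Rmin_l _ _))).
  specialize (K2 w (Rlt_le_trans _ _ _ Hw (Rmin_r _ _))).
  replace (F w + G w - (F z + G z))%C with ((F w - F z) + (G w - G z))%C by ring.
  eapply Rle_lt_trans; [apply Cmod_triangle|]. lra.
Qed.

Lemma ccont_comp F G z : ccont G z -> ccont F (G z) -> ccont (fun w => F (G w)) z.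
Proof.
  intros HG HF e He. destruct (HF e He) as [d [Hd K]]. destruct (HG d Hd) as [d' [Hd' K']].
  exists d'; split; [easy|]. intros w Hw. apply K, K', Hw.
Qed.

Lemma ccont_mult F G z : ccont F z -> ccont G z -> ccont (fun w => F w * G w)%C z.
Proof.
  intros HF HG e He.
  assert (HGz := Cmod_ge_0 (G z)). assert (HFz := Cmod_ge_0 (F z)).
  destruct (HF (Rmin 1 (e/2/(Cmod (G z) + 1)))) as [d1 [Hd1 K1]].
  { apply Rmin_pos; [lra|]. apply Rdiv_lt_0_compat; lra. }
  destruct (HG (e/2/(Cmod (F z) + 1))) as [d2 [Hd2 K2]].
  { apply Rdiv_lt_0_compat; lra. }
  exists (Rmin d1 d2); split; [now apply Rmin_pos|]. intros w Hw.
  specialize (K1 w (Rlt_le_trans _ _ _ Hw (Rmin_l _ _))).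
  specialize (K2 w (Rlt_le_trans _ _ _ Hw (Rmin_r _ _))).
  assert (K3 := Rlt_le_trans _ _ _ K1 (Rmin_l _ _)).
  assert (K4 := Rlt_le_trans _ _ _ K1 (Rmin_r _ _)).
  assert (K5 : Cmod (F w) < Cmod (F z) + 1).
  { assert (T := Cmod_ge_sub (F w) (F z)). lra. }
  replace (F w * G w - F z * G z)%C with ((F w - F z) * G z + F w * (G w - G z))%C by ring.
  eapply Rle_lt_trans; [apply Cmod_triangle|]. rewrite !Cmod_mult.
  assert (Cmod (F w - F z) * Cmod (G z) <= e / 2).
  { apply Rle_trans with (e / 2 / (Cmod (G z) + 1) * (Cmod (G z) + 1)).
    - apply Rmult_le_compat; try apply Cmod_ge_0; lra.
    - right; field; lra. }
  assert (Cmod (F w) * Cmod (G w - G z) < e / 2).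
  { apply Rlt_le_trans with ((Cmod (F z) + 1) * (e / 2 / (Cmod (F z) + 1))).
    - apply Rmult_le_0_lt_compat; try apply Cmod_ge_0; lra.
    - right; field; lra. }
  lra.
Qed.

Lemma ccont_opp F z : ccont F z -> ccont (fun w => - F w)%C z.
Proof.
  intros H e He. destruct (H e He) as [d [Hd K]]. exists d; split; [easy|].
  intros w Hw. rewrite <- Cmod_opp. replace (- (- F w - - F z))%C with (F w - F z)%C by ring. auto.
Qed.

Lemma ccont_minus F G z : ccont F z -> ccont G z -> ccont (fun w => F w - G w)%C z.
Proof. intros HF HG. apply (ccont_plus F (fun w => - G w)%C z HF). now apply ccont_opp. Qed.

Lemma ccont_inv F z : ccont F z -> F z <> 0%C -> ccont (fun w => / F w)%C z.
Proof.
  intros HF H. apply (ccont_comp (fun w => / w)%C F z HF).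
  eapply cder_cont. now apply cder_inv_id.
Qed.

(* Coquelicot states equations over canonical structures on [R], which [ring] and [lra] do not see through. *)
Ltac asR := match goal with |- @eq _ ?x ?y => enough (@eq R x y) by assumption end.

(** * Integrals along segments *)

Definition CInt (f : R -> C) (a b : R) : C :=
  (RInt (fun t => Re (f t)) a b, RInt (fun t => Im (f t)) a b).

Lemma pcont_ReIm f t : pcont f t ->
  continuous (fun t => Re (f t)) t /\ continuous (fun t => Im (f t)) t.
Proof.
  intros H. split; apply filterlim_locally; intros eps;
    destruct (H eps (cond_pos eps)) as [d [Hd K]]; exists (mkposreal d Hd); intros y Hy;
    specialize (K y Hy).
  - apply Rle_lt_trans with (2 := K). apply (re_le_Cmod (f y - f t)).
  - apply Rle_lt_trans with (2 := K). apply (im_le_Cmod (f y - f t)).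
Qed.

Lemma pder_ReIm f t l : pder f t l ->
  is_derive (fun t => Re (f t)) t (Re l) /\ is_derive (fun t => Im (f t)) t (Im l).
Proof.
  intros H.
  assert (G : forall (pr : C -> R), (forall c, Rabs (pr c) <= Cmod c) ->
     (forall a b, pr (a - b)%C = pr a - pr b) -> (forall a r, pr (a * RtoC r)%C = pr a * r) ->
     is_derive (fun t => pr (f t)) t (pr l)).
  { intros pr H1 H2 H3. apply is_derive_Reals. intros e He.
    destruct (H (e/2)) as [d [Hd K]]; [lra|].
    exists (mkposreal d Hd). intros h Hh0 Hh. simpl in Hh.
    specialize (K (t + h)). replace (t + h - t) with h in K by ring. specialize (K Hh).
    assert (K2 := Rle_trans _ _ _ (H1 _) K). rewrite !H2, H3 in K2.
    replace ((pr (f (t + h)) - pr (f t)) / h - pr l)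
      with ((pr (f (t + h)) - pr (f t) - pr l * h) / h) by (field; easy).
    unfold Rdiv at 1. rewrite Rabs_mult, Rabs_inv.
    assert (Hp := Rabs_pos_lt _ Hh0).
    apply Rmult_lt_reg_r with (Rabs h); [easy|]. rewrite Rmult_assoc, Rinv_l; [|lra]. nra. }
  split; apply G.
  - apply re_le_Cmod.
  - reflexivity.
  - intros [x y] r. unfold RtoC, Cmult, Re; simpl. ring.
  - apply im_le_Cmod.
  - reflexivity.
  - intros [x y] r. unfold RtoC, Cmult, Im; simpl. ring.
Qed.

Lemma pder_cont f t l : pder f t l -> pcont f t.
Proof.
  intros H e He. destruct (H 1 Rlt_0_1) as [d [Hd K]]. assert (Hl := Cmod_ge_0 l).
  exists (Rmin d (e / (Cmod l + 1))). split.
  { apply Rmin_pos; [easy|]. apply Rdiv_lt_0_compat; lra. }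
  intros s Hs. assert (H1 := Rlt_le_trans _ _ _ Hs (Rmin_l _ _)).
  assert (H2 := Rlt_le_trans _ _ _ Hs (Rmin_r _ _)). specialize (K s H1).
  assert (T := Cmod_triangle (f s - f t - l * RtoC (s - t)) (l * RtoC (s - t))).
  replace (f s - f t - l * RtoC (s - t) + l * RtoC (s - t))%C with (f s - f t)%C in T by ring.
  rewrite (Cmod_mult l), Cmod_R in T.
  apply Rle_lt_trans with ((Cmod l + 1) * Rabs (s - t)); [lra|].
  apply Rmult_lt_reg_r with (/ (Cmod l + 1)); [apply Rinv_0_lt_compat; lra|].
  replace ((Cmod l + 1) * Rabs (s - t) * / (Cmod l + 1)) with (Rabs (s - t)) by (field; lra).
  exact H2.
Qed.

Definition pcont_on f a b := forall t, a <= t <= b -> pcont f t.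

Lemma pcont_comp F g t : pcont g t -> ccont F (g t) -> pcont (fun s => F (g s)) t.
Proof.
  intros Hg HF e He. destruct (HF e He) as [d [Hd K]]. destruct (Hg d Hd) as [d' [Hd' K']].
  exists d'; split; [easy|]. intros; auto.
Qed.

Lemma pder_comp F g t l m : pder g t m -> cder F (g t) l -> pder (fun s => F (g s)) t (l * m).
Proof.
  intros HG HF e He.
  assert (Hl := Cmod_ge_0 l). assert (Hm := Cmod_ge_0 m).
  destruct (HF (e/2/(Cmod m + 1))) as [d2 [Hd2 K2]]; [apply Rdiv_lt_0_compat; lra|].
  destruct (HG (e/2/(Cmod l + 1))) as [d3 [Hd3 K3]]; [apply Rdiv_lt_0_compat; lra|].
  destruct (HG 1 Rlt_0_1) as [d1 [Hd1 K1]].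
  destruct (pder_cont _ _ _ HG d2 Hd2) as [d4 [Hd4 K4]].
  exists (Rmin d1 (Rmin d3 d4)). split; [repeat apply Rmin_pos; easy|]. intros w Hw.
  assert (A1 := Rmin_l d1 (Rmin d3 d4)). assert (A2 := Rmin_r d1 (Rmin d3 d4)).
  assert (A3 := Rmin_l d3 d4). assert (A4 := Rmin_r d3 d4).
  specialize (K1 w ltac:(lra)). specialize (K3 w ltac:(lra)). specialize (K4 w ltac:(lra)).
  specialize (K2 _ K4).
  assert (K5 : Cmod (g w - g t) <= (Cmod m + 1) * Rabs (w - t)).
  { assert (T := Cmod_triangle (g w - g t - m * RtoC (w - t)) (m * RtoC (w - t))).
    replace (g w - g t - m * RtoC (w - t) + m * RtoC (w - t))%C with (g w - g t)%C in T by ring.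
    rewrite (Cmod_mult m), Cmod_R in T. lra. }
  replace (F (g w) - F (g t) - l * m * RtoC (w - t))%C
   with ((F (g w) - F (g t) - l * (g w - g t)) + l * (g w - g t - m * RtoC (w - t)))%C by ring.
  eapply Rle_trans; [apply Cmod_triangle|]. rewrite (Cmod_mult l).
  assert (Hh := Rabs_pos (w - t)).
  assert (C1 : Cmod (F (g w) - F (g t) - l * (g w - g t)) <= e / 2 * Rabs (w - t)).
  { eapply Rle_trans; [exact K2|].
    apply Rle_trans with (e / 2 / (Cmod m + 1) * ((Cmod m + 1) * Rabs (w - t))).
    - apply Rmult_le_compat_l; [|easy]. apply Rlt_le, Rdiv_lt_0_compat; lra.
    - right. field. lra. }
  assert (C2 : Cmod l * Cmod (g w - g t - m * RtoC (w - t)) <= e / 2 * Rabs (w - t)).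
  { apply Rle_trans with ((Cmod l + 1) * (e / 2 / (Cmod l + 1) * Rabs (w - t))).
    - apply Rmult_le_compat; try apply Cmod_ge_0; try lra.
    - right. field. lra. }
  lra.
Qed.

Lemma pcont_const c t : pcont (fun _ => c) t.
Proof. intros e He. exists 1; split; [lra|]. intros. rewrite Cmod_diag. easy. Qed.

Lemma pcont_plus f g t : pcont f t -> pcont g t -> pcont (fun s => f s + g s)%C t.
Proof.
  intros HF HG e He. destruct (HF (e/2)) as [d1 [Hd1 K1]]; [lra|].
  destruct (HG (e/2)) as [d2 [Hd2 K2]]; [lra|].
  exists (Rmin d1 d2); split; [now apply Rmin_pos|]. intros w Hw.
  specialize (K1 w (Rlt_le_trans _ _ _ Hw (Rmin_l _ _))).
  specialize (K2 w (Rlt_le_trans _ _ _ Hw (Rmin_r _ _))).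
  replace (f w + g w - (f t + g t))%C with ((f w - f t) + (g w - g t))%C by ring.
  eapply Rle_lt_trans; [apply Cmod_triangle|]. lra.
Qed.

Lemma pcont_mult f g t : pcont f t -> pcont g t -> pcont (fun s => f s * g s)%C t.
Proof.
  intros HF HG e He.
  assert (HGz := Cmod_ge_0 (g t)). assert (HFz := Cmod_ge_0 (f t)).
  destruct (HF (Rmin 1 (e/2/(Cmod (g t) + 1)))) as [d1 [Hd1 K1]].
  { apply Rmin_pos; [lra|]. apply Rdiv_lt_0_compat; lra. }
  destruct (HG (e/2/(Cmod (f t) + 1))) as [d2 [Hd2 K2]].
  { apply Rdiv_lt_0_compat; lra. }
  exists (Rmin d1 d2); split; [now apply Rmin_pos|]. intros w Hw.
  specialize (K1 w (Rlt_le_trans _ _ _ Hw (Rmin_l _ _))).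
  specialize (K2 w (Rlt_le_trans _ _ _ Hw (Rmin_r _ _))).
  assert (K3 := Rlt_le_trans _ _ _ K1 (Rmin_l _ _)).
  assert (K4 := Rlt_le_trans _ _ _ K1 (Rmin_r _ _)).
  assert (K5 : Cmod (f w) < Cmod (f t) + 1).
  { assert (T := Cmod_ge_sub (f w) (f t)). lra. }
  replace (f w * g w - f t * g t)%C with ((f w - f t) * g t + f w * (g w - g t))%C by ring.
  eapply Rle_lt_trans; [apply Cmod_triangle|]. rewrite !Cmod_mult.
  assert (Cmod (f w - f t) * Cmod (g t) <= e / 2).
  { apply Rle_trans with (e / 2 / (Cmod (g t) + 1) * (Cmod (g t) + 1)).
    - apply Rmult_le_compat; try apply Cmod_ge_0; lra.
    - right; field; lra. }
  assert (Cmod (f w) * Cmod (g w - g t) < e / 2).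
  { apply Rlt_le_trans with ((Cmod (f t) + 1) * (e / 2 / (Cmod (f t) + 1))).
    - apply Rmult_le_0_lt_compat; try apply Cmod_ge_0; lra.
    - right; field; lra. }
  lra.
Qed.

Lemma pcont_scal c f t : pcont f t -> pcont (fun s => c * f s)%C t.
Proof. intros H. apply (pcont_mult (fun _ => c)); [apply pcont_const|easy]. Qed.

Lemma pcont_on_ex f a b : a <= b -> pcont_on f a b ->
  ex_RInt (fun t => Re (f t)) a b /\ ex_RInt (fun t => Im (f t)) a b.
Proof.
  intros Hab H. split; apply (@ex_RInt_continuous R_CompleteNormedModule); intros t;
    rewrite Rmin_left, Rmax_right by easy; intros Ht.
  - exact (proj1 (pcont_ReIm f t (H t Ht))).
  - exact (proj2 (pcont_ReIm f t (H t Ht))).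
Qed.

Lemma CInt_ext f g a b : a <= b -> (forall t, a <= t <= b -> f t = g t) -> CInt f a b = CInt g a b.
Proof.
  intros Hab H. unfold CInt. f_equal; apply RInt_ext; intros t;
    rewrite Rmin_left, Rmax_right by easy; intros Ht; rewrite H; lra || easy.
Qed.

Lemma CInt_plus f g a b : a <= b -> pcont_on f a b -> pcont_on g a b ->
  CInt (fun t => f t + g t)%C a b = (CInt f a b + CInt g a b)%C.
Proof.
  intros Hab Hf Hg. apply pcont_on_ex in Hf; [|easy]. apply pcont_on_ex in Hg; [|easy].
  destruct Hf, Hg. apply C_ext; simpl.
  - apply (RInt_plus (fun t => Re (f t)) (fun t => Re (g t))); easy.
  - apply (RInt_plus (fun t => Im (f t)) (fun t => Im (g t))); easy.
Qed.

Lemma CInt_scal c f a b : a <= b -> pcont_on f a b ->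
  CInt (fun t => c * f t)%C a b = (c * CInt f a b)%C.
Proof.
  intros Hab Hf. apply pcont_on_ex in Hf; [|easy]. destruct Hf as [H1 H2].
  apply C_ext; simpl.
  - apply is_RInt_unique.
    apply (is_RInt_ext (fun t => minus (scal (Re c) (Re (f t))) (scal (Im c) (Im (f t))))).
    { intros; reflexivity. }
    apply (@is_RInt_minus R_NormedModule); apply (@is_RInt_scal R_NormedModule); now apply (@RInt_correct R_CompleteNormedModule).
  - apply is_RInt_unique.
    apply (is_RInt_ext (fun t => plus (scal (Re c) (Im (f t))) (scal (Im c) (Re (f t))))).
    { intros; reflexivity. }
    apply (@is_RInt_plus R_NormedModule); apply (@is_RInt_scal R_NormedModule); now apply (@RInt_correct R_CompleteNormedModule).
Qed.

Lemma CInt_Chasles f a b c : a <= b <= c -> pcont_on f a c ->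
  CInt f a c = (CInt f a b + CInt f b c)%C.
Proof.
  intros [H1 H2] Hf.
  assert (F1 : pcont_on f a b) by (intros t Ht; apply Hf; lra).
  assert (F2 : pcont_on f b c) by (intros t Ht; apply Hf; lra).
  apply pcont_on_ex in F1; [|easy]. apply pcont_on_ex in F2; [|easy]. destruct F1, F2.
  apply C_ext; simpl; symmetry; apply (@RInt_Chasles R_CompleteNormedModule); easy.
Qed.

(** Multiplying by the unimodular [u] turns the integral into its modulus; then real integrals are
    compared. *)
Lemma CInt_bound f g a b : a <= b -> pcont_on f a b -> ex_RInt g a b ->
  (forall t, a <= t <= b -> Cmod (f t) <= g t) -> Cmod (CInt f a b) <= RInt g a b.
Proof.
  intros Hab Hf Hg H. set (I := CInt f a b).
  destruct (classic (I = 0%C)) as [E|E].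
  { rewrite E, Cmod_0. apply RInt_ge_0; [easy|easy|]. intros t Ht.
    eapply Rle_trans; [apply Cmod_ge_0|apply H; lra]. }
  assert (Hp := proj1 (Cmod_gt_0 I) E).
  set (u := (Cconj I * RtoC (/ Cmod I))%C).
  assert (Hu : Cmod u = 1).
  { unfold u. rewrite Cmod_mult, Cmod_conj, Cmod_RtoC_pos.
    - now apply Rinv_r, Rgt_not_eq. - now apply Rlt_le, Rinv_0_lt_compat. }
  assert (HuI : (u * I)%C = RtoC (Cmod I)).
  { unfold u. replace (Cconj I * RtoC (/ Cmod I) * I)%C with (I * Cconj I * RtoC (/ Cmod I))%C by ring.
    rewrite <- Cmod2_conj. rewrite RtoC_inv by lra. rewrite RtoC_pow. field.
    intros K. apply E. apply Cmod_eq_0. now apply RtoC_inj. }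
  assert (HI : Cmod I = RInt (fun t => Re (u * f t)) a b).
  { transitivity (Re (u * I)).
    - rewrite HuI. reflexivity.
    - unfold I. rewrite <- CInt_scal by easy. reflexivity. }
  rewrite HI. apply RInt_le; [easy| |easy|].
  - apply (pcont_on_ex (fun t => u * f t)%C); [easy|]. intros t Ht. now apply pcont_scal, Hf.
  - intros t Ht. eapply Rle_trans; [apply Rle_abs|]. eapply Rle_trans; [apply re_le_Cmod|].
    rewrite Cmod_mult, Hu, Rmult_1_l. apply H. lra.
Qed.

Lemma CInt_bound_const f M a b : a <= b -> pcont_on f a b ->
  (forall t, a <= t <= b -> Cmod (f t) <= M) -> Cmod (CInt f a b) <= (b - a) * M.
Proof.
  intros Hab Hf H. eapply Rle_trans; [apply (CInt_bound f (fun _ => M)); try easy|].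
  - apply ex_RInt_const.
  - rewrite RInt_const. right. reflexivity.
Qed.

Lemma CInt_FTC P f a b : a <= b -> (forall t, a <= t <= b -> pder P t (f t)) -> pcont_on f a b ->
  CInt f a b = (P b - P a)%C.
Proof.
  intros Hab HP Hf.
  apply C_ext; simpl; apply is_RInt_unique.
  - apply (is_RInt_derive (fun t => Re (P t))); intros t; rewrite Rmin_left, Rmax_right by easy; intros Ht.
    + exact (proj1 (pder_ReIm _ _ _ (HP t Ht))). + exact (proj1 (pcont_ReIm _ _ (Hf t Ht))).
  - apply (is_RInt_derive (fun t => Im (P t))); intros t; rewrite Rmin_left, Rmax_right by easy; intros Ht.
    + exact (proj2 (pder_ReIm _ _ _ (HP t Ht))). + exact (proj2 (pcont_ReIm _ _ (Hf t Ht))).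
Qed.

Definition seg (a b : C) (t : R) : C := (a + RtoC t * (b - a))%C.

Lemma seg_0 a b : seg a b 0 = a. Proof. unfold seg. ring. Qed.
Lemma seg_1 a b : seg a b 1 = b. Proof. unfold seg. ring. Qed.

Lemma seg_dist a b s t : Cmod (seg a b s - seg a b t) = Rabs (s - t) * Cmod (b - a).
Proof.
  unfold seg. replace (a + RtoC s * (b - a) - (a + RtoC t * (b - a)))%C with (RtoC (s - t) * (b - a))%C
    by (rewrite RtoC_minus; ring).
  now rewrite Cmod_mult, Cmod_R.
Qed.

Lemma pder_seg a b t : pder (seg a b) t (b - a).
Proof.
  intros e He. exists 1; split; [lra|]. intros s _. unfold seg.
  replace (a + RtoC s * (b - a) - (a + RtoC t * (b - a)) - (b - a) * RtoC (s - t))%C with (RtoC 0)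
    by (rewrite RtoC_minus; ring).
  rewrite Cmod_0. apply Rmult_le_pos; [lra|apply Rabs_pos].
Qed.

Lemma pcont_seg a b t : pcont (seg a b) t.
Proof. eapply pder_cont, pder_seg. Qed.

(** The line integral of [F] over the segment from [a] to [b]. *)
Definition J (F : C -> C) (a b : C) : C := ((b - a) * CInt (fun t => F (seg a b t)) 0 1)%C.

Definition cont_seg F a b := forall t, 0 <= t <= 1 -> ccont F (seg a b t).

Lemma cont_seg_p F a b : cont_seg F a b -> pcont_on (fun t => F (seg a b t)) 0 1.
Proof. intros H t Ht. apply pcont_comp; [apply pcont_seg|now apply H]. Qed.

Lemma J_plus F G a b : cont_seg F a b -> cont_seg G a b ->
  J (fun z => F z + G z)%C a b = (J F a b + J G a b)%C.
Proof.
  intros HF HG. unfold J. rewrite (CInt_plus (fun t => F (seg a b t)) (fun t => G (seg a b t))).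
  - ring. - lra. - now apply cont_seg_p. - now apply cont_seg_p.
Qed.

Lemma J_FTC P F a b : (forall t, 0 <= t <= 1 -> cder P (seg a b t) (F (seg a b t))) ->
  cont_seg F a b -> J F a b = (P b - P a)%C.
Proof.
  intros HP HF. unfold J. rewrite <- CInt_scal; [|lra|now apply cont_seg_p].
  rewrite (CInt_FTC (fun t => P (seg a b t))).
  - now rewrite seg_0, seg_1.
  - lra.
  - intros t Ht. replace ((b - a) * F (seg a b t))%C with (F (seg a b t) * (b - a))%C by ring.
    apply pder_comp; [apply pder_seg|now apply HP].
  - intros t Ht. apply pcont_scal. now apply cont_seg_p.
Qed.

Lemma J_bound F M a b : cont_seg F a b -> (forall t, 0 <= t <= 1 -> Cmod (F (seg a b t)) <= M) ->
  Cmod (J F a b) <= Cmod (b - a) * M.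
Proof.
  intros HF H. unfold J. rewrite Cmod_mult. apply Rmult_le_compat_l; [apply Cmod_ge_0|].
  replace M with ((1 - 0) * M) by ring. apply CInt_bound_const; try easy; [lra|now apply cont_seg_p].
Qed.

Lemma RInt_lin (f : R -> R) u v a b : u <> 0 -> ex_RInt f (u * a + v) (u * b + v) ->
  RInt (fun t => f (u * t + v)) a b = / u * RInt f (u * a + v) (u * b + v).
Proof.
  intros Hu Hex. assert (H := RInt_comp_lin f u v a b Hex).
  assert (E : ex_RInt (fun y => f (u * y + v)) a b).
  { apply (ex_RInt_comp_lin f u v a b) in Hex.
    apply (ex_RInt_ext (fun y => scal (/ u) (scal u (f (u * y + v))))).
    - intros x _. unfold scal; simpl; unfold mult; simpl. now field.
    - now apply @ex_RInt_scal. }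
  rewrite RInt_scal in H by easy.
  assert (H2 : forall x y : R, u * x = y -> x = / u * y) by (intros x y <-; now field).
  apply H2. exact H.
Qed.

Lemma J_swap F a b : cont_seg F a b -> J F b a = (- J F a b)%C.
Proof.
  intros HF. unfold J.
  assert (E : CInt (fun t => F (seg b a t)) 0 1 = CInt (fun t => F (seg a b t)) 0 1).
  2:{ rewrite E. ring. }
  destruct (pcont_on_ex _ 0 1 ltac:(lra) (cont_seg_p _ _ _ HF)) as [E1 E2].
  assert (Es : forall t, seg b a t = seg a b ((-1) * t + 1)).
  { intros t. unfold seg. rewrite RtoC_plus, RtoC_mult. change (RtoC (-1)) with (RtoC (Ropp 1)).
    rewrite RtoC_opp. ring. }
  assert (SW : forall f : R -> R, ex_RInt f 0 1 -> RInt f 1 0 = - RInt f 0 1).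
  { intros f Hf. symmetry. exact (opp_RInt_swap f 0 1 Hf). }
  apply C_ext; simpl.
  - rewrite (RInt_ext _ (fun t => (fun s => Re (F (seg a b s))) ((-1) * t + 1)))
      by (intros; now rewrite Es).
    rewrite (RInt_lin (fun s => Re (F (seg a b s))) (-1) 1 0 1); [|lra|].
    + replace (-1 * 0 + 1) with 1 by ring. replace (-1 * 1 + 1) with 0 by ring.
      rewrite SW by easy. asR. field.
    + replace (-1 * 0 + 1) with 1 by ring. replace (-1 * 1 + 1) with 0 by ring.
      now apply ex_RInt_swap.
  - rewrite (RInt_ext _ (fun t => (fun s => Im (F (seg a b s))) ((-1) * t + 1)))
      by (intros; now rewrite Es).
    rewrite (RInt_lin (fun s => Im (F (seg a b s))) (-1) 1 0 1); [|lra|].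
    + replace (-1 * 0 + 1) with 1 by ring. replace (-1 * 1 + 1) with 0 by ring.
      rewrite SW by easy. asR. field.
    + replace (-1 * 0 + 1) with 1 by ring. replace (-1 * 1 + 1) with 0 by ring.
      now apply ex_RInt_swap.
Qed.

Lemma J_split F a b s : 0 < s < 1 -> cont_seg F a b ->
  J F a b = (J F a (seg a b s) + J F (seg a b s) b)%C.
Proof.
  intros Hs HF.
  assert (P := cont_seg_p _ _ _ HF).
  assert (Q1 : pcont_on (fun t => F (seg a b t)) 0 s) by (intros t Ht; apply P; lra).
  assert (Q2 : pcont_on (fun t => F (seg a b t)) s 1) by (intros t Ht; apply P; lra).
  assert (G : forall u v, 0 < u -> 0 <= v -> u + v <= 1 ->
    CInt (fun t => F (seg a b (u * t + v))) 0 1 = (RtoC (/ u) * CInt (fun t => F (seg a b t)) v (u + v))%C).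
  { intros u v Hu Hv Huv.
    assert (Q : pcont_on (fun t => F (seg a b t)) v (u + v)) by (intros t Ht; apply P; lra).
    destruct (pcont_on_ex _ v (u + v) ltac:(lra) Q) as [E1 E2].
    assert (X : (u * 0 + v) = v) by ring. assert (Y : u * 1 + v = u + v) by ring.
    apply C_ext; simpl.
    - rewrite (RInt_lin (fun s => Re (F (seg a b s)))); rewrite ?X, ?Y; [asR; ring|lra|easy].
    - rewrite (RInt_lin (fun s => Im (F (seg a b s)))); rewrite ?X, ?Y; [asR; ring|lra|easy]. }
  unfold J. rewrite (CInt_Chasles _ 0 s 1 ltac:(lra) P).
  rewrite (CInt_ext (fun t => F (seg a (seg a b s) t)) (fun t => F (seg a b (s * t + 0)))); [|lra|].
  2:{ intros t _. f_equal. unfold seg. rewrite RtoC_plus, RtoC_mult. ring. }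
  rewrite (CInt_ext (fun t => F (seg (seg a b s) b t)) (fun t => F (seg a b ((1 - s) * t + s)))); [|lra|].
  2:{ intros t _. f_equal. unfold seg. rewrite RtoC_plus, RtoC_mult, RtoC_minus. ring. }
  rewrite !G by lra. replace (s + 0) with s by ring. replace (1 - s + s) with 1 by ring.
  generalize (CInt (fun t => F (seg a b t)) 0 s) (CInt (fun t => F (seg a b t)) s 1). intros I1 I2.
  unfold seg. rewrite !RtoC_inv, RtoC_minus by lra.
  field. split.
  - rewrite <- RtoC_minus. intros K. apply RtoC_inj in K. lra.
  - intros K. apply RtoC_inj in K. lra.
Qed.

(** * The Cauchy-Goursat theorem *)

Lemma C_complete (u : nat -> C) :
  (forall e, 0 < e -> exists N, forall m n, (N <= m)%nat -> (N <= n)%nat -> Cmod (u m - u n) < e) ->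
  exists l, forall e, 0 < e -> exists N, forall n, (N <= n)%nat -> Cmod (u n - l) < e.
Proof.
  intros H.
  destruct (Rcomplete.R_complete (fun n => Re (u n))) as [x Hx].
  { intros e He. destruct (H e He) as [N HN]. exists N. intros n m Hn Hm.
    eapply Rle_lt_trans; [|apply (HN n m Hn Hm)]. apply (re_le_Cmod (u n - u m)). }
  destruct (Rcomplete.R_complete (fun n => Im (u n))) as [y Hy].
  { intros e He. destruct (H e He) as [N HN]. exists N. intros n m Hn Hm.
    eapply Rle_lt_trans; [|apply (HN n m Hn Hm)]. apply (im_le_Cmod (u n - u m)). }
  exists (x, y). intros e He.
  destruct (Hx (e/2)) as [N1 H1]; [lra|]. destruct (Hy (e/2)) as [N2 H2]; [lra|].
  exists (N1 + N2)%nat. intros n Hn. specialize (H1 n ltac:(lia)). specialize (H2 n ltac:(lia)).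
  eapply Rle_lt_trans; [apply Cmod_le_ReIm|]. unfold Rdist in *. simpl.
  unfold Re, Im in *. unfold Rminus in H1, H2. lra.
Qed.

Lemma two_pow_pos n : 0 < 2 ^ n.
Proof. apply pow_lt; lra. Qed.

Lemma half_pow_small K e : 0 < e -> exists n, K / 2 ^ n < e.
Proof.
  intros He. destruct (Pow_x_infinity 2 ltac:(rewrite Rabs_pos_eq; lra) (Rabs K / e + 1)) as [N HN].
  exists N. specialize (HN N (Nat.le_refl _)). rewrite Rabs_pos_eq in HN by (apply Rlt_le, two_pow_pos).
  assert (Hp := two_pow_pos N).
  apply Rmult_lt_reg_r with (2 ^ N); [easy|]. unfold Rdiv. rewrite Rmult_assoc, Rinv_l, Rmult_1_r by lra.
  assert (HK : Rabs K < e * 2 ^ N).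
  { apply Rmult_lt_reg_r with (/ e); [now apply Rinv_0_lt_compat|].
    replace (e * 2 ^ N * / e) with (2 ^ N) by (field; lra). unfold Rdiv in HN. lra. }
  assert (T := Rle_abs K). lra.
Qed.

(** Serves two limits: the nested triangles of [goursat] and the Newton iterates of
    [near_linear_surj]. *)
Lemma geometric_limit (u : nat -> C) K : 0 <= K -> (forall n, Cmod (u (S n) - u n) <= K / 2 ^ n) ->
  exists l, forall n, Cmod (u n - l) <= 2 * K / 2 ^ n.
Proof.
  intros HK H.
  assert (H2 : forall n k, Cmod (u (n + k)%nat - u n) <= 2 * K / 2 ^ n - 2 * K / 2 ^ (n + k)).
  { intros n k. induction k as [|k IH].
    - rewrite Nat.add_0_r, Cmod_diag. lra.
    - rewrite Nat.add_succ_r. eapply Rle_trans; [apply (Cmod_tri _ (u (n + k)%nat))|].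
      specialize (H (n + k)%nat). simpl pow.
      assert (E : 2 * K / (2 * 2 ^ (n + k)) = K / 2 ^ (n + k)) by (field; apply pow_nonzero; lra).
      rewrite E. assert (E2 : 2 * K / 2 ^ (n + k) = K / 2 ^ (n + k) + K / 2 ^ (n + k)) by (unfold Rdiv; ring). lra. }
  assert (H3 : forall n m, (n <= m)%nat -> Cmod (u m - u n) <= 2 * K / 2 ^ n).
  { intros n m Hm. replace m with (n + (m - n))%nat by lia. eapply Rle_trans; [apply H2|].
    assert (0 <= 2 * K / 2 ^ (n + (m - n))).
    { apply Rmult_le_pos; [lra|]. apply Rlt_le, Rinv_0_lt_compat, two_pow_pos. } lra. }
  destruct (C_complete u) as [l Hl].
  { intros e He. destruct (half_pow_small (2 * K) (e / 2)) as [N HN]; [lra|]. exists N.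
    intros m n Hm Hn. eapply Rle_lt_trans; [apply (Cmod_tri _ (u N))|].
    rewrite (Cmod_sym (u N)). assert (A := H3 N m Hm). assert (B := H3 N n Hn). lra. }
  exists l. intros n. apply le_epsilon. intros e He. destruct (Hl e He) as [N HN].
  eapply Rle_trans; [apply (Cmod_tri _ (u (n + N)%nat))|].
  assert (A := H3 n (n + N)%nat ltac:(lia)). rewrite Cmod_sym in A. specialize (HN (n + N)%nat ltac:(lia)).
  lra.
Qed.

Definition convex (S : C -> Prop) := forall a b t, S a -> S b -> 0 <= t <= 1 -> S (seg a b t).
Definition cclosed (S : C -> Prop) := forall z, (forall e, 0 < e -> exists w, S w /\ Cmod (w - z) < e) -> S z.

(** The integral of [F] around the oriented triangle. *)
Definition T3 F a b c := (J F a b + J F b c + J F c a)%C.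
Definition perim a b c := Cmod (b - a) + Cmod (c - b) + Cmod (a - c).

Lemma seg_half a b : seg a b (/2) = ((a + b) / 2)%C.
Proof. unfold seg. rewrite RtoC_inv by lra. field. Qed.

Lemma Cmod_half (a b c : C) : c = (a / 2)%C -> Cmod c = Cmod a / 2.
Proof.
  intros ->. rewrite Cmod_div.
  - rewrite Cmod_RtoC_pos; lra.
  - intros K. apply RtoC_inj in K. lra.
Qed.

Lemma two_neq_0 : RtoC 2 <> 0%C.
Proof. intros K. apply RtoC_inj in K. lra. Qed.

(** Joining the midpoints gives four triangles of half the size whose integrals add up to the whole,
    so one of them carries at least a quarter of it. The last clause makes the first vertices of
    iterated triangles converge geometrically. *)
Lemma T3_step F S a b c : convex S -> (forall z, S z -> ccont F z) -> S a -> S b -> S c ->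
  exists a' b' c', (S a' /\ S b' /\ S c') /\ perim a' b' c' = perim a b c / 2 /\
    Cmod (T3 F a b c) <= 4 * Cmod (T3 F a' b' c') /\ Cmod (a' - a) <= perim a b c.
Proof.
  intros HS HF Ha Hb Hc.
  assert (CS : forall x y, S x -> S y -> cont_seg F x y).
  { intros x y Hx Hy t Ht. apply HF, HS; easy. }
  set (p := seg a b (/2)). set (q := seg b c (/2)). set (r := seg c a (/2)).
  assert (Hp : S p) by (apply HS; lra || easy).
  assert (Hq : S q) by (apply HS; lra || easy).
  assert (Hr : S r) by (apply HS; lra || easy).
  assert (E : T3 F a b c = (T3 F a p r + T3 F p b q + T3 F r q c + T3 F p q r)%C).
  { unfold T3. rewrite (J_split F a b (/2)) by (lra || auto).
    rewrite (J_split F b c (/2)) by (lra || auto). rewrite (J_split F c a (/2)) by (lra || auto).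
    fold p q r. rewrite (J_swap F r p) by auto. rewrite (J_swap F p q) by auto. rewrite (J_swap F q r) by auto.
    ring. }
  assert (Ep : p = ((a + b) / 2)%C) by apply seg_half.
  assert (Eq : q = ((b + c) / 2)%C) by apply seg_half.
  assert (Er : r = ((c + a) / 2)%C) by apply seg_half.
  assert (N2 := two_neq_0).
  assert (B1 := Cmod_triangle (T3 F a p r + T3 F p b q + T3 F r q c) (T3 F p q r)).
  assert (B2 := Cmod_triangle (T3 F a p r + T3 F p b q) (T3 F r q c)).
  assert (B3 := Cmod_triangle (T3 F a p r) (T3 F p b q)).
  rewrite <- E in B1.
  assert (D1 := Cmod_ge_0 (b - a)). assert (D2 := Cmod_ge_0 (c - b)). assert (D3 := Cmod_ge_0 (a - c)).
  assert (Hcase : Cmod (T3 F a b c) <= 4 * Cmod (T3 F a p r) \/ Cmod (T3 F a b c) <= 4 * Cmod (T3 F p b q) \/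
    Cmod (T3 F a b c) <= 4 * Cmod (T3 F r q c) \/ Cmod (T3 F a b c) <= 4 * Cmod (T3 F p q r)) by lra.
  assert (Pa : Cmod (p - a) = Cmod (b - a) / 2) by (apply Cmod_half; [easy|rewrite Ep; field; easy]).
  assert (Ra : Cmod (r - a) = Cmod (a - c) / 2).
  { rewrite (Cmod_sym a c). apply Cmod_half; [easy|rewrite Er; field; easy]. }
  unfold perim.
  destruct Hcase as [H|[H|[H|H]]].
  - exists a, p, r. split; [auto|]. split; [|split; [easy|rewrite Cmod_diag; lra]].
    rewrite (Cmod_half (b - a) 0 (p - a)) by (rewrite Ep; field; easy).
    rewrite (Cmod_half (c - b) 0 (r - p)) by (rewrite Ep, Er; field; easy).
    rewrite (Cmod_half (a - c) 0 (a - r)) by (rewrite Er; field; easy). lra.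
  - exists p, b, q. split; [auto|]. split; [|split; [easy|rewrite Pa; lra]].
    rewrite (Cmod_half (b - a) 0 (b - p)) by (rewrite Ep; field; easy).
    rewrite (Cmod_half (c - b) 0 (q - b)) by (rewrite Eq; field; easy).
    rewrite (Cmod_half (a - c) 0 (p - q)) by (rewrite Ep, Eq; field; easy). lra.
  - exists r, q, c. split; [auto|]. split; [|split; [easy|rewrite Ra; lra]].
    rewrite (Cmod_half (b - a) 0 (q - r)) by (rewrite Er, Eq; field; easy).
    rewrite (Cmod_half (c - b) 0 (c - q)) by (rewrite Eq; field; easy).
    rewrite (Cmod_half (a - c) 0 (r - c)) by (rewrite Er; field; easy). lra.
  - exists p, q, r. split; [auto|]. split; [|split; [easy|rewrite Pa; lra]].
    rewrite (Cmod_sym q p), (Cmod_sym r q), (Cmod_sym p r).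
    rewrite (Cmod_half (a - c) 0 (p - q)) by (rewrite Ep, Eq; field; easy).
    rewrite (Cmod_half (b - a) 0 (q - r)) by (rewrite Er, Eq; field; easy).
    rewrite (Cmod_half (c - b) 0 (r - p)) by (rewrite Ep, Er; field; easy). lra.
Qed.

(** An affine function has a quadratic primitive; hence only the error of the linear approximation
    counts in [goursat]. *)
Lemma T3_affine (al be a b c : C) : T3 (fun z => al + be * z)%C a b c = 0%C.
Proof.
  assert (A : forall x y, J (fun z => al + be * z)%C x y =
     ((al * y + be * (y * y) / 2) - (al * x + be * (x * x) / 2))%C).
  { intros x y. apply (J_FTC (fun z => al * z + be * (z * z) / 2)%C).
    - intros t _. generalize (seg x y t). intros z.
      eapply cder_val; [|apply cder_plus; [apply cder_scal, cder_id|]].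
      2:{ apply (cder_ext (fun z => (be / 2) * (z * z))%C); [intros; field|].
          apply cder_scal, cder_mult; apply cder_id. }
      simpl. field.
    - intros t _. apply ccont_plus; [apply ccont_const|]. apply ccont_mult; [apply ccont_const|apply ccont_id]. }
  unfold T3. rewrite !A. ring.
Qed.

Lemma T3_plus F G a b c :
  (cont_seg F a b /\ cont_seg F b c /\ cont_seg F c a) ->
  (cont_seg G a b /\ cont_seg G b c /\ cont_seg G c a) ->
  T3 (fun z => F z + G z)%C a b c = (T3 F a b c + T3 G a b c)%C.
Proof. intros (?&?&?) (?&?&?). unfold T3. rewrite !J_plus by easy. ring. Qed.

Lemma J_ext F G a b : (forall t, 0 <= t <= 1 -> F (seg a b t) = G (seg a b t)) -> J F a b = J G a b.
Proof. intros H. unfold J. f_equal. apply CInt_ext; [lra|easy]. Qed.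

(** Bisection, then differentiability at the common limit point of the triangles. [S] is general
    because [primitive_exceptional] applies this to a disk cut by a half-plane. *)
Theorem goursat F S a b c : convex S -> cclosed S -> (forall z, S z -> exists l, cder F z l) ->
  S a -> S b -> S c -> T3 F a b c = 0%C.
Proof.
  intros HS HSc HF Ha Hb Hc.
  assert (HFc : forall z, S z -> ccont F z).
  { intros z Hz. destruct (HF z Hz) as [l Hl]. eapply cder_cont, Hl. }
  set (good := fun t : C * C * C => S (fst (fst t)) /\ S (snd (fst t)) /\ S (snd t)).
  set (P := fun t : C * C * C => perim (fst (fst t)) (snd (fst t)) (snd t)).
  set (T := fun t : C * C * C => T3 F (fst (fst t)) (snd (fst t)) (snd t)).
  set (R := fun t t' : C * C * C => good t' /\ P t' = P t / 2 /\ Cmod (T t) <= 4 * Cmod (T t') /\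
     Cmod (fst (fst t') - fst (fst t)) <= P t).
  assert (Hstep : forall t, good t -> exists t', R t t').
  { intros t (H1 & H2 & H3). destruct (T3_step F S _ _ _ HS HFc H1 H2 H3) as (a' & b' & c' & Q1 & Q2 & Q3 & Q4).
    exists (a', b', c'). split; [exact Q1|]. split; [exact Q2|]. split; [exact Q3|exact Q4]. }
  set (nxt := fun t => epsilon (inhabits t) (R t)).
  assert (Hn : forall t, good t -> R t (nxt t)).
  { intros t Ht. unfold nxt. apply epsilon_spec. auto. }
  set (X := fix X n := match n with O => (a, b, c) | Datatypes.S n => nxt (X n) end).
  assert (Xg : forall n, good (X n)).
  { induction n as [|n IH]; [now repeat split|]. apply (Hn _ IH). }
  set (L := perim a b c).
  assert (HL : 0 <= L) by (unfold L, perim; assert (D1 := Cmod_ge_0 (b - a)); assert (D2 := Cmod_ge_0 (c - b)); assert (D3 := Cmod_ge_0 (a - c)); lra).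
  assert (XP : forall n, P (X n) = L / 2 ^ n).
  { induction n as [|n IH]; [unfold L, P; simpl; field|].
    destruct (Hn _ (Xg n)) as (_ & E & _). simpl X. rewrite E, IH. simpl. field. apply pow_nonzero; lra. }
  assert (XT : forall n, Cmod (T (X 0%nat)) <= 4 ^ n * Cmod (T (X n))).
  { induction n as [|n IH]; [simpl; lra|].
    destruct (Hn _ (Xg n)) as (_ & _ & E & _). simpl X. simpl pow.
    eapply Rle_trans; [exact IH|]. rewrite (Rmult_comm 4), Rmult_assoc. apply Rmult_le_compat_l; [|exact E].
    apply pow_le; lra. }
  destruct (geometric_limit (fun n => fst (fst (X n))) L HL) as [zs Hzs].
  { intros n. rewrite <- XP. apply (Hn _ (Xg n)). }
  assert (Szs : S zs).
  { apply HSc. intros e He. destruct (half_pow_small (2 * L) e He) as [n Hn'].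
    exists (fst (fst (X n))). split; [apply Xg|]. eapply Rle_lt_trans; [apply Hzs|exact Hn']. }
  destruct (HF zs Szs) as [l Hl].
  change (T3 F a b c) with (T (X 0%nat)).
  apply Cmod_eq_of_small. intros e0 He0.
  replace (T (X 0%nat) - 0)%C with (T (X 0%nat)) by ring.
  (* The [n]-th triangle has perimeter [Ln = L / 2 ^ n] and lies within [4 * Ln] of [zs]. Its
     integral is at most [Ln * (e * (4 * Ln))], which after multiplication by [4 ^ n] is
     [4 * e * L ^ 2]. *)
  set (e := e0 / (4 * (L * L + 1))).
  assert (HLL : 0 <= L * L) by (apply Rmult_le_pos; easy).
  assert (He : 0 < e) by (apply Rdiv_lt_0_compat; lra).
  destruct (Hl e He) as [d [Hd K]].
  destruct (half_pow_small (4 * L) d Hd) as [n Hnd].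
  assert (Hp := two_pow_pos n).
  set (Ln := L / 2 ^ n).
  assert (HLn : 0 <= Ln) by (apply Rmult_le_pos; [easy|now apply Rlt_le, Rinv_0_lt_compat]).
  assert (HLd : 4 * Ln < d) by (unfold Ln; unfold Rdiv in *; lra).
  eapply Rle_trans; [apply (XT n)|].
  destruct (Xg n) as (G1 & G2 & G3). specialize (XP n). specialize (Hzs n).
  unfold T. unfold P in XP. revert G1 G2 G3 XP Hzs. generalize (fst (fst (X n))) (snd (fst (X n))) (snd (X n)).
  intros x y z Gx Gy Gz XP Hzs. fold Ln in XP. replace (2 * L / 2 ^ n) with (2 * Ln) in Hzs by (unfold Ln; field; lra).
  assert (D1 := Cmod_ge_0 (y - x)). assert (D2 := Cmod_ge_0 (z - y)). assert (D3 := Cmod_ge_0 (x - z)).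
  unfold perim in XP.
  set (A := fun w => ((F zs - l * zs) + l * w)%C).
  set (E := fun w => (F w - A w)%C).
  assert (CS : forall u v, S u -> S v -> cont_seg F u v).
  { intros u v Hu Hv t Ht. apply HFc, HS; easy. }
  assert (CA : forall u v, cont_seg A u v).
  { intros u v t _. apply ccont_plus; [apply ccont_const|]. apply ccont_mult; [apply ccont_const|apply ccont_id]. }
  assert (CE : forall u v, S u -> S v -> cont_seg E u v).
  { intros u v Hu Hv t Ht. apply ccont_minus; [now apply CS|now apply CA]. }
  assert (BE : forall u v, S u -> S v -> (forall t, 0 <= t <= 1 -> Cmod (seg u v t - zs) <= 4 * Ln) ->
     Cmod (J E u v) <= Cmod (v - u) * (e * (4 * Ln))).
  { intros u v Hu Hv Hs. apply J_bound; [now apply CE|]. intros t Ht. specialize (Hs t Ht).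
    unfold E, A. replace (F (seg u v t) - (F zs - l * zs + l * seg u v t))%C with
     (F (seg u v t) - F zs - l * (seg u v t - zs))%C by ring.
    eapply Rle_trans; [apply K; lra|]. apply Rmult_le_compat_l; lra. }
  assert (ET : T3 F x y z = (T3 A x y z + T3 E x y z)%C).
  { rewrite <- T3_plus; [|now auto|now auto]. unfold T3. f_equal; [f_equal|]; apply J_ext; intros; unfold E; ring. }
  rewrite ET. unfold A at 1. rewrite T3_affine. rewrite Cplus_0_l.
  assert (SB : forall u v, Cmod (u - zs) + Cmod (v - u) <= 4 * Ln -> forall t, 0 <= t <= 1 -> Cmod (seg u v t - zs) <= 4 * Ln).
  { intros u v Huv t Ht. eapply Rle_trans; [apply (Cmod_tri _ (seg u v 0))|].
    rewrite seg_dist, seg_0, Rminus_0_r, Rabs_pos_eq by lra.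
    assert (Q := Cmod_ge_0 (v - u)). nra. }
  assert (T1 := Cmod_tri y x zs). assert (T2 := Cmod_tri z x zs).
  rewrite (Cmod_sym x z) in XP, D3.
  assert (N1 : Cmod (J E x y) <= Cmod (y - x) * (e * (4 * Ln))) by (apply BE, SB; auto; lra).
  assert (N2 : Cmod (J E y z) <= Cmod (z - y) * (e * (4 * Ln))) by (apply BE, SB; auto; lra).
  assert (N3 : Cmod (J E z x) <= Cmod (x - z) * (e * (4 * Ln))).
  { apply BE, SB; auto. rewrite (Cmod_sym x z). assert (T4 := Cmod_tri z y x).
    assert (T5 := Cmod_tri z x zs). lra. }
  rewrite (Cmod_sym x z) in N3.
  assert (TT : Cmod (T3 E x y z) <= Ln * (e * (4 * Ln))).
  { unfold T3. eapply Rle_trans; [apply Cmod_triangle|].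
    assert (Q := Cmod_triangle (J E x y) (J E y z)). rewrite <- XP at 1. lra. }
  apply Rle_trans with (4 ^ n * (Ln * (e * (4 * Ln)))).
  { apply Rmult_le_compat_l; [apply pow_le; lra|easy]. }
  replace (4 ^ n) with (2 ^ n * 2 ^ n) by (rewrite <- Rpow_mult_distr; f_equal; ring).
  unfold Ln. replace (2 ^ n * 2 ^ n * (L / 2 ^ n * (e * (4 * (L / 2 ^ n))))) with (e * (4 * (L * L))) by (field; lra).
  unfold e. apply Rle_trans with (e0 / (4 * (L * L + 1)) * (4 * (L * L + 1))).
  - apply Rmult_le_compat_l; [now apply Rlt_le|lra].
  - right. field. lra.
Qed.

(** * Cauchy's formula *)

Definition hol (F : C -> C) (A : C -> Prop) : Prop := forall z, A z -> exists l, cder F z l.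

Lemma cdisk_center z r : 0 < r -> cdisk z r z.
Proof. intros H. unfold cdisk. now rewrite Cmod_diag. Qed.

Lemma seg_in_ball c a b r t : Cmod (a - c) <= r -> Cmod (b - c) <= r -> 0 <= t <= 1 ->
  Cmod (seg a b t - c) <= r.
Proof.
  intros Ha Hb Ht. unfold seg.
  replace (a + RtoC t * (b - a) - c)%C with (RtoC (1 - t) * (a - c) + RtoC t * (b - c))%C
    by (rewrite RtoC_minus; ring).
  eapply Rle_trans; [apply Cmod_triangle|]. rewrite !Cmod_mult, !Cmod_RtoC_pos by lra. nra.
Qed.

Lemma cdisk_convex c r : convex (cdisk c r).
Proof.
  intros a b t Ha Hb Ht. unfold cdisk in *.
  apply Rle_lt_trans with (Rmax (Cmod (a - c)) (Cmod (b - c))).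
  - apply seg_in_ball; [apply Rmax_l|apply Rmax_r|easy].
  - now apply Rmax_lub_lt.
Qed.

Lemma J_refl F a : J F a a = 0%C.
Proof. unfold J. replace (a - a)%C with (RtoC 0) by ring. ring. Qed.

(** The difference quotient of [H] is the mean of [h] over a short segment. Only the local identity
    is required, so [H] may be an integral from any base point. *)
Lemma J_deriv h H z : (exists r, 0 < r /\ forall w, Cmod (w - z) < r -> ccont h w /\ (H w - H z)%C = J h z w) ->
  cder H z (h z).
Proof.
  intros (r & Hr & K) e He.
  destruct (proj1 (K z ltac:(rewrite Cmod_diag; lra)) e He) as [d [Hd Kd]].
  exists (Rmin d r). split; [now apply Rmin_pos|]. intros w Hw.
  assert (Hw1 := Rlt_le_trans _ _ _ Hw (Rmin_l _ _)).
  assert (Hw2 := Rlt_le_trans _ _ _ Hw (Rmin_r _ _)).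
  assert (Hs : forall t, 0 <= t <= 1 -> Cmod (seg z w t - z) <= Cmod (w - z)).
  { intros t Ht. apply seg_in_ball; [rewrite Cmod_diag; apply Cmod_ge_0|lra|easy]. }
  rewrite (proj2 (K w Hw2)).
  assert (CH : cont_seg h z w).
  { intros t Ht. apply K. specialize (Hs t Ht). lra. }
  assert (CC : cont_seg (fun _ => h z) z w) by (intros t _; apply ccont_const).
  assert (CM : cont_seg (fun u => h u - h z)%C z w).
  { intros t Ht. apply ccont_minus; [now apply CH|apply ccont_const]. }
  assert (E : J h z w = (J (fun _ => h z) z w + J (fun u => h u - h z)%C z w)%C).
  { rewrite <- J_plus by easy. apply J_ext. intros; ring. }
  assert (E2 : J (fun _ => h z) z w = (h z * w - h z * z)%C).
  { apply (J_FTC (fun u => h z * u)%C); [|easy]. intros t _.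
    eapply cder_val; [|apply cder_scal, cder_id]. ring. }
  rewrite E, E2.
  replace (h z * w - h z * z + J (fun u => h u - h z) z w - h z * (w - z))%C
    with (J (fun u => h u - h z)%C z w) by ring.
  rewrite Rmult_comm. apply J_bound; [easy|]. intros t Ht. apply Rlt_le, Kd. specialize (Hs t Ht). lra.
Qed.

(** [Re ((u - a) * Cconj b)] is the Euclidean inner product of [u - a] and [b]. *)
Lemma halfplane_closed a b d : cclosed (fun u => d <= Re ((u - a) * Cconj b)).
Proof.
  intros z H. apply Rnot_lt_le. intros K.
  set (e := (d - Re ((z - a) * Cconj b)) / (Cmod b + 1)).
  assert (Hb := Cmod_ge_0 b).
  assert (He : 0 < e) by (apply Rdiv_lt_0_compat; lra).
  destruct (H e He) as [w [Hw Hd]].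
  assert (Q := re_le_Cmod ((w - z) * Cconj b)). rewrite Cmod_mult, Cmod_conj in Q.
  replace ((w - z) * Cconj b)%C with ((w - a) * Cconj b - (z - a) * Cconj b)%C in Q by ring.
  change (Re ((w - a) * Cconj b - (z - a) * Cconj b)) with (Re ((w - a) * Cconj b) - Re ((z - a) * Cconj b)) in Q.
  assert (Q2 := Rle_abs (Re ((w - a) * Cconj b) - Re ((z - a) * Cconj b))).
  assert (Q3 : e * (Cmod b + 1) = d - Re ((z - a) * Cconj b)) by (unfold e; field; lra).
  assert (Cmod (w - z) * Cmod b <= e * Cmod b) by (apply Rmult_le_compat_r; lra).
  lra.
Qed.

Lemma halfplane_convex a b d : convex (fun u => d <= Re ((u - a) * Cconj b)).
Proof.
  intros x y t Hx Hy Ht. unfold seg.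
  replace ((x + RtoC t * (y - x) - a) * Cconj b)%C with
    (RtoC (1 - t) * ((x - a) * Cconj b) + RtoC t * ((y - a) * Cconj b))%C by (rewrite RtoC_minus; ring).
  assert (S : forall r z, Re (RtoC r * z) = r * Re z).
  { intros r [u v]. unfold RtoC, Cmult, Re; simpl. ring. }
  change (d <= Re (RtoC (1 - t) * ((x - a) * Cconj b)) + Re (RtoC t * ((y - a) * Cconj b))).
  rewrite !S. nra.
Qed.

Lemma closed_ball_closed c r : cclosed (fun u => Cmod (u - c) <= r).
Proof.
  intros z H. apply le_epsilon. intros e He. destruct (H e He) as [w [Hw Hd]].
  assert (T := Cmod_tri z w c). rewrite Cmod_sym in Hd. lra.
Qed.

Lemma cclosed_inter A B : cclosed A -> cclosed B -> cclosed (fun z => A z /\ B z).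
Proof.
  intros HA HB z H. split.
  - apply HA. intros e He. destruct (H e He) as [w [[? ?] ?]]. now exists w.
  - apply HB. intros e He. destruct (H e He) as [w [[? ?] ?]]. now exists w.
Qed.

Lemma Re_mult_conj z : Re (z * Cconj z) = Cmod z * Cmod z.
Proof.
  assert (H := Cmod2_alt z). replace (Cmod z * Cmod z) with (Cmod z ^ 2) by ring. rewrite H.
  destruct z as [x y]. unfold Cmult, Cconj, Re, Im; simpl. ring.
Qed.

(* The exceptional point is cut off by a shrinking triangle with vertex [zeta], where
   continuity suffices. *)
Lemma primitive_exceptional h c r zeta : cdisk c r zeta ->
  (forall z, cdisk c r z -> ccont h z) ->
  (forall z, cdisk c r z -> z <> zeta -> exists l, cder h z l) ->
  exists H, forall z, cdisk c r z -> cder H z (h z).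
Proof.
  intros Hz Hc Hd. exists (fun z => J h zeta z). intros z Dz. apply J_deriv.
  assert (CS : forall x y, cdisk c r x -> cdisk c r y -> cont_seg h x y).
  { intros x y Hx Hy t Ht. apply Hc. now apply cdisk_convex. }
  destruct (classic (z = zeta)) as [->|Hne].
  { unfold cdisk in Dz. exists (r - Cmod (zeta - c)). split; [lra|]. intros w Hw. split.
    - apply Hc. unfold cdisk. assert (T := Cmod_tri w zeta c). lra.
    - rewrite J_refl. ring. }
  assert (Hp := Cmod_neq_pos _ _ Hne).
  set (A := Cmod (z - zeta)) in *.
  (* Within distance [A / 2] of [z] the inner product with [z - zeta] stays at least [A * A / 2], so
     one half-plane contains [z], [w] and their contractions towards [zeta], but not [zeta]. *)
  exists (Rmin (r - Cmod (z - c)) (A / 2)). unfold cdisk in Dz.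
  split; [apply Rmin_pos; lra|]. intros w Hw.
  assert (Hw1 := Rlt_le_trans _ _ _ Hw (Rmin_l _ _)).
  assert (Hw2 := Rlt_le_trans _ _ _ Hw (Rmin_r _ _)).
  assert (Dw : cdisk c r w) by (unfold cdisk; assert (T := Cmod_tri w z c); lra).
  split; [now apply Hc|].
  enough (E : T3 h zeta z w = 0%C).
  { unfold T3 in E. rewrite (J_swap h zeta w) in E by now apply CS.
    replace (J h z w) with (J h zeta z + J h z w + - J h zeta w - J h zeta z + J h zeta w)%C by ring.
    rewrite E. ring. }
  set (Pe := perim zeta z w).
  assert (HPe : 0 <= Pe).
  { unfold Pe, perim. assert (X1 := Cmod_ge_0 (z - zeta)). assert (X2 := Cmod_ge_0 (w - z)).
    assert (X3 := Cmod_ge_0 (zeta - w)). lra. }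
  destruct (Hc zeta Hz 1 Rlt_0_1) as [d0 [Hd0 Kd0]].
  set (M := Cmod (h zeta) + 1). assert (HM : 0 < M) by (unfold M; assert (X := Cmod_ge_0 (h zeta)); lra).
  assert (Small : forall eps, 0 < eps < 1 -> eps * Pe < d0 -> Cmod (T3 h zeta z w) <= eps * Pe * M).
  { intros eps Heps Hsm.
    set (z' := seg zeta z eps). set (w' := seg zeta w eps).
    assert (Dz' : cdisk c r z') by (apply cdisk_convex; [easy|exact Dz|lra]).
    assert (Dw' : cdisk c r w') by (apply cdisk_convex; [easy|exact Dw|lra]).
    set (rho := Rmax (Rmax (Cmod (z - c)) (Cmod (w - c))) (Rmax (Cmod (z' - c)) (Cmod (w' - c)))).
    assert (Hrho : rho < r) by (unfold rho; repeat apply Rmax_lub_lt; easy).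
    set (S := fun u => Cmod (u - c) <= rho /\ eps * (A * A) / 2 <= Re ((u - zeta) * Cconj (z - zeta))).
    assert (Sc : convex S).
    { intros x y t [Hx1 Hx2] [Hy1 Hy2] Ht. split; [now apply seg_in_ball|].
      now apply (halfplane_convex zeta (z - zeta)). }
    assert (Scl : cclosed S) by (apply cclosed_inter; [apply closed_ball_closed|apply halfplane_closed]).
    assert (Sd : forall u, S u -> exists l, cder h u l).
    { intros u [Hu1 Hu2]. apply Hd; [unfold cdisk; lra|]. intros ->.
      replace ((zeta - zeta) * Cconj (z - zeta))%C with (RtoC 0) in Hu2 by ring. simpl in Hu2.
      assert (0 < eps * (A * A)) by (repeat apply Rmult_lt_0_compat; lra). lra. }
    assert (Iz : Re ((z - zeta) * Cconj (z - zeta)) = A * A) by apply Re_mult_conj.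
    assert (Iw : A * A / 2 <= Re ((w - zeta) * Cconj (z - zeta))).
    { replace ((w - zeta) * Cconj (z - zeta))%C with ((w - z) * Cconj (z - zeta) + (z - zeta) * Cconj (z - zeta))%C by ring.
      change (A * A / 2 <= Re ((w - z) * Cconj (z - zeta)) + Re ((z - zeta) * Cconj (z - zeta))). rewrite Iz.
      assert (Q := re_le_Cmod ((w - z) * Cconj (z - zeta))). rewrite Cmod_mult, Cmod_conj in Q. fold A in Q.
      assert (Q1 := Rle_abs (- Re ((w - z) * Cconj (z - zeta)))). rewrite Rabs_Ropp in Q1.
      assert (Cmod (w - z) * A <= A / 2 * A) by (apply Rmult_le_compat_r; lra). lra. }
    assert (Is : forall u, Re ((seg zeta u eps - zeta) * Cconj (z - zeta)) = eps * Re ((u - zeta) * Cconj (z - zeta))).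
    { intros u. unfold seg. replace (zeta + RtoC eps * (u - zeta) - zeta)%C with (RtoC eps * (u - zeta))%C by ring.
      rewrite <- Cmult_assoc. generalize ((u - zeta) * Cconj (z - zeta))%C. intros [x y]. unfold RtoC, Cmult, Re; simpl. ring. }
    assert (HAA : 0 < A * A) by (apply Rmult_lt_0_compat; lra).
    assert (Sz : S z). { split; [|rewrite Iz; nra]. eapply Rle_trans; [|apply Rmax_l]; apply Rmax_l. }
    assert (Sw : S w). { split; [|nra]. eapply Rle_trans; [|apply Rmax_l]; apply Rmax_r. }
    assert (Sz' : S z'). { split; [|unfold z'; rewrite Is, Iz; nra]. eapply Rle_trans; [|apply Rmax_r]; apply Rmax_l. }
    assert (Sw' : S w'). { split; [|unfold w'; rewrite Is; nra]. eapply Rle_trans; [|apply Rmax_r]; apply Rmax_r. }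
    assert (G1 := goursat h S z' z w Sc Scl Sd Sz' Sz Sw).
    assert (G2 := goursat h S z' w w' Sc Scl Sd Sz' Sw Sw').
    (* The quadrilateral [z' z w w'] consists of two triangles inside [S], on which the integral
       vanishes. *)
    assert (E : T3 h zeta z w = T3 h zeta z' w').
    { transitivity (T3 h zeta z w - T3 h z' z w - T3 h z' w w')%C; [rewrite G1, G2; ring|].
      unfold T3. rewrite (J_split h zeta z eps) by (easy || (apply CS; easy)).
      rewrite (J_swap h zeta w) by (apply CS; easy).
      rewrite (J_split h zeta w eps) by (easy || (apply CS; easy)). fold z' w'.
      rewrite (J_swap h z' w) by (apply CS; easy). rewrite (J_swap h z' w') by (apply CS; easy).
      rewrite (J_swap h zeta w') by (apply CS; easy). rewrite (J_swap h w' w) by (apply CS; easy). ring. }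
    rewrite E. unfold T3.
    assert (Bz : Cmod (z' - zeta) = eps * Cmod (z - zeta)).
    { unfold z'. rewrite <- (seg_0 zeta z) at 2. rewrite seg_dist, Rminus_0_r, Rabs_pos_eq; lra. }
    assert (Bw : Cmod (w' - zeta) = eps * Cmod (w - zeta)).
    { unfold w'. rewrite <- (seg_0 zeta w) at 2. rewrite seg_dist, Rminus_0_r, Rabs_pos_eq; lra. }
    assert (Bzw : Cmod (w' - z') = eps * Cmod (w - z)).
    { unfold w', z', seg. replace (zeta + RtoC eps * (w - zeta) - (zeta + RtoC eps * (z - zeta)))%C with
       (RtoC eps * (w - z))%C by ring. rewrite Cmod_mult, Cmod_RtoC_pos; lra. }
    assert (P1 := Cmod_ge_0 (z - zeta)). assert (P2 := Cmod_ge_0 (w - z)). assert (P3 := Cmod_ge_0 (w - zeta)).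
    assert (EP : Pe = Cmod (z - zeta) + Cmod (w - z) + Cmod (w - zeta)) by (unfold Pe, perim; now rewrite (Cmod_sym zeta w)).
    assert (Bd : forall x y, cdisk c r x -> cdisk c r y -> Cmod (x - zeta) <= eps * Pe -> Cmod (y - zeta) <= eps * Pe ->
       Cmod (J h x y) <= Cmod (y - x) * M).
    { intros x y Hx Hy Bx By. apply J_bound; [now apply CS|]. intros t Ht.
      assert (X := seg_in_ball zeta x y _ t Bx By Ht).
      specialize (Kd0 (seg x y t) ltac:(lra)). assert (Y := Cmod_ge_sub (h (seg x y t)) (h zeta)). unfold M. lra. }
    assert (H0e : Cmod (zeta - zeta) <= eps * Pe) by (rewrite Cmod_diag; apply Rmult_le_pos; lra).
    assert (Hze : Cmod (z' - zeta) <= eps * Pe) by (rewrite Bz; apply Rmult_le_compat_l; lra).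
    assert (Hwe : Cmod (w' - zeta) <= eps * Pe) by (rewrite Bw; apply Rmult_le_compat_l; lra).
    assert (N1 := Bd zeta z' Hz Dz' H0e Hze). assert (N2 := Bd z' w' Dz' Dw' Hze Hwe).
    assert (N3 := Bd w' zeta Dw' Hz Hwe H0e). rewrite (Cmod_sym zeta w') in N3.
    eapply Rle_trans; [apply Cmod_triangle|].
    assert (Q := Cmod_triangle (J h zeta z') (J h z' w')). rewrite Bz in N1. rewrite Bw in N3. rewrite Bzw in N2.
    rewrite EP. nra. }
  apply Cmod_eq_of_small. intros e He. replace (T3 h zeta z w - 0)%C with (T3 h zeta z w) by ring.
  set (K := Pe * M + Pe + 1).
  assert (HPM : 0 <= Pe * M) by (apply Rmult_le_pos; lra).
  set (eps := Rmin (/ 2) (Rmin (e / K) (d0 / K))).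
  assert (He1 := Rmin_l (/ 2) (Rmin (e / K) (d0 / K))). assert (He2 := Rmin_r (/ 2) (Rmin (e / K) (d0 / K))).
  assert (He3 := Rmin_l (e / K) (d0 / K)). assert (He4 := Rmin_r (e / K) (d0 / K)). fold eps in He1, He2.
  assert (HK : 0 < K) by (unfold K; lra).
  assert (Heps : 0 < eps) by (unfold eps; repeat apply Rmin_pos; try lra; now apply Rdiv_lt_0_compat).
  assert (X1 : eps * K <= e).
  { apply Rle_trans with (e / K * K); [apply Rmult_le_compat_r; lra|right; field; lra]. }
  assert (X2 : eps * K <= d0).
  { apply Rle_trans with (d0 / K * K); [apply Rmult_le_compat_r; lra|right; field; lra]. }
  eapply Rle_trans; [apply (Small eps); [lra|]|]; unfold K in X1, X2; nra.
Qed.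

Lemma primitive_disk F c r : 0 < r -> hol F (cdisk c r) -> exists H, forall z, cdisk c r z -> cder H z (F z).
Proof.
  intros Hr HF. apply (primitive_exceptional F c r c).
  - now apply cdisk_center.
  - intros z Hz. destruct (HF z Hz) as [l Hl]. eapply cder_cont, Hl.
  - intros z Hz _. now apply HF.
Qed.

(** * Integrals over circles and the Cauchy kernel *)

Definition eit (t : R) : C := (cos t, sin t).
Definition circ (c : C) (r t : R) : C := (c + RtoC r * eit t)%C.

Lemma Cmod_eit t : Cmod (eit t) = 1.
Proof.
  unfold eit, Cmod; simpl. replace (cos t * (cos t * 1) + sin t * (sin t * 1)) with 1.
  - apply sqrt_1. - assert (H := sin2_cos2 t). unfold Rsqr in H. lra.
Qed.

Lemma eit_neq_0 t : eit t <> 0%C.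
Proof. apply Cmod_gt_0. rewrite Cmod_eit. lra. Qed.

Lemma circ_dist c r t : 0 <= r -> Cmod (circ c r t - c) = r.
Proof.
  intros H. unfold circ. replace (c + RtoC r * eit t - c)%C with (RtoC r * eit t)%C by ring.
  rewrite Cmod_mult, Cmod_eit, Cmod_RtoC_pos; lra.
Qed.

Lemma circ_period c r : circ c r (2 * PI) = circ c r 0.
Proof. unfold circ, eit. now rewrite cos_2PI, sin_2PI, cos_0, sin_0. Qed.

Lemma pder_of_ReIm g t l : derivable_pt_lim (fun s => Re (g s)) t (Re l) ->
  derivable_pt_lim (fun s => Im (g s)) t (Im l) -> pder g t l.
Proof.
  intros H1 H2 e He. destruct (H1 (e/2)) as [d1 K1]; [lra|]. destruct (H2 (e/2)) as [d2 K2]; [lra|].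
  exists (Rmin d1 d2). split; [apply Rmin_pos; apply cond_pos|]. intros s Hs.
  destruct (Req_dec s t) as [->|Hne].
  { replace (t - t) with 0 by ring. rewrite Rabs_R0, Rmult_0_r.
    replace (g t - g t - l * RtoC 0)%C with (RtoC 0) by ring. rewrite Cmod_0. lra. }
  set (h := s - t) in *. assert (Hh : h <> 0) by (unfold h; lra). assert (Es : s = t + h) by (unfold h; ring).
  assert (X1 := K1 h Hh (Rlt_le_trans _ _ _ Hs (Rmin_l _ _))).
  assert (X2 := K2 h Hh (Rlt_le_trans _ _ _ Hs (Rmin_r _ _))). rewrite Es.
  assert (Hp := Rabs_pos_lt _ Hh).
  assert (G : forall a b, Rabs (a / h - b) < e / 2 -> Rabs (a - b * h) <= e / 2 * Rabs h).
  { intros a b Hab. replace (a - b * h) with ((a / h - b) * h) by (field; easy). rewrite Rabs_mult.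
    apply Rmult_le_compat_r; lra. }
  apply G in X1. apply G in X2.
  eapply Rle_trans; [apply Cmod_le_ReIm|].
  replace (Re (g (t + h)%R - g t - l * RtoC h)) with (Re (g (t + h)) - Re (g t) - Re l * h)
    by (destruct (g (t + h)), (g t), l; unfold Re, RtoC; simpl; ring).
  replace (Im (g (t + h)%R - g t - l * RtoC h)) with (Im (g (t + h)) - Im (g t) - Im l * h)
    by (destruct (g (t + h)), (g t), l; unfold Im, RtoC; simpl; ring).
  lra.
Qed.

Lemma pder_eit t : pder eit t (Ci * eit t).
Proof.
  apply pder_of_ReIm; unfold eit, Ci, Cmult, Re, Im; simpl.
  - replace (0 * cos t - 1 * sin t) with (- sin t) by ring. apply derivable_pt_lim_cos.
  - replace (0 * sin t + 1 * cos t) with (cos t) by ring. apply derivable_pt_lim_sin.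
Qed.

Lemma pder_circ c r t : pder (circ c r) t (RtoC r * (Ci * eit t)).
Proof.
  apply (pder_comp (fun z => c + RtoC r * z)%C eit t (RtoC r) (Ci * eit t)); [apply pder_eit|].
  eapply cder_val; [|apply cder_plus; [apply cder_const|apply cder_scal, cder_id]]. ring.
Qed.

Definition dcirc (r t : R) : C := (RtoC r * (Ci * eit t))%C.

Lemma pcont_dcirc r t : pcont (dcirc r) t.
Proof. apply pcont_scal, pcont_scal. eapply pder_cont, pder_eit. Qed.

Lemma Cmod_dcirc r t : 0 <= r -> Cmod (dcirc r t) = r.
Proof. intros H. unfold dcirc. rewrite !Cmod_mult, Cmod_eit, Cmod_Ci, Cmod_RtoC_pos; lra. Qed.

Lemma two_PI_pos : 0 < 2 * PI.
Proof. assert (H := PI_RGT_0). lra. Qed.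

Lemma circ_primitive H h c r : 0 <= r -> (forall t, cder H (circ c r t) (h (circ c r t))) ->
  (forall t, ccont h (circ c r t)) -> CInt (fun t => h (circ c r t) * dcirc r t)%C 0 (2 * PI) = 0%C.
Proof.
  intros Hr HH Hh. assert (P := two_PI_pos).
  rewrite (CInt_FTC (fun t => H (circ c r t))).
  - rewrite circ_period. ring.
  - lra.
  - intros t _. apply pder_comp; [apply pder_circ|apply HH].
  - intros t _. apply pcont_mult; [|apply pcont_dcirc]. apply pcont_comp; [eapply pder_cont, pder_circ|apply Hh].
Qed.

(** The quadratic remainder, uniform in [t], integrates to an error of second order in [w - z]. *)
Lemma deriv_under_int (K : R -> C -> C) (K1 : R -> C) a b z M d : a <= b -> 0 < d -> 0 <= M ->
  (forall w, Cmod (w - z) < d -> pcont_on (fun t => K t w) a b) -> pcont_on K1 a b ->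
  (forall t w, a <= t <= b -> Cmod (w - z) < d ->
     Cmod (K t w - K t z - K1 t * (w - z)) <= M * (Cmod (w - z) * Cmod (w - z))) ->
  cder (fun w => CInt (fun t => K t w) a b) z (CInt K1 a b).
Proof.
  intros Hab Hd HM HK HK1 H e He.
  set (Q := (b - a) * M + 1). assert (HQ : 0 < Q) by (unfold Q; assert (0 <= (b - a) * M) by (apply Rmult_le_pos; lra); lra).
  exists (Rmin d (e / Q)). split; [apply Rmin_pos; [easy|now apply Rdiv_lt_0_compat]|].
  intros w Hw. assert (Hw1 := Rlt_le_trans _ _ _ Hw (Rmin_l _ _)).
  assert (Hw2 := Rlt_le_trans _ _ _ Hw (Rmin_r _ _)).
  assert (Cw := HK w Hw1). assert (Cz := HK z ltac:(rewrite Cmod_diag; easy)).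
  assert (C1 : pcont_on (fun t => (-1) * K t z)%C a b) by (intros t Ht; apply pcont_scal, Cz, Ht).
  assert (C2 : pcont_on (fun t => (- (w - z)) * K1 t)%C a b) by (intros t Ht; apply pcont_scal, HK1, Ht).
  assert (C3 : pcont_on (fun t => K t w + (-1) * K t z)%C a b) by (intros t Ht; apply pcont_plus; auto).
  replace (CInt (fun t => K t w) a b - CInt (fun t => K t z) a b - CInt K1 a b * (w - z))%C
    with (CInt (fun t => K t w + (-1) * K t z + (- (w - z)) * K1 t)%C a b).
  2:{ rewrite (CInt_plus (fun t => K t w + (-1) * K t z)%C), (CInt_plus (fun t => K t w)), !CInt_scal by auto.
      ring. }
  assert (Hh := Cmod_ge_0 (w - z)).
  apply Rle_trans with ((b - a) * (M * (Cmod (w - z) * Cmod (w - z)))).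
  - apply CInt_bound_const; [easy| |].
    + intros t Ht. apply (pcont_plus (fun t => K t w + (-1) * K t z)%C); auto.
    + intros t Ht. replace (K t w + (-1) * K t z + - (w - z) * K1 t)%C with (K t w - K t z - K1 t * (w - z))%C by ring. auto.
  - assert (X : Cmod (w - z) * Q <= e).
    { apply Rle_trans with (e / Q * Q); [apply Rmult_le_compat_r; lra|right; field; lra]. }
    unfold Q in X. nra.
Qed.

Section CauchyKernel.
Variables (phi : R -> C) (g : R -> C) (a b : R) (z : C) (rho B : R).
Hypothesis Hab : a <= b.
Hypothesis Hrho : 0 < rho.
Hypothesis Hphi : pcont_on phi a b.
Hypothesis Hg : pcont_on g a b.
Hypothesis HB : forall t, a <= t <= b -> Cmod (phi t) <= B.
Hypothesis Hfar : forall t, a <= t <= b -> rho <= Cmod (g t - z).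

Lemma kernel_far t w : a <= t <= b -> Cmod (w - z) < rho / 2 -> rho / 2 <= Cmod (g t - w).
Proof. intros Ht Hw. specialize (Hfar t Ht). assert (T := Cmod_tri (g t) w z). lra. Qed.

Lemma kernel_neq t w : a <= t <= b -> Cmod (w - z) < rho / 2 -> (g t - w)%C <> 0%C.
Proof. intros Ht Hw. apply Cmod_gt_0. assert (T := kernel_far t w Ht Hw). lra. Qed.

Lemma kernel_pcont w : Cmod (w - z) < rho / 2 -> pcont_on (fun t => / (g t - w))%C a b.
Proof.
  intros Hw t Ht. apply (pcont_comp (fun u => / (u - w))%C g t); [now apply Hg|].
  apply ccont_inv; [apply ccont_minus; [apply ccont_id|apply ccont_const]|]. now apply kernel_neq.
Qed.

Lemma B_nonneg : 0 <= B.
Proof. eapply Rle_trans; [apply Cmod_ge_0|apply (HB a)]. lra. Qed.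

Lemma kernel_deriv1 : cder (fun w => CInt (fun t => phi t * / (g t - w))%C a b) z
   (CInt (fun t => phi t * (/ (g t - z) * / (g t - z)))%C a b).
Proof.
  assert (B0 := B_nonneg). assert (Hz : Cmod (z - z) < rho / 2) by (rewrite Cmod_diag; lra).
  apply (deriv_under_int _ _ a b z (B * (2 / (rho * rho * rho))) (rho / 2)); try lra.
  - apply Rmult_le_pos; [easy|]. apply Rlt_le, Rdiv_lt_0_compat; [lra|]. repeat apply Rmult_lt_0_compat; lra.
  - intros w Hw t Ht. apply pcont_mult; [now apply Hphi|now apply kernel_pcont].
  - intros t Ht. apply pcont_mult; [now apply Hphi|]. apply pcont_mult; now apply kernel_pcont.
  - intros t w Ht Hw.
    assert (N1 := kernel_neq t w Ht Hw). assert (N2 := kernel_neq t z Ht Hz).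
    assert (F1 := kernel_far t w Ht Hw). assert (F2 := Hfar t Ht).
    replace (phi t * / (g t - w) - phi t * / (g t - z) - phi t * (/ (g t - z) * / (g t - z)) * (w - z))%C
      with (phi t * (/ ((g t - z) * (g t - z) * (g t - w)) * ((w - z) * (w - z))))%C by (field; auto).
    rewrite Cmod_mult, (Cmod_mult (/ _)), (Cmod_mult (w - z)).
    rewrite <- Rmult_assoc. apply Rmult_le_compat_r.
    + apply Rmult_le_pos; apply Cmod_ge_0.
    + apply Rmult_le_compat; try apply Cmod_ge_0; [now apply HB|].
      rewrite Cmod_inv by (repeat apply Cmult_neq_0; auto). rewrite !Cmod_mult.
      replace (2 / (rho * rho * rho)) with (/ (rho * rho * (rho / 2))) by (field; lra).
      apply Rinv_le_contravar; [repeat apply Rmult_lt_0_compat; lra|].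
      apply Rmult_le_compat; try lra; [apply Rmult_le_pos; lra|]. apply Rmult_le_compat; lra.
Qed.

Lemma kernel_deriv2 : exists l, cder (fun w => CInt (fun t => phi t * (/ (g t - w) * / (g t - w)))%C a b) z l.
Proof.
  assert (B0 := B_nonneg). assert (Hz : Cmod (z - z) < rho / 2) by (rewrite Cmod_diag; lra).
  exists (CInt (fun t => phi t * (2 * (/ (g t - z) * (/ (g t - z) * / (g t - z)))))%C a b).
  apply (deriv_under_int _ _ a b z (B * (16 / (rho * rho * (rho * rho)))) (rho / 2)); try lra.
  - apply Rmult_le_pos; [easy|]. apply Rlt_le, Rdiv_lt_0_compat; [lra|]. repeat apply Rmult_lt_0_compat; lra.
  - intros w Hw t Ht. apply pcont_mult; [now apply Hphi|]. apply pcont_mult; now apply kernel_pcont.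
  - intros t Ht. apply pcont_mult; [now apply Hphi|]. apply pcont_scal.
    repeat apply pcont_mult; now apply kernel_pcont.
  - intros t w Ht Hw.
    assert (N1 := kernel_neq t w Ht Hw). assert (N2 := kernel_neq t z Ht Hz).
    assert (F1 := kernel_far t w Ht Hw). assert (F2 := Hfar t Ht).
    set (A := (g t - z)%C) in *. set (h := (w - z)%C) in *.
    assert (EA : (g t - w)%C = (A - h)%C) by (unfold A, h; ring).
    rewrite EA in *. fold A in F2.
    assert (NAh : (A - h)%C <> 0%C) by exact N1.
    replace (phi t * (/ (A - h) * / (A - h)) - phi t * (/ A * / A) - phi t * (2 * (/ A * (/ A * / A))) * h)%C
      with (phi t * ((3 * A - 2 * h) * / (A * A * A * ((A - h) * (A - h))) * (h * h)))%C by (field; auto).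
    rewrite Cmod_mult, (Cmod_mult _ (h * h)), (Cmod_mult h).
    rewrite <- Rmult_assoc. apply Rmult_le_compat_r.
    + apply Rmult_le_pos; apply Cmod_ge_0.
    + apply Rmult_le_compat; try apply Cmod_ge_0; [now apply HB|].
      rewrite Cmod_mult, Cmod_inv by (repeat apply Cmult_neq_0; auto). rewrite !Cmod_mult.
      assert (T : Cmod (3 * A - 2 * h) <= 4 * Cmod A).
      { eapply Rle_trans; [apply Cmod_sub_le|]. rewrite !Cmod_mult, !Cmod_RtoC_pos by lra. lra. }
      set (u := Cmod A) in *. set (v := Cmod (A - h)) in *.
      apply Rle_trans with (4 * u * / (u * u * u * (v * v))).
      { apply Rmult_le_compat_r; [|easy]. apply Rlt_le, Rinv_0_lt_compat. repeat apply Rmult_lt_0_compat; lra. }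
      replace (4 * u * / (u * u * u * (v * v))) with (4 * / (u * u * (v * v))) by (field; lra).
      replace (16 / (rho * rho * (rho * rho))) with (4 * / (rho * rho * ((rho / 2) * (rho / 2)))) by (field; lra).
      apply Rmult_le_compat_l; [lra|]. apply Rinv_le_contravar; [repeat apply Rmult_lt_0_compat; lra|].
      apply Rmult_le_compat; try apply Rmult_le_compat; try apply Rmult_le_pos; lra.
Qed.
End CauchyKernel.

Lemma cder_0_const F S a b : convex S -> (forall z, S z -> cder F z 0) -> S a -> S b -> F a = F b.
Proof.
  intros HS HF Ha Hb.
  assert (E : J (fun _ => 0%C) a b = (F b - F a)%C).
  { apply J_FTC; [|intros t _; apply ccont_const]. intros t Ht. apply HF. now apply HS. }
  assert (E2 : J (fun _ => 0%C) a b = (0 - 0)%C).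
  { apply (J_FTC (fun _ => 0%C)); intros t _; [apply cder_const|apply ccont_const]. }
  rewrite E in E2. replace (F a) with (F b - (F b - F a))%C by ring. rewrite E2. ring.
Qed.

Lemma CInt_const k a b : a <= b -> CInt (fun _ => k) a b = (RtoC (b - a) * k)%C.
Proof.
  intros H. rewrite (CInt_FTC (fun t => RtoC t * k)%C); [rewrite RtoC_minus; ring|easy| |].
  - intros t _ e He. exists 1; split; [lra|]. intros s _.
    replace (RtoC s * k - RtoC t * k - k * RtoC (s - t))%C with (RtoC 0) by (rewrite RtoC_minus; ring).
    rewrite Cmod_0. apply Rmult_le_pos; [lra|apply Rabs_pos].
  - intros t _. apply pcont_const.
Qed.

Lemma circ_far c r zeta t : 0 <= r -> r - Cmod (zeta - c) <= Cmod (circ c r t - zeta).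
Proof. intros Hr. assert (T := Cmod_tri (circ c r t) zeta c). rewrite circ_dist in T by easy. lra. Qed.

(** As a function of the point, the integral has as derivative the integral of [1/(w-z)^2] around
    the circle, which vanishes because of the primitive [-1/(w-z)]. So the point may be moved to the
    centre, where the integrand is [Ci]. *)
Lemma winding c r zeta : 0 < r -> cdisk c r zeta ->
  CInt (fun t => dcirc r t * / (circ c r t - zeta))%C 0 (2 * PI) = (RtoC (2 * PI) * Ci)%C.
Proof.
  intros Hr Hz. assert (P := two_PI_pos).
  set (I := fun w => CInt (fun t => dcirc r t * / (circ c r t - w))%C 0 (2 * PI)).
  assert (E : I zeta = I c).
  { apply (cder_0_const I (cdisk c r)); [apply cdisk_convex| |easy|now apply cdisk_center].
    intros z Dz. unfold cdisk in Dz. eapply cder_val; [|apply (kernel_deriv1 (dcirc r) (circ c r) 0 (2 * PI) z (r - Cmod (z - c)) r)].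
    - transitivity (CInt (fun t => (fun w => / ((w - z) * (w - z)))%C (circ c r t) * dcirc r t)%C 0 (2 * PI)).
      { apply CInt_ext; [lra|]. intros t _.
        assert (N : (circ c r t - z)%C <> 0%C).
        { apply Cmod_gt_0. assert (X := circ_far c r z t). lra. } field. easy. }
      assert (N : forall t, (circ c r t - z)%C <> 0%C).
      { intros t. apply Cmod_gt_0. assert (X := circ_far c r z t). lra. }
      assert (D : forall t, cder (fun w => w - z)%C (circ c r t) 1).
      { intros t. eapply cder_val; [|apply cder_minus; [apply cder_id|apply cder_const]]. ring. }
      apply (circ_primitive (fun w => - / (w - z))%C (fun w => / ((w - z) * (w - z)))%C); [lra| |].
      + intros t. eapply cder_val; [|apply (cder_opp (fun w => / (w - z))%C), (cder_inv (fun w => w - z)%C _ 1); [apply D|apply N]]. field. apply N.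
      + intros t. apply (ccont_inv (fun w => (w - z) * (w - z))%C); [apply ccont_mult; eapply cder_cont; apply D|].
        apply Cmult_neq_0; apply N.
    - lra.
    - lra.
    - intros t _. apply pcont_dcirc.
    - intros t _. eapply pder_cont, pder_circ.
    - intros t _. rewrite Cmod_dcirc; lra.
    - intros t _. apply circ_far. lra. }
  unfold I in E. rewrite E.
  rewrite (CInt_ext _ (fun _ => Ci)); [|lra|].
  - rewrite CInt_const by lra. f_equal. f_equal. ring.
  - intros t _. unfold circ, dcirc. assert (N := eit_neq_0 t). assert (N2 : RtoC r <> 0%C) by (intros K; apply RtoC_inj in K; lra). field. replace (c + RtoC r * eit t - c)%C with (RtoC r * eit t)%C by ring. now apply Cmult_neq_0.
Qed.

(** The value [l] at [c] makes the quotient total, so that [dq_mult] holds at every point, whatever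
    [l] is. *)
Definition dq (F : C -> C) (l c z : C) : C :=
  if excluded_middle_informative (z = c) then l else ((F z - F c) / (z - c))%C.

Lemma dq_neq F l c z : z <> c -> dq F l c z = ((F z - F c) / (z - c))%C.
Proof. intros H. unfold dq. now destruct (excluded_middle_informative (z = c)). Qed.

Lemma dq_eq F l c : dq F l c c = l.
Proof. unfold dq. now destruct (excluded_middle_informative (c = c)). Qed.

Lemma sub_neq_0 (z c : C) : z <> c -> (z - c)%C <> 0%C.
Proof. intros H K. apply H. replace z with ((z - c) + c)%C by ring. rewrite K. ring. Qed.

Lemma dq_mult F l c z : F z = (F c + (z - c) * dq F l c z)%C.
Proof.
  destruct (classic (z = c)) as [->|H].
  - ring.
  - rewrite dq_neq by easy. field. now apply sub_neq_0.
Qed.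

Lemma dq_cont F l c : cder F c l -> ccont (dq F l c) c.
Proof.
  intros H e He. destruct (H (e/2)) as [d [Hd K]]; [lra|]. exists d; split; [easy|].
  intros w Hw. rewrite dq_eq. destruct (classic (w = c)) as [->|Hn].
  - rewrite dq_eq, Cmod_diag. easy.
  - rewrite dq_neq by easy. specialize (K w Hw). assert (N := sub_neq_0 _ _ Hn).
    assert (P := Cmod_neq_pos _ _ Hn).
    replace ((F w - F c) / (w - c) - l)%C with ((F w - F c - l * (w - c)) / (w - c))%C by (field; easy).
    rewrite Cmod_div by easy. apply Rmult_lt_reg_r with (Cmod (w - c)); [easy|].
    unfold Rdiv. rewrite Rmult_assoc, Rinv_l by lra. nra.
Qed.

Lemma dq_der F l c z : z <> c -> (exists m, cder F z m) -> exists m, cder (dq F l c) z m.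
Proof.
  intros Hn [m Hm]. eexists. apply (cder_ext_loc (fun w => (F w - F c) * / (w - c))%C).
  - exists (Cmod (z - c)). split; [now apply Cmod_neq_pos|]. intros w Hw. symmetry. apply dq_neq.
    intros ->. rewrite Cmod_sym in Hw. lra.
  - apply cder_mult; [apply cder_minus; [exact Hm|apply cder_const]|].
    apply cder_inv; [apply cder_minus; [apply cder_id|apply cder_const]|]. now apply sub_neq_0.
Qed.

(** The difference quotient at [zeta] is continuous there and holomorphic elsewhere, so it has a
    primitive and integrates to zero; the remaining term is [F zeta] times the winding integral. *)
Theorem cauchy_formula F c r R zeta : 0 < r < R -> hol F (cdisk c R) -> cdisk c r zeta ->
  CInt (fun t => F (circ c r t) * dcirc r t * / (circ c r t - zeta))%C 0 (2 * PI) = (RtoC (2 * PI) * Ci * F zeta)%C.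
Proof.
  intros Hr HF Hz. assert (P := two_PI_pos). unfold cdisk in Hz.
  assert (HzR : cdisk c R zeta) by (unfold cdisk; lra).
  destruct (HF zeta HzR) as [l Hl]. set (h := dq F l zeta).
  assert (Hcirc : forall t, cdisk c R (circ c r t)) by (intros t; unfold cdisk; rewrite circ_dist; lra).
  assert (N : forall t, circ c r t <> zeta).
  { intros t K. assert (X := circ_far c r zeta t). rewrite K, Cmod_diag in X. lra. }
  assert (Hh : forall z, cdisk c R z -> ccont h z).
  { intros z Dz. destruct (classic (z = zeta)) as [->|Hn]; [now apply dq_cont|].
    destruct (dq_der F l zeta z Hn (HF z Dz)) as [m Hm]. eapply cder_cont, Hm. }
  destruct (primitive_exceptional h c R zeta HzR Hh) as [H HH].
  { intros z Dz Hn. apply dq_der; auto. }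
  assert (E0 : CInt (fun t => h (circ c r t) * dcirc r t)%C 0 (2 * PI) = 0%C).
  { apply (circ_primitive H); [lra|auto|auto]. }
  assert (PK : pcont_on (fun t => dcirc r t * / (circ c r t - zeta))%C 0 (2 * PI)).
  { intros t _. apply pcont_mult; [apply pcont_dcirc|].
    apply (pcont_comp (fun u => / (u - zeta))%C (circ c r) t); [eapply pder_cont, pder_circ|].
    apply ccont_inv; [apply ccont_minus; [apply ccont_id|apply ccont_const]|]. apply sub_neq_0, N. }
  rewrite (CInt_ext _ (fun t => h (circ c r t) * dcirc r t + F zeta * (dcirc r t * / (circ c r t - zeta)))%C).
  - rewrite CInt_plus.
    + rewrite E0, CInt_scal by (lra || easy). rewrite winding by (lra || easy). ring.
    + lra.
    + intros t _. apply pcont_mult; [|apply pcont_dcirc]. apply pcont_comp; [eapply pder_cont, pder_circ|].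
      apply Hh, Hcirc.
    + intros t Ht. apply pcont_scal. now apply PK.
  - lra.
  - intros t _. unfold h. rewrite dq_neq by apply N. field. apply sub_neq_0, N.
Qed.

(** The derivative as a total function; its value is meaningful only where [F] is differentiable. *)
Definition Dv (F : C -> C) (z : C) : C := epsilon (inhabits (RtoC 0)) (fun l => cder F z l).

Lemma Dv_spec F z : (exists l, cder F z l) -> cder F z (Dv F z).
Proof. intros H. unfold Dv. now apply epsilon_spec. Qed.

Lemma Dv_eq F z l : cder F z l -> Dv F z = l.
Proof. intros H. apply (cder_unique F z); [|easy]. apply Dv_spec. now exists l. Qed.

Lemma two_pi_i_neq : (RtoC (2 * PI) * Ci)%C <> 0%C.
Proof.
  apply Cmod_gt_0. assert (P := two_PI_pos). rewrite Cmod_mult, Cmod_Ci, Cmod_RtoC_pos; lra.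
Qed.

(** Cauchy's formula writes [F], and after differentiation under the integral also its derivative,
    as kernel integrals; these can be differentiated once more. *)
Lemma hol_Dv_disk F c R : 0 < R -> hol F (cdisk c R) -> exists l, cder (Dv F) c l.
Proof.
  intros HR HF. assert (P := two_PI_pos). set (r := R / 2).
  set (phi := fun t => (F (circ c r t) * dcirc r t)%C).
  assert (Hcirc : forall t, cdisk c R (circ c r t)) by (intros t; unfold cdisk, r; rewrite circ_dist; lra).
  assert (Cphi : pcont_on phi 0 (2 * PI)).
  { intros t _. apply pcont_mult; [|apply pcont_dcirc]. apply pcont_comp; [eapply pder_cont, pder_circ|].
    destruct (HF _ (Hcirc t)) as [l Hl]. eapply cder_cont, Hl. }
  assert (Bphi : exists B, forall t, 0 <= t <= 2 * PI -> Cmod (phi t) <= B).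
  { destruct (continuity_ab_maj (fun t => Cmod (phi t)) 0 (2 * PI)) as [t0 [Ht0 _]]; [lra| |].
    - intros t Ht. intros e He. destruct (Cphi t Ht e He) as [d [Hd K]]. exists d. split; [easy|].
      intros s [_ Hs]. simpl in *. unfold Rdist in *. specialize (K s Hs).
      assert (X := Cmod_ge_sub (phi s) (phi t)). assert (Y := Cmod_ge_sub (phi t) (phi s)).
      rewrite (Cmod_sym (phi t)) in Y. apply Rabs_def1; lra.
    - exists (Cmod (phi t0)). exact Ht0. }
  destruct Bphi as [B HB].
  set (k := (/ (RtoC (2 * PI) * Ci))%C).
  assert (HD : forall z, cdisk c r z -> Dv F z = (k * CInt (fun t => phi t * (/ (circ c r t - z) * / (circ c r t - z)))%C 0 (2 * PI))%C).
  { intros z Dz. apply Dv_eq. unfold cdisk in Dz.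
    apply (cder_ext_loc (fun w => k * CInt (fun t => phi t * / (circ c r t - w))%C 0 (2 * PI))%C).
    - exists (r - Cmod (z - c)). split; [lra|]. intros w Hw.
      transitivity (k * (RtoC (2 * PI) * Ci * F w))%C.
      + f_equal. apply (cauchy_formula F c r R w); [unfold r; lra|easy|].
        unfold cdisk. assert (T := Cmod_tri w z c). lra.
      + unfold k. rewrite Cmult_assoc, Cinv_l by apply two_pi_i_neq. ring.
    - apply cder_scal. apply (kernel_deriv1 phi (circ c r) 0 (2 * PI) z (r - Cmod (z - c)) B); try easy; try lra.
      + intros t _. eapply pder_cont, pder_circ.
      + intros t _. apply circ_far. unfold r; lra. }
  destruct (kernel_deriv2 phi (circ c r) 0 (2 * PI) c r B) as [l Hl]; try easy; try (unfold r; lra).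
  - intros t _. eapply pder_cont, pder_circ.
  - intros t _. rewrite circ_dist; unfold r; lra.
  - exists (k * l)%C. apply (cder_ext_loc (fun z => k * CInt (fun t => phi t * (/ (circ c r t - z) * / (circ c r t - z)))%C 0 (2 * PI))%C).
    + exists r. split; [unfold r; lra|]. intros w Hw. symmetry. now apply HD.
    + now apply cder_scal.
Qed.

Lemma hol_sub F A B : hol F A -> subset B A -> hol F B.
Proof. intros H S z Hz. apply H, S, Hz. Qed.

Theorem hol_Dv F A : c_open A -> hol F A -> hol (Dv F) A.
Proof.
  intros HA HF z Hz. destruct (HA z Hz) as [e [He S]]. apply (hol_Dv_disk F z e He). now apply (hol_sub F A).
Qed.

(** Near [c] the quotient is the derivative of its own primitive, hence differentiable at [c]. All
    later divisions by [z - c] rest on this. *)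
Theorem hol_dq F A c : c_open A -> hol F A -> A c -> hol (dq F (Dv F c) c) A.
Proof.
  intros HA HF Hc z Hz. destruct (classic (z = c)) as [->|Hn]; [|apply dq_der; auto].
  destruct (HA c Hc) as [e [He S]].
  set (h := dq F (Dv F c) c).
  destruct (primitive_exceptional h c e c (cdisk_center c e He)) as [H HH].
  - intros z Dz. destruct (classic (z = c)) as [->|Hn]; [now apply dq_cont, Dv_spec, HF|].
    destruct (dq_der F (Dv F c) c z Hn (HF z (S z Dz))) as [m Hm]. eapply cder_cont, Hm.
  - intros z Dz Hn. apply dq_der; auto.
  - destruct (hol_Dv_disk H c e He) as [l Hl].
    + intros z Dz. eexists. now apply HH.
    + exists l. apply (cder_ext_loc (Dv H)); [|easy]. exists e. split; [easy|]. intros w Hw. apply Dv_eq. now apply HH.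
Qed.

Lemma mean_value F c r R : 0 < r < R -> hol F (cdisk c R) ->
  CInt (fun t => F (circ c r t)) 0 (2 * PI) = (RtoC (2 * PI) * F c)%C.
Proof.
  intros Hr HF. assert (P := two_PI_pos).
  assert (E := cauchy_formula F c r R c Hr HF (cdisk_center c r (proj1 Hr))).
  rewrite (CInt_ext _ (fun t => Ci * F (circ c r t))%C) in E; [|lra|].
  - rewrite CInt_scal in E; [|lra|].
    + assert (NC : Ci <> 0%C) by (apply Cmod_gt_0; rewrite Cmod_Ci; lra).
      replace (CInt (fun t => F (circ c r t)) 0 (2 * PI)) with (/ Ci * (Ci * CInt (fun t => F (circ c r t)) 0 (2 * PI)))%C by (field; easy).
      rewrite E. field. easy.
    + intros t _. apply pcont_comp; [eapply pder_cont, pder_circ|].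
      destruct (HF (circ c r t)) as [l Hl]; [unfold cdisk; rewrite circ_dist; lra|]. eapply cder_cont, Hl.
  - intros t _. unfold circ, dcirc. assert (N := eit_neq_0 t).
    assert (N2 : RtoC r <> 0%C) by (intros K; apply RtoC_inj in K; lra). field.
    replace (c + RtoC r * eit t - c)%C with (RtoC r * eit t)%C by ring. now apply Cmult_neq_0.
Qed.

(** * Compactness and connectedness in the plane *)

Lemma cdisk_open c r : c_open (cdisk c r).
Proof.
  intros z Hz. unfold cdisk in Hz. exists (r - Cmod (z - c)). split; [lra|]. intros w Hw. unfold cdisk in *.
  assert (T := Cmod_tri w z c). lra.
Qed.

Lemma grid_1d N h x : 0 <= h -> 0 <= x <= INR N * h -> exists i, (i <= N)%nat /\ Rabs (x - INR i * h) <= h.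
Proof.
  intros Hh. induction N as [|N IH]; intros Hx.
  - simpl in Hx. exists 0%nat. split; [lia|]. simpl. replace x with 0 by lra.
    replace (0 - 0 * h) with 0 by ring. now rewrite Rabs_R0.
  - rewrite S_INR in Hx. destruct (Rle_dec x (INR N * h)) as [H|H].
    + destruct (IH (conj (proj1 Hx) H)) as [i [Hi Hi2]]. exists i. split; [lia|easy].
    + exists N. split; [lia|]. rewrite Rabs_pos_eq; lra.
Qed.

(** The bounds on [g] keep the grid points inside the square on which [heine_borel] has a gauge. *)
Lemma finite_net R d : 0 < d -> exists L : list C, forall z, Cmod z <= R ->
  exists g, In g L /\ Cmod (z - g) <= d /\ Rabs (Re g) <= R + d /\ Rabs (Im g) <= R + d.
Proof.
  intros Hd. set (h := d / 2).
  destruct (INR_unbounded (2 * R / h)) as [N HN].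
  set (p := fun i : nat => - R + INR i * h).
  exists (flat_map (fun i => map (fun j => (p i, p j)) (seq 0 (S N))) (seq 0 (S N))).
  intros z Hz. assert (HR := Cmod_ge_0 z).
  assert (Hh : 0 < h) by (unfold h; lra).
  assert (HNh : 2 * R <= INR N * h).
  { apply Rlt_le. apply Rmult_lt_reg_r with (/ h); [now apply Rinv_0_lt_compat|].
    replace (INR N * h * / h) with (INR N) by (field; lra). exact HN. }
  assert (G : forall x, Rabs x <= R -> exists i, (i <= N)%nat /\ Rabs (x - p i) <= h).
  { intros x Hx. apply Rabs_le_between in Hx. destruct (grid_1d N h (x + R)) as [i [Hi Hi2]]; [lra|lra|].
    exists i. split; [easy|]. unfold p. replace (x - (- R + INR i * h)) with (x + R - INR i * h) by ring. easy. }
  assert (Hre : Rabs (Re z) <= R) by (eapply Rle_trans; [apply re_le_Cmod|easy]).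
  assert (Him : Rabs (Im z) <= R) by (eapply Rle_trans; [apply im_le_Cmod|easy]).
  destruct (G (Re z) Hre) as [i [Hi Hi2]]. destruct (G (Im z) Him) as [j [Hj Hj2]].
  exists (p i, p j). repeat split.
  - apply in_flat_map. exists i. split; [apply in_seq; lia|]. apply in_map_iff. exists j. split; [easy|apply in_seq; lia].
  - eapply Rle_trans; [apply Cmod_le_ReIm|].
    change (Rabs (Re z - p i) + Rabs (Im z - p j) <= d). unfold h in *. lra.
  - change (Rabs (p i) <= R + d). assert (T := Rabs_triang (p i - Re z) (Re z)).
    rewrite (Rabs_minus_sym (p i)) in T. replace (p i - Re z + Re z) with (p i) in T by ring. unfold h in *. lra.
  - change (Rabs (p j) <= R + d). assert (T := Rabs_triang (p j - Im z) (Im z)).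
    rewrite (Rabs_minus_sym (p j)) in T. replace (p j - Im z + Im z) with (p j) in T by ring. unfold h in *. lra.
Qed.

Lemma not_cclosed_far K z : cclosed K -> ~ K z -> exists e, 0 < e /\ forall w, K w -> e <= Cmod (w - z).
Proof.
  intros HK Hz. apply NNPP. intros H. apply Hz, HK. intros e He. apply NNPP. intros H2.
  apply H. exists e. split; [easy|]. intros w Hw. apply Rnot_lt_le. intros K2. apply H2. now exists w.
Qed.

(** Every point has a radius within which [K] is either inside one member of the cover or absent.
    [compactness_value_2d] gives a [d] such that each point of a square is close to a gauge point
    whose radius is at least [d]; a finite grid then selects the subcover. *)
Theorem heine_borel K : cclosed K -> c_bounded K -> c_compact K.
Proof.
  intros HK [R HR] I O HO Hcov.
  (* The factor 4 absorbs the way from [w] to a grid point and from there, in two coordinates, to a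
     gauge point: less than three radii plus slack. *)
  assert (D : forall z, exists d, 0 < d /\ ((exists i, forall w, K w -> Cmod (w - z) < 4 * d -> O i w) \/ (forall w, K w -> 4 * d <= Cmod (w - z)))).
  { intros z. destruct (classic (K z)) as [Hz|Hz].
    - destruct (Hcov z Hz) as [i Hi]. destruct (HO i z Hi) as [e [He S]]. exists (e / 4). split; [lra|]. left.
      exists i. intros w _ Hw. apply S. unfold cdisk. lra.
    - destruct (not_cclosed_far K z HK Hz) as [e [He S]]. exists (e / 4). split; [lra|]. right.
      intros w Hw. specialize (S w Hw). lra. }
  set (dl := fun z => epsilon (inhabits 1) (fun d => 0 < d /\ ((exists i, forall w, K w -> Cmod (w - z) < 4 * d -> O i w) \/ (forall w, K w -> 4 * d <= Cmod (w - z))))).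
  assert (Hdl : forall z, 0 < dl z /\ ((exists i, forall w, K w -> Cmod (w - z) < 4 * dl z -> O i w) \/ (forall w, K w -> 4 * dl z <= Cmod (w - z)))).
  { intros z. unfold dl. now apply epsilon_spec. }
  destruct (compactness_value_2d (- R - 1) (R + 1) (- R - 1) (R + 1) (fun x y => mkposreal (dl (x, y)) (proj1 (Hdl (x, y))))) as [d Hd].
  assert (Hd1 : 0 < Rmin d 1) by (apply Rmin_pos; [apply cond_pos|lra]).
  destruct (finite_net R (Rmin d 1) Hd1) as [L HL].
  assert (Q : forall g, Rabs (Re g) <= R + 1 -> Rabs (Im g) <= R + 1 ->
     (exists i, forall w, K w -> Cmod (w - g) <= d -> O i w) \/ (forall w, K w -> ~ Cmod (w - g) <= d)).
  { intros [x y] Hx Hy. simpl in Hx, Hy. apply Rabs_le_between in Hx. apply Rabs_le_between in Hy.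
    apply NNPP. intros HQ. apply (Hd x y); [lra|lra|]. intros (u & v & Hu & Hv & X1 & X2 & X3). simpl in *.
    apply HQ. assert (Dg : forall w, Cmod (w - (x, y)) <= d -> Cmod (w - (u, v)) < 4 * dl (u, v)).
    { intros w Hw. eapply Rle_lt_trans; [apply (Cmod_tri _ (x, y))|].
      assert (Y : Cmod ((x, y) - (u, v)) <= Rabs (x - u) + Rabs (y - v)) by apply (Cmod_le_ReIm ((x, y) - (u, v))).
      assert (Z := proj1 (Hdl (u, v))). lra. }
    destruct (proj2 (Hdl (u, v))) as [[i Hi]|Hf].
    - left. exists i. intros w Hw Hw2. apply Hi; auto.
    - right. intros w Hw Hw2. specialize (Hf w Hw). specialize (Dg w Hw2). lra. }
  assert (Fin : forall L' : list C, exists l : list I, forall z g, K z -> In g L' -> Rabs (Re g) <= R + 1 -> Rabs (Im g) <= R + 1 ->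
     Cmod (z - g) <= d -> exists i, In i l /\ O i z).
  { induction L' as [|g L' [l IH]]; [exists nil; intros z g _ []|].
    destruct (classic (exists i, forall w, K w -> Cmod (w - g) <= d -> O i w)) as [[i Hi]|Hno].
    - exists (i :: l). intros z g' Hz [<-|Hg'] X Y Hzg; [exists i; split; [now left|auto]|].
      destruct (IH z g' Hz Hg' X Y Hzg) as [i' [? ?]]. exists i'. split; [now right|easy].
    - exists l. intros z g' Hz [<-|Hg'] X Y Hzg; [|eauto].
      destruct (Q g X Y) as [?|Hf]; [contradiction|]. now destruct (Hf z Hz). }
  destruct (Fin L) as [l Hl]. exists l. intros z Hz. destruct (HL z (HR z Hz)) as [g (G1 & G2 & G3 & G4)].
  assert (M1 := Rmin_l d 1). assert (M2 := Rmin_r d 1).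
  apply (Hl z g); try easy; lra.
Qed.

Lemma list_sup {I} (l : list I) (f : I -> R) : exists M, 0 < M /\ forall i, In i l -> f i <= M.
Proof.
  induction l as [|a l [M [HM IH]]]; [exists 1; split; [lra|intros i []]|].
  exists (Rmax M (f a)). split; [eapply Rlt_le_trans; [exact HM|apply Rmax_l]|].
  intros i [<-|Hi]; [apply Rmax_r|]. eapply Rle_trans; [now apply IH|apply Rmax_l].
Qed.

Lemma list_inf {I} (l : list I) (f : I -> R) : (forall i, In i l -> 0 < f i) -> exists m, 0 < m /\ forall i, In i l -> m <= f i.
Proof.
  induction l as [|a l IH]; intros H; [exists 1; split; [lra|intros i []]|].
  destruct IH as [m [Hm IH]]; [intros i Hi; apply H; now right|].
  exists (Rmin m (f a)). split; [apply Rmin_pos; [easy|apply H; now left]|].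
  intros i [<-|Hi]; [apply Rmin_r|]. eapply Rle_trans; [apply Rmin_l|auto].
Qed.

Lemma compact_bounded K : c_compact K -> c_bounded K.
Proof.
  intros HK. destruct (HK nat (fun n => cdisk 0 (INR n))) as [l Hl].
  - intros n. apply cdisk_open.
  - intros z _. destruct (INR_unbounded (Cmod z)) as [n Hn]. exists n. unfold cdisk. replace (Cminus z 0) with z by ring. easy.
  - destruct (list_sup l INR) as [M [_ HM]]. exists M. intros z Hz. destruct (Hl z Hz) as [i [Hi Hd]].
    specialize (HM i Hi). unfold cdisk in Hd. replace (Cminus z 0) with z in Hd by ring. lra.
Qed.

Lemma compact_closed K : c_compact K -> cclosed K.
Proof.
  intros HK z Hz. apply NNPP. intros Hn.
  destruct (HK nat (fun n w => / (INR n + 1) < Cmod (w - z))) as [l Hl].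
  - intros n w Hw. exists (Cmod (w - z) - / (INR n + 1)). split; [lra|]. intros u Hu. unfold cdisk in Hu.
    assert (T := Cmod_tri w u z). rewrite (Cmod_sym w u) in T. change (Cmod (u - w) < Cmod (w - z) - / (INR n + 1)) in Hu. lra.
  - intros w Hw. assert (Hp : 0 < Cmod (w - z)) by (apply Cmod_neq_pos; intros ->; contradiction).
    destruct (INR_unbounded (/ Cmod (w - z))) as [n Hn2]. exists n.
    assert (0 <= INR n) by apply pos_INR.
    rewrite <- (Rinv_inv (Cmod (w - z))). apply Rinv_lt_contravar; [|lra].
    apply Rmult_lt_0_compat; [now apply Rinv_0_lt_compat|lra].
  - destruct (list_inf l (fun n => / (INR n + 1))) as [m [Hm Hm2]].
    { intros i _. apply Rinv_0_lt_compat. assert (0 <= INR i) by apply pos_INR. lra. }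
    destruct (Hz m Hm) as [w [Hw Hw2]]. destruct (Hl w Hw) as [i [Hi Hi2]]. specialize (Hm2 i Hi). lra.
Qed.

Lemma compact_subset K A : c_compact K -> cclosed A -> subset A K -> c_compact A.
Proof.
  intros HK HA HS. apply heine_borel; [easy|]. destruct (compact_bounded K HK) as [M HM]. exists M. auto.
Qed.

(** Turns radii found point by point into a single one. The cover is indexed by the pairs of a
    centre and a radius that work, and [P] is inherited by smaller radii. Upper bounds are obtained
    in the same way, written as [/ r]. *)
Lemma compact_uniform K (P : C -> R -> Prop) : c_compact K ->
  (forall y r r', P y r -> 0 < r' <= r -> P y r') ->
  (forall x, K x -> exists r, 0 < r /\ forall y, K y -> Cmod (y - x) < r -> P y r) ->
  exists r, 0 < r /\ forall y, K y -> P y r.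
Proof.
  intros HK Hmono H.
  destruct (HK {p : C * R | 0 < snd p /\ forall y, K y -> Cmod (y - fst p) < snd p -> P y (snd p)}
    (fun p => cdisk (fst (proj1_sig p)) (snd (proj1_sig p)))) as [l Hl].
  - intros p. apply cdisk_open.
  - intros x Hx. destruct (H x Hx) as [r [Hr Hr2]]. exists (exist _ (x, r) (conj Hr Hr2)). now apply cdisk_center.
  - destruct (list_inf l (fun p => snd (proj1_sig p))) as [m [Hm Hm2]].
    { intros p _. apply (proj2_sig p). }
    exists m. split; [easy|]. intros y Hy. destruct (Hl y Hy) as [p [Hp Hp2]].
    apply (Hmono y (snd (proj1_sig p))); [|split; [easy|now apply Hm2]]. now apply (proj2_sig p).
Qed.

Lemma list_argmax {I} (l : list I) (f : I -> R) : l <> nil -> exists i, In i l /\ forall j, In j l -> f j <= f i.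
Proof.
  induction l as [|a l IH]; [easy|]. intros _. destruct l as [|b l].
  - exists a. split; [now left|]. intros j [<-|[]]. lra.
  - destruct IH as [i [Hi IH]]; [easy|]. destruct (Rle_dec (f a) (f i)) as [H|H].
    + exists i. split; [now right|]. intros j [<-|Hj]; auto.
    + exists a. split; [now left|]. intros j [<-|Hj]; [lra|]. specialize (IH j Hj). lra.
Qed.

(** Upper semicontinuity on [K] is assumed. Without a maximum, the sets where [u] is locally below
    some [u y] cover [K], and the largest [u y] of a finite subcover would be below another one. *)
Lemma compact_max K (u : C -> R) : c_compact K -> (exists z, K z) ->
  (forall x, K x -> forall e, 0 < e -> exists d, 0 < d /\ forall y, K y -> Cmod (y - x) < d -> u y < u x + e) ->
  exists x, K x /\ forall y, K y -> u y <= u x.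
Proof.
  intros HK [z0 Hz0] Hu. apply NNPP. intros Hno.
  destruct (HK {y : C | K y} (fun y x => exists r, 0 < r /\ forall x', K x' -> Cmod (x' - x) < r -> u x' < u (proj1_sig y))) as [l Hl].
  - intros y x [r [Hr Hr2]]. exists (r / 2). split; [lra|]. intros w Hw. unfold cdisk in Hw. exists (r / 2). split; [lra|].
    intros x' Hx' Hd. apply Hr2; [easy|]. assert (T := Cmod_tri x' w x). lra.
  - intros x Hx. assert (Hex : exists y, K y /\ u x < u y).
    { apply NNPP. intros H. apply Hno. exists x. split; [easy|]. intros y Hy. apply Rnot_lt_le. intros H2. apply H. now exists y. }
    destruct Hex as [y [Hy Hxy]]. exists (exist _ y Hy). simpl.
    destruct (Hu x Hx (u y - u x)) as [d [Hd Hd2]]; [lra|]. exists d. split; [easy|]. intros x' Hx' Hxx. specialize (Hd2 x' Hx' Hxx). lra.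
  - destruct l as [|p l].
    { destruct (Hl z0 Hz0) as [i [[] _]]. }
    destruct (list_argmax (p :: l) (fun y => u (proj1_sig y))) as [y [Hy Hmax]]; [easy|].
    destruct (Hl (proj1_sig y) (proj2_sig y)) as [y' [Hy' [r [Hr Hr2]]]].
    specialize (Hmax y' Hy'). specialize (Hr2 (proj1_sig y) (proj2_sig y)). rewrite Cmod_diag in Hr2.
    specialize (Hr2 Hr). lra.
Qed.

Lemma ccont_mod F x : ccont F x -> forall e, 0 < e -> exists d, 0 < d /\ forall y, Cmod (y - x) < d -> Cmod (F y) < Cmod (F x) + e.
Proof.
  intros H e He. destruct (H e He) as [d [Hd K]]. exists d. split; [easy|]. intros y Hy. specialize (K y Hy).
  assert (T := Cmod_ge_sub (F y) (F x)). lra.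
Qed.

Lemma compact_image K F : c_compact K -> (forall x, K x -> ccont F x) -> c_compact (image F K).
Proof.
  intros HK HF I O HO Hcov.
  destruct (HK I (fun i x => exists r, 0 < r /\ forall x', K x' -> Cmod (x' - x) < r -> O i (F x'))) as [l Hl].
  - intros i x [r [Hr Hr2]]. exists (r / 2). split; [lra|]. intros w Hw. unfold cdisk in Hw. exists (r / 2). split; [lra|].
    intros x' Hx' Hd. apply Hr2; [easy|]. assert (T := Cmod_tri x' w x). lra.
  - intros x Hx. destruct (Hcov (F x)) as [i Hi]; [now exists x|]. exists i. destruct (HO i _ Hi) as [e [He S]].
    destruct (HF x Hx e He) as [d [Hd K2]]. exists d. split; [easy|]. intros x' _ Hx'. now apply S, K2.
  - exists l. intros w [x [Hx <-]]. destruct (Hl x Hx) as [i [Hi [r [Hr Hr2]]]]. exists i. split; [easy|].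
    apply Hr2; [easy|]. now rewrite Cmod_diag.
Qed.

Lemma closed_ball_compact c r : c_compact (fun z => Cmod (z - c) <= r).
Proof.
  apply heine_borel; [apply closed_ball_closed|]. exists (r + Cmod c). intros z Hz.
  assert (T := Cmod_ge_sub z c). lra.
Qed.

Lemma finite_cover_disks K r : c_compact K -> 0 < r -> exists L : list C, (forall g, In g L -> K g) /\ forall z, K z -> exists g, In g L /\ Cmod (z - g) < r.
Proof.
  intros HK Hr. destruct (HK {g : C | K g} (fun g => cdisk (proj1_sig g) r)) as [l Hl].
  - intros g. apply cdisk_open.
  - intros z Hz. exists (exist _ z Hz). now apply cdisk_center.
  - exists (map (@proj1_sig _ _) l). split.
    + intros g Hg. apply in_map_iff in Hg. destruct Hg as [p [<- _]]. apply (proj2_sig p).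
    + intros z Hz. destruct (Hl z Hz) as [p [Hp Hp2]]. exists (proj1_sig p). split; [now apply in_map|exact Hp2].
Qed.

Lemma closure_closed A : cclosed (c_closure A).
Proof.
  intros z H e He. destruct (H (e/2)) as [w [Hw Hd]]; [lra|]. destruct (Hw (e/2)) as [u [Hu Hd2]]; [lra|].
  exists u. split; [easy|]. assert (T := Cmod_tri u w z). lra.
Qed.

Lemma subset_closure A : subset A (c_closure A).
Proof. intros z Hz e He. exists z. split; [easy|]. now rewrite Cmod_diag. Qed.

Lemma closure_min A B : subset A B -> cclosed B -> subset (c_closure A) B.
Proof. intros HS HB z Hz. apply HB. intros e He. destruct (Hz e He) as [w [Hw Hd]]. exists w; auto. Qed.

Lemma closure_compact A : c_bounded A -> c_compact (c_closure A).
Proof.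
  intros [M HM]. apply heine_borel; [apply closure_closed|]. exists M.
  apply closure_min; [easy|]. intros z Hz. apply le_epsilon. intros e He. destruct (Hz e He) as [w [Hw Hd]].
  assert (T := Cmod_ge_sub z w). rewrite Cmod_sym in T. lra.
Qed.

Lemma closed_compl_open A : cclosed A -> c_open (fun z => ~ A z).
Proof.
  intros HA z Hz. destruct (not_cclosed_far A z HA Hz) as [e [He S]]. exists e. split; [easy|].
  intros w Hw Hin. specialize (S w Hin). unfold cdisk in Hw. lra.
Qed.

Lemma c_interior_open A : c_open (c_interior A).
Proof.
  intros z [e [He S]]. exists e. split; [easy|]. intros w Hw. destruct (cdisk_open z e w Hw) as [d [Hd S2]].
  exists d. split; [easy|]. intros u Hu. now apply S, S2.
Qed.

Lemma c_interior_sub A : subset (c_interior A) A.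
Proof. intros z [e [He S]]. apply S. now apply cdisk_center. Qed.

Lemma convex_connected S : convex S -> c_connected S.
Proof.
  intros HS O1 O2 H1 H2 Hcov Hdis. apply NNPP. intros Hn. apply not_or_and in Hn. destruct Hn as [Hn1 Hn2].
  apply not_all_ex_not in Hn1. destruct Hn1 as [a Ha]. apply imply_to_and in Ha. destruct Ha as [Sa Ha].
  apply not_all_ex_not in Hn2. destruct Hn2 as [b Hb]. apply imply_to_and in Hb. destruct Hb as [Sb Hb].
  set (E := fun t => 0 <= t <= 1 /\ forall s, 0 <= s <= t -> O2 (seg a b s)).
  assert (E0 : E 0).
  { split; [lra|]. intros s Hs. replace s with 0 by lra. rewrite seg_0. destruct (Hcov a Sa); [contradiction|easy]. }
  destruct (completeness E) as [m [Hm1 Hm2]].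
  { exists 1. intros t [Ht _]. lra. }
  { now exists 0. }
  assert (Hm : 0 <= m <= 1).
  { split; [now apply Hm1|]. apply Hm2. intros t [Ht _]. lra. }
  assert (Sm : S (seg a b m)) by (apply HS; easy).
  assert (Near : forall e, 0 < e -> exists d, 0 < d /\ forall s, Rabs (s - m) < d -> cdisk (seg a b m) e (seg a b s)).
  { intros e He. destruct (pcont_seg a b m e He) as [d [Hd K]]. exists d. split; [easy|]. intros s Hs. now apply K. }
  assert (Below : forall t, t < m -> exists s, t < s /\ E s).
  { intros t Ht. apply NNPP. intros H. assert (m <= t); [|lra]. apply Hm2. intros s Hs. apply Rnot_lt_le. intros K. apply H. now exists s. }
  destruct (Hcov _ Sm) as [HO|HO].
  - destruct (H1 _ HO) as [e [He S1]]. destruct (Near e He) as [d [Hd K]].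
    destruct (Below (m - d)) as [s [Hs Es]]; [lra|]. assert (s <= m) by (now apply Hm1).
    apply (Hdis (seg a b s)). split; [apply HS; try easy; apply Es|]. split.
    + apply S1, K. rewrite Rabs_left1; lra.
    + apply Es. destruct Es. lra.
  - destruct (H2 _ HO) as [e [He S2]]. destruct (Near e He) as [d [Hd K]].
    assert (Em : forall s, 0 <= s < m + d -> O2 (seg a b s)).
    { intros s Hs. destruct (Rlt_dec s m) as [Hl|Hl].
      - destruct (Below s Hl) as [s' [Hs' Es']]. apply Es'. lra.
      - apply S2, K. rewrite Rabs_pos_eq; lra. }
    destruct (Rlt_dec m 1) as [Hl|Hl].
    + set (t := Rmin 1 (m + d / 2)). assert (Ht1 := Rmin_l 1 (m + d / 2)). assert (Ht2 := Rmin_r 1 (m + d / 2)).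
      assert (Ht3 : m < t) by (unfold t; apply Rmin_glb_lt; lra). fold t in Ht1, Ht2.
      assert (E t). { split; [lra|]. intros s Hs. apply Em. lra. }
      assert (t <= m) by (now apply Hm1). lra.
    + apply Hb. rewrite <- (seg_1 a b). apply Em. lra.
Qed.

Lemma connected_union_point A B z : c_connected A -> c_connected B -> A z -> B z -> c_connected (fun w => A w \/ B w).
Proof.
  intros HA HB Az Bz O1 O2 H1 H2 Hcov Hdis.
  destruct (HA O1 O2 H1 H2) as [KA|KA]; [intros w Hw; apply Hcov; auto|intros w (X&Y&Z); apply (Hdis w); auto| |];
  (destruct (HB O1 O2 H1 H2) as [KB|KB]; [intros w Hw; apply Hcov; auto|intros w (X&Y&Z); apply (Hdis w); auto| |]).
  - left. intros w [?|?]; auto.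
  - exfalso. apply (Hdis z). auto.
  - exfalso. apply (Hdis z). auto.
  - right. intros w [?|?]; auto.
Qed.

Lemma component_absorb A K D z : is_component A K -> c_connected D -> subset D A -> K z -> D z -> subset D K.
Proof.
  intros (HK1 & HK2 & HK3 & HK4) HD HDA Kz Dz.
  assert (X := HK4 (fun w => K w \/ D w) (connected_union_point K D z HK3 HD Kz Dz)).
  intros w Hw. apply X; [intros u Hu; now left| |now right]. intros u [Hu|Hu]; auto.
Qed.

Lemma component_open A K : c_open A -> is_component A K -> c_open K.
Proof.
  intros HA HK z Kz. assert (Az : A z) by (apply HK; easy). destruct (HA z Az) as [e [He S]]. exists e. split; [easy|].
  apply (component_absorb A K (cdisk z e) z); [easy|apply convex_connected, cdisk_convex|easy|easy|now apply cdisk_center].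
Qed.

Lemma component_eq A K1 K2 z : is_component A K1 -> is_component A K2 -> K1 z -> K2 z -> same_set K1 K2.
Proof.
  intros H1 H2 Z1 Z2 w. split; intros Hw.
  - apply (component_absorb A K2 K1 z); try easy; apply H1.
  - apply (component_absorb A K1 K2 z); try easy; apply H2.
Qed.

Lemma component_exists A z : A z -> exists K, is_component A K /\ K z.
Proof.
  intros Az. exists (fun w => exists D, c_connected D /\ subset D A /\ D z /\ D w).
  assert (Cz : c_connected (fun w => w = z)).
  { intros O1 O2 H1 H2 Hcov Hdis. destruct (Hcov z eq_refl) as [H|H]; [left|right]; intros w ->; easy. }
  assert (Hz : exists D, c_connected D /\ subset D A /\ D z /\ D z).
  { exists (fun w => w = z). repeat split; try easy. intros w ->. easy. }
  split; [|exact Hz]. split; [now exists z|]. split; [|split].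
  - intros w (D & _ & HS & _ & Dw). now apply HS.
  - intros O1 O2 H1 H2 Hcov Hdis.
    assert (Q : forall O1 O2, c_open O1 -> c_open O2 -> subset (fun w => exists D, c_connected D /\ subset D A /\ D z /\ D w) (fun z => O1 z \/ O2 z) ->
      (forall w, ~ ((exists D, c_connected D /\ subset D A /\ D z /\ D w) /\ O1 w /\ O2 w)) -> O1 z -> subset (fun w => exists D, c_connected D /\ subset D A /\ D z /\ D w) O1).
    { clear. intros O1 O2 H1 H2 Hcov Hdis Oz w (D & HD & HS & Dz & Dw).
      destruct (HD O1 O2 H1 H2) as [K|K].
      - intros u Hu. apply Hcov. now exists D.
      - intros u (X & Y & Z). apply (Hdis u). split; [now exists D|easy].
      - now apply K.
      - exfalso. apply (Hdis z). split; [now exists D|]. split; [easy|now apply K]. }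
    destruct (Hcov z Hz) as [Oz|Oz].
    + left. now apply (Q O1 O2).
    + right. apply (Q O2 O1); try easy.
      * intros w Hw. destruct (Hcov w Hw); auto.
      * intros w (X & Y & Z). apply (Hdis w). auto.
  - intros D HD HS HDA w Hw. exists D. repeat split; try easy. apply HS. exact Hz.
Qed.

Lemma clopen_bounded_empty A z : c_open A -> cclosed A -> c_bounded A -> ~ A z.
Proof.
  intros Ho Hc [M HM] Hz.
  assert (CC : c_connected (fun _ => True)) by (apply convex_connected; intros a b t _ _ _; exact I).
  destruct (CC A (fun w => ~ A w) Ho (closed_compl_open A Hc)) as [K|K].
  - intros w _. apply classic.
  - intros w (_ & X & Y). contradiction.
  - specialize (HM (RtoC (Rabs M + 1)) (K _ I)). rewrite Cmod_RtoC_pos in HM by (assert (X := Rabs_pos M); lra).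
    assert (X := Rle_abs M). lra.
  - now apply (K z I).
Qed.

Lemma image_connected F A : (forall z, A z -> ccont F z) -> c_connected A -> c_connected (image F A).
Proof.
  intros HF HA O1 O2 H1 H2 Hcov Hdis.
  assert (Op : forall O, c_open O -> c_open (fun z => exists r, 0 < r /\ forall w, A w -> Cmod (w - z) < r -> O (F w))).
  { intros O HO z [r [Hr Hr2]]. exists (r / 2). split; [lra|]. intros w Hw. unfold cdisk in Hw. exists (r / 2). split; [lra|].
    intros x' Hx' Hd. apply Hr2; [easy|]. assert (T := Cmod_tri x' w z). lra. }
  assert (In : forall O z, c_open O -> A z -> O (F z) -> exists r, 0 < r /\ forall w, A w -> Cmod (w - z) < r -> O (F w)).
  { intros O z HO Az Oz. destruct (HO _ Oz) as [e [He S]]. destruct (HF z Az e He) as [d [Hd K]]. exists d. split; [easy|].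
    intros w _ Hw. now apply S, K. }
  assert (Out : forall O z, A z -> (exists r, 0 < r /\ forall w, A w -> Cmod (w - z) < r -> O (F w)) -> O (F z)).
  { intros O z Az [r [Hr Hr2]]. apply Hr2; [easy|]. now rewrite Cmod_diag. }
  destruct (HA _ _ (Op O1 H1) (Op O2 H2)) as [K|K].
  - intros z Az. destruct (Hcov (F z)) as [H|H]; [now exists z|left|right]; now apply In.
  - intros z (Az & X & Y). apply (Hdis (F z)). split; [now exists z|]. split; now apply Out.
  - left. intros w [z [Az <-]]. apply Out; [easy|now apply K].
  - right. intros w [z [Az <-]]. apply Out; [easy|now apply K].
Qed.

(** * Local theory of holomorphic functions *)

Lemma hol_ccont F A z : hol F A -> A z -> ccont F z.
Proof. intros H Hz. destruct (H z Hz) as [l Hl]. eapply cder_cont, Hl. Qed.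

Lemma hol_mult F G A : hol F A -> hol G A -> hol (fun z => F z * G z)%C A.
Proof. intros HF HG z Hz. destruct (HF z Hz), (HG z Hz). eexists. apply cder_mult; eassumption. Qed.

Lemma hol_plus F G A : hol F A -> hol G A -> hol (fun z => F z + G z)%C A.
Proof. intros HF HG z Hz. destruct (HF z Hz), (HG z Hz). eexists. apply cder_plus; eassumption. Qed.

Lemma hol_minus F G A : hol F A -> hol G A -> hol (fun z => F z - G z)%C A.
Proof. intros HF HG z Hz. destruct (HF z Hz), (HG z Hz). eexists. apply cder_minus; eassumption. Qed.

Lemma hol_const c A : hol (fun _ => c) A.
Proof. intros z _. eexists. apply cder_const. Qed.

Lemma hol_id A : hol (fun z => z) A.
Proof. intros z _. eexists. apply cder_id. Qed.

Lemma hol_inv F A : hol F A -> (forall z, A z -> F z <> 0%C) -> hol (fun z => / F z)%C A.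
Proof. intros HF HN z Hz. destruct (HF z Hz). eexists. apply cder_inv; [eassumption|auto]. Qed.

Lemma hol_comp F G A B : hol G A -> hol F B -> (forall z, A z -> B (G z)) -> hol (fun z => F (G z)) A.
Proof. intros HG HF H z Hz. destruct (HG z Hz), (HF _ (H z Hz)). eexists. apply cder_comp; eassumption. Qed.

Lemma Cmod_sqr_add (p q : C) : Cmod (p + q) * Cmod (p + q) = Cmod p * Cmod p + Cmod q * Cmod q + 2 * Re (Cconj p * q).
Proof.
  assert (E : forall z, Cmod z * Cmod z = Re z * Re z + Im z * Im z).
  { intros z. assert (H := Cmod2_alt z). simpl in H. rewrite !Rmult_1_r in H. exact H. }
  rewrite !E. destruct p as [a b], q as [c d]. unfold Cconj, Cmult, Cplus, Re, Im; simpl. ring.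
Qed.

(* [|F|^2 + eps |w - z|^2] is strictly subharmonic, hence has no interior maximum. *)
Theorem max_modulus F O M : c_bounded O -> c_open O -> hol F O -> (forall z, c_closure O z -> ccont F z) ->
  (forall z, c_boundary O z -> Cmod (F z) <= M) -> forall z, O z -> Cmod (F z) <= M.
Proof.
  intros HB HO HF HC HM a Ha. assert (PP := two_PI_pos).
  assert (HK := closure_compact O HB).
  destruct (compact_bounded _ HK) as [R HR].
  assert (R0 : 0 <= R) by (eapply Rle_trans; [apply Cmod_ge_0|apply (HR a), subset_closure, Ha]).
  assert (M0 : forall x, c_boundary O x -> 0 <= M) by (intros x Hx; eapply Rle_trans; [apply Cmod_ge_0|apply (HM x Hx)]).
  assert (Key : forall e, 0 < e -> Cmod (F a) * Cmod (F a) <= Rmax 0 M * Rmax 0 M + e * (4 * R * R)).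
  { intros e He.
    set (u := fun w => Cmod (F w) * Cmod (F w) + e * (Cmod (w - a) * Cmod (w - a))).
    destruct (compact_max (c_closure O) u HK) as [x [Hx Hmax]].
    { exists a. now apply subset_closure. }
    { intros x Hx e1 He1.
      assert (Cu : ccont (fun w => F w * F w)%C x) by (apply ccont_mult; now apply HC).
      assert (Cv : ccont (fun w => (w - a) * (w - a))%C x).
      { apply ccont_mult; apply ccont_minus; (apply ccont_id || apply ccont_const). }
      destruct (ccont_mod _ _ Cu (e1 / 2)) as [d1 [Hd1 K1]]; [lra|].
      destruct (ccont_mod _ _ Cv (e1 / (2 * e))) as [d2 [Hd2 K2]]; [apply Rdiv_lt_0_compat; lra|].
      exists (Rmin d1 d2). split; [now apply Rmin_pos|]. intros y _ Hy.
      specialize (K1 y (Rlt_le_trans _ _ _ Hy (Rmin_l _ _))). specialize (K2 y (Rlt_le_trans _ _ _ Hy (Rmin_r _ _))).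
      rewrite !Cmod_mult in K1, K2. unfold u.
      assert (K3 : e * (Cmod (y - a) * Cmod (y - a)) < e * (Cmod (x - a) * Cmod (x - a) + e1 / (2 * e))) by (apply Rmult_lt_compat_l; easy).
      rewrite Rmult_plus_distr_l in K3. replace (e * (e1 / (2 * e))) with (e1 / 2) in K3 by (field; lra). lra. }
    assert (Hux : Cmod (F a) * Cmod (F a) <= u x).
    { eapply Rle_trans; [|apply (Hmax a), subset_closure, Ha]. unfold u. rewrite Cmod_diag. lra. }
    destruct (classic (c_interior O x)) as [Hin|Hin].
    - exfalso. destruct Hin as [rr [Hrr S]]. set (r := rr / 2).
      set (p := (x - a)%C).
      (* On the circle [|w - a|^2] is [|p|^2 + r^2] plus twice the real part of [Cconj p * (w - x)],
         so maximality of [u] at [x] bounds [|F|^2] by the real part of the holomorphic [A].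
         Averaging both over the circle contradicts the value at [x] by [e * r ^ 2]. *)
      set (A := fun w => (RtoC (u x - e * (Cmod p * Cmod p + r * r)) + (- (2 * RtoC e) * Cconj p) * (w - x))%C).
      assert (HA : hol A (cdisk x rr)).
      { intros w _. eexists. apply cder_plus; [apply cder_const|]. apply cder_scal, cder_minus; [apply cder_id|apply cder_const]. }
      assert (HF2 : hol (fun w => F w * F w)%C (cdisk x rr)) by (apply hol_mult; now apply (hol_sub F O)).
      assert (Hc : forall t, cdisk x rr (circ x r t)) by (intros t; unfold cdisk, r; rewrite circ_dist; lra).
      assert (MA := mean_value A x r rr ltac:(unfold r; lra) HA).
      assert (MF := mean_value _ x r rr ltac:(unfold r; lra) HF2).
      assert (PA : pcont_on (fun t => A (circ x r t)) 0 (2 * PI)).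
      { intros t _. apply pcont_comp; [eapply pder_cont, pder_circ|]. now apply (hol_ccont A (cdisk x rr)). }
      assert (Bd : Cmod (CInt (fun t => (F (circ x r t) * F (circ x r t))%C) 0 (2 * PI)) <= RInt (fun t => Re (A (circ x r t))) 0 (2 * PI)).
      { apply CInt_bound; [lra| |exact (proj1 (pcont_on_ex _ 0 (2 * PI) ltac:(lra) PA))|].
        - intros t _. apply (pcont_comp (fun w => F w * F w)%C); [eapply pder_cont, pder_circ|]. now apply (hol_ccont _ (cdisk x rr)).
        - intros t _. rewrite Cmod_mult.
          assert (X := Hmax (circ x r t) (subset_closure _ _ (S _ (Hc t)))). unfold u at 1 in X.
          assert (Y : Cmod (circ x r t - a) * Cmod (circ x r t - a) = Cmod p * Cmod p + r * r + 2 * Re (Cconj p * (circ x r t - x))).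
          { replace (circ x r t - a)%C with (p + (circ x r t - x))%C by (unfold p; ring). rewrite Cmod_sqr_add.
            rewrite circ_dist by (unfold r; lra). easy. }
          rewrite Y in X. unfold A.
          assert (Z : Re (RtoC (u x - e * (Cmod p * Cmod p + r * r)) + - (2 * RtoC e) * Cconj p * (circ x r t - x))%C =
             u x - e * (Cmod p * Cmod p + r * r) - 2 * e * Re (Cconj p * (circ x r t - x))%C).
          { replace (- (2 * RtoC e) * Cconj p * (circ x r t - x))%C with (RtoC (- (2 * e)) * (Cconj p * (circ x r t - x)))%C
              by (rewrite RtoC_opp, RtoC_mult; ring).
            generalize (Cconj p * (circ x r t - x))%C. intros [q1 q2]. unfold RtoC, Cplus, Cmult, Re; simpl. ring. }
          rewrite Z. lra. }
      rewrite MF in Bd. change (RInt (fun t => Re (A (circ x r t))) 0 (2 * PI)) with (Re (CInt (fun t => A (circ x r t)) 0 (2 * PI))) in Bd.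
      rewrite MA in Bd. rewrite !Cmod_mult, Cmod_RtoC_pos in Bd by lra.
      assert (EA : A x = RtoC (u x - e * (Cmod p * Cmod p + r * r))) by (unfold A; ring). rewrite EA, <- RtoC_mult in Bd.
      change (Re (RtoC (2 * PI * (u x - e * (Cmod p * Cmod p + r * r))))) with (2 * PI * (u x - e * (Cmod p * Cmod p + r * r))) in Bd.
      apply Rmult_le_reg_l in Bd; [|easy]. unfold u in Bd. fold p in Bd.
      assert (0 < e * (r * r)) by (unfold r; repeat apply Rmult_lt_0_compat; lra). lra.
    - assert (HMx := HM x (conj Hx Hin)). assert (M1 := M0 x (conj Hx Hin)).
      eapply Rle_trans; [exact Hux|]. unfold u. rewrite Rmax_right by easy. assert (X := Cmod_ge_0 (F x)).
      apply Rplus_le_compat; [apply Rmult_le_compat; easy|]. apply Rmult_le_compat_l; [lra|].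
      assert (Y : Cmod (x - a) <= 2 * R).
      { assert (Y1 := HR x Hx). assert (Y2 := HR a (subset_closure _ _ Ha)). assert (Y3 := Cmod_sub_le x a). lra. }
      assert (Y4 := Cmod_ge_0 (x - a)). nra. }
  assert (Key2 : Cmod (F a) <= Rmax 0 M).
  { assert (X := Cmod_ge_0 (F a)). assert (Y := Rmax_l 0 M). apply Rnot_lt_le. intros K.
    assert (K2 : Rmax 0 M * Rmax 0 M < Cmod (F a) * Cmod (F a)) by nra.
    set (D := Cmod (F a) * Cmod (F a) - Rmax 0 M * Rmax 0 M) in *.
    specialize (Key (D / (2 * (4 * R * R + 1)))). assert (0 <= 4 * R * R) by nra.
    assert (E : D / (2 * (4 * R * R + 1)) * (4 * R * R) <= D / 2).
    { apply Rle_trans with (D / (2 * (4 * R * R + 1)) * (4 * R * R + 1)); [|right; field; lra].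
      apply Rmult_le_compat_l; [|lra]. apply Rlt_le, Rdiv_lt_0_compat; unfold D; lra. }
    assert (0 < D) by (unfold D; lra).
    assert (0 < D / (2 * (4 * R * R + 1))) by (apply Rdiv_lt_0_compat; lra). specialize (Key H1). unfold D in *. lra. }
  (* A negative [M] would leave the boundary empty and [O] clopen. *)
  assert (Mn : 0 <= M).
  { apply NNPP. intros Hn.
    assert (Hall : forall z, c_closure O z -> c_interior O z).
    { intros z Hz. apply NNPP. intros K. apply Hn. now apply (M0 z). }
    apply (clopen_bounded_empty O a); try easy.
    intros z Hz. apply (c_interior_sub O). apply Hall. exact Hz. }
  now rewrite Rmax_right in Key2.
Qed.

Lemma closure_disk c r z : c_closure (cdisk c r) z -> Cmod (z - c) <= r.
Proof.
  intros H. apply (closed_ball_closed c r). intros e He. destruct (H e He) as [w [Hw Hd]]. exists w. split; [|easy].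
  apply Rlt_le. exact Hw.
Qed.

Lemma boundary_disk c r z : c_boundary (cdisk c r) z -> Cmod (z - c) = r.
Proof.
  intros [H1 H2]. apply closure_disk in H1. apply Rle_antisym; [easy|]. apply Rnot_lt_le. intros K. apply H2.
  exact (cdisk_open c r z K).
Qed.

Lemma cdisk_bounded c r : c_bounded (cdisk c r).
Proof. exists (r + Cmod c). intros z Hz. unfold cdisk in Hz. assert (T := Cmod_ge_sub z c). lra. Qed.

Lemma max_modulus_disk F c r M : 0 < r -> hol F (fun z => Cmod (z - c) <= r) -> (forall z, Cmod (z - c) = r -> Cmod (F z) <= M) ->
  forall z, Cmod (z - c) <= r -> Cmod (F z) <= M.
Proof.
  intros Hr HF HM z Hz. destruct (Req_dec (Cmod (z - c)) r) as [E|E]; [now apply HM|].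
  apply (max_modulus F (cdisk c r)).
  - apply cdisk_bounded.
  - apply cdisk_open.
  - apply (hol_sub F _ _ HF). intros w Hw. now apply Rlt_le.
  - intros w Hw. apply (hol_ccont F _ w HF). now apply closure_disk.
  - intros w Hw. now apply HM, boundary_disk.
  - unfold cdisk. lra.
Qed.

(** Schwarz's argument: on the circle of radius [r] the numerator is at most [2 * M], and the
    maximum principle carries the bound inside. *)
Lemma dq_bound F c R M r : 0 < r < R -> hol F (cdisk c R) -> (forall z, cdisk c R z -> Cmod (F z) <= M) ->
  forall z, Cmod (z - c) <= r -> Cmod (dq F (Dv F c) c z) <= 2 * M / r.
Proof.
  intros Hr HF HM.
  assert (Hcc : cdisk c R c) by (apply cdisk_center; lra).
  assert (HD := hol_dq F (cdisk c R) c (cdisk_open c R) HF Hcc).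
  apply max_modulus_disk; [easy| |].
  - apply (hol_sub _ _ _ HD). intros w Hw. unfold cdisk. apply Rle_lt_trans with r; [exact Hw|easy].
  - intros z Hz. assert (Hn : z <> c) by (apply Cmod_pos_neq; lra). rewrite dq_neq by easy.
    rewrite Cmod_div by now apply sub_neq_0. rewrite Hz. apply Rmult_le_compat_r; [apply Rlt_le, Rinv_0_lt_compat; lra|].
    assert (T := Cmod_sub_le (F z) (F c)). assert (X := HM z ltac:(unfold cdisk; lra)). assert (Y := HM c Hcc). lra.
Qed.

Lemma hol_lipschitz F c R M : 0 < R -> hol F (cdisk c R) -> (forall z, cdisk c R z -> Cmod (F z) <= M) ->
  forall z, Cmod (z - c) <= R / 2 -> Cmod (F z - F c) <= 4 * M / R * Cmod (z - c).
Proof.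
  intros HR HF HM z Hz. assert (X := dq_bound F c R M (R / 2) ltac:(lra) HF HM z Hz).
  assert (E := dq_mult F (Dv F c) c z). rewrite E. replace (F c + (z - c) * dq F (Dv F c) c z - F c)%C with ((z - c) * dq F (Dv F c) c z)%C by ring.
  rewrite Cmod_mult, Rmult_comm. apply Rmult_le_compat_r; [apply Cmod_ge_0|]. replace (4 * M / R) with (2 * M / (R / 2)) by (field; lra). exact X.
Qed.

(** For holomorphic [F], [dqn F c n c] is the [n]-th Taylor coefficient at [c]; zeros are factored
    out by repeated division. *)
Fixpoint dqn (F : C -> C) (c : C) (n : nat) : C -> C :=
  match n with O => F | S n => dq (dqn F c n) (Dv (dqn F c n) c) c end.

Lemma hol_dqn F A c n : c_open A -> hol F A -> A c -> hol (dqn F c n) A.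
Proof. intros HA HF Hc. induction n; simpl; [easy|now apply hol_dq]. Qed.

Lemma dqn_factor F c n : (forall k, (k < n)%nat -> dqn F c k c = 0%C) -> forall z, F z = (Cpow (z - c) n * dqn F c n z)%C.
Proof.
  induction n as [|n IH]; intros H z.
  - simpl. change (Cpow (z - c) 0) with (RtoC 1). ring.
  - rewrite (IH ltac:(intros; apply H; lia) z). rewrite (dq_mult (dqn F c n) (Dv (dqn F c n) c) c z). rewrite (H n) by lia.
    change (Cpow (z - c) (S n)) with ((z - c) * Cpow (z - c) n)%C. simpl. ring.
Qed.

(** If every coefficient vanishes, [F] is [(z - c) ^ n * dqn F c n] for all [n], and the maximum
    principle for [dqn F c n] gives [|F z| <= M * (|z - c| / r) ^ n]. *)
Theorem isolated_zeros F c R : 0 < R -> hol F (cdisk c R) ->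
  (forall z, cdisk c R z -> F z = 0%C) \/
  exists N G, hol G (cdisk c R) /\ G c <> 0%C /\ forall z, F z = (Cpow (z - c) N * G z)%C.
Proof.
  intros HR HF. assert (Hcc := cdisk_center c R HR).
  destruct (classic (exists n, dqn F c n c <> 0%C)) as [He|Hn].
  - right. destruct He as [n0 Hn0].
    assert (exists n, dqn F c n c <> 0%C /\ forall k, (k < n)%nat -> dqn F c k c = 0%C) as [n [H1 H2]].
    { induction n0 as [n0 IH] using (well_founded_induction lt_wf).
      destruct (classic (exists k, (k < n0)%nat /\ dqn F c k c <> 0%C)) as [[k [Hk Hk2]]|Hno]; [eauto|].
      exists n0. split; [easy|]. intros k Hk. apply NNPP. intros K. apply Hno. now exists k. }
    exists n, (dqn F c n). split; [apply hol_dqn; [apply cdisk_open|easy|easy]|]. split; [easy|]. now apply dqn_factor.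
  - left. assert (H0 : forall n, dqn F c n c = 0%C) by (intros n; apply NNPP; intros K; apply Hn; now exists n).
    intros z Hz. unfold cdisk in Hz. set (r := (Cmod (z - c) + R) / 2).
    assert (X := Cmod_ge_0 (z - c)).
    assert (HF1 : hol F (fun z => Cmod (z - c) <= r)).
    { apply (hol_sub _ _ _ HF). intros w Hw. unfold cdisk. apply Rle_lt_trans with r; [exact Hw|unfold r; lra]. }
    destruct (compact_max (fun z => Cmod (z - c) <= r) (fun z => Cmod (F z)) (closed_ball_compact c r)) as [x [Hx Hmax]].
    { exists c. rewrite Cmod_diag. unfold r; lra. }
    { intros x Hx e He. destruct (ccont_mod F x (hol_ccont _ _ _ HF1 Hx) e He) as [d [Hd K]]. exists d. split; [easy|]. intros; auto. }
    set (M := Cmod (F x)).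
    assert (HM0 : 0 <= M) by apply Cmod_ge_0.
    assert (Hb : forall n, Cmod (F z) <= M * (Cmod (z - c) / r) ^ n).
    { intros n. assert (Hr : 0 < r) by (unfold r; lra).
      assert (Hn1 : forall w, Cmod (w - c) <= r -> Cmod (dqn F c n w) <= M / r ^ n).
      { apply max_modulus_disk; [easy| |].
        - apply (hol_sub _ (cdisk c R)); [apply hol_dqn; [apply cdisk_open|easy|easy]|].
          intros w Hw. unfold cdisk. apply Rle_lt_trans with r; [exact Hw|unfold r; lra].
        - intros w Hw. assert (E := dqn_factor F c n (fun k _ => H0 k) w). assert (Y := Hmax w ltac:(rewrite Hw; lra)).
          fold M in Y. rewrite E, Cmod_mult, Cmod_pow, Hw in Y.
          assert (Hp : 0 < r ^ n) by now apply pow_lt.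
          apply Rmult_le_reg_l with (r ^ n); [easy|]. replace (r ^ n * (M / r ^ n)) with M by (field; lra). exact Y. }
      rewrite (dqn_factor F c n (fun k _ => H0 k) z). rewrite Cmod_mult, Cmod_pow.
      replace (M * (Cmod (z - c) / r) ^ n) with (Cmod (z - c) ^ n * (M / r ^ n)).
      - apply Rmult_le_compat_l; [apply pow_le, X|]. apply Hn1. unfold r; lra.
      - unfold Rdiv. rewrite Rpow_mult_distr, pow_inv. ring. }
    apply Cmod_eq_of_small. intros e He. replace (F z - 0)%C with (F z) by ring.
    assert (Hq : Rabs (Cmod (z - c) / r) < 1).
    { assert (Hr : 0 < r) by (unfold r; lra). rewrite Rabs_pos_eq by (apply Rmult_le_pos; [easy|now apply Rlt_le, Rinv_0_lt_compat]).
      apply Rmult_lt_reg_r with r; [easy|]. unfold Rdiv. rewrite Rmult_assoc, Rinv_l by lra. unfold r; lra. }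
    destruct (pow_lt_1_zero _ Hq (e / (M + 1))) as [N HN]; [apply Rdiv_lt_0_compat; lra|].
    specialize (HN N (Nat.le_refl N)). eapply Rle_trans; [apply (Hb N)|].
    assert (Y := Rle_abs ((Cmod (z - c) / r) ^ N)).
    apply Rle_trans with (M * (e / (M + 1))); [apply Rmult_le_compat_l; lra|].
    apply Rle_trans with ((M + 1) * (e / (M + 1))); [|right; field; lra].
    apply Rmult_le_compat_r; [apply Rlt_le, Rdiv_lt_0_compat; lra|lra].
Qed.

Lemma isolated_zero_punctured F c R : 0 < R -> hol F (cdisk c R) -> ~ (forall z, cdisk c R z -> F z = 0%C) ->
  exists s, 0 < s /\ forall z, 0 < Cmod (z - c) <= s -> F z <> 0%C.
Proof.
  intros HR HF Hn. destruct (isolated_zeros F c R HR HF) as [H|(N & G & HG & HG0 & E)]; [contradiction|].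
  destruct (hol_ccont G _ c HG (cdisk_center c R HR) (Cmod (G c))) as [d [Hd K]]; [now apply Cmod_gt_0|].
  exists (d / 2). split; [lra|]. intros z Hz. rewrite E. apply Cmult_neq_0.
  - apply Cpow_nz. apply sub_neq_0. apply Cmod_pos_neq. lra.
  - intros K2. specialize (K z ltac:(lra)). rewrite K2 in K. rewrite Cmod_sym in K.
    replace (G c - 0)%C with (G c) in K by ring. lra.
Qed.

(** On a small circle [F] keeps a distance [m] from [F c]. If some [y] within [m / 2] were omitted,
    [/ (F - y)] would be larger at the centre than on the circle. *)
Theorem open_mapping F c R : 0 < R -> hol F (cdisk c R) -> ~ (forall z, cdisk c R z -> F z = F c) ->
  exists d, 0 < d /\ forall y, Cmod (y - F c) < d -> exists z, cdisk c R z /\ F z = y.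
Proof.
  intros HR HF Hn.
  destruct (isolated_zero_punctured (fun z => F z - F c)%C c R HR) as [s0 [Hs0 HN0]].
  { apply hol_minus; [easy|apply hol_const]. }
  { intros K. apply Hn. intros z Hz. specialize (K z Hz). replace (F z) with ((F z - F c) + F c)%C by ring. rewrite K. ring. }
  set (s := Rmin s0 (R / 2)). assert (Hs : 0 < s) by (apply Rmin_pos; lra).
  assert (Hs1 : s <= s0) by apply Rmin_l. assert (Hs2 : s <= R / 2) by apply Rmin_r.
  assert (Hsub : forall z, Cmod (z - c) <= s -> cdisk c R z) by (intros z Hz; unfold cdisk; lra).
  assert (Hcirc : c_compact (fun z => Cmod (z - c) = s)).
  { apply (compact_subset _ _ (closed_ball_compact c s)); [|intros z Hz; apply Req_le, Hz].
    intros z Hz. apply Rle_antisym.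
    - apply (closed_ball_closed c s). intros e He. destruct (Hz e He) as [w [Hw Hd]]. exists w. split; [lra|easy].
    - apply le_epsilon. intros e He. destruct (Hz e He) as [w [Hw Hd]]. assert (T := Cmod_tri w z c). lra. }
  destruct (compact_max (fun z => Cmod (z - c) = s) (fun z => - Cmod (F z - F c)) Hcirc) as [x [Hx Hmin]].
  { exists (circ c s 0). apply circ_dist. lra. }
  { intros x Hx e He. destruct (hol_ccont F _ x HF (Hsub x ltac:(lra)) e He) as [d [Hd K]]. exists d. split; [easy|].
    intros y _ Hy. specialize (K y Hy). assert (T := Cmod_tri (F x) (F y) (F c)). rewrite (Cmod_sym (F x) (F y)) in T. lra. }
  set (m := Cmod (F x - F c)) in *.
  assert (Hm : 0 < m). { apply Cmod_gt_0. apply HN0. lra. }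
  exists (m / 2). split; [lra|]. intros y Hy. apply NNPP. intros Hno.
  assert (HNy : forall z, Cmod (z - c) <= s -> (F z - y)%C <> 0%C).
  { intros z Hz K. apply Hno. exists z. split; [now apply Hsub|]. replace (F z) with ((F z - y) + y)%C by ring. rewrite K. ring. }
  assert (X := max_modulus_disk (fun z => / (F z - y))%C c s (2 / m) Hs).
  specialize (X ltac:(apply hol_inv; [apply hol_minus; [now apply (hol_sub F (cdisk c R))|apply hol_const]|exact HNy])).
  assert (Y : Cmod (/ (F c - y)) <= 2 / m).
  { apply X; [|rewrite Cmod_diag; lra]. intros z Hz. rewrite Cmod_inv by (apply HNy; lra).
    replace (2 / m) with (/ (m / 2)) by (field; lra). apply Rinv_le_contravar; [lra|].
    specialize (Hmin z Hz). assert (T := Cmod_tri (F z) y (F c)). lra. }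
  rewrite Cmod_inv in Y by (apply HNy; rewrite Cmod_diag; lra).
  assert (Hp : 0 < Cmod (F c - y)) by (apply Cmod_gt_0, HNy; rewrite Cmod_diag; lra).
  rewrite (Cmod_sym y) in Hy.
  assert (Z : 2 / m < / Cmod (F c - y)).
  { replace (2 / m) with (/ (m / 2)) by (field; lra). apply Rinv_lt_contravar; [|easy]. apply Rmult_lt_0_compat; lra. }
  lra.
Qed.

(** [F - lam * id] has Lipschitz constant at most [|lam| / 2]: this yields injectivity with an
    expansion bound, and surjectivity onto a disk, with explicit radii. *)
Definition near_linear (F : C -> C) (lam x : C) (s : R) : Prop :=
  forall a b, Cmod (a - x) <= s -> Cmod (b - x) <= s -> Cmod (F a - F b - lam * (a - b)) <= Cmod lam / 2 * Cmod (a - b).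

Lemma near_linear_expand F lam x s a b : near_linear F lam x s -> Cmod (a - x) <= s -> Cmod (b - x) <= s ->
  Cmod lam / 2 * Cmod (a - b) <= Cmod (F a - F b).
Proof.
  intros H Ha Hb. specialize (H a b Ha Hb). assert (T := Cmod_tri (lam * (a - b)) (F a - F b) 0).
  replace (lam * (a - b) - 0)%C with (lam * (a - b))%C in T by ring. replace (F a - F b - 0)%C with (F a - F b)%C in T by ring.
  rewrite (Cmod_sym (lam * (a - b))) in T. rewrite Cmod_mult in T. lra.
Qed.

Lemma near_linear_surj F lam x s y : 0 <= s -> near_linear F lam x s -> 0 < Cmod lam ->
  Cmod (y - F x) <= Cmod lam / 2 * s -> exists a, Cmod (a - x) <= s /\ F a = y.
Proof.
  intros Hs H Hl Hy. set (L := Cmod lam) in *.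
  assert (Nl : lam <> 0%C) by (apply Cmod_gt_0; exact Hl).
  (* Newton's iteration with the slope frozen at [lam]; the bound on the correction halves at each
     step. *)
  set (nxt := fun a => (a - (F a - y) / lam)%C).
  set (u := fix u n := match n with O => x | S n => nxt (u n) end).
  assert (Du : forall n, Cmod (u (S n) - u n) = Cmod (F (u n) - y) / L).
  { intros n. simpl. unfold nxt. replace (u n - (F (u n) - y) / lam - u n)%C with (- ((F (u n) - y) / lam))%C by ring.
    rewrite Cmod_opp, Cmod_div; easy. }
  assert (Hind : forall n, Cmod (u n - x) <= s - s / 2 ^ n /\ Cmod (u (S n) - u n) <= s / 2 / 2 ^ n).
  { induction n as [|n [IH1 IH2]].
    - split; [simpl; rewrite Cmod_diag; lra|]. rewrite Du. simpl u. rewrite Cmod_sym.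
      simpl. apply Rmult_le_reg_r with L; [easy|]. unfold Rdiv at 1. rewrite Rmult_assoc, Rinv_l by lra. lra.
    - assert (Hp := two_pow_pos n). assert (Hq : 0 <= s / 2 ^ n) by (apply Rmult_le_pos; [easy|now apply Rlt_le, Rinv_0_lt_compat]).
      assert (E1 : s / 2 ^ S n = s / 2 ^ n / 2) by (simpl; field; lra).
      assert (E2 : s / 2 / 2 ^ n = s / 2 ^ n / 2) by (field; lra).
      assert (E3 : s / 2 / 2 ^ S n = s / 2 ^ n / 4) by (simpl; field; lra).
      rewrite E1, E3. rewrite E2 in IH2.
      assert (B1 : Cmod (u (S n) - x) <= s - s / 2 ^ n / 2).
      { eapply Rle_trans; [apply (Cmod_tri _ (u n))|]. lra. }
      split; [exact B1|].
      rewrite Du. specialize (H (u (S n)) (u n) ltac:(lra) ltac:(lra)).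
      replace (F (u (S n)) - F (u n) - lam * (u (S n) - u n))%C with (F (u (S n)) - y)%C in H.
      2:{ simpl. unfold nxt at 3. field. easy. }
      fold L in H. apply Rmult_le_reg_r with L; [easy|]. unfold Rdiv at 1. rewrite Rmult_assoc, Rinv_l by lra.
      apply Rle_trans with (L / 2 * (s / 2 ^ n / 2)); [|lra].
      rewrite Rmult_1_r. eapply Rle_trans; [exact H|]. apply Rmult_le_compat_l; lra. }
  destruct (geometric_limit u (s / 2)) as [l Hl2]; [lra|intros n; apply Hind|].
  assert (Hls : Cmod (l - x) <= s).
  { apply le_epsilon. intros e He. destruct (half_pow_small (2 * (s / 2)) e He) as [n Hn].
    assert (X := proj1 (Hind n)). specialize (Hl2 n). rewrite Cmod_sym in Hl2. assert (T := Cmod_tri l (u n) x).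
    assert (0 <= s / 2 ^ n) by (apply Rmult_le_pos; [easy|apply Rlt_le, Rinv_0_lt_compat, two_pow_pos]). lra. }
  exists l. split; [easy|]. apply Cmod_eq_of_small. intros e He.
  destruct (half_pow_small (4 * L * s) e He) as [n Hn].
  assert (Hp := two_pow_pos n). destruct (Hind n) as [I1 I2]. specialize (Hl2 n).
  assert (Hq : 0 <= s / 2 ^ n) by (apply Rmult_le_pos; [easy|now apply Rlt_le, Rinv_0_lt_compat]).
  assert (X : Cmod (F l - F (u n)) <= 2 * L * (s / 2 ^ n)).
  { rewrite (Cmod_sym (u n)) in Hl2. specialize (H l (u n) Hls ltac:(lra)).
    assert (T := Cmod_tri (F l - F (u n)) (lam * (l - u n)) 0).
    replace (F l - F (u n) - 0)%C with (F l - F (u n))%C in T by ring. replace (lam * (l - u n) - 0)%C with (lam * (l - u n))%C in T by ring.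
    rewrite Cmod_mult in T. fold L in T, H. replace (2 * (s / 2) / 2 ^ n) with (s / 2 ^ n) in Hl2 by (field; lra).
    assert (L * Cmod (l - u n) <= L * (s / 2 ^ n)) by (apply Rmult_le_compat_l; lra). assert (0 <= L * (s / 2 ^ n)) by (apply Rmult_le_pos; lra). lra. }
  rewrite Du in I2. assert (Y : Cmod (F (u n) - y) <= L * (s / 2 ^ n)).
  { replace (Cmod (F (u n) - y)) with (L * (Cmod (F (u n) - y) / L)) by (field; lra). apply Rmult_le_compat_l; [lra|].
    replace (s / 2 / 2 ^ n) with (s / 2 ^ n / 2) in I2 by (field; lra). lra. }
  eapply Rle_trans; [apply (Cmod_tri _ (F (u n)))|].
  replace (4 * L * s / 2 ^ n) with (4 * (L * (s / 2 ^ n))) in Hn by (field; lra). lra.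
Qed.

Lemma near_linear_of_deriv F lam x s R : s < R -> hol F (cdisk x R) -> (forall z, Cmod (z - x) <= s -> Cmod (Dv F z - lam) <= Cmod lam / 2) ->
  near_linear F lam x s.
Proof.
  intros Hs HF HD a b Ha Hb.
  assert (HD2 := hol_Dv F (cdisk x R) (cdisk_open x R) HF).
  assert (In : forall t, 0 <= t <= 1 -> Cmod (seg b a t - x) <= s) by (intros t Ht; now apply seg_in_ball).
  assert (InR : forall t, 0 <= t <= 1 -> cdisk x R (seg b a t)) by (intros t Ht; specialize (In t Ht); unfold cdisk; lra).
  assert (CS : cont_seg (fun z => Dv F z - lam)%C b a).
  { intros t Ht. apply ccont_minus; [|apply ccont_const]. apply (hol_ccont _ _ _ HD2). auto. }
  assert (E : J (fun z => Dv F z - lam)%C b a = ((F a - lam * a) - (F b - lam * b))%C).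
  { apply (J_FTC (fun z => F z - lam * z)%C); [|easy]. intros t Ht.
    apply cder_minus; [apply Dv_spec, HF; auto|]. eapply cder_val; [|apply cder_scal, cder_id]. ring. }
  replace (F a - F b - lam * (a - b))%C with (F a - lam * a - (F b - lam * b))%C by ring. rewrite <- E.
  rewrite Rmult_comm. apply J_bound; [easy|]. intros t Ht. apply HD. auto.
Qed.

Lemma local_near_linear F x R : 0 < R -> hol F (cdisk x R) -> Dv F x <> 0%C ->
  exists s, 0 < s < R /\ near_linear F (Dv F x) x s.
Proof.
  intros HR HF HN. assert (HD := hol_Dv F (cdisk x R) (cdisk_open x R) HF).
  assert (Hp := proj1 (Cmod_gt_0 _) HN).
  destruct (hol_ccont _ _ x HD (cdisk_center x R HR) (Cmod (Dv F x) / 2)) as [d [Hd K]]; [lra|].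
  exists (Rmin d R / 2). assert (X1 := Rmin_l d R). assert (X2 := Rmin_r d R). assert (0 < Rmin d R) by now apply Rmin_pos.
  split; [lra|]. apply (near_linear_of_deriv F _ x _ R); [lra|easy|]. intros z Hz. apply Rlt_le, K. lra.
Qed.

(** The inverse function rule for a lift: [h] is given as continuous only, and its Lipschitz bound
    comes from [l <> 0]. *)
Lemma cder_lift F h g z l m : ccont h z -> (exists d, 0 < d /\ forall w, Cmod (w - z) < d -> F (h w) = g w) ->
  cder g z m -> cder F (h z) l -> l <> 0%C -> cder h z (m / l).
Proof.
  intros Hh (d0 & Hd0 & E) Hg HF Hl e He.
  assert (Lp := proj1 (Cmod_gt_0 l) Hl). set (L := Cmod l) in *. assert (Hm := Cmod_ge_0 m).
  destruct (HF (L / 2)) as [d1 [Hd1 K1]]; [lra|].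
  destruct (cder_lip g z m Hg) as [d2 [Hd2 K2]].
  set (Q := 2 * (Cmod m + 1) / L).
  assert (HQ : 0 < Q) by (apply Rdiv_lt_0_compat; lra).
  destruct (HF (e * L / 2 / Q)) as [d3 [Hd3 K3]]; [repeat apply Rdiv_lt_0_compat; try lra; apply Rmult_lt_0_compat; lra|].
  destruct (Hg (e * L / 2)) as [d4 [Hd4 K4]]; [apply Rdiv_lt_0_compat; [apply Rmult_lt_0_compat; lra|lra]|].
  destruct (Hh (Rmin d1 d3) (Rmin_pos _ _ Hd1 Hd3)) as [d5 [Hd5 K5]].
  exists (Rmin (Rmin d0 d2) (Rmin d4 d5)).
  assert (A1 := Rmin_l (Rmin d0 d2) (Rmin d4 d5)). assert (A2 := Rmin_r (Rmin d0 d2) (Rmin d4 d5)).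
  assert (A3 := Rmin_l d0 d2). assert (A4 := Rmin_r d0 d2). assert (A5 := Rmin_l d4 d5). assert (A6 := Rmin_r d4 d5).
  assert (A7 := Rmin_l d1 d3). assert (A8 := Rmin_r d1 d3).
  split; [repeat apply Rmin_pos; easy|]. intros w Hw.
  specialize (K5 w ltac:(lra)). specialize (K1 (h w) ltac:(lra)). specialize (K3 (h w) ltac:(lra)).
  specialize (K2 w ltac:(lra)). specialize (K4 w ltac:(lra)).
  rewrite (E w), (E z) in K1, K3 by (try rewrite Cmod_diag; lra).
  assert (B1 : Cmod (h w - h z) <= Q * Cmod (w - z)).
  { assert (T := Cmod_tri (l * (h w - h z)) (g w - g z) 0).
    replace (l * (h w - h z) - 0)%C with (l * (h w - h z))%C in T by ring. replace (g w - g z - 0)%C with (g w - g z)%C in T by ring.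
    rewrite (Cmod_sym (l * (h w - h z))), Cmod_mult in T. fold L in T.
    assert (L / 2 * Cmod (h w - h z) <= (Cmod m + 1) * Cmod (w - z)) by lra.
    apply Rmult_le_reg_l with (L / 2); [lra|]. replace (L / 2 * (Q * Cmod (w - z))) with ((Cmod m + 1) * Cmod (w - z)) by (unfold Q; field; lra). easy. }
  assert (B2 : Cmod (g w - g z - l * (h w - h z)) <= e * L / 2 * Cmod (w - z)).
  { eapply Rle_trans; [exact K3|]. apply Rle_trans with (e * L / 2 / Q * (Q * Cmod (w - z))).
    - apply Rmult_le_compat_l; [|easy]. apply Rlt_le. repeat apply Rdiv_lt_0_compat; try lra; apply Rmult_lt_0_compat; lra.
    - right. field. lra. }
  replace (h w - h z - m / l * (w - z))%C with (((g w - g z - m * (w - z)) - (g w - g z - l * (h w - h z))) / l)%C by (field; easy).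
  rewrite Cmod_div by easy. fold L. apply Rmult_le_reg_r with L; [easy|]. unfold Rdiv at 1. rewrite Rmult_assoc, Rinv_l, Rmult_1_r by lra.
  eapply Rle_trans; [apply Cmod_sub_le|]. lra.
Qed.

(** [(z - c)^2 * G], set to 0 at [c], is differentiable there with derivative 0; two divisions by
    [z - c] give the extension. *)
Theorem removable G c R : 0 < R -> hol G (fun z => cdisk c R z /\ z <> c) ->
  (forall e, 0 < e -> exists d, 0 < d /\ forall z, 0 < Cmod (z - c) < d -> Cmod ((z - c) * G z) < e) ->
  exists F, hol F (cdisk c R) /\ forall z, z <> c -> F z = G z.
Proof.
  intros HR HG Hlim.
  set (H := fun z => if excluded_middle_informative (z = c) then RtoC 0 else ((z - c) * ((z - c) * G z))%C).
  assert (Hc : H c = 0%C) by (unfold H; destruct (excluded_middle_informative (c = c)); easy).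
  assert (Hn : forall z, z <> c -> H z = ((z - c) * ((z - c) * G z))%C) by (intros z Hz; unfold H; destruct (excluded_middle_informative (z = c)); easy).
  assert (D0 : cder H c 0).
  { intros e He. destruct (Hlim e He) as [d [Hd K]]. exists d. split; [easy|]. intros w Hw. rewrite Hc.
    destruct (classic (w = c)) as [->|Hw2].
    - rewrite Hc. replace (0 - 0 - 0 * (c - c))%C with (RtoC 0) by ring. rewrite Cmod_0, Cmod_diag. lra.
    - rewrite (Hn w Hw2). replace ((w - c) * ((w - c) * G w) - 0 - 0 * (w - c))%C with ((w - c) * G w * (w - c))%C by ring.
      rewrite Cmod_mult. apply Rmult_le_compat_r; [apply Cmod_ge_0|]. apply Rlt_le, K. split; [now apply Cmod_neq_pos|easy]. }
  assert (HH : hol H (cdisk c R)).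
  { intros z Hz. destruct (classic (z = c)) as [->|Hz2]; [now exists 0%C|].
    destruct (HG z (conj Hz Hz2)) as [l Hl]. eexists. apply (cder_ext_loc (fun z => (z - c) * ((z - c) * G z))%C).
    - exists (Cmod (z - c)). split; [now apply Cmod_neq_pos|]. intros w Hw. symmetry. apply Hn. intros ->. rewrite Cmod_sym in Hw. lra.
    - assert (X : cder (fun w => w - c)%C z (1 - 0)) by (apply cder_minus; [apply cder_id|apply cder_const]).
      apply (cder_mult (fun z => z - c)%C (fun z => (z - c) * G z)%C); [exact X|]. apply cder_mult; [exact X|exact Hl]. }
  assert (Hcc := cdisk_center c R HR).
  exists (dqn H c 2). split; [apply hol_dqn; [apply cdisk_open|easy|easy]|]. intros z Hz.
  assert (N := sub_neq_0 z c Hz). simpl. rewrite (dq_neq _ _ _ _ Hz), (dq_neq _ _ _ _ Hz), dq_eq, (Dv_eq H c 0 D0), Hc, (Hn z Hz). field. easy.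
Qed.

(** * Bloch's theorem and distortion of injective functions *)

(** Maximizing [(rho - |z - w|) * |L' z|] yields a point around which, on a disk of half the
    distance to the circle, [|L'|] is at most twice its central value. *)
Theorem bloch L w R rho : 0 < rho < R -> hol L (cdisk w R) -> Dv L w <> 0%C ->
  exists z, cdisk w R z /\ forall y, Cmod (y - L z) <= rho * Cmod (Dv L w) / 64 -> exists a, cdisk w R a /\ L a = y.
Proof.
  intros Hr HL HN. assert (HD := hol_Dv L (cdisk w R) (cdisk_open w R) HL).
  assert (Hp := proj1 (Cmod_gt_0 _) HN). set (lam := Cmod (Dv L w)) in *.
  assert (Hin : forall z, Cmod (z - w) <= rho -> cdisk w R z) by (intros z Hz; unfold cdisk; lra).
  destruct (compact_max (fun z => Cmod (z - w) <= rho) (fun z => (rho - Cmod (z - w)) * Cmod (Dv L z)) (closed_ball_compact w rho)) as [z [Hz Hmax]].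
  { exists w. rewrite Cmod_diag. lra. }
  { intros x Hx e He.
    destruct (ccont_mod (fun z => (RtoC rho * Dv L z))%C x) with (e := e / 2) as [d1 [Hd1 K1]]; [|lra|].
    { apply ccont_mult; [apply ccont_const|]. apply (hol_ccont _ _ _ HD). auto. }
    assert (Cd := hol_ccont _ _ x HD (Hin x Hx)).
    set (B := Cmod (Dv L x) + 1). assert (HB : 0 < B) by (unfold B; assert (X := Cmod_ge_0 (Dv L x)); lra).
    destruct (Cd (Rmin 1 (e / (2 * rho)))) as [d2 [Hd2 K2]]; [apply Rmin_pos; [lra|apply Rdiv_lt_0_compat; lra]|].
    exists (Rmin d2 (e / (2 * B))). split; [apply Rmin_pos; [easy|apply Rdiv_lt_0_compat; lra]|]. intros y Hy Hyx.
    assert (Y1 := Rlt_le_trans _ _ _ Hyx (Rmin_l _ _)). assert (Y2 := Rlt_le_trans _ _ _ Hyx (Rmin_r _ _)).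
    specialize (K2 y Y1). assert (K3 := Rlt_le_trans _ _ _ K2 (Rmin_l _ _)). assert (K4 := Rlt_le_trans _ _ _ K2 (Rmin_r _ _)).
    assert (X1 := Cmod_ge_sub (Dv L y) (Dv L x)). assert (X2 := Cmod_tri x y w). rewrite (Cmod_sym x y) in X2.
    assert (X3 := Cmod_ge_0 (Dv L y)). assert (X4 := Cmod_ge_0 (y - x)). assert (X5 := Cmod_ge_0 (Dv L x)).
    assert (E1 : Cmod (y - x) * Cmod (Dv L y) <= Cmod (y - x) * B) by (apply Rmult_le_compat_l; [easy|unfold B; lra]).
    assert (E2 : Cmod (y - x) * B < e / 2).
    { apply Rlt_le_trans with (e / (2 * B) * B); [now apply Rmult_lt_compat_r|right; field; lra]. }
    assert (E3 : rho * (Cmod (Dv L y) - Cmod (Dv L x)) < e / 2).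
    { apply Rle_lt_trans with (rho * Cmod (Dv L y - Dv L x)); [apply Rmult_le_compat_l; lra|].
      apply Rlt_le_trans with (rho * (e / (2 * rho))); [apply Rmult_lt_compat_l; lra|right; field; lra]. }
    assert (X6 := Cmod_ge_0 (x - w)).
    assert (E4 : (rho - Cmod (y - w)) * Cmod (Dv L y) <= (rho - Cmod (x - w)) * Cmod (Dv L y) + Cmod (y - x) * Cmod (Dv L y)) by nra.
    assert (E5 : (rho - Cmod (x - w)) * (Cmod (Dv L y) - Cmod (Dv L x)) < e / 2).
    { destruct (Rle_dec 0 (Cmod (Dv L y) - Cmod (Dv L x))) as [H|H]; nra. }
    lra. }
  set (mu := Cmod (Dv L z)) in *. set (s := (rho - Cmod (z - w)) / 2).
  assert (Hge : rho * lam <= (rho - Cmod (z - w)) * mu).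
  { specialize (Hmax w). rewrite Cmod_diag, Rminus_0_r in Hmax. apply Hmax. lra. }
  assert (Hpp : 0 < rho * lam) by (apply Rmult_lt_0_compat; lra).
  assert (Hmu0 : 0 <= mu) by apply Cmod_ge_0.
  assert (Hs : 0 < s).
  { unfold s. destruct (Rle_dec (rho - Cmod (z - w)) 0); [|lra]. nra. }
  assert (Hmu : 0 < mu) by (unfold s in Hs; destruct (Req_dec mu 0); [nra|lra]).
  assert (Hb : forall u, cdisk z s u -> Cmod (Dv L u) <= 2 * mu).
  { intros u Hu. unfold cdisk in Hu. assert (T := Cmod_tri u z w). assert (Hu2 : Cmod (u - w) <= rho) by (unfold s in *; lra).
    specialize (Hmax u Hu2). assert (s <= rho - Cmod (u - w)) by (unfold s in *; lra).
    assert (s * Cmod (Dv L u) <= s * (2 * mu)).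
    { apply Rle_trans with ((rho - Cmod (u - w)) * Cmod (Dv L u)); [apply Rmult_le_compat_r; [apply Cmod_ge_0|easy]|].
      eapply Rle_trans; [exact Hmax|]. unfold s. lra. }
    now apply Rmult_le_reg_l with s. }
  assert (HDz : hol (Dv L) (cdisk z s)).
  { apply (hol_sub _ _ _ HD). intros u Hu. apply Hin. unfold cdisk in Hu. assert (T := Cmod_tri u z w). unfold s in *. lra. }
  assert (Hlip := hol_lipschitz (Dv L) z s (2 * mu) Hs HDz Hb).
  (* [L'] differs from its value at [z] by at most [8 * mu / s] times the distance, hence by at most
     [mu / 2] on radius [s / 16]. The covered radius [mu / 2 * (s / 16)] is
     [(rho - |z - w|) * mu / 64]. *)
  set (r := s / 16).
  assert (NL : near_linear L (Dv L z) z r).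
  { apply (near_linear_of_deriv L _ z r s); [unfold r; lra| |].
    - apply (hol_sub _ _ _ HL). intros u Hu. apply Hin. unfold cdisk in Hu. assert (T := Cmod_tri u z w). unfold s in *. lra.
    - intros u Hu. eapply Rle_trans; [apply Hlip; unfold r in Hu; lra|]. fold mu.
      apply Rle_trans with (4 * (2 * mu) / s * r).
      + apply Rmult_le_compat_l; [|easy]. apply Rmult_le_pos; [lra|]. now apply Rlt_le, Rinv_0_lt_compat.
      + right. unfold r. field. lra. }
  exists z. split; [now apply Hin|]. intros y Hy.
  destruct (near_linear_surj L (Dv L z) z r y) as [a [Ha Hay]]; [unfold r; lra|easy|easy| |].
  - eapply Rle_trans; [exact Hy|]. fold mu. unfold r, s.
    replace (mu / 2 * ((rho - Cmod (z - w)) / 2 / 16)) with ((rho - Cmod (z - w)) * mu / 64) by field. lra.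
  - exists a. split; [|easy]. apply Hin. assert (T := Cmod_tri a z w). unfold r, s in *. lra.
Qed.

(** * The complex exponential and logarithms on disks *)

Definition cexp (z : C) : C := (RtoC (exp (Re z)) * eit (Im z))%C.

Lemma cexp_plus a b : cexp (a + b) = (cexp a * cexp b)%C.
Proof.
  destruct a as [x y], b as [u v]. unfold cexp, eit, Cmult, Cplus, RtoC, Re, Im; simpl.
  rewrite exp_plus, cos_plus, sin_plus. f_equal; ring.
Qed.

Lemma cexp_0 : cexp 0 = 1%C.
Proof. unfold cexp, eit, Cmult, RtoC, Re, Im; simpl. rewrite exp_0, cos_0, sin_0. f_equal; ring. Qed.

Lemma cexp_neq_0 z : cexp z <> 0%C.
Proof.
  intros K. assert (H := cexp_plus z (- z)). rewrite K in H. replace (z + - z)%C with (RtoC 0) in H by ring.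
  rewrite cexp_0 in H. replace (0 * cexp (- z))%C with (RtoC 0) in H by ring. apply RtoC_inj in H. lra.
Qed.

Lemma cexp_period z : cexp (z + 2 * RtoC PI * Ci) = cexp z.
Proof.
  rewrite cexp_plus. replace (cexp (2 * RtoC PI * Ci)) with (RtoC 1); [ring|].
  unfold cexp, eit, Ci, Cmult, RtoC, Re, Im; simpl.
  replace (2 * PI - 0 * 0) with (2 * PI) by ring.
  replace ((2 * PI - 0 * 0) * 0 - (2 * 0 + 0 * PI) * 1) with 0 by ring.
  replace ((2 * PI - 0 * 0) * 1 + (2 * 0 + 0 * PI) * 0) with (2 * PI) by ring.
  replace ((2 * PI) * 1 + (2 * 0 + 0 * PI) * 0) with (2 * PI) by ring.
  replace ((2 * PI) * 0 - (2 * 0 + 0 * PI) * 1) with 0 by ring.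
  rewrite exp_0, cos_2PI, sin_2PI. f_equal; ring.
Qed.

Lemma cder_cexp_0 : cder cexp 0 1.
Proof.
  intros e0 He0. set (e := Rmin (e0 / 8) (/ 2)).
  assert (He : 0 < e) by (apply Rmin_pos; lra). assert (He1 : e <= e0 / 8) by apply Rmin_l. assert (He2 : e <= / 2) by apply Rmin_r.
  assert (G : forall f l, derivable_pt_lim f 0 l -> exists d : posreal, forall h, Rabs h < d -> Rabs (f h - f 0 - l * h) <= e * Rabs h).
  { intros f l H. destruct (H e He) as [d K]. exists d. intros h Hh. destruct (Req_dec h 0) as [->|Hn].
    - rewrite Rabs_R0. replace (f 0 - f 0 - l * 0) with 0 by ring. rewrite Rabs_R0. lra.
    - specialize (K h Hn Hh). rewrite Rplus_0_l in K. replace (f h - f 0 - l * h) with (((f h - f 0) / h - l) * h) by (field; easy).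
      rewrite Rabs_mult. apply Rmult_le_compat_r; [apply Rabs_pos|lra]. }
  destruct (G exp 1) as [d1 K1]; [assert (H := derivable_pt_lim_exp 0); rewrite exp_0 in H; exact H|].
  destruct (G sin 1) as [d2 K2]; [assert (H := derivable_pt_lim_sin 0); rewrite cos_0 in H; exact H|].
  destruct (G cos 0) as [d3 K3]; [assert (H := derivable_pt_lim_cos 0); rewrite sin_0, Ropp_0 in H; exact H|].
  exists (Rmin (Rmin d1 d2) (Rmin d3 e)). split; [apply Rmin_pos; apply Rmin_pos; try apply cond_pos; exact He|].
  intros w Hw. rewrite cexp_0. replace (w - 0)%C with w in * by ring.
  assert (A1 := Rmin_l (Rmin d1 d2) (Rmin d3 e)). assert (A2 := Rmin_r (Rmin d1 d2) (Rmin d3 e)).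
  assert (A3 := Rmin_l d1 d2). assert (A4 := Rmin_r d1 d2). assert (A5 := Rmin_l d3 e). assert (A6 := Rmin_r d3 e).
  assert (Hre := re_le_Cmod w). assert (Him := im_le_Cmod w).
  destruct w as [x y]. change (Re (x, y)) with x in *. change (Im (x, y)) with y in *.
  specialize (K1 x ltac:(lra)). specialize (K2 y ltac:(lra)). specialize (K3 y ltac:(lra)).
  rewrite exp_0 in K1. rewrite sin_0 in K2. rewrite cos_0 in K3.
  eapply Rle_trans; [apply Cmod_le_ReIm|].
  replace (Re (cexp (x, y) - 1 - 1 * (x, y))) with (exp x * (cos y - 1 - 0 * y) + (exp x - 1 - 1 * x))
    by (unfold cexp, eit, Cmult, RtoC, Re, Im; simpl; ring).
  replace (Im (cexp (x, y) - 1 - 1 * (x, y))) with ((exp x - 1 - 1 * x) * sin y + 1 * x * sin y + (sin y - 0 - 1 * y))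
    by (unfold cexp, eit, Cmult, RtoC, Re, Im; simpl; ring).
  set (m := Cmod (x, y)) in *. assert (Hm : 0 <= m) by apply Cmod_ge_0.
  assert (B1 : Rabs (exp x) <= 3).
  { replace (exp x) with ((exp x - 1 - 1 * x) + 1 + x) by ring. assert (T1 := Rabs_triang (exp x - 1 - 1 * x + 1) x).
    assert (T2 := Rabs_triang (exp x - 1 - 1 * x) 1). rewrite Rabs_R1 in T2. nra. }
  assert (B2 : Rabs (sin y) <= 1) by (apply Rabs_le, SIN_bound).
  assert (B3 : Rabs (sin y) <= 2 * m).
  { replace (sin y) with ((sin y - 0 - 1 * y) + y) by ring. assert (T := Rabs_triang (sin y - 0 - 1 * y) y). nra. }
  assert (K1' : Rabs (exp x - 1 - 1 * x) <= e * m) by (eapply Rle_trans; [exact K1|apply Rmult_le_compat_l; lra]).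
  assert (K2' : Rabs (sin y - 0 - 1 * y) <= e * m) by (eapply Rle_trans; [exact K2|apply Rmult_le_compat_l; lra]).
  assert (K3' : Rabs (cos y - 1 - 0 * y) <= e * m) by (eapply Rle_trans; [exact K3|apply Rmult_le_compat_l; lra]).
  assert (Hem : 0 <= e * m) by (apply Rmult_le_pos; lra).
  assert (C1 : Rabs (exp x * (cos y - 1 - 0 * y)) <= 3 * (e * m)).
  { rewrite Rabs_mult. apply Rmult_le_compat; try apply Rabs_pos; easy. }
  assert (C2 : Rabs ((exp x - 1 - 1 * x) * sin y) <= (e * m) * 1).
  { rewrite Rabs_mult. apply Rmult_le_compat; try apply Rabs_pos; easy. }
  assert (C3 : Rabs (1 * x * sin y) <= e * (2 * m)).
  { rewrite Rmult_1_l, Rabs_mult. apply Rmult_le_compat; try apply Rabs_pos; lra. }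
  assert (T1 := Rabs_triang (exp x * (cos y - 1 - 0 * y)) (exp x - 1 - 1 * x)).
  assert (T2 := Rabs_triang ((exp x - 1 - 1 * x) * sin y + 1 * x * sin y) (sin y - 0 - 1 * y)).
  assert (T3 := Rabs_triang ((exp x - 1 - 1 * x) * sin y) (1 * x * sin y)).
  assert (X : 8 * (e * m) <= e0 * m) by nra. lra.
Qed.

Lemma cder_cexp z : cder cexp z (cexp z).
Proof.
  apply (cder_ext (fun w => cexp z * cexp (w - z))%C).
  { intros w. rewrite <- cexp_plus. f_equal. ring. }
  eapply cder_val; [|apply cder_scal, (cder_comp cexp (fun w => w - z)%C z 1 1)].
  - ring.
  - eapply cder_val; [|apply cder_minus; [apply cder_id|apply cder_const]]. ring.
  - replace (z - z)%C with (RtoC 0) by ring. apply cder_cexp_0.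
Qed.

(** [L] is a primitive of [G' / G], and [G * cexp (- L)] is constant. The constant is kept as the
    factor [k] rather than absorbed into [L]. *)
Lemma log_disk G c R : 0 < R -> hol G (cdisk c R) -> (forall z, cdisk c R z -> G z <> 0%C) ->
  exists (L : C -> C) (k : C), k <> 0%C /\ hol L (cdisk c R) /\ (forall z, cdisk c R z -> G z = (k * cexp (L z))%C /\ Dv L z = (Dv G z / G z)%C).
Proof.
  intros HR HG HN. assert (HD := hol_Dv G _ (cdisk_open c R) HG). assert (Hcc := cdisk_center c R HR).
  destruct (primitive_disk (fun z => Dv G z * / G z)%C c R HR) as [L HL].
  { apply hol_mult; [easy|]. now apply hol_inv. }
  set (H := fun z => (G z * cexp (- L z))%C).
  assert (HH : forall z, cdisk c R z -> cder H z 0).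
  { intros z Hz. eapply cder_val; [|apply (cder_mult G (fun z => cexp (- L z))); [apply Dv_spec, HG, Hz|]].
    2:{ apply (cder_comp cexp (fun z => - L z)%C); [apply cder_opp, HL, Hz|apply cder_cexp]. }
    cbv beta. field. now apply HN. }
  exists L, (H c). split; [|split].
  - apply Cmult_neq_0; [now apply HN|apply cexp_neq_0].
  - intros z Hz. eexists. now apply HL.
  - intros z Hz. split; [|now apply Dv_eq, HL].
    rewrite (cder_0_const H (cdisk c R) c z (cdisk_convex c R) HH Hcc Hz). unfold H.
    rewrite <- Cmult_assoc, <- cexp_plus. replace (- L z + L z)%C with (RtoC 0) by ring. rewrite cexp_0. ring.
Qed.

(* A Koebe-type distortion bound: if [g] is injective, a branch [L] of [log (g - b)] never takes two values
   differing by [2 pi i], so its image contains no disk of radius [> pi]; apply Bloch's theorem to [L]. *)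
Theorem koebe g w R rho b : 0 < rho < R -> hol g (cdisk w R) ->
  (forall x y, cdisk w R x -> cdisk w R y -> g x = g y -> x = y) ->
  (forall x, cdisk w R x -> g x <> b) -> rho * Cmod (Dv g w) <= 256 * Cmod (g w - b).
Proof.
  intros Hr Hg Hinj Hb. assert (HR : 0 < R) by lra. assert (Hcc := cdisk_center w R HR).
  destruct (log_disk (fun z => g z - b)%C w R HR) as (L & k & Hk & HL & E).
  { apply hol_minus; [easy|apply hol_const]. }
  { intros z Hz. apply sub_neq_0. now apply Hb. }
  destruct (E w Hcc) as [_ E2].
  assert (ED : Dv (fun z => g z - b)%C w = Dv g w).
  { apply Dv_eq. eapply cder_val; [|apply cder_minus; [apply Dv_spec, Hg, Hcc|apply cder_const]]. ring. }
  rewrite ED in E2. assert (Nb := sub_neq_0 _ _ (Hb w Hcc)). assert (Pb := proj1 (Cmod_gt_0 _) Nb).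
  apply Rnot_lt_le. intros K.
  assert (HlamE : Cmod (Dv L w) = Cmod (Dv g w) / Cmod (g w - b)) by (rewrite E2; now apply Cmod_div).
  assert (Hlam : 256 < rho * Cmod (Dv L w)).
  { rewrite HlamE. apply Rmult_lt_reg_r with (Cmod (g w - b)); [easy|].
    replace (rho * (Cmod (Dv g w) / Cmod (g w - b)) * Cmod (g w - b)) with (rho * Cmod (Dv g w)) by (field; lra). easy. }
  assert (HN : Dv L w <> 0%C) by (intros Z; rewrite Z, Cmod_0 in Hlam; lra).
  destruct (bloch L w R rho Hr HL HN) as (z & Hz & Hcov).
  (* The constant 256 is [64 * 4] with [PI <= 4]: the disk from [bloch] has radius above 4 and
     contains [L z + PI * Ci] and [L z - PI * Ci]. *)
  assert (P4 := PI_4). assert (P0 := PI_RGT_0).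
  assert (MP : Cmod (RtoC PI * Ci) = PI) by (rewrite Cmod_mult, Cmod_Ci, Cmod_RtoC_pos; lra).
  destruct (Hcov (L z + RtoC PI * Ci)%C) as (a1 & Ha1 & La1).
  { replace (L z + RtoC PI * Ci - L z)%C with (RtoC PI * Ci)%C by ring. rewrite MP. lra. }
  destruct (Hcov (L z - RtoC PI * Ci)%C) as (a2 & Ha2 & La2).
  { replace (L z - RtoC PI * Ci - L z)%C with (- (RtoC PI * Ci))%C by ring. rewrite Cmod_opp, MP. lra. }
  assert (EL : L a1 = (L a2 + 2 * RtoC PI * Ci)%C) by (rewrite La1, La2; ring).
  assert (Eg : g a1 = g a2).
  { destruct (E a1 Ha1) as [F1 _]. destruct (E a2 Ha2) as [F2 _]. rewrite EL, cexp_period, <- F2 in F1.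
    replace (g a1) with (g a1 - b + b)%C by ring. rewrite F1. ring. }
  assert (Ea := Hinj a1 a2 Ha1 Ha2 Eg). rewrite Ea in EL.
  assert (Z : (RtoC PI * Ci)%C = 0%C).
  { replace (RtoC PI * Ci)%C with ((L a2 + 2 * RtoC PI * Ci - L a2) / 2)%C by field. rewrite <- EL. field. }
  rewrite Z, Cmod_0 in MP. lra.
Qed.

(** * Packings of disks *)

Fixpoint rsum {A} (f : A -> R) (l : list A) : R := match l with nil => 0 | a :: l => f a + rsum f l end.
Fixpoint csum {A} (f : A -> C) (l : list A) : C := match l with nil => RtoC 0 | a :: l => (f a + csum f l)%C end.

Lemma rsum_app {A} (f : A -> R) l1 l2 : rsum f (l1 ++ l2) = rsum f l1 + rsum f l2.
Proof. induction l1; simpl; [ring|rewrite IHl1; ring]. Qed.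

Lemma rsum_le {A} (f g : A -> R) l : (forall a, In a l -> f a <= g a) -> rsum f l <= rsum g l.
Proof.
  induction l as [|a l IH]; intros H; simpl; [lra|]. assert (f a <= g a) by (apply H; now left).
  assert (rsum f l <= rsum g l) by (apply IH; intros; apply H; now right). lra.
Qed.

Lemma rsum_scal {A} (f : A -> R) k l : rsum (fun a => k * f a) l = k * rsum f l.
Proof. induction l; simpl; [ring|rewrite IHl; ring]. Qed.

Lemma rsum_nonneg {A} (f : A -> R) l : (forall a, In a l -> 0 <= f a) -> 0 <= rsum f l.
Proof.
  induction l as [|a l IH]; intros H; simpl; [lra|]. assert (0 <= f a) by (apply H; now left).
  assert (0 <= rsum f l) by (apply IH; intros; apply H; now right). lra.
Qed.

Lemma rsum_filter {A} (f : A -> R) p l : rsum f l = rsum f (filter p l) + rsum f (filter (fun a => negb (p a)) l).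
Proof. induction l as [|a l IH]; simpl; [ring|]. rewrite IH. destruct (p a); simpl; ring. Qed.

Definition zrange (i0 : Z) (n : nat) : list Z := map (fun k => (i0 + Z.of_nat k)%Z) (seq 0 n).

Lemma zrange_in i0 n i : In i (zrange i0 n) <-> (i0 <= i < i0 + Z.of_nat n)%Z.
Proof.
  unfold zrange. rewrite in_map_iff. split.
  - intros [k [<- Hk]]. apply in_seq in Hk. lia.
  - intros H. exists (Z.to_nat (i - i0)). split; [lia|]. apply in_seq. lia.
Qed.

Lemma zrange_NoDup i0 n : NoDup (zrange i0 n).
Proof. apply Injective_map_NoDup; [intros a b H; lia|apply seq_NoDup]. Qed.

Lemma zrange_length i0 n : length (zrange i0 n) = n.
Proof. unfold zrange. now rewrite length_map, length_seq. Qed.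

(** A deviation of [r / 3] in each coordinate keeps the sum of the two below [r]. *)
Lemma zrange_inside x r h : 0 < h -> 6 * h <= r -> exists i0 n,
  (forall i, In i (zrange i0 n) -> Rabs (IZR i * h - x) <= r / 3) /\ r / 2 <= INR n * h.
Proof.
  intros Hh Hr. destruct (archimed ((x - r / 3) / h)) as [A1 A2].
  set (i0 := up ((x - r / 3) / h)) in *.
  destruct (nfloor_ex (2 * r / 3 / h)) as [n [N1 N2]]; [apply Rlt_le, Rdiv_lt_0_compat; lra|].
  assert (E1 : (x - r / 3) / h * h = x - r / 3) by (field; lra).
  assert (E2 : 2 * r / 3 / h * h = 2 * r / 3) by (field; lra).
  assert (B1 : x - r / 3 < IZR i0 * h) by (rewrite <- E1; apply Rmult_lt_compat_r; lra).
  assert (B2 : IZR i0 * h <= x - r / 3 + h) by (rewrite <- E1; nra).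
  assert (B3 : INR n * h <= 2 * r / 3) by (rewrite <- E2; apply Rmult_le_compat_r; lra).
  assert (B4 : 2 * r / 3 < (INR n + 1) * h) by (rewrite <- E2; apply Rmult_lt_compat_r; lra).
  exists i0, n. split; [|lra]. intros i Hi. apply zrange_in in Hi.
  assert (C1 : IZR i0 <= IZR i) by (apply IZR_le; lia).
  assert (C2 : IZR i <= IZR i0 + INR n - 1).
  { rewrite INR_IZR_INZ, <- plus_IZR, <- minus_IZR. apply IZR_le. lia. }
  assert (C3 : IZR i0 * h <= IZR i * h) by (apply Rmult_le_compat_r; lra).
  assert (C4 : IZR i * h <= (IZR i0 + INR n - 1) * h) by (apply Rmult_le_compat_r; lra).
  apply Rabs_le. lra.
Qed.

Lemma zrange_outside x r h : 0 < h <= r -> exists i0 n,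
  (forall i, Rabs (IZR i * h - x) < r -> In i (zrange i0 n)) /\ INR n * h <= 3 * r.
Proof.
  intros [Hh Hr]. destruct (archimed ((x - r) / h)) as [A1 A2].
  set (i0 := up ((x - r) / h)) in *.
  destruct (nfloor_ex (2 * r / h)) as [n [N1 N2]]; [apply Rlt_le, Rdiv_lt_0_compat; lra|].
  assert (E1 : (x - r) / h * h = x - r) by (field; lra).
  assert (E2 : 2 * r / h * h = 2 * r) by (field; lra).
  assert (B3 : INR n * h <= 2 * r) by (rewrite <- E2; apply Rmult_le_compat_r; lra).
  exists i0, (S n). split; [|rewrite S_INR; lra]. intros i Hi. apply Rabs_def2 in Hi. apply zrange_in.
  assert (D1 : (x - r) / h < IZR i).
  { apply Rmult_lt_reg_r with h; [easy|]. rewrite E1. lra. }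
  assert (D2 : IZR i < (x - r) / h + 2 * r / h).
  { apply Rmult_lt_reg_r with h; [easy|]. rewrite Rmult_plus_distr_r, E1, E2. lra. }
  split.
  - assert (IZR (i0 - 1) < IZR i) by (rewrite minus_IZR; lra). apply lt_IZR in H. lia.
  - apply lt_IZR. rewrite plus_IZR, <- INR_IZR_INZ, S_INR. lra.
Qed.

Definition disjoint_disks {A} (l : list A) (c : A -> C) (r : A -> R) : Prop :=
  forall i j z, In i l -> In j l -> i <> j -> cdisk (c i) (r i) z -> cdisk (c j) (r j) z -> False.

Lemma NoDup_app {A} (l1 l2 : list A) : NoDup l1 -> NoDup l2 -> (forall x, In x l1 -> In x l2 -> False) -> NoDup (l1 ++ l2).
Proof.
  induction l1 as [|a l1 IH]; intros H1 H2 H; simpl; [easy|]. inversion H1; subst. constructor.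
  - rewrite in_app_iff. intros [K|K]; [contradiction|]. apply (H a); [now left|easy].
  - apply IH; try easy. intros x X Y. apply (H x); [now right|easy].
Qed.

Lemma list_prod_NoDup {A B} (l1 : list A) (l2 : list B) : NoDup l1 -> NoDup l2 -> NoDup (list_prod l1 l2).
Proof.
  intros H1 H2. induction H1 as [|a l1 Ha H1 IH]; simpl; [constructor|]. apply NoDup_app; [|easy|].
  - apply Injective_map_NoDup; [intros x y E; now inversion E|easy].
  - intros [x y] X Y. apply in_map_iff in X. destruct X as [z [E _]]. inversion E; subst. apply in_prod_iff in Y. easy.
Qed.

(* Count the points of a fine square lattice lying in the disks. *)
Theorem packing {A} (l : list A) (c : A -> C) (r : A -> R) (a : C) (R : R) : 0 < R -> NoDup l ->
  (forall i, In i l -> 0 < r i) -> disjoint_disks l c r ->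
  (forall i, In i l -> subset (cdisk (c i) (r i)) (cdisk a R)) ->
  rsum (fun i => r i * r i) l <= 36 * (R * R).
Proof.
  intros HR Hnd Hr Hdis Hsub.
  destruct (list_inf l r Hr) as [m [Hm Hm2]].
  set (h := Rmin (m / 6) R). assert (Hh : 0 < h) by (apply Rmin_pos; lra).
  assert (Hh1 : h <= m / 6) by apply Rmin_l. assert (Hh2 : h <= R) by apply Rmin_r.
  destruct (zrange_outside (Re a) R h (conj Hh Hh2)) as (i0 & n1 & I1 & I2).
  destruct (zrange_outside (Im a) R h (conj Hh Hh2)) as (j0 & n2 & J1 & J2).
  set (pt := fun q : Z * Z => (IZR (fst q) * h, IZR (snd q) * h) : C).
  (* Each disk holds at least [(r / (2 * h)) ^ 2] lattice points, and disjoint disks hold different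
     ones; the big disk holds at most [(3 * R / h) ^ 2]. Hence [36 = 4 * 9]. *)
  assert (Main : exists L : list (Z * Z), NoDup L /\ (forall q, In q L -> exists i, In i l /\ cdisk (c i) (r i) (pt q)) /\
    rsum (fun i => r i * r i) l <= 4 * (INR (length L) * (h * h))).
  { revert Hnd Hr Hdis Hsub Hm2. induction l as [|i l IH]; intros Hnd Hr Hdis Hsub Hm2.
    - exists nil. split; [constructor|]. split; [intros q []|]. simpl. lra.
    - destruct IH as (L & L1 & L2 & L3).
      + now inversion Hnd.
      + intros j Hj. apply Hr. now right.
      + intros j k z Hj Hk. apply Hdis; now right.
      + intros j Hj. apply Hsub. now right.
      + intros j Hj. apply Hm2. now right.
      + assert (Hi := Hm2 i (or_introl eq_refl)).
        destruct (zrange_inside (Re (c i)) (r i) h Hh ltac:(lra)) as (a0 & k1 & A1 & A2).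
        destruct (zrange_inside (Im (c i)) (r i) h Hh ltac:(lra)) as (b0 & k2 & B1 & B2).
        set (Q := list_prod (zrange a0 k1) (zrange b0 k2)).
        assert (HQ : forall q, In q Q -> cdisk (c i) (r i) (pt q)).
        { intros [x y] Hq. apply in_prod_iff in Hq. destruct Hq as [Hx Hy]. specialize (A1 x Hx). specialize (B1 y Hy).
          unfold cdisk. eapply Rle_lt_trans; [apply Cmod_le_ReIm|].
          change (Rabs (IZR x * h - Re (c i)) + Rabs (IZR y * h - Im (c i)) < r i). lra. }
        exists (Q ++ L). split; [|split].
        * apply NoDup_app; [apply list_prod_NoDup; apply zrange_NoDup|easy|]. intros q X Y.
          destruct (L2 q Y) as [j [Hj Hj2]]. apply (Hdis i j (pt q)); [now left|now right| |now apply HQ|easy].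
          intros ->. inversion Hnd; contradiction.
        * intros q Hq. apply in_app_iff in Hq. destruct Hq as [Hq|Hq].
          -- exists i. split; [now left|now apply HQ].
          -- destruct (L2 q Hq) as [j [? ?]]. exists j. split; [now right|easy].
        * simpl. rewrite length_app, plus_INR. unfold Q. rewrite length_prod, !zrange_length, mult_INR.
          assert (X : (r i / 2) * (r i / 2) <= (INR k1 * h) * (INR k2 * h)) by (apply Rmult_le_compat; lra).
          assert (Hri := Hr i (or_introl eq_refl)). lra. }
  destruct Main as (L & L1 & L2 & L3).
  assert (Hincl : incl L (list_prod (zrange i0 n1) (zrange j0 n2))).
  { intros [x y] Hq. destruct (L2 _ Hq) as [i [Hi Hi2]]. apply (Hsub i Hi) in Hi2. unfold cdisk in Hi2.
    apply in_prod_iff. split.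
    - apply I1. eapply Rle_lt_trans; [|exact Hi2]. apply (re_le_Cmod (pt (x, y) - a)).
    - apply J1. eapply Rle_lt_trans; [|exact Hi2]. apply (im_le_Cmod (pt (x, y) - a)). }
  assert (Hlen := NoDup_incl_length L1 Hincl). rewrite length_prod, !zrange_length in Hlen.
  apply le_INR in Hlen. rewrite mult_INR in Hlen.
  assert (X : INR (length L) * (h * h) <= (INR n1 * INR n2) * (h * h)) by (apply Rmult_le_compat_r; [nra|easy]).
  assert (Y : (INR n1 * h) * (INR n2 * h) <= (3 * R) * (3 * R)).
  { apply Rmult_le_compat; try lra; apply Rmult_le_pos; try lra; apply pos_INR. }
  lra.
Qed.

Lemma disjoint_disks_incl {A} (l l' : list A) (c : A -> C) r : incl l' l -> disjoint_disks l c r -> disjoint_disks l' c r.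
Proof. intros H D i j z Hi Hj. apply D; auto. Qed.

(** A discrete form of the integral of [1/|z - a|] over a disk of radius [d]. Disks centred in the
    shell between [d / 2] and [d] lie in the disk of radius [2 * d], so by [packing] the shell
    contributes at most [288 * d], and the halved radii sum to [576 * d]. The number [n] of shells
    serves the induction and is absent from the bound. *)
Lemma tail_dyadic {A} n : forall (l : list A) (c : A -> C) (r : A -> R) (a : C) (d : R), 0 < d -> NoDup l ->
  (forall i, In i l -> 0 < r i <= Cmod (c i - a)) -> disjoint_disks l c r ->
  (forall i, In i l -> d / 2 ^ n <= Cmod (c i - a) < d) ->
  rsum (fun i => r i * r i / Cmod (c i - a)) l <= 576 * d.
Proof.
  induction n as [|n IH]; intros l c r a d Hd Hnd Hr Hdis Hl.
  - destruct l as [|i l]; [simpl; lra|]. exfalso. specialize (Hl i (or_introl eq_refl)). simpl in Hl. lra.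
  - set (p := fun i => if Rlt_dec (Cmod (c i - a)) (d / 2) then true else false).
    assert (Hp : forall i, p i = true -> Cmod (c i - a) < d / 2) by (intros i; unfold p; destruct (Rlt_dec _ _); easy).
    assert (Hp2 : forall i, negb (p i) = true -> d / 2 <= Cmod (c i - a)) by (intros i; unfold p; destruct (Rlt_dec _ _); simpl; lra || easy).
    assert (In1 : incl (filter p l) l) by (intros i Hi; now apply filter_In in Hi).
    assert (In2 : incl (filter (fun i => negb (p i)) l) l) by (intros i Hi; now apply filter_In in Hi).
    rewrite (rsum_filter _ p).
    assert (X1 : rsum (fun i => r i * r i / Cmod (c i - a)) (filter p l) <= 576 * (d / 2)).
    { apply (IH (filter p l) c r a (d / 2)); [lra|now apply NoDup_filter|intros i Hi; apply Hr, In1, Hi|now apply (disjoint_disks_incl l)|].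
      intros i Hi. split; [|now apply Hp; apply filter_In in Hi]. specialize (Hl i (In1 i Hi)).
      replace (d / 2 / 2 ^ n) with (d / 2 ^ S n) by (simpl; field; apply pow_nonzero; lra). easy. }
    assert (X2 : rsum (fun i => r i * r i / Cmod (c i - a)) (filter (fun i => negb (p i)) l) <= rsum (fun i => 2 / d * (r i * r i)) (filter (fun i => negb (p i)) l)).
    { apply rsum_le. intros i Hi. assert (Hi2 := Hr i (In2 i Hi)). apply filter_In in Hi. destruct Hi as [Hi Hi3]. apply Hp2 in Hi3.
      unfold Rdiv at 1. rewrite Rmult_comm. apply Rmult_le_compat_r; [nra|].
      replace (2 / d) with (/ (d / 2)) by (field; lra). apply Rinv_le_contravar; lra. }
    rewrite rsum_scal in X2.
    assert (X3 : rsum (fun i => r i * r i) (filter (fun i => negb (p i)) l) <= 36 * ((2 * d) * (2 * d))).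
    { apply (packing _ c r a (2 * d)); [lra|now apply NoDup_filter|intros i Hi; apply Hr, In2, Hi|now apply (disjoint_disks_incl l)|].
      intros i Hi z Hz. unfold cdisk in *. specialize (Hl i (In2 i Hi)). specialize (Hr i (In2 i Hi)).
      assert (T := Cmod_tri z (c i) a). lra. }
    assert (X4 : 2 / d * rsum (fun i => r i * r i) (filter (fun i => negb (p i)) l) <= 2 / d * (36 * ((2 * d) * (2 * d)))).
    { apply Rmult_le_compat_l; [apply Rlt_le, Rdiv_lt_0_compat; lra|easy]. }
    replace (2 / d * (36 * ((2 * d) * (2 * d)))) with (288 * d) in X4 by (field; lra). lra.
Qed.

(** Splitting at distance [d] makes the bound independent of [a]: the first term is small by the
    choice of [d], the second once the sum of squares is small. *)
Theorem tail_bound {A} (l : list A) (c : A -> C) (r : A -> R) (a : C) (d : R) : 0 < d -> NoDup l ->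
  (forall i, In i l -> 0 < r i <= Cmod (c i - a)) -> disjoint_disks l c r ->
  rsum (fun i => r i * r i / Cmod (c i - a)) l <= 576 * d + rsum (fun i => r i * r i) l / d.
Proof.
  intros Hd Hnd Hr Hdis.
  set (p := fun i => if Rlt_dec (Cmod (c i - a)) d then true else false).
  assert (Hp : forall i, p i = true -> Cmod (c i - a) < d) by (intros i; unfold p; destruct (Rlt_dec _ _); easy).
  assert (Hp2 : forall i, negb (p i) = true -> d <= Cmod (c i - a)) by (intros i; unfold p; destruct (Rlt_dec _ _); simpl; lra || easy).
  assert (In1 : incl (filter p l) l) by (intros i Hi; now apply filter_In in Hi).
  assert (In2 : incl (filter (fun i => negb (p i)) l) l) by (intros i Hi; now apply filter_In in Hi).
  rewrite (rsum_filter _ p). apply Rplus_le_compat.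
  - destruct (list_inf (filter p l) (fun i => Cmod (c i - a))) as [m [Hm Hm2]].
    { intros i Hi. specialize (Hr i (In1 i Hi)). lra. }
    destruct (half_pow_small d m Hm) as [n Hn].
    apply (tail_dyadic n); [easy|now apply NoDup_filter|intros i Hi; apply Hr, In1, Hi|now apply (disjoint_disks_incl l)|].
    intros i Hi. split; [specialize (Hm2 i Hi); lra|]. apply Hp. now apply filter_In in Hi.
  - unfold Rdiv at 2. rewrite Rmult_comm, <- rsum_scal. rewrite (rsum_filter _ p l).
    assert (0 <= rsum (fun i => / d * (r i * r i)) (filter p l)).
    { apply rsum_nonneg. intros i Hi. apply Rmult_le_pos; [now apply Rlt_le, Rinv_0_lt_compat|]. specialize (Hr i (In1 i Hi)). nra. }
    assert (rsum (fun i => r i * r i / Cmod (c i - a)) (filter (fun i => negb (p i)) l) <= rsum (fun i => / d * (r i * r i)) (filter (fun i => negb (p i)) l)); [|lra].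
    apply rsum_le. intros i Hi. assert (Hi2 := Hr i (In2 i Hi)). apply filter_In in Hi. destruct Hi as [Hi Hi3]. apply Hp2 in Hi3.
    unfold Rdiv. rewrite Rmult_comm. apply Rmult_le_compat_r; [nra|]. apply Rinv_le_contravar; lra.
Qed.

(** * Unordered sums *)

Lemma csum_app {A} (f : A -> C) l1 l2 : csum f (l1 ++ l2) = (csum f l1 + csum f l2)%C.
Proof. induction l1; simpl; [ring|rewrite IHl1; ring]. Qed.

Lemma csum_plus {A} (f g : A -> C) l : csum (fun a => f a + g a)%C l = (csum f l + csum g l)%C.
Proof. induction l; simpl; [ring|rewrite IHl; ring]. Qed.

Lemma csum_scal {A} k (f : A -> C) l : csum (fun a => k * f a)%C l = (k * csum f l)%C.
Proof. induction l; simpl; [ring|rewrite IHl; ring]. Qed.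

Lemma csum_ext {A} (f g : A -> C) l : (forall a, In a l -> f a = g a) -> csum f l = csum g l.
Proof.
  induction l as [|a l IH]; intros H; simpl; [easy|]. rewrite (H a) by now left. rewrite IH; [easy|].
  intros; apply H; now right.
Qed.

Lemma csum_0 {A} (f : A -> C) l : (forall a, In a l -> f a = 0%C) -> csum f l = 0%C.
Proof.
  intros H. rewrite (csum_ext f (fun _ => (0 * 0)%C)); [|intros a Ha; rewrite H by easy; ring].
  rewrite csum_scal. ring.
Qed.

Lemma csum_mod {A} (f : A -> C) l : Cmod (csum f l) <= rsum (fun a => Cmod (f a)) l.
Proof.
  induction l; simpl; [rewrite Cmod_0; lra|]. eapply Rle_trans; [apply Cmod_triangle|]. lra.
Qed.

Lemma csum_perm {A} (f : A -> C) l l' : Permutation l l' -> csum f l = csum f l'.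
Proof. induction 1; simpl; [easy|congruence|ring|congruence]. Qed.

Lemma csum_filter {A} (f : A -> C) p l : csum f l = (csum f (filter p l) + csum f (filter (fun a => negb (p a)) l))%C.
Proof. induction l as [|a l IH]; simpl; [ring|]. rewrite IH. destruct (p a); simpl; ring. Qed.

Lemma csum_flat_map {A B} (f : B -> C) (g : A -> list B) l : csum f (flat_map g l) = csum (fun a => csum f (g a)) l.
Proof. induction l; simpl; [easy|]. now rewrite csum_app, IHl. Qed.

Definition C_dec (x y : C) : {x = y} + {x <> y} := excluded_middle_informative (x = y).

Definition fin (Om : C -> Prop) (l : list C) : Prop := NoDup l /\ forall x, In x l -> Om x.

(** Unordered summation, the limit over finite subsets directed by inclusion; it suits a set given
    without an enumeration and regrouping along fibres. *)
Definition usum (Om : C -> Prop) (a : C -> C) (L : C) : Prop :=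
  forall e, 0 < e -> exists l0, fin Om l0 /\ forall l, fin Om l -> incl l0 l -> Cmod (csum a l - L) < e.

Definition minus_list (l l' : list C) : list C := filter (fun x => negb (if in_dec C_dec x l' then true else false)) l.
Definition inter_list (l l' : list C) : list C := filter (fun x => if in_dec C_dec x l' then true else false) l.

Lemma minus_list_in l l' x : In x (minus_list l l') <-> In x l /\ ~ In x l'.
Proof. unfold minus_list. rewrite filter_In. destruct (in_dec C_dec x l'); simpl; intuition easy. Qed.

Lemma inter_list_in l l' x : In x (inter_list l l') <-> In x l /\ In x l'.
Proof. unfold inter_list. rewrite filter_In. destruct (in_dec C_dec x l'); simpl; intuition easy. Qed.

Lemma fin_minus Om l l' : fin Om l -> fin Om (minus_list l l').
Proof. intros [H1 H2]. split; [now apply NoDup_filter|]. intros x Hx. apply minus_list_in in Hx. now apply H2. Qed.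

Lemma csum_diff Om a l l' : fin Om l -> fin Om l' ->
  Cmod (csum a l - csum a l') <= rsum (fun x => Cmod (a x)) (minus_list l l') + rsum (fun x => Cmod (a x)) (minus_list l' l).
Proof.
  intros [H1 _] [H2 _].
  assert (E1 : csum a l = (csum a (inter_list l l') + csum a (minus_list l l'))%C) by apply csum_filter.
  assert (E2 : csum a l' = (csum a (inter_list l' l) + csum a (minus_list l' l))%C) by apply csum_filter.
  assert (E3 : csum a (inter_list l l') = csum a (inter_list l' l)).
  { apply csum_perm, NoDup_Permutation; [now apply NoDup_filter|now apply NoDup_filter|].
    intros x. rewrite !inter_list_in. tauto. }
  rewrite E1, E2, E3.
  replace (csum a (inter_list l' l) + csum a (minus_list l l') - (csum a (inter_list l' l) + csum a (minus_list l' l)))%C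
    with (csum a (minus_list l l') - csum a (minus_list l' l))%C by ring.
  eapply Rle_trans; [apply Cmod_sub_le|]. apply Rplus_le_compat; apply csum_mod.
Qed.

Lemma fin_nil Om : fin Om nil.
Proof. split; [constructor|intros x []]. Qed.

Lemma fin_app Om l l' : fin Om l -> fin Om l' -> (forall x, In x l -> In x l' -> False) -> fin Om (l ++ l').
Proof.
  intros [H1 H2] [H3 H4] H. split; [now apply NoDup_app|]. intros x Hx. apply in_app_iff in Hx. destruct Hx; auto.
Qed.

Lemma fin_union Om l l' : fin Om l -> fin Om l' -> exists l2, fin Om l2 /\ incl l l2 /\ incl l' l2.
Proof.
  intros H H'. exists (l ++ minus_list l' l). split; [|split].
  - apply fin_app; [easy|now apply fin_minus|]. intros x X Y. now apply minus_list_in in Y.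
  - intros x Hx. apply in_app_iff. now left.
  - intros x Hx. apply in_app_iff. destruct (in_dec C_dec x l); [now left|right]. now apply minus_list_in.
Qed.

(** A finite sum within [e] of the supremum leaves less than [e] for every disjoint one. *)
Lemma tail_small Om (b : C -> R) B : (forall x, Om x -> 0 <= b x) -> (forall l, fin Om l -> rsum b l <= B) ->
  forall e, 0 < e -> exists l0, fin Om l0 /\ forall l, fin Om l -> (forall x, In x l -> ~ In x l0) -> rsum b l < e.
Proof.
  intros Hb HB e He.
  destruct (completeness (fun s => exists l, fin Om l /\ rsum b l = s)) as [S [S1 S2]].
  { exists B. intros s [l [Hl <-]]. now apply HB. }
  { exists 0, nil. split; [apply fin_nil|easy]. }
  assert (exists l0, fin Om l0 /\ S - e < rsum b l0) as [l0 [H0 H1]].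
  { apply NNPP. intros H. assert (S <= S - e); [|lra]. apply S2. intros s [l [Hl <-]]. apply Rnot_lt_le. intros K. apply H. now exists l. }
  exists l0. split; [easy|]. intros l Hl Hd.
  assert (rsum b (l0 ++ l) <= S).
  { apply S1. exists (l0 ++ l). split; [|easy]. apply fin_app; try easy. intros x X Y. now apply (Hd x). }
  rewrite rsum_app in H. lra.
Qed.

(** Finite sets [L n] with tails below [/ 2 ^ n] give a Cauchy sequence of sums, although they are
    not nested. *)
Lemma usum_exists Om a B : (forall l, fin Om l -> rsum (fun x => Cmod (a x)) l <= B) -> exists L, usum Om a L.
Proof.
  intros HB.
  assert (T := tail_small Om (fun x => Cmod (a x)) B (fun x _ => Cmod_ge_0 (a x)) HB).
  assert (Ex : forall n, exists l0, fin Om l0 /\ forall l, fin Om l -> (forall x, In x l -> ~ In x l0) -> rsum (fun x => Cmod (a x)) l < / 2 ^ n).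
  { intros n. apply T. apply Rinv_0_lt_compat, two_pow_pos. }
  set (L := fun n => epsilon (inhabits nil) (fun l0 => fin Om l0 /\ forall l, fin Om l -> (forall x, In x l -> ~ In x l0) -> rsum (fun x => Cmod (a x)) l < / 2 ^ n)).
  assert (HL : forall n, fin Om (L n) /\ forall l, fin Om l -> (forall x, In x l -> ~ In x (L n)) -> rsum (fun x => Cmod (a x)) l < / 2 ^ n).
  { intros n. unfold L. now apply epsilon_spec. }
  assert (Hd : forall n l, fin Om l -> rsum (fun x => Cmod (a x)) (minus_list l (L n)) < / 2 ^ n).
  { intros n l Hl. apply HL; [now apply fin_minus|]. intros x Hx. now apply minus_list_in in Hx. }
  destruct (C_complete (fun n => csum a (L n))) as [l Hl].
  { intros e He. destruct (half_pow_small 1 (e / 2)) as [N HN]; [lra|]. exists N. intros m n Hm Hn.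
    assert (Mono : forall k, (N <= k)%nat -> / 2 ^ k <= / 2 ^ N).
    { intros k Hk. apply Rinv_le_contravar; [apply two_pow_pos|]. apply Rle_pow; [lra|easy]. }
    eapply Rle_lt_trans; [apply (csum_diff Om); apply HL|].
    assert (X := Hd n (L m) (proj1 (HL m))). assert (Y := Hd m (L n) (proj1 (HL n))).
    specialize (Mono m Hm) as M1. specialize (Mono n Hn) as M2. lra. }
  exists l. intros e He. destruct (Hl (e / 2)) as [N HN]; [lra|].
  destruct (half_pow_small 1 (e / 2)) as [N2 HN2]; [lra|]. set (n := (N + N2)%nat).
  exists (L n). split; [apply HL|]. intros l' Hl' Hi.
  eapply Rle_lt_trans; [apply (Cmod_tri _ (csum a (L n)))|].
  specialize (HN n ltac:(lia)).
  assert (X := csum_diff Om a l' (L n) Hl' (proj1 (HL n))). assert (Y := Hd n l' Hl').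
  assert (Z : minus_list (L n) l' = nil).
  { destruct (minus_list (L n) l') as [|x q] eqn:E; [easy|]. assert (W : In x (minus_list (L n) l')) by (rewrite E; now left).
    apply minus_list_in in W. destruct W as [W1 W2]. exfalso. apply W2, Hi, W1. }
  rewrite Z in X. simpl in X.
  assert (M : / 2 ^ n <= / 2 ^ N2).
  { apply Rinv_le_contravar; [apply two_pow_pos|]. apply Rle_pow; [lra|unfold n; lia]. }
  lra.
Qed.

Lemma usum_plus Om a b L M : usum Om a L -> usum Om b M -> usum Om (fun x => a x + b x)%C (L + M).
Proof.
  intros HA HB e He. destruct (HA (e/2)) as [l1 [F1 K1]]; [lra|]. destruct (HB (e/2)) as [l2 [F2 K2]]; [lra|].
  destruct (fin_union Om l1 l2 F1 F2) as [l0 [F0 [I1 I2]]]. exists l0. split; [easy|]. intros l Hl Hi. rewrite csum_plus.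
  specialize (K1 l Hl ltac:(intros x Hx; apply Hi, I1, Hx)). specialize (K2 l Hl ltac:(intros x Hx; apply Hi, I2, Hx)).
  replace (csum a l + csum b l - (L + M))%C with ((csum a l - L) + (csum b l - M))%C by ring.
  eapply Rle_lt_trans; [apply Cmod_triangle|]. lra.
Qed.

Lemma usum_scal Om k a L : usum Om a L -> usum Om (fun x => k * a x)%C (k * L).
Proof.
  intros HA e He. assert (Hk := Cmod_ge_0 k). destruct (HA (e / (Cmod k + 1))) as [l1 [F1 K1]]; [apply Rdiv_lt_0_compat; lra|].
  exists l1. split; [easy|]. intros l Hl Hi. rewrite csum_scal. specialize (K1 l Hl Hi).
  replace (k * csum a l - k * L)%C with (k * (csum a l - L))%C by ring. rewrite Cmod_mult.
  apply Rle_lt_trans with (Cmod k * (e / (Cmod k + 1))); [apply Rmult_le_compat_l; lra|].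
  apply Rlt_le_trans with ((Cmod k + 1) * (e / (Cmod k + 1))); [|right; field; lra].
  apply Rmult_lt_compat_r; [apply Rdiv_lt_0_compat; lra|lra].
Qed.

Lemma usum_ext Om a b L : (forall x, Om x -> a x = b x) -> usum Om a L -> usum Om b L.
Proof.
  intros E H e He. destruct (H e He) as [l0 [F0 K]]. exists l0. split; [easy|]. intros l Hl Hi.
  rewrite <- (csum_ext a b); [auto|]. intros x Hx. apply E. now apply Hl.
Qed.

Lemma usum_unique Om a L M : usum Om a L -> usum Om a M -> L = M.
Proof.
  intros HL HM. apply Cmod_eq_of_small. intros e He.
  destruct (HL (e/2)) as [l1 [F1 K1]]; [lra|]. destruct (HM (e/2)) as [l2 [F2 K2]]; [lra|].
  destruct (fin_union Om l1 l2 F1 F2) as [l0 [F0 [I1 I2]]]. specialize (K1 l0 F0 I1). specialize (K2 l0 F0 I2).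
  eapply Rle_trans; [apply (Cmod_tri _ (csum a l0))|]. rewrite (Cmod_sym L). lra.
Qed.

Lemma usum_bound Om a L B : (forall l, fin Om l -> rsum (fun x => Cmod (a x)) l <= B) -> usum Om a L -> Cmod L <= B.
Proof.
  intros HB HL. apply le_epsilon. intros e He. destruct (HL e He) as [l0 [F0 K]]. specialize (K l0 F0 (fun x Hx => Hx)).
  assert (T := Cmod_ge_sub L (csum a l0)). rewrite Cmod_sym in T. assert (X := csum_mod a l0). specialize (HB l0 F0). lra.
Qed.

(** A finite union of fibres is one of the finite sets that the limit already controls. For [f] on
    the grand orbit this becomes the invariance under push-forward. *)
Lemma usum_fiber Om (f : C -> C) (phi : C -> list C) a L : (forall x, Om x -> Om (f x)) ->
  (forall y, Om y -> NoDup (phi y) /\ forall x, In x (phi y) <-> Om x /\ f x = y) ->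
  usum Om a L -> usum Om (fun y => csum a (phi y)) L.
Proof.
  intros Hf Hphi HL e He. destruct (HL e He) as [l0 [[N0 F0] K]].
  exists (nodup C_dec (map f l0)). split.
  { split; [apply NoDup_nodup|]. intros y Hy. apply nodup_In, in_map_iff in Hy. destruct Hy as [x [<- Hx]]. auto. }
  intros l [Nl Fl] Hi. rewrite <- csum_flat_map. apply K.
  - split.
    + clear Hi. induction l as [|y l IH]; simpl; [constructor|]. inversion Nl; subst. apply NoDup_app.
      * apply Hphi, Fl. now left.
      * apply IH; [easy|]. intros x Hx. apply Fl. now right.
      * intros x X Y. apply in_flat_map in Y. destruct Y as [y' [Y1 Y2]].
        apply (Hphi y) in X; [|apply Fl; now left]. apply (Hphi y') in Y2; [|apply Fl; now right].
        destruct X as [_ <-], Y2 as [_ <-]. contradiction.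
    + intros x Hx. apply in_flat_map in Hx. destruct Hx as [y [Hy Hx]]. now apply (Hphi y (Fl y Hy)).
  - intros x Hx. apply in_flat_map. exists (f x). split.
    + apply Hi. apply nodup_In. now apply in_map.
    + apply Hphi; auto.
Qed.

(** Each [V] is a linear equation in unknowns indexed by [ws]; a [w0] with [V w0 <> 0] is the pivot
    that eliminates one unknown. *)
Lemma underdetermined (Vs : list (C -> C)) : forall ws : list C, NoDup ws -> (length Vs < length ws)%nat ->
  exists c : C -> C, (exists w, In w ws /\ c w <> 0%C) /\ forall V, In V Vs -> csum (fun w => c w * V w)%C ws = 0%C.
Proof.
  remember (length Vs) as k eqn:Ek. revert Vs Ek. induction k as [|k IH]; intros Vs Ek ws Hnd Hlen.
  - destruct Vs; [|easy]. destruct ws as [|w ws]; [simpl in Hlen; lia|]. exists (fun _ => RtoC 1). split; [|intros V []].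
    exists w. split; [now left|]. intros K. apply RtoC_inj in K. lra.
  - destruct Vs as [|V Vs]; [easy|]. simpl in Ek. injection Ek as Ek.
    destruct (classic (exists w0, In w0 ws /\ V w0 <> 0%C)) as [[w0 [Hw0 HV0]]|Hno].
    + destruct (in_split w0 ws Hw0) as (l1 & l2 & ->).
      set (V' := fun V1 : C -> C => fun w => (V1 w - V1 w0 * V w / V w0)%C).
      destruct (IH (map V' Vs) ltac:(now rewrite length_map) (l1 ++ l2)) as (c & (w & Hw & Hcw) & Hc).
      { now apply NoDup_remove_1 in Hnd. }
      { rewrite length_app in *. simpl in Hlen. lia. }
      assert (Hni := NoDup_remove_2 _ _ _ Hnd).
      set (S := csum (fun w => c w * V w)%C (l1 ++ l2)).
      set (c' := fun w => if C_dec w w0 then (- S / V w0)%C else c w).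
      assert (E0 : c' w0 = (- S / V w0)%C) by (unfold c'; destruct (C_dec w0 w0); easy).
      assert (E1 : forall x, In x (l1 ++ l2) -> c' x = c x).
      { intros x Hx. unfold c'. destruct (C_dec x w0) as [->|]; easy. }
      assert (Split : forall W : C -> C, csum (fun w => c' w * W w)%C (l1 ++ w0 :: l2) = (csum (fun w => c w * W w)%C (l1 ++ l2) - S / V w0 * W w0)%C).
      { intros W. rewrite <- (csum_ext (fun w => c' w * W w)%C (fun w => c w * W w)%C (l1 ++ l2)) by (intros x Hx; now rewrite E1).
        rewrite !csum_app. simpl. rewrite E0. field. easy. }
      exists c'. split.
      { exists w. split; [apply in_app_iff in Hw; apply in_app_iff; simpl; tauto|]. now rewrite E1. }
      intros W [<-|HW]; rewrite Split.
      * fold S. field. easy.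
      * specialize (Hc (V' W) (in_map V' Vs W HW)).
        rewrite (csum_ext (fun w => c w * V' W w)%C (fun w => c w * W w + (- (W w0 / V w0)) * (c w * V w))%C) in Hc.
        2:{ intros x _. unfold V'. field. easy. }
        rewrite csum_plus, csum_scal in Hc. fold S in Hc. rewrite <- Hc. field. easy.
    + destruct (IH Vs Ek ws Hnd ltac:(lia)) as (c & Hc1 & Hc2). exists c. split; [easy|]. intros W [<-|HW]; [|auto].
      apply csum_0. intros w Hw. destruct (classic (V w = 0%C)) as [->|K]; [ring|]. exfalso. apply Hno. now exists w.
Qed.

Lemma function_net (xs : list C) B e : 0 < e -> forall Fam : (C -> C) -> Prop,
  (forall F x, Fam F -> In x xs -> Cmod (F x) <= B) ->
  exists Fs : list (C -> C), (forall F, In F Fs -> Fam F) /\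
    forall F, Fam F -> exists G, In G Fs /\ forall x, In x xs -> Cmod (F x - G x) < e.
Proof.
  intros He. induction xs as [|x xs IH]; intros Fam HB.
  - destruct (classic (exists F, Fam F)) as [[F0 HF0]|Hno].
    + exists (F0 :: nil). split; [intros F [<-|[]]; easy|]. intros F HF. exists F0. split; [now left|intros x []].
    + exists nil. split; [intros F []|]. intros F HF. exfalso. apply Hno. now exists F.
  - destruct (finite_net B (e / 4)) as [L HL]; [lra|].
    assert (Q : forall L' : list C, exists Fs : list (C -> C), (forall F, In F Fs -> Fam F) /\
      forall F g, Fam F -> In g L' -> Cmod (F x - g) <= e / 4 -> exists G, In G Fs /\ forall y, In y (x :: xs) -> Cmod (F y - G y) < e).
    { induction L' as [|g L' [Fs [I1 I2]]].
      - exists nil. split; [intros F []|intros F g _ []].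
      - destruct (IH (fun F => Fam F /\ Cmod (F x - g) <= e / 4)) as [Gs [G1 G2]].
        { intros F y [HF _] Hy. apply HB; [easy|now right]. }
        exists (Gs ++ Fs). split.
        + intros F HF. apply in_app_iff in HF. destruct HF as [HF|HF]; [now apply G1|now apply I1].
        + intros F g' HF [<-|Hg'] Hd.
          * destruct (G2 F (conj HF Hd)) as [G [HG HG2]]. exists G. split; [apply in_app_iff; now left|].
            intros y [<-|Hy]; [|auto]. destruct (G1 G HG) as [_ HGd]. assert (T := Cmod_tri (F x) g (G x)).
            rewrite (Cmod_sym g) in T. lra.
          * destruct (I2 F g' HF Hg' Hd) as [G [HG HG2]]. exists G. split; [apply in_app_iff; now right|easy]. }
    destruct (Q L) as [Fs [F1 F2]]. exists Fs. split; [easy|]. intros F HF.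
    destruct (HL (F x) (HB F x HF (or_introl eq_refl))) as [g [Hg [Hg2 _]]]. now apply (F2 F g).
Qed.

(** * The filled Julia set of a box map *)

(* Of a Jordan domain [P], only the connectedness and unboundedness of the complement matter ([bm_piece]). *)
Record box_map (f : C -> C) (U V : C -> Prop) : Prop := {
  bm_Uopen : c_open U;
  bm_Vopen : c_open V;
  bm_Ucomp : c_compact (c_closure U);
  bm_UV : subset (c_closure U) V;
  bm_hol : hol f U;
  bm_map : forall z, U z -> V (f z);
  bm_proper : forall K, c_compact K -> subset K V -> c_compact (fun z => U z /\ K (f z));
  bm_piece : forall z, U z -> exists P, P z /\ subset P U /\ c_open P /\ c_open (fun w => U w /\ ~ P w) /\
     c_connected (fun w => ~ P w) /\ ~ c_bounded (fun w => ~ P w);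
  bm_crit : forall z, U z -> Dv f z = 0%C -> filled_julia f U z
}.

Lemma singleton_compact y : c_compact (fun z : C => z = y).
Proof.
  apply heine_borel.
  - intros z Hz. apply Cmod_eq_of_small. intros e He. destruct (Hz e He) as [w [-> Hw]]. rewrite Cmod_sym. lra.
  - exists (Cmod y). intros z ->. lra.
Qed.

Lemma isolated_finite K (X : C -> Prop) : c_compact K -> subset X K ->
  (forall z, K z -> exists s, 0 < s /\ forall w, X w -> Cmod (w - z) < s -> w = z) ->
  exists l : list C, NoDup l /\ forall x, In x l <-> X x.
Proof.
  intros HK HX H.
  destruct (HK {p : C * R | forall w, X w -> Cmod (w - fst p) < snd p -> w = fst p} (fun p => cdisk (fst (proj1_sig p)) (snd (proj1_sig p)))) as [l Hl].
  - intros p. apply cdisk_open.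
  - intros z Hz. destruct (H z Hz) as [s [Hs Hs2]]. exists (exist _ (z, s) Hs2). now apply cdisk_center.
  - set (L := map (fun p => fst (proj1_sig p)) l).
    exists (nodup C_dec (filter (fun x => if excluded_middle_informative (X x) then true else false) L)). split; [apply NoDup_nodup|].
    intros x. rewrite nodup_In, filter_In. destruct (excluded_middle_informative (X x)) as [Hx|Hx]; split; try easy.
    intros _. split; [|easy]. destruct (Hl x (HX x Hx)) as [p [Hp Hp2]]. apply in_map_iff. exists p. split; [|easy].
    symmetry. apply (proj2_sig p); easy.
Qed.

Section BoxMap.
Variables (f : C -> C) (U V : C -> Prop).
Hypothesis H : box_map f U V.

Lemma bm_cont z : U z -> ccont f z.
Proof. apply hol_ccont, H. Qed.

Lemma f_cder z : U z -> cder f z (Dv f z).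
Proof. intros Hz. apply Dv_spec. now apply H. Qed.

Lemma U_disk z : U z -> exists r, 0 < r /\ subset (cdisk z r) U.
Proof. apply (bm_Uopen _ _ _ H). Qed.

Lemma V_of_U z : U z -> V z.
Proof. intros Hz. apply (bm_UV _ _ _ H). now apply subset_closure. Qed.

Lemma fiber_compact y : V y -> c_compact (fun z => U z /\ f z = y).
Proof. intros Hy. apply (bm_proper _ _ _ H (fun z => z = y) (singleton_compact y)). intros z ->. exact Hy. Qed.

(* A locally constant germ would spread to a compact open subset of [U]. *)
Lemma not_locally_constant z r : 0 < r -> subset (cdisk z r) U -> ~ (forall w, cdisk z r w -> f w = f z).
Proof.
  intros Hr HS Hc. assert (Uz : U z) by (apply HS; now apply cdisk_center).
  set (y := f z). assert (Vy : V y) by now apply (bm_map _ _ _ H).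
  set (Z := fun x => exists s, 0 < s /\ subset (cdisk x s) U /\ forall w, cdisk x s w -> f w = y).
  assert (ZF : subset Z (fun x => U x /\ f x = y)).
  { intros x (s & Hs & S1 & S2). split; [apply S1|apply S2]; now apply cdisk_center. }
  apply (clopen_bounded_empty Z z).
  - intros x (s & Hs & S1 & S2). exists (s / 2). split; [lra|]. intros w Hw. unfold cdisk in Hw. exists (s / 2). split; [lra|].
    assert (Sub : subset (cdisk w (s / 2)) (cdisk x s)).
    { intros v Hv. unfold cdisk in *. assert (T := Cmod_tri v w x). lra. }
    split; intros v Hv; [apply S1|apply S2]; now apply Sub.
  - intros x Hx.
    assert (Fx : U x /\ f x = y).
    { apply (compact_closed _ (fiber_compact y Vy)). intros e He. destruct (Hx e He) as [w [Hw Hd]]. exists w. split; [now apply ZF|easy]. }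
    destruct Fx as [Ux fx]. destruct (U_disk x Ux) as [e [He Se]].
    destruct (classic (forall w, cdisk x e w -> (f w - y)%C = 0%C)) as [Hz|Hz].
    + exists e. split; [easy|]. split; [easy|]. intros w Hw. replace (f w) with ((f w - y) + y)%C by ring. rewrite (Hz w Hw). ring.
    + destruct (isolated_zero_punctured (fun w => f w - y)%C x e He) as [s [Hs Hs2]]; [|easy|].
      { apply hol_minus; [|apply hol_const]. apply (hol_sub f U); [apply H|easy]. }
      destruct (Hx s Hs) as [w [Hw Hd]]. destruct (classic (w = x)) as [->|Hn]; [exact Hw|].
      exfalso. apply (Hs2 w).
      * split; [now apply Cmod_neq_pos|lra].
      * rewrite (proj2 (ZF w Hw)). ring.
  - destruct (compact_bounded _ (fiber_compact y Vy)) as [M HM]. exists M. intros x Hx. now apply HM, ZF.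
  - exists r. now split.
Qed.

Lemma f_open_at z r : 0 < r -> subset (cdisk z r) U -> exists d, 0 < d /\ forall y, Cmod (y - f z) < d -> exists w, cdisk z r w /\ f w = y.
Proof.
  intros Hr HS. apply open_mapping; [easy|apply (hol_sub f U); [apply H|easy]|now apply not_locally_constant].
Qed.

Lemma f_image_open O : c_open O -> subset O U -> c_open (image f O).
Proof.
  intros HO HS w [z [Hz <-]]. destruct (HO z Hz) as [r [Hr S]].
  destruct (f_open_at z r Hr) as [d [Hd K]]; [intros x Hx; now apply HS, S|].
  exists d. split; [easy|]. intros y Hy. destruct (K y Hy) as [x [Hx Hx2]]. exists x. split; [now apply S|easy].
Qed.

Definition KJ := filled_julia f U.

Lemma KJ_U : subset KJ U. Proof. intros z [Hz _]. exact Hz. Qed.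

Lemma iter_succ n z : Nat.iter (S n) f z = Nat.iter n f (f z).
Proof. induction n as [|n IH]; [easy|]. simpl in *. now rewrite IH. Qed.

Lemma KJ_f z : KJ z -> KJ (f z).
Proof.
  intros [_ Hn]. split; [exact (Hn 1%nat)|]. intros n. rewrite <- iter_succ. apply Hn.
Qed.

Lemma KJ_iff z : KJ z <-> U z /\ KJ (f z).
Proof.
  split; [intros Hz; split; [now apply KJ_U|now apply KJ_f]|]. intros [Uz [_ Hn]]. split; [easy|].
  intros [|n]; [easy|]. rewrite iter_succ. apply Hn.
Qed.

(** Compact sets decreasing to [KJ]; starting from the closure of [U] makes properness apply at
    every stage. *)
Fixpoint Ck (n : nat) : C -> Prop := match n with O => c_closure U | S n => fun z => U z /\ Ck n (f z) end.

Lemma Ck_compact n : c_compact (Ck n) /\ subset (Ck n) V.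
Proof.
  induction n as [|n [I1 I2]]; simpl; [split; apply H|]. split; [now apply H|]. intros z [Hz _]. now apply V_of_U.
Qed.

Lemma KJ_Ck n : subset KJ (Ck n).
Proof.
  induction n as [|n IH]; intros z Hz; simpl; [apply subset_closure; now apply KJ_U|]. apply KJ_iff in Hz. destruct Hz. auto.
Qed.

Lemma KJ_closed : cclosed KJ.
Proof.
  intros z Hz.
  assert (HC : forall n, Ck n z).
  { intros n. apply (compact_closed _ (proj1 (Ck_compact n))). intros e He. destruct (Hz e He) as [w [Hw Hd]]. exists w. split; [now apply KJ_Ck|easy]. }
  assert (Hn : forall n z, Ck (S n) z -> U (Nat.iter n f z)).
  { induction n as [|n IH]; intros x Hx; [apply Hx|]. rewrite iter_succ. apply IH. apply Hx. }
  split; [apply (Hn 0%nat), HC|]. intros n. now apply Hn.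
Qed.

Lemma KJ_compact : c_compact KJ.
Proof. apply (compact_subset _ _ (proj1 (Ck_compact 0)) KJ_closed). apply (KJ_Ck 0). Qed.

Lemma crit_isolated z : U z -> exists s, 0 < s /\ forall w, 0 < Cmod (w - z) < s -> U w /\ Dv f w <> 0%C.
Proof.
  intros Uz. destruct (U_disk z Uz) as [r [Hr S]].
  assert (Hf : hol f (cdisk z r)) by (apply (hol_sub f U); [apply H|easy]).
  destruct (isolated_zero_punctured (Dv f) z r Hr) as [s [Hs Hs2]].
  - apply hol_Dv; [apply cdisk_open|easy].
  - intros K. apply (not_locally_constant z r Hr S). intros w Hw.
    apply (cder_0_const f (cdisk z r)); [apply cdisk_convex| |easy|now apply cdisk_center].
    intros u Hu. rewrite <- (K u Hu). apply f_cder. now apply S.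
  - exists (Rmin s r). split; [now apply Rmin_pos|]. intros w Hw. split.
    + apply S. unfold cdisk. apply Rlt_le_trans with (1 := proj2 Hw). apply Rmin_r.
    + apply Hs2. split; [easy|]. apply Rlt_le, (Rlt_le_trans _ _ _ (proj2 Hw)). apply Rmin_l.
Qed.

(** Critical points are isolated in [U], and [bm_crit] confines them to a compact set. *)
Lemma crit_finite : exists l, NoDup l /\ forall c, In c l <-> U c /\ Dv f c = 0%C.
Proof.
  apply (isolated_finite KJ); [apply KJ_compact| |].
  - intros z [Hz Hz2]. now apply H.
  - intros z Kz. destruct (crit_isolated z (KJ_U z Kz)) as [s [Hs Hs2]]. exists s. split; [easy|].
    intros w [_ Hw] Hd. apply NNPP. intros Hn. apply (Hs2 w); [|easy]. split; [now apply Cmod_neq_pos|easy].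
Qed.

Lemma iter_cont n z : (forall k, (k < n)%nat -> U (Nat.iter k f z)) -> ccont (Nat.iter n f) z.
Proof.
  induction n as [|n IH]; intros Hk; [apply ccont_id|]. apply (ccont_comp f (Nat.iter n f)).
  - apply IH. intros k Hk'. apply Hk. lia.
  - apply bm_cont. apply Hk. lia.
Qed.

Lemma iter_image_open n O : c_open O -> (forall k z, (k < n)%nat -> O z -> U (Nat.iter k f z)) -> c_open (image (Nat.iter n f) O).
Proof.
  induction n as [|n IH]; intros HO Hk.
  - intros w [z [Hz <-]]. destruct (HO z Hz) as [r [Hr S]]. exists r. split; [easy|]. intros x Hx. exists x. split; [now apply S|easy].
  - assert (I2 := IH HO (fun k z Hk' => Hk k z ltac:(lia))).
    assert (I3 : c_open (image f (image (Nat.iter n f) O))).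
    { apply f_image_open; [easy|]. intros w [z [Hz <-]]. apply Hk; [lia|easy]. }
    intros w [z [Hz <-]]. destruct (I3 (Nat.iter (S n) f z)) as [r [Hr S]].
    { exists (Nat.iter n f z). split; [now exists z|easy]. }
    exists r. split; [easy|]. intros x Hx. destruct (S x Hx) as [y [[z' [Hz' <-]] <-]]. now exists z'.
Qed.

Lemma iter_KJ n z : KJ z -> KJ (Nat.iter n f z).
Proof. intros Hz. induction n; [easy|]. simpl. now apply KJ_f. Qed.

(** The component has no holes: the iterates of [f] cannot carry [O] out of [U], because a piece of
    [U] containing the image of the boundary contains the image of [O] as well. *)
Lemma full_interior W O : is_component (c_interior KJ) W -> c_bounded O -> c_open O -> subset (c_boundary O) W -> subset O W.
Proof.
  intros HW HB HO HbW.
  assert (WK : subset W KJ) by (intros z Hz; apply (c_interior_sub KJ); now apply HW).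
  assert (HcO := closure_compact O HB).
  assert (Hbd : forall z, c_closure O z -> ~ O z -> c_boundary O z).
  { intros z Hz Hn. split; [easy|]. intros K. now apply Hn, c_interior_sub. }
  assert (Claim : forall i z, c_closure O z -> U (Nat.iter i f z)).
  { induction i as [i IH] using (well_founded_induction lt_wf). intros z0 Hz0. apply NNPP. intros Hn0.
    assert (HFc : forall z, c_closure O z -> ccont (Nat.iter i f) z) by (intros z Hz; apply iter_cont; intros k Hk; now apply IH).
    assert (HFo : c_open (image (Nat.iter i f) O)).
    { apply iter_image_open; [easy|]. intros k z Hk Hz. apply IH; [easy|now apply subset_closure]. }
    assert (Hb : exists b, c_boundary O b).
    { apply NNPP. intros Hno.
      assert (Hcl : cclosed O). { intros z Hz. apply NNPP. intros Hn. apply Hno. exists z. now apply Hbd. }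
      assert (Oz0 : O z0). { apply Hcl. exact Hz0. }
      now apply (clopen_bounded_empty O z0). }
    destruct Hb as [b Hb]. assert (Kb : KJ (Nat.iter i f b)) by now apply iter_KJ, WK, HbW.
    destruct (bm_piece _ _ _ H _ (KJ_U _ Kb)) as (P & P1 & P2 & P3 & P4 & P5 & P6).
    assert (WP : forall z, W z -> P (Nat.iter i f z)).
    { assert (Hcon : c_connected (image (Nat.iter i f) W)).
      { apply image_connected; [|apply HW]. intros z Hz. apply iter_cont. intros k _. apply KJ_U, iter_KJ, WK, Hz. }
      destruct (Hcon P _ P3 P4) as [K|K].
      - intros w [z [Hz <-]]. destruct (classic (P (Nat.iter i f z))) as [?|Hn]; [now left|right]. split; [|easy]. apply KJ_U, iter_KJ, WK, Hz.
      - intros w (_ & X & _ & Y). contradiction.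
      - intros z Hz. apply K. now exists z.
      - exfalso. destruct (K (Nat.iter i f b)) as [_ Y]; [|contradiction]. exists b. split; [now apply HbW|easy]. }
    assert (Hout : forall z, c_closure O z -> ~ P (Nat.iter i f z) -> O z).
    { intros z Hz HnP. apply NNPP. intros Hn. apply HnP, WP, HbW. now apply Hbd. }
    assert (HX := compact_image _ _ HcO HFc).
    (* The connected complement of [P] is covered by the open image of [O] and the complement of the
       compact image of its closure, which are disjoint. Being unbounded it cannot lie in the
       former; hence it misses the image of the closure, contrary to the choice of [z0]. *)
    destruct (P5 (image (Nat.iter i f) O) (fun w => ~ image (Nat.iter i f) (c_closure O) w) HFo) as [K|K].
    - apply closed_compl_open. now apply compact_closed.
    - intros w Hw. destruct (classic (image (Nat.iter i f) (c_closure O) w)) as [[z [Hz <-]]|Hn]; [left|now right].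
      exists z. split; [now apply Hout|easy].
    - intros w (_ & [z [Hz <-]] & Hn). apply Hn. exists z. split; [now apply subset_closure|easy].
    - apply P6. destruct (compact_bounded _ HX) as [M HM]. exists M. intros w Hw. apply HM.
      destruct (K w Hw) as [z [Hz <-]]. exists z. split; [now apply subset_closure|easy].
    - apply (K (Nat.iter i f z0)).
      + intros HP. now apply Hn0, P2.
      + now exists z0. }
  assert (HOK : subset O (c_interior KJ)).
  { intros z Hz. destruct (HO z Hz) as [r [Hr S]]. exists r. split; [easy|]. intros w Hw.
    assert (Cw : c_closure O w) by (apply subset_closure; now apply S).
    split; [apply (Claim 0%nat w Cw)|]. intros k. now apply Claim. }
  intros z Hz. apply NNPP. intros Hn.
  (* A second component meeting [O] could not leave [O] through its boundary, so it would be clopen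
     and bounded. *)
  destruct (component_exists (c_interior KJ) z (HOK z Hz)) as [W' [HW' Wz]].
  assert (Wo := component_open _ _ (c_interior_open KJ) HW').
  assert (Hdis : forall w, W' w -> ~ W w).
  { intros w Hw1 Hw2. apply Hn. apply (component_eq _ W' W w HW' HW Hw1 Hw2). exact Wz. }
  assert (WO : subset W' O).
  { destruct (proj1 (proj2 (proj2 HW')) O (fun w => ~ c_closure O w) HO) as [K|K].
    - apply closed_compl_open, closure_closed.
    - intros w Hw. destruct (classic (O w)) as [?|Hno]; [now left|right]. intros Hcl. apply (Hdis w Hw), HbW. now apply Hbd.
    - intros w (_ & X & Y). apply Y. now apply subset_closure.
    - exact K.
    - exfalso. apply (K z Wz). now apply subset_closure. }
  apply (clopen_bounded_empty W' z); [easy| |destruct HB as [M HM]; exists M; auto|easy].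
  intros w Hw.
  assert (Cw : c_closure O w). { intros e He. destruct (Hw e He) as [v [Hv Hd]]. exists v. split; [now apply WO|easy]. }
  assert (Iw : c_interior KJ w).
  { destruct (classic (O w)) as [Ow|Now]; [now apply HOK|]. apply HW, HbW. now apply Hbd. }
  destruct (c_interior_open KJ w Iw) as [r [Hr S]]. destruct (Hw r Hr) as [v [Hv Hd]].
  apply (component_absorb _ _ (cdisk w r) v HW'); [apply convex_connected, cdisk_convex|easy|easy|exact Hd|now apply cdisk_center].
Qed.

(** A small disk around [x] maps into [W'], hence lies in the interior of [KJ], and it meets [W].
    This makes the part of [W] that maps into a compact part of [W'] compact. *)
Lemma preimage_component W W' x : is_component (c_interior KJ) W -> is_component (c_interior KJ) W' ->
  (forall z, W z -> W' (f z)) -> KJ x -> W' (f x) -> c_closure W x -> W x.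
Proof.
  intros HW HW' HWW Kx Hfx Hx.
  assert (Wo := component_open _ _ (c_interior_open KJ) HW').
  destruct (Wo _ Hfx) as [e [He S]]. destruct (bm_cont x (KJ_U x Kx) e He) as [d [Hd Kd]].
  destruct (U_disk x (KJ_U x Kx)) as [r [Hr Sr]].
  assert (Hs : subset (cdisk x (Rmin d r / 2)) (c_interior KJ)).
  { assert (X1 := Rmin_l d r). assert (X2 := Rmin_r d r). assert (X3 : 0 < Rmin d r) by now apply Rmin_pos.
    intros w Hw. unfold cdisk in Hw. exists (Rmin d r / 2). split; [lra|]. intros v Hv. unfold cdisk in Hv.
    assert (T := Cmod_tri v w x). apply KJ_iff. split; [apply Sr; unfold cdisk; lra|].
    apply (c_interior_sub KJ), HW', S, Kd. lra. }
  assert (X3 : 0 < Rmin d r) by now apply Rmin_pos.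
  destruct (Hx (Rmin d r / 2)) as [v [Hv Hdv]]; [lra|].
  apply (component_absorb _ _ (cdisk x (Rmin d r / 2)) v HW); [apply convex_connected, cdisk_convex|easy|easy|exact Hdv|].
  apply cdisk_center. lra.
Qed.

End BoxMap.

(** * Lifting closed lattice walks *)

(** The parity of the number of [k < n] with [p k]; applied to [crosses] it is a winding number
    modulo 2. *)
Fixpoint par (p : nat -> bool) (n : nat) : bool := match n with O => false | S n => xorb (par p n) (p n) end.

Lemma par_ext p q n : (forall k, (k < n)%nat -> p k = q k) -> par p n = par q n.
Proof. induction n as [|n IH]; intros H; simpl; [easy|]. rewrite IH, (H n); auto. Qed.

Lemma par_xor p q n : par (fun k => xorb (p k) (q k)) n = xorb (par p n) (par q n).
Proof. induction n as [|n IH]; simpl; [easy|]. rewrite IH. destruct (par p n), (par q n), (p n), (q n); easy. Qed.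

Lemma par_telescope g n : par (fun k => xorb (g k) (g (S k))) n = xorb (g 0%nat) (g n).
Proof. induction n as [|n IH]; simpl; [now destruct (g 0%nat)|]. rewrite IH. destruct (g 0%nat), (g n), (g (S n)); easy. Qed.

Lemma par_false p n : (forall k, (k < n)%nat -> p k = false) -> par p n = false.
Proof. induction n as [|n IH]; intros H; simpl; [easy|]. rewrite IH, (H n); auto. Qed.

Lemma par_single p n s : (s < n)%nat -> p s = true -> (forall k, (k < n)%nat -> k <> s -> p k = false) -> par p n = true.
Proof.
  induction n as [|n IH]; intros Hs Hp H; [lia|]. simpl. destruct (Nat.eq_dec s n) as [->|Hn].
  - rewrite par_false; [now rewrite Hp|]. intros k Hk. apply H; lia.
  - rewrite IH; [|lia|easy|intros k Hk; apply H; lia]. rewrite H; [easy|lia|lia].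
Qed.

Lemma par_true_ex p n : par p n = true -> exists k, (k < n)%nat /\ p k = true.
Proof.
  intros Hp. apply NNPP. intros Hno. rewrite par_false in Hp; [easy|]. intros k Hk. destruct (p k) eqn:E; [|easy].
  exfalso. apply Hno. now exists k.
Qed.

Definition adj (u v : Z * Z) : Prop :=
  (fst u = fst v /\ (snd v = snd u + 1 \/ snd u = snd v + 1) \/
   snd u = snd v /\ (fst v = fst u + 1 \/ fst u = fst v + 1))%Z.

(* The step [a -> b] crosses the upward vertical ray issued from the unit square with lower left corner [s]. *)
Definition crosses (s a b : Z * Z) : bool :=
  ((snd a =? snd b)%Z && (snd s + 1 <=? snd a)%Z && (Z.min (fst a) (fst b) =? fst s)%Z)%bool.

Ltac zcase := repeat match goal with
  | |- context [(?x =? ?y)%Z] => destruct (Z.eqb_spec x y)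
  | |- context [(?x <=? ?y)%Z] => destruct (Z.leb_spec x y) end; simpl; try reflexivity; try lia.

(** The rays of the two squares differ only by the edge between the squares. *)
Lemma crosses_up i j a b : adj a b -> ~ (snd a = j + 1 /\ snd b = j + 1 /\ Z.min (fst a) (fst b) = i)%Z ->
  crosses (i, j) a b = crosses (i, (j + 1)%Z) a b.
Proof. destruct a as [a1 a2], b as [b1 b2]. unfold adj, crosses; simpl. intros Ha Hn. zcase. Qed.

(** Except on the common edge, the sum of the two indicators is a coboundary in the vertices of the
    step, so it cancels around a closed walk. *)
Lemma crosses_right i j a b : adj a b -> ~ (fst a = i + 1 /\ fst b = i + 1 /\ Z.min (snd a) (snd b) = j)%Z ->
  xorb (crosses (i, j) a b) (crosses ((i + 1)%Z, j) a b) =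
  xorb ((fst a =? i + 1)%Z && (j + 1 <=? snd a)%Z)%bool ((fst b =? i + 1)%Z && (j + 1 <=? snd b)%Z)%bool.
Proof. destruct a as [a1 a2], b as [b1 b2]. unfold adj, crosses; simpl. intros Ha Hn. zcase. Qed.

(** Below the whole walk the indicator alone is a coboundary, so the parity vanishes there; this
    bounds the odd squares from below. *)
Lemma crosses_low i j a b : adj a b -> (j + 1 <= snd a)%Z -> (j + 1 <= snd b)%Z ->
  crosses (i, j) a b = xorb (fst a <=? i)%Z (fst b <=? i)%Z.
Proof. destruct a as [a1 a2], b as [b1 b2]. unfold adj, crosses; simpl. intros Ha H1 H2. zcase. Qed.

Section Lattice.
Variables (h : R) (L : C -> Prop).
Hypothesis Hh : 0 < h.
Hypothesis Lclosed : cclosed L.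
Hypothesis Lfull : forall O, c_bounded O -> c_open O -> subset (c_boundary O) L -> subset O L.

Definition pt (v : Z * Z) : C := (IZR (fst v) * h, IZR (snd v) * h).
Definition sq (s : Z * Z) (z : C) : Prop :=
  IZR (fst s) * h <= Re z <= (IZR (fst s) + 1) * h /\ IZR (snd s) * h <= Im z <= (IZR (snd s) + 1) * h.
Definition good u v := adj u v /\ forall t, 0 <= t <= 1 -> L (seg (pt u) (pt v) t).

Lemma seg_pt u v t : seg (pt u) (pt v) t =
  ((IZR (fst u) + t * (IZR (fst v) - IZR (fst u))) * h, (IZR (snd u) + t * (IZR (snd v) - IZR (snd u))) * h).
Proof. unfold seg, pt, RtoC, Cplus, Cmult, Cminus, Copp; simpl. f_equal; ring. Qed.

Lemma on_vertical_edge a b x j z : adj a b -> fst a = x -> fst b = x -> Z.min (snd a) (snd b) = j ->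
  Re z = IZR x * h -> IZR j * h <= Im z <= (IZR j + 1) * h -> exists t, 0 <= t <= 1 /\ z = seg (pt a) (pt b) t.
Proof.
  intros Hadj Ha Hb Hj Hre Him. set (y := Im z / h).
  assert (Ey : y * h = Im z) by (unfold y; field; lra).
  assert (Hy : IZR j <= y <= IZR j + 1).
  { split; apply Rmult_le_reg_r with h; try easy; rewrite Ey; lra. }
  destruct (Z.leb_spec (snd a) (snd b)) as [Hab|Hab].
  - assert (Ea : snd a = j) by lia. assert (Eb : snd b = (j + 1)%Z) by (unfold adj in Hadj; lia).
    exists (y - IZR j). split; [lra|]. rewrite seg_pt, Ha, Hb, Ea, Eb, plus_IZR. apply C_ext; simpl.
    + rewrite Hre. ring. + rewrite <- Ey. ring.
  - assert (Ea : snd a = (j + 1)%Z) by (unfold adj in Hadj; lia). assert (Eb : snd b = j) by lia.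
    exists (IZR j + 1 - y). split; [lra|]. rewrite seg_pt, Ha, Hb, Ea, Eb, plus_IZR. apply C_ext; simpl.
    + rewrite Hre. ring. + rewrite <- Ey. ring.
Qed.

Lemma on_horizontal_edge a b i y z : adj a b -> snd a = y -> snd b = y -> Z.min (fst a) (fst b) = i ->
  Im z = IZR y * h -> IZR i * h <= Re z <= (IZR i + 1) * h -> exists t, 0 <= t <= 1 /\ z = seg (pt a) (pt b) t.
Proof.
  intros Hadj Ha Hb Hj Him Hre. set (x := Re z / h).
  assert (Ex : x * h = Re z) by (unfold x; field; lra).
  assert (Hx : IZR i <= x <= IZR i + 1).
  { split; apply Rmult_le_reg_r with h; try easy; rewrite Ex; lra. }
  destruct (Z.leb_spec (fst a) (fst b)) as [Hab|Hab].
  - assert (Ea : fst a = i) by lia. assert (Eb : fst b = (i + 1)%Z) by (unfold adj in Hadj; lia).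
    exists (x - IZR i). split; [lra|]. rewrite seg_pt, Ha, Hb, Ea, Eb, plus_IZR. apply C_ext; simpl.
    + rewrite <- Ex. ring. + rewrite Him. ring.
  - assert (Ea : fst a = (i + 1)%Z) by (unfold adj in Hadj; lia). assert (Eb : fst b = i) by lia.
    exists (IZR i + 1 - x). split; [lra|]. rewrite seg_pt, Ha, Hb, Ea, Eb, plus_IZR. apply C_ext; simpl.
    + rewrite <- Ex. ring. + rewrite Him. ring.
Qed.

(** Applied in both coordinates: points near [z] lie in a lattice square that contains [z] too, even
    if [z] is on an edge. *)
Lemma cell_1d a : exists r, 0 < r /\ forall b, Rabs (b - a) < r -> exists i : Z, IZR i <= b <= IZR i + 1 /\ IZR i <= a <= IZR i + 1.
Proof.
  destruct (archimed a) as [A1 A2]. set (k := up a) in *.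
  destruct (Rle_lt_or_eq_dec (IZR k - a) 1 A2) as [Hlt|Heq].
  - exists (Rmin (IZR k - a) (1 - (IZR k - a))). split; [apply Rmin_pos; lra|]. intros b Hb.
    assert (X1 := Rmin_l (IZR k - a) (1 - (IZR k - a))). assert (X2 := Rmin_r (IZR k - a) (1 - (IZR k - a))).
    apply Rabs_def2 in Hb. exists (k - 1)%Z. rewrite minus_IZR. lra.
  - exists 1. split; [lra|]. intros b Hb. apply Rabs_def2 in Hb. destruct (Rle_dec a b).
    + exists (k - 1)%Z. rewrite minus_IZR. lra.
    + exists (k - 2)%Z. rewrite minus_IZR. lra.
Qed.

Lemma cclosed_union A B : cclosed A -> cclosed B -> cclosed (fun z => A z \/ B z).
Proof.
  intros HA HB z Hz. destruct (classic (A z)) as [Ha|Ha]; [now left|right].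
  destruct (not_cclosed_far A z HA Ha) as [e [He Hf]]. apply HB. intros e' He'.
  destruct (Hz (Rmin e e')) as [w [[Hw|Hw] Hd]]; [now apply Rmin_pos| |].
  - specialize (Hf w Hw). assert (X := Rmin_l e e'). lra.
  - exists w. split; [easy|]. assert (X := Rmin_r e e'). lra.
Qed.

Lemma cclosed_list_union {A} (l : list A) (p : A -> Prop) (q : A -> C -> Prop) : (forall s, cclosed (q s)) ->
  cclosed (fun z => exists s, In s l /\ p s /\ q s z).
Proof.
  intros Hq. induction l as [|a l IH].
  - intros z Hz. destruct (Hz 1 Rlt_0_1) as [w [[s [[] _]] _]].
  - assert (HC : cclosed (fun z => (p a /\ q a z) \/ exists s, In s l /\ p s /\ q s z)).
    { apply cclosed_union; [|easy]. intros z Hz. split; [destruct (Hz 1 Rlt_0_1) as [w [[? _] _]]; easy|].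
      apply Hq. intros e He. destruct (Hz e He) as [w [[_ Hw] Hd]]. now exists w. }
    intros z Hz. destruct (HC z) as [[H1 H2]|(s & H1 & H2 & H3)].
    + intros e He. destruct (Hz e He) as [w [(s & [<-|Hs] & Hp & Hw) Hd]]; exists w; split; try easy; [now left|right; now exists s].
    + exists a. split; [now left|easy]. + exists s. split; [now right|easy].
Qed.

Lemma sq_closed s : cclosed (sq s).
Proof.
  assert (G : forall (g : C -> R) b, (forall z w, Rabs (g z - g w) <= Cmod (z - w)) -> cclosed (fun z => g z <= b)).
  { intros g b Hg z Hz. apply le_epsilon. intros e He. destruct (Hz e He) as [w [Hw Hd]].
    assert (X := Hg z w). rewrite Cmod_sym in X. assert (Y := Rle_abs (g z - g w)). lra. }
  assert (Hre : forall z w, Rabs (Re z - Re w) <= Cmod (z - w)) by (intros z w; apply (re_le_Cmod (z - w))).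
  assert (Him : forall z w, Rabs (Im z - Im w) <= Cmod (z - w)) by (intros z w; apply (im_le_Cmod (z - w))).
  intros z Hz. split; split.
  - apply Ropp_le_cancel. apply (G (fun z => - Re z)).
    + intros x y. replace (- Re x - - Re y) with (- (Re x - Re y)) by ring. now rewrite Rabs_Ropp.
    + intros e He. destruct (Hz e He) as [w [Hw Hd]]. exists w. split; [|easy]. unfold sq in Hw. lra.
  - apply (G Re); [easy|]. intros e He. destruct (Hz e He) as [w [Hw Hd]]. exists w. split; [|easy]. unfold sq in Hw. lra.
  - apply Ropp_le_cancel. apply (G (fun z => - Im z)).
    + intros x y. replace (- Im x - - Im y) with (- (Im x - Im y)) by ring. now rewrite Rabs_Ropp.
    + intros e He. destruct (Hz e He) as [w [Hw Hd]]. exists w. split; [|easy]. unfold sq in Hw. lra.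
  - apply (G Im); [easy|]. intros e He. destruct (Hz e He) as [w [Hw Hd]]. exists w. split; [|easy]. unfold sq in Hw. lra.
Qed.

Lemma sq_open_interior s z : IZR (fst s) * h < Re z < (IZR (fst s) + 1) * h ->
  IZR (snd s) * h < Im z < (IZR (snd s) + 1) * h -> c_interior (sq s) z.
Proof.
  intros Hx Hy.
  set (e := Rmin (Rmin (Re z - IZR (fst s) * h) ((IZR (fst s) + 1) * h - Re z)) (Rmin (Im z - IZR (snd s) * h) ((IZR (snd s) + 1) * h - Im z))).
  assert (E1 := Rmin_l (Rmin (Re z - IZR (fst s) * h) ((IZR (fst s) + 1) * h - Re z)) (Rmin (Im z - IZR (snd s) * h) ((IZR (snd s) + 1) * h - Im z))).
  assert (E2 := Rmin_r (Rmin (Re z - IZR (fst s) * h) ((IZR (fst s) + 1) * h - Re z)) (Rmin (Im z - IZR (snd s) * h) ((IZR (snd s) + 1) * h - Im z))).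
  fold e in E1, E2.
  assert (E3 := Rmin_l (Re z - IZR (fst s) * h) ((IZR (fst s) + 1) * h - Re z)). assert (E4 := Rmin_r (Re z - IZR (fst s) * h) ((IZR (fst s) + 1) * h - Re z)).
  assert (E5 := Rmin_l (Im z - IZR (snd s) * h) ((IZR (snd s) + 1) * h - Im z)). assert (E6 := Rmin_r (Im z - IZR (snd s) * h) ((IZR (snd s) + 1) * h - Im z)).
  exists e. split; [unfold e; repeat apply Rmin_pos; lra|]. intros w Hw. unfold cdisk in Hw.
  assert (X := re_le_Cmod (w - z)). assert (Y := im_le_Cmod (w - z)).
  change (Re (w - z)) with (Re w - Re z) in X. change (Im (w - z)) with (Im w - Im z) in Y.
  apply Rabs_le_between in X. apply Rabs_le_between in Y. split; lra.
Qed.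

Section Walk.
Variables (w : nat -> Z * Z) (n : nat).
Hypothesis Hw : forall k, (k < n)%nat -> good (w k) (w (S k)).
Hypothesis Hcl : w 0%nat = w n.
Hypothesis HLb : c_bounded L.

(** The winding number modulo 2 of the closed walk around the square [s]. *)
Definition sqpar s := par (fun k => crosses s (w k) (w (S k))) n.
Definition trav z := exists k t, (k < n)%nat /\ 0 <= t <= 1 /\ z = seg (pt (w k)) (pt (w (S k))) t.

Lemma sqpar_up i j : (forall k, (k < n)%nat -> ~ (snd (w k) = j + 1 /\ snd (w (S k)) = j + 1 /\ Z.min (fst (w k)) (fst (w (S k))) = i)%Z) ->
  sqpar (i, j) = sqpar (i, (j + 1)%Z).
Proof. intros Hk. apply par_ext. intros k Hkn. apply crosses_up; [apply Hw, Hkn|now apply Hk]. Qed.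

Lemma sqpar_right i j : (forall k, (k < n)%nat -> ~ (fst (w k) = i + 1 /\ fst (w (S k)) = i + 1 /\ Z.min (snd (w k)) (snd (w (S k))) = j)%Z) ->
  sqpar (i, j) = sqpar ((i + 1)%Z, j).
Proof.
  intros Hk. assert (E : xorb (sqpar (i, j)) (sqpar ((i + 1)%Z, j)) = false).
  { unfold sqpar. rewrite <- par_xor.
    set (g := fun k => ((fst (w k) =? i + 1)%Z && (j + 1 <=? snd (w k))%Z)%bool).
    rewrite (par_ext _ (fun k => xorb (g k) (g (S k)))).
    - rewrite par_telescope. unfold g. rewrite Hcl. apply Bool.xorb_nilpotent.
    - intros k Hkn. apply crosses_right; [apply Hw, Hkn|now apply Hk]. }
  now apply Bool.xorb_eq.
Qed.

(** Squares sharing a point are at most one step apart in each coordinate. The point lies on the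
    edges crossed in passing from one to the other, so if the walk misses the point it does not use
    these edges. *)
Lemma sqpar_move s s' z : sq s z -> sq s' z -> ~ trav z -> sqpar s = sqpar s'.
Proof.
  destruct s as [i j], s' as [i' j']. intros [Hx Hy] [Hx' Hy'] Hn. simpl in *.
  assert (Ki : (i' - 1 <= i <= i' + 1)%Z).
  { assert (IZR i <= IZR i' + 1) by (apply Rmult_le_reg_r with h; lra). assert (IZR i' <= IZR i + 1) by (apply Rmult_le_reg_r with h; lra).
    rewrite <- plus_IZR in *. apply le_IZR in H, H0. lia. }
  assert (Kj : (j' - 1 <= j <= j' + 1)%Z).
  { assert (IZR j <= IZR j' + 1) by (apply Rmult_le_reg_r with h; lra). assert (IZR j' <= IZR j + 1) by (apply Rmult_le_reg_r with h; lra).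
    rewrite <- plus_IZR in *. apply le_IZR in H, H0. lia. }
  assert (A1 : forall i j, IZR j * h <= Im z <= (IZR j + 1) * h -> Re z = IZR (i + 1) * h -> sqpar (i, j) = sqpar ((i + 1)%Z, j)).
  { clear - Hw Hcl Hn Hh. intros i j Hy Hx. apply sqpar_right. intros k Hk (K1 & K2 & K3). apply Hn.
    destruct (on_vertical_edge (w k) (w (S k)) (i + 1) j z) as [t [Ht Et]]; try easy; [apply Hw, Hk|]. now exists k, t. }
  assert (A2 : forall i j, IZR i * h <= Re z <= (IZR i + 1) * h -> Im z = IZR (j + 1) * h -> sqpar (i, j) = sqpar (i, (j + 1)%Z)).
  { clear - Hw Hcl Hn Hh. intros i j Hx Hy. apply sqpar_up. intros k Hk (K1 & K2 & K3). apply Hn.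
    destruct (on_horizontal_edge (w k) (w (S k)) i (j + 1) z) as [t [Ht Et]]; try easy; [apply Hw, Hk|]. now exists k, t. }
  transitivity (sqpar (i', j)).
  - destruct (Z.eq_dec i i') as [->|Ni]; [easy|]. destruct (Z.eq_dec i (i' + 1)) as [->|Ni2].
    + symmetry. apply A1; [easy|]. rewrite plus_IZR in *. lra.
    + assert (E : i' = (i + 1)%Z) by lia. subst i'. apply A1; [easy|]. rewrite plus_IZR in *. lra.
  - destruct (Z.eq_dec j j') as [->|Nj]; [easy|]. destruct (Z.eq_dec j (j' + 1)) as [->|Nj2].
    + symmetry. apply A2; [easy|]. rewrite plus_IZR in *. lra.
    + assert (E : j' = (j + 1)%Z) by lia. subst j'. apply A2; [easy|]. rewrite plus_IZR in *. lra.
Qed.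

Lemma walk_vertex_L k : (k <= n)%nat -> (0 < n)%nat -> L (pt (w k)).
Proof.
  intros Hk Hn. destruct (Nat.eq_dec k n) as [->|].
  - rewrite <- Hcl, <- (seg_0 (pt (w 0%nat)) (pt (w 1%nat))). apply (Hw 0%nat Hn). lra.
  - rewrite <- (seg_0 (pt (w k)) (pt (w (S k)))). apply (Hw k); [lia|lra].
Qed.

Lemma lattice_bound : exists B : Z, forall v, L (pt v) -> (- B <= fst v <= B /\ - B <= snd v <= B)%Z.
Proof.
  destruct HLb as [M HM]. exists (up (M / h)). intros v Hv. specialize (HM _ Hv).
  destruct (archimed (M / h)) as [A1 _].
  assert (X := re_le_Cmod (pt v)). assert (Y := im_le_Cmod (pt v)). simpl in X, Y.
  assert (EM : M / h * h = M) by (field; lra).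
  assert (G : forall k, Rabs (IZR k * h) <= M -> (- up (M / h) <= k <= up (M / h))%Z).
  { intros k Hk. apply Rabs_le_between in Hk.
    assert (IZR k <= M / h) by (apply Rmult_le_reg_r with h; lra). assert (- (M / h) <= IZR k) by (apply Rmult_le_reg_r with h; lra).
    split; apply le_IZR; rewrite ?opp_IZR; lra. }
  split; apply G; lra.
Qed.

Lemma sqpar_finite : exists l : list (Z * Z), forall s, sqpar s = true -> In s l.
Proof.
  destruct lattice_bound as [B HB].
  exists (list_prod (zrange (- B - 1) (Z.to_nat (2 * B + 3))) (zrange (- B - 1) (Z.to_nat (2 * B + 3)))).
  intros [i j] Hs. destruct (par_true_ex _ _ Hs) as [k [Hk Hc]].
  assert (V : forall k, (k <= n)%nat -> (- B <= fst (w k) <= B /\ - B <= snd (w k) <= B)%Z) by (intros k' Hk'; apply HB, walk_vertex_L; lia).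
  assert (Hj : (- B <= j)%Z).
  { apply Z.nlt_ge. intros Hlt. unfold sqpar in Hs. rewrite (par_ext _ (fun k => xorb (fst (w k) <=? i)%Z (fst (w (S k)) <=? i)%Z)) in Hs.
    - rewrite (par_telescope (fun k => (fst (w k) <=? i)%Z)), Hcl, Bool.xorb_nilpotent in Hs. easy.
    - intros k' Hk'. apply crosses_low; [apply Hw, Hk'| |]; [specialize (V k' ltac:(lia))|specialize (V (S k') ltac:(lia))]; lia. }
  unfold crosses in Hc. apply andb_prop in Hc. destruct Hc as [Hc H3]. apply andb_prop in Hc. destruct Hc as [H1 H2].
  apply Z.eqb_eq in H1, H3. apply Z.leb_le in H2. simpl in H2, H3.
  assert (V1 := V k ltac:(lia)). assert (V2 := V (S k) ltac:(lia)).
  apply in_prod_iff. rewrite !zrange_in. lia.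
Qed.

(* The squares of odd parity form a region whose boundary is covered by the walk. *)
Lemma odd_square_in_L s : sqpar s = true -> forall z, sq s z -> L z.
Proof.
  intros Hs.
  set (Q := fun z => exists s, sqpar s = true /\ sq s z).
  destruct sqpar_finite as [l Hl].
  assert (Qc : cclosed Q).
  { intros z Hz. destruct (cclosed_list_union l (fun s => sqpar s = true) sq sq_closed z) as (s' & _ & S1 & S2).
    - intros e He. destruct (Hz e He) as [v [[s' [S1 S2]] Hd]]. exists v. split; [|easy]. exists s'. auto.
    - now exists s'. }
  set (O := c_interior Q).
  assert (Ob : c_bounded O).
  { assert (G : exists M, forall s z, In s l -> sq s z -> Cmod z <= M).
    { clear. induction l as [|s l [M IH]]; [exists 0; intros s z []|].
      exists (Rmax M (Rabs (IZR (fst s)) * Rabs h + Rabs h + (Rabs (IZR (snd s)) * Rabs h + Rabs h))). intros s' z [<-|Hs'] Hz.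
      - eapply Rle_trans; [|apply Rmax_r]. eapply Rle_trans; [apply Cmod_le_ReIm|].
        assert (K : forall a x, IZR a * h <= x <= (IZR a + 1) * h -> Rabs x <= Rabs (IZR a) * Rabs h + Rabs h).
        { intros a x Hx. rewrite <- Rabs_mult. replace x with (IZR a * h + (x - IZR a * h)) by ring.
          eapply Rle_trans; [apply Rabs_triang|]. apply Rplus_le_compat_l. assert (0 <= h) by lra. rewrite (Rabs_pos_eq h) by easy. apply Rabs_le. lra. }
        destruct Hz. apply Rplus_le_compat; now apply K.
      - eapply Rle_trans; [|apply Rmax_l]. now apply (IH s'). }
    destruct G as [M HM]. exists M. intros z Hz. apply c_interior_sub in Hz. destruct Hz as [s' [S1 S2]]. apply (HM s'); auto. }
  assert (Obd : subset (c_boundary O) L).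
  { intros z [Hz1 Hz2].
    assert (Qz : Q z) by (apply (closure_min O Q); [apply c_interior_sub|easy|easy]).
    assert (Nz : ~ c_interior Q z).
    { intros K. apply Hz2. destruct (c_interior_open Q z K) as [r [Hr S]]. exists r. split; easy. }
    destruct (classic (trav z)) as [(k & t & Hk & Ht & ->)|Hnt]; [now apply Hw|]. exfalso. apply Nz.
    destruct (cell_1d (Re z / h)) as [r1 [Hr1 C1]]. destruct (cell_1d (Im z / h)) as [r2 [Hr2 C2]].
    exists (Rmin r1 r2 * h). split; [apply Rmult_lt_0_compat; [now apply Rmin_pos|easy]|]. intros v Hv. unfold cdisk in Hv.
    assert (X := re_le_Cmod (v - z)). assert (Y := im_le_Cmod (v - z)).
    change (Re (v - z)) with (Re v - Re z) in X. change (Im (v - z)) with (Im v - Im z) in Y.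
    assert (G : forall a b r, Rabs (a - b) < r * h -> Rabs (a / h - b / h) < r).
    { intros a b r Hab. replace (a / h - b / h) with ((a - b) / h) by (field; lra). unfold Rdiv. rewrite Rabs_mult, (Rabs_pos_eq (/ h)) by (apply Rlt_le, Rinv_0_lt_compat; easy).
      apply Rmult_lt_reg_r with h; [easy|]. rewrite Rmult_assoc, Rinv_l by lra. lra. }
    assert (M1 : Rmin r1 r2 * h <= r1 * h) by (apply Rmult_le_compat_r; [lra|apply Rmin_l]).
    assert (M2 : Rmin r1 r2 * h <= r2 * h) by (apply Rmult_le_compat_r; [lra|apply Rmin_r]).
    destruct (C1 (Re v / h)) as [i [I1 I2]]; [apply G; lra|]. destruct (C2 (Im v / h)) as [j [J1 J2]]; [apply G; lra|].
    assert (K : forall a x, IZR a <= x / h <= IZR a + 1 -> IZR a * h <= x <= (IZR a + 1) * h).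
    { intros a x Hx. replace x with (x / h * h) by (field; lra). split; apply Rmult_le_compat_r; lra. }
    apply K in I1, I2, J1, J2.
    exists (i, j). split; [|now split]. destruct Qz as [s' [S1 S2]]. rewrite <- S1. apply (sqpar_move (i, j) s' z); [now split|easy|easy]. }
  assert (OL := Lfull O Ob (c_interior_open Q) Obd).
  intros z Hz. apply Lclosed. intros e He.
  (* Points of the edges are approached from inside along the segment to the centre [m]; then
     closedness of [L] applies. *)
  set (m := ((IZR (fst s) + / 2) * h, (IZR (snd s) + / 2) * h) : C).
  set (t := Rmin (/ 2) (e / (Cmod (m - z) + 1) / 2)).
  assert (Hm := Cmod_ge_0 (m - z)).
  assert (Hep : 0 < e / (Cmod (m - z) + 1)) by (apply Rdiv_lt_0_compat; lra).
  assert (Ht : 0 < t) by (apply Rmin_pos; lra). assert (T1 := Rmin_l (/ 2) (e / (Cmod (m - z) + 1) / 2)). assert (T2 := Rmin_r (/ 2) (e / (Cmod (m - z) + 1) / 2)). fold t in T1, T2.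
  exists (seg z m t). split.
  - apply OL. destruct Hz as [Hz1 Hz2]. assert (Hin : c_interior (sq s) (seg z m t)).
    { assert (Es : seg z m t = (Re z + t * ((IZR (fst s) + / 2) * h - Re z), Im z + t * ((IZR (snd s) + / 2) * h - Im z))).
      { unfold seg, m. destruct z as [z1 z2]. unfold RtoC, Cplus, Cmult, Cminus, Copp, Re, Im; simpl. f_equal; ring. }
      rewrite Es. clear - Hz1 Hz2 Ht T1 Hh.
      assert (K : forall a x, a * h <= x <= (a + 1) * h -> a * h < x + t * ((a + / 2) * h - x) < (a + 1) * h).
      { intros a x Hx. replace (x + t * ((a + / 2) * h - x)) with ((1 - t) * (x - a * h) + t * (/ 2 * h) + a * h) by ring.
        assert (0 < t * (/ 2 * h)) by (repeat apply Rmult_lt_0_compat; lra).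
        assert (0 <= (1 - t) * (x - a * h)) by (apply Rmult_le_pos; lra).
        assert ((1 - t) * (x - a * h) <= (1 - t) * h) by (apply Rmult_le_compat_l; lra). nra. }
      apply sq_open_interior; simpl; now apply K. }
    destruct Hin as [r [Hr S]]. exists r. split; [easy|]. intros v Hv. exists s. split; [easy|now apply S].
  - rewrite <- (seg_0 z m) at 2. rewrite seg_dist, Rminus_0_r, Rabs_pos_eq by lra.
    assert (t * Cmod (m - z) <= e / (Cmod (m - z) + 1) / 2 * Cmod (m - z)) by (apply Rmult_le_compat_r; lra).
    assert (e / (Cmod (m - z) + 1) / 2 * (Cmod (m - z) + 1) = e / 2) by (field; lra). nra.
Qed.
End Walk.

(** * Lifts of lattice walks *)

Fixpoint endp (u : Z * Z) (l : list (Z * Z)) := match l with nil => u | v :: l => endp v l end.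
Fixpoint walk (u : Z * Z) (l : list (Z * Z)) : Prop := match l with nil => True | v :: l => good u v /\ walk v l end.

Lemma endp_app u l1 l2 : endp u (l1 ++ l2) = endp (endp u l1) l2.
Proof. revert u; induction l1; intros u; simpl; auto. Qed.

Lemma walk_app u l1 l2 : walk u (l1 ++ l2) <-> walk u l1 /\ walk (endp u l1) l2.
Proof. revert u; induction l1; intros u; simpl; [tauto|]. rewrite IHl1. tauto. Qed.

Lemma walk_nth u l k : walk u l -> (k < length l)%nat -> good (nth k (u :: l) u) (nth (S k) (u :: l) u).
Proof.
  revert u k; induction l as [|v l IH]; intros u k Hw Hk; [simpl in Hk; lia|]. destruct Hw as [Hg Hw]. destruct k as [|k]; [exact Hg|].
  simpl in Hk. assert (X := IH v k Hw ltac:(lia)).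
  rewrite (nth_indep (v :: l) v u) in X by (simpl; lia). rewrite (nth_indep (v :: l) v u (n := S k)) in X by (simpl; lia). exact X.
Qed.

Lemma endp_firstn u l k : (k <= length l)%nat -> endp u (firstn k l) = nth k (u :: l) u.
Proof.
  revert u k; induction l as [|v l IH]; intros u k Hk.
  - simpl in Hk. now replace k with 0%nat by lia.
  - destruct k as [|k]; [easy|]. simpl in Hk. change (endp v (firstn k l) = nth k (v :: l) u). rewrite IH by lia.
    apply nth_indep. simpl. lia.
Qed.

Section Lift.
Variables (f : C -> C) (A : C -> Prop) (eps delta : R).
Hypothesis Hdelta : 2 * h < delta.
Hypothesis Heps : 0 < eps.
Hypothesis Lbd : c_bounded L.
Hypothesis Hlift : forall x y, A x -> L (f x) -> Cmod (y - f x) < delta -> exists x', A x' /\ Cmod (x' - x) < eps /\ f x' = y.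
Hypothesis Huniq : forall x a b, A x -> L (f x) -> A a -> A b -> Cmod (a - x) < 3 * eps -> Cmod (b - x) < 3 * eps -> f a = f b -> a = b.

Definition nx (x y : C) : C := epsilon (inhabits x) (fun x' => A x' /\ Cmod (x' - x) < eps /\ f x' = y).

Lemma nx_spec x y : A x -> L (f x) -> Cmod (y - f x) < delta -> A (nx x y) /\ Cmod (nx x y - x) < eps /\ f (nx x y) = y.
Proof. intros. unfold nx. apply epsilon_spec. now apply Hlift. Qed.

Lemma nx_unique x y x' : A x -> L (f x) -> Cmod (y - f x) < delta -> A x' -> Cmod (x' - x) < 3 * eps -> f x' = y -> x' = nx x y.
Proof.
  intros Hx HL Hy Hx' Hd E. destruct (nx_spec x y Hx HL Hy) as (N1 & N2 & N3).
  apply (Huniq x); try easy; [lra|congruence].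
Qed.

(** Two steps of length below [eps], compared with a single one, stay within the uniqueness radius
    [3 * eps]. *)
Lemma nx_triangle x y1 y2 : A x -> L (f x) -> L y1 -> Cmod (y1 - f x) < delta -> Cmod (y2 - y1) < delta -> Cmod (y2 - f x) < delta ->
  nx (nx x y1) y2 = nx x y2.
Proof.
  intros Hx HL HL1 H1 H2 H3. destruct (nx_spec x y1 Hx HL H1) as (N1 & N2 & N3).
  destruct (nx_spec (nx x y1) y2) as (M1 & M2 & M3); rewrite ?N3; try easy.
  apply nx_unique; try easy. assert (T := Cmod_tri (nx (nx x y1) y2) (nx x y1) x). lra.
Qed.

Lemma nx_back x y : A x -> L (f x) -> L y -> Cmod (y - f x) < delta -> nx (nx x y) (f x) = x.
Proof.
  intros Hx HL HLy Hy. assert (Hd0 : Cmod (f x - f x) < delta) by (rewrite Cmod_diag; lra).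
  rewrite (nx_triangle x y (f x)); try easy; [|now rewrite Cmod_sym].
  symmetry. apply nx_unique; try easy. rewrite Cmod_diag. lra.
Qed.

Definition lift (x : C) (l : list (Z * Z)) : C := fold_left (fun x v => nx x (pt v)) l x.

Lemma pt_dist u v : adj u v -> Cmod (pt v - pt u) <= h.
Proof.
  intros Hadj. unfold adj in Hadj.
  assert (E : (pt v - pt u)%C = ((IZR (fst v - fst u)) * h, (IZR (snd v - snd u)) * h)).
  { unfold pt, Cminus, Cplus, Copp; simpl. rewrite !minus_IZR. f_equal; ring. }
  rewrite E. eapply Rle_trans; [apply Cmod_le_ReIm|]. simpl.
  rewrite !Rabs_mult, (Rabs_pos_eq h), <- !abs_IZR by lra.
  assert (X : (Z.abs (fst v - fst u) + Z.abs (snd v - snd u) = 1)%Z) by lia.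
  apply (f_equal IZR) in X. rewrite plus_IZR in X. nra.
Qed.

Lemma good_L u v : good u v -> L (pt u) /\ L (pt v).
Proof.
  intros [_ Hg]. split; [rewrite <- (seg_0 (pt u) (pt v))|rewrite <- (seg_1 (pt u) (pt v))]; apply Hg; lra.
Qed.

Lemma step_spec x u v : A x -> f x = pt u -> good u v -> A (nx x (pt v)) /\ f (nx x (pt v)) = pt v /\ Cmod (nx x (pt v) - x) < eps.
Proof.
  intros Hx E Hg. destruct (nx_spec x (pt v) Hx) as (N1 & N2 & N3).
  - rewrite E. now apply (good_L u v).
  - rewrite E. apply Rle_lt_trans with h; [apply pt_dist, Hg|lra].
  - auto.
Qed.

Lemma lift_spec x u l : A x -> f x = pt u -> walk u l -> A (lift x l) /\ f (lift x l) = pt (endp u l).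
Proof.
  revert x u; induction l as [|v l IH]; intros x u Hx E Hw; [easy|]. destruct Hw as [Hg Hw].
  destruct (step_spec x u v Hx E Hg) as (S1 & S2 & _). simpl. now apply IH.
Qed.

Lemma lift_app x l1 l2 : lift x (l1 ++ l2) = lift (lift x l1) l2.
Proof. apply fold_left_app. Qed.

Variable B : Z.
Hypothesis HB : forall v, L (pt v) -> (- B <= fst v <= B /\ - B <= snd v <= B)%Z.

(** Pushing a horizontal edge one row down creates two vertical edges of weight 1 and saves 3, so
    the measure drops by one. The shift by [B] keeps heights in the range where [Z.to_nat] is
    faithful. *)
Definition weight (u v : Z * Z) : nat := (1 + if (snd u =? snd v)%Z then 3 * Z.to_nat (snd u + B + 1) else 0)%nat.
Fixpoint meas (u : Z * Z) (l : list (Z * Z)) : nat := match l with nil => 0%nat | v :: l => (weight u v + meas v l)%nat end.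

Lemma meas_app u l1 l2 : meas u (l1 ++ l2) = (meas u l1 + meas (endp u l1) l2)%nat.
Proof. revert u; induction l1; intros u; simpl; [easy|]. rewrite IHl1. lia. Qed.

Lemma meas_pos u l : l <> nil -> (0 < meas u l)%nat.
Proof. destruct l; [easy|]. intros _. simpl. unfold weight. lia. Qed.

Lemma nat_argmax (g : nat -> Z) n : exists k, (k <= n)%nat /\ forall j, (j <= n)%nat -> (g j <= g k)%Z.
Proof.
  induction n as [|n [k [Hk IH]]].
  - exists 0%nat. split; [lia|]. intros j Hj. replace j with 0%nat by lia. lia.
  - destruct (Z.le_gt_cases (g (S n)) (g k)) as [Hle|Hgt].
    + exists k. split; [lia|]. intros j Hj. destruct (Nat.eq_dec j (S n)) as [->|]; [easy|apply IH; lia].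
    + exists (S n). split; [lia|]. intros j Hj. destruct (Nat.eq_dec j (S n)) as [->|]; [lia|]. specialize (IH j ltac:(lia)). lia.
Qed.

(** The two neighbours of a highest vertex, if both were strictly below it, would be the same
    vertex. *)
Lemma top_edge (w : nat -> Z * Z) n : (3 <= n)%nat -> (forall k, (k < n)%nat -> adj (w k) (w (S k))) -> w 0%nat = w n ->
  (forall i j, (i < j <= n)%nat -> (i, j) <> (0%nat, n) -> w i <> w j) ->
  exists s, (s < n)%nat /\ snd (w s) = snd (w (S s)) /\ forall k, (k <= n)%nat -> (snd (w k) <= snd (w s))%Z.
Proof.
  intros Hn Hadj Hcl Hd. destruct (nat_argmax (fun k => snd (w k)) n) as [k [Hk Hmax]].
  assert (Main : forall p q x, adj p x -> adj x q -> p <> q -> (snd p <= snd x)%Z -> (snd q <= snd x)%Z -> snd p = snd x \/ snd x = snd q).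
  { intros [p1 p2] [q1 q2] [x1 x2]. unfold adj; simpl. intros H1 H2 H3 H4 H5.
    destruct (Z.eq_dec p2 x2); [now left|]. destruct (Z.eq_dec x2 q2); [now right|]. exfalso. apply H3. f_equal; lia. }
  assert (Hcase : exists k, (0 < k < n)%nat /\ (forall j, (j <= n)%nat -> (snd (w j) <= snd (w k))%Z) \/ k = n /\ (forall j, (j <= n)%nat -> (snd (w j) <= snd (w n))%Z)).
  { destruct (Nat.eq_dec k 0) as [->|]; [exists n; right; split; [easy|]; rewrite <- Hcl; easy|].
    destruct (Nat.eq_dec k n) as [->|]; [exists n; now right|]. exists k. left. split; [lia|easy]. }
  destruct Hcase as [k' [[Hk' Hm]|[-> Hm]]].
  - destruct k' as [|k']; [lia|].
    destruct (Main (w k') (w (S (S k'))) (w (S k'))) as [E|E]; try (apply Hadj; lia); try (apply Hm; lia).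
    + apply Hd; [lia|]. intros E. inversion E. lia.
    + exists k'. split; [lia|]. split; [easy|]. rewrite E. exact Hm.
    + exists (S k'). split; [lia|]. split; [easy|exact Hm].
  - destruct n as [|n']; [lia|].
    destruct (Main (w n') (w 1%nat) (w (S n'))) as [E|E].
    + apply Hadj; lia. + rewrite <- Hcl. apply Hadj; lia.
    + apply not_eq_sym. apply Hd; [lia|]. intros E. inversion E.
    + apply Hm; lia. + apply Hm; lia.
    + exists n'. split; [lia|]. split; [easy|]. rewrite E. exact Hm.
    + exists 0%nat. split; [lia|]. rewrite Hcl. split; [easy|exact Hm].
Qed.

(** Running through an edge again repeats a vertex. At least three steps are required, since a loop
    of two steps retraces its edge. *)
Lemma edge_once (w : nat -> Z * Z) n s k : (3 <= n)%nat -> (forall k, (k < n)%nat -> adj (w k) (w (S k))) -> w 0%nat = w n ->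
  (forall i j, (i < j <= n)%nat -> (i, j) <> (0%nat, n) -> w i <> w j) ->
  (s < n)%nat -> (k < n)%nat -> k <> s -> snd (w s) = snd (w (S s)) -> snd (w k) = snd (w (S k)) -> snd (w k) = snd (w s) ->
  Z.min (fst (w k)) (fst (w (S k))) = Z.min (fst (w s)) (fst (w (S s))) -> False.
Proof.
  intros Hn Hadj Hcl Hd Hs Hk Hks E1 E2 E3 E4.
  assert (Ds : forall i j, (i < n)%nat -> (j < n)%nat -> w i = w j -> i = j).
  { intros i j Hi Hj E. destruct (Nat.lt_trichotomy i j) as [Hl|[?|Hl]]; [|easy|]; exfalso.
    - apply (Hd i j); [lia|intros K; inversion K; lia|easy].
    - apply (Hd j i); [lia|intros K; inversion K; lia|easy]. }
  assert (As := Hadj s Hs). assert (Ak := Hadj k Hk).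
  assert (Hc : w k = w s \/ (w k = w (S s) /\ w (S k) = w s)).
  { destruct (w k) as [a1 a2], (w (S k)) as [b1 b2], (w s) as [c1 c2], (w (S s)) as [d1 d2]. unfold adj in *. simpl in *.
    destruct (Z.eq_dec a1 c1); [left; f_equal; lia|right; split; f_equal; lia]. }
  destruct Hc as [Hc|[Hc1 Hc2]]; [now apply Hks, Ds|].
  destruct (Nat.eq_dec (S s) n) as [Es|Es]; destruct (Nat.eq_dec (S k) n) as [Ek|Ek].
  - lia.
  - rewrite Es, <- Hcl in Hc1. apply Ds in Hc1; [|lia|lia]. subst k. apply Ds in Hc2; lia.
  - rewrite Ek, <- Hcl in Hc2. apply Ds in Hc2; [|lia|lia]. subst s. apply Ds in Hc1; lia.
  - apply Ds in Hc1; [|lia|lia]. apply Ds in Hc2; lia.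
Qed.

(* Induction on [meas]: cut the loop at a repeated vertex, or push a topmost horizontal edge, which is traversed
   once, across the square below it. *)
Theorem closed_walk_lift N : forall u l, (meas u l <= N)%nat -> walk u l -> endp u l = u -> forall x, A x -> f x = pt u -> lift x l = x.
Proof.
  induction N as [|N IH]; intros u l HN Hw He x Hx Ex.
  { destruct l as [|v l]; [easy|]. exfalso. assert (X := meas_pos u (v :: l)). specialize (X ltac:(easy)). lia. }
  destruct (classic (exists l1 l2 l3, l = l1 ++ l2 ++ l3 /\ endp u l1 = endp u (l1 ++ l2) /\ l2 <> nil /\ l1 ++ l3 <> nil)) as [(l1 & l2 & l3 & El & E12 & N2 & N13)|Hno].
  { subst l. rewrite endp_app in E12. rewrite !walk_app in Hw. destruct Hw as (W1 & W2 & W3).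
    rewrite !endp_app in He. rewrite <- E12 in He, W3. rewrite !meas_app, <- E12 in HN.
    assert (P2 := meas_pos (endp u l1) l2 N2). assert (P13 := meas_pos u (l1 ++ l3) N13). rewrite meas_app in P13.
    destruct (lift_spec x u l1 Hx Ex W1) as [L1 L2].
    rewrite !lift_app, (IH (endp u l1) l2); try easy; [|lia]. rewrite <- lift_app. apply (IH u); try easy.
    - rewrite meas_app. lia. - rewrite walk_app. easy. - now rewrite endp_app. }
  set (n := length l). set (w := fun k => nth k (u :: l) u).
  assert (Hgood : forall k, (k < n)%nat -> good (w k) (w (S k))) by (intros k Hk; now apply walk_nth).
  assert (Hend : forall k, (k <= n)%nat -> endp u (firstn k l) = w k) by (intros k Hk; now apply endp_firstn).
  assert (Hwn : w n = u) by (rewrite <- Hend by lia; unfold n; now rewrite firstn_all).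
  assert (Hcl : w 0%nat = w n) by now rewrite Hwn.
  assert (Hdist : forall i j, (i < j <= n)%nat -> (i, j) <> (0%nat, n) -> w i <> w j).
  { intros i j Hij Hne E. apply Hno. exists (firstn i l), (firstn (j - i) (skipn i l)), (skipn j l).
    assert (Ej : firstn i l ++ firstn (j - i) (skipn i l) = firstn j l).
    { rewrite <- (firstn_skipn i l) at 3. rewrite firstn_app, firstn_firstn, length_firstn.
      replace (Nat.min j i) with i by lia. replace (Nat.min i (length l)) with i by (unfold n in *; lia). easy. }
    split; [rewrite app_assoc, Ej; now rewrite firstn_skipn|]. split; [rewrite Ej, !Hend by lia; exact E|]. split.
    - intros K. apply (f_equal (@length _)) in K. rewrite length_firstn, length_skipn in K. simpl in K. unfold n in *. lia.
    - intros K. apply (f_equal (@length _)) in K. rewrite length_app, length_firstn, length_skipn in K. simpl in K.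
      apply Hne. unfold n in *. f_equal; lia. }
  destruct (Nat.le_gt_cases 3 n) as [Hn3|Hn3].
  2:{ unfold n in *. destruct l as [|v [|v2 [|v3 l]]]; simpl in Hn3; try lia.
      - easy.
      - exfalso. destruct Hw as [[Hadj _] _]. simpl in He. subst v. unfold adj in Hadj. lia.
      - simpl in He. subst v2. destruct Hw as [Hg _]. simpl.
        rewrite <- Ex. apply nx_back; try easy.
        + rewrite Ex. apply (good_L u v Hg). + apply (good_L u v Hg).
        + rewrite Ex. apply Rle_lt_trans with h; [apply pt_dist, Hg|lra]. }
  assert (Hadj : forall k, (k < n)%nat -> adj (w k) (w (S k))) by (intros k Hk; apply (Hgood k Hk)).
  destruct (top_edge w n Hn3 Hadj Hcl Hdist) as (s & Hs & Esy & Htop).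
  set (a := w s) in *. set (v := w (S s)) in *.
  set (i := Z.min (fst a) (fst v)). set (y := (snd a - 1)%Z).
  (* [(i, y)] is the square below the top edge. Its upward ray meets the walk only in this edge, as
     nothing lies higher, so the parity is odd and the square lies in [L]. *)
  assert (Hpar : sqpar w n (i, y) = true).
  { apply (par_single _ _ s Hs).
    - unfold crosses. fold a v. rewrite Esy, Z.eqb_refl. unfold i, y. simpl. rewrite Esy, Z.eqb_refl.
      destruct (Z.leb_spec (snd v - 1 + 1) (snd v)); [easy|lia].
    - intros k Hk Hks. destruct (crosses (i, y) (w k) (w (S k))) eqn:Ec; [|easy]. exfalso.
      unfold crosses in Ec. apply andb_prop in Ec. destruct Ec as [Ec H3]. apply andb_prop in Ec. destruct Ec as [H1 H2].
      apply Z.eqb_eq in H1, H3. apply Z.leb_le in H2. simpl in H2, H3. specialize (Htop k ltac:(lia)).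
      apply (edge_once w n s k); try easy; fold a v; unfold y in *; lia. }
  assert (HSq := odd_square_in_L w n Hgood Hcl Lbd (i, y) Hpar).
  assert (Hav := Hadj s Hs). fold a v in Hav.
  set (a' := (fst a, y)). set (v' := (fst v, y)).
  assert (Hxx : (fst a = i /\ fst v = i + 1 \/ fst a = i + 1 /\ fst v = i)%Z) by (unfold adj in Hav; unfold i; lia).
  assert (SqIn : forall p q, (p = fst a \/ p = fst v) -> (q = y \/ q = y + 1)%Z -> sq (i, y) (IZR p * h, IZR q * h)).
  { intros p q Hp Hq. unfold sq; simpl. assert (Hp' : (i <= p <= i + 1)%Z) by lia. assert (Hq' : (y <= q <= y + 1)%Z) by lia.
    destruct Hp' as [P1 P2], Hq' as [Q1 Q2]. apply IZR_le in P1, P2, Q1, Q2. rewrite plus_IZR in P2, Q2.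
    split; split; apply Rmult_le_compat_r; lra. }
  assert (SqConv : forall p q t, sq (i, y) p -> sq (i, y) q -> 0 <= t <= 1 -> sq (i, y) (seg p q t)).
  { intros [p1 p2] [q1 q2] t [X1 X2] [Y1 Y2] Ht. unfold sq, seg, RtoC, Cplus, Cmult, Cminus, Copp in *; simpl in *. split; split; nra. }
  assert (Say : snd a = (y + 1)%Z) by (unfold y; lia).
  assert (Svy : snd v = (y + 1)%Z) by (rewrite <- Esy; exact Say).
  assert (Ga : good a a').
  { split; [unfold adj, a', y; simpl; lia|]. intros t Ht. apply HSq, SqConv; [|apply SqIn; simpl; auto|easy]. unfold pt. rewrite Say. apply SqIn; auto. }
  assert (Gv : good v' v).
  { split; [unfold adj, v', y; simpl; rewrite <- Esy; lia|]. intros t Ht. apply HSq, SqConv; [apply SqIn; simpl; auto| |easy]. unfold pt. rewrite Svy. apply SqIn; auto. }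
  assert (Gav : good a' v').
  { split; [unfold adj, a', v'; simpl; lia|]. intros t Ht. apply HSq, SqConv; [apply SqIn; simpl; auto|apply SqIn; simpl; auto|easy]. }
  set (l1 := firstn s l). set (l3 := skipn (S s) l).
  assert (El : l = l1 ++ v :: l3).
  { unfold l1, l3, v, w. rewrite <- (firstn_skipn s l) at 1. f_equal. simpl nth. clear - Hs. unfold n in Hs. revert s Hs.
    induction l as [|b l IHl]; intros s Hs; [simpl in Hs; lia|]. destruct s as [|s]; [easy|]. simpl in Hs. change (skipn s l = nth s l u :: skipn (S s) l). apply IHl. lia. }
  assert (E1 : endp u l1 = a) by (apply Hend; lia).
  rewrite El, walk_app, E1 in Hw. destruct Hw as (W1 & G & W3).
  rewrite El, meas_app, E1 in HN. rewrite El, endp_app, E1 in He. simpl in HN, He.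
  destruct (lift_spec x u l1 Hx Ex W1) as [L1 L2]. rewrite E1 in L2.
  (* The detour around the square has smaller measure, and by [nx_triangle] its three steps lift to
     the same end as the single edge. *)
  assert (Enew : lift x (l1 ++ a' :: v' :: v :: l3) = x).
  { apply (IH u); try easy.
    - rewrite meas_app, E1. simpl. unfold weight in *. unfold a', v' in *. simpl. rewrite Esy in *. rewrite !Z.eqb_refl in *.
      assert (HBa : (- B <= y)%Z) by (apply (HB a'), (good_L a a' Ga)).
      destruct (Z.eqb_spec (snd v) y); [lia|]. destruct (Z.eqb_spec y (snd v)); [lia|].
      assert (Z.to_nat (snd v + B + 1) = S (Z.to_nat (y + B + 1))) by lia. lia.
    - rewrite walk_app, E1. simpl. auto.
    - rewrite endp_app, E1. simpl. exact He. }
  rewrite El. rewrite <- Enew at 2. rewrite !lift_app. unfold lift at 1 3. simpl. f_equal.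
  set (x1 := lift x l1) in *.
  assert (D1 : Cmod (pt a' - pt a) <= h) by apply pt_dist, Ga.
  assert (D2 : Cmod (pt v' - pt a') <= h) by apply pt_dist, Gav.
  assert (D3 : Cmod (pt v - pt v') <= h) by apply pt_dist, Gv.
  assert (D4 : Cmod (pt v - pt a) <= h) by apply pt_dist, G.
  assert (D5 := Cmod_tri (pt v') (pt a') (pt a)).
  assert (La := proj1 (good_L a a' Ga)). assert (La' := proj2 (good_L a a' Ga)). assert (Lv' := proj1 (good_L v' v Gv)).
  rewrite (nx_triangle x1 (pt a') (pt v')), (nx_triangle x1 (pt v') (pt v)); rewrite ?L2; try easy; lra.
Qed.
End Lift.
End Lattice.

(** * Injectivity on wandering components *)

(** The erosion of [S] by [eta]: closed for every [S], and by [deep_full] without holes if [S]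
    is. *)
Definition deep (eta : R) (S : C -> Prop) (z : C) : Prop := subset (cdisk z eta) S.

Lemma deep_closed eta S : cclosed (deep eta S).
Proof.
  intros z Hz w Hw. unfold cdisk in Hw. destruct (Hz (eta - Cmod (w - z))) as [v [Hv Hd]]; [lra|].
  apply Hv. unfold cdisk. assert (T := Cmod_tri w z v). rewrite (Cmod_sym z v) in T. lra.
Qed.

Lemma deep_sub eta S : 0 < eta -> subset (deep eta S) S.
Proof. intros He z Hz. apply Hz. now apply cdisk_center. Qed.

(* The translates of [O] by vectors shorter than [eta] have their boundary in [S], hence lie in [S]. *)
Lemma deep_full eta S : (forall O, c_bounded O -> c_open O -> subset (c_boundary O) S -> subset O S) ->
  forall O, c_bounded O -> c_open O -> subset (c_boundary O) (deep eta S) -> subset O (deep eta S).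
Proof.
  intros Hfull O [M HM] HO Hb z Hz w Hw. unfold cdisk in Hw. set (t := (w - z)%C).
  assert (Q : subset (fun v => O (v - t)%C) S).
  { apply Hfull.
    - exists (M + Cmod t). intros v Hv. specialize (HM _ Hv). assert (T := Cmod_ge_sub v t). lra.
    - intros v Hv. destruct (HO _ Hv) as [e [He Se]]. exists e. split; [easy|]. intros x Hx. apply Se. unfold cdisk in *.
      replace (Cminus (x - t) (v - t))%C with (x - v)%C by ring. exact Hx.
    - intros v [Hv1 Hv2]. assert (Hvb : c_boundary O (v - t)%C).
      { split.
        - intros e He. destruct (Hv1 e He) as [x [Hx Hd]]. exists (x - t)%C. split; [exact Hx|].
          replace (Cminus (x - t) (v - t))%C with (x - v)%C by ring. exact Hd.
        - intros [e [He Se]]. apply Hv2. exists e. split; [easy|]. intros x Hx. apply Se. unfold cdisk in *.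
          replace (Cminus (x - t) (v - t))%C with (x - v)%C by ring. exact Hx. }
      apply (Hb _ Hvb). unfold cdisk. replace (Cminus v (v - t))%C with t by ring. exact Hw. }
  apply Q. unfold t. replace (w - (w - z))%C with z by ring. exact Hz.
Qed.

(** * Chains of small steps in connected sets *)

Fixpoint chain (S : C -> Prop) (tau : R) (x : C) (l : list C) : Prop :=
  match l with nil => True | y :: l => S y /\ Cmod (y - x) < tau /\ chain S tau y l end.
Fixpoint cend (x : C) (l : list C) : C := match l with nil => x | y :: l => cend y l end.

Lemma chain_app S tau x l1 l2 : chain S tau x l1 -> chain S tau (cend x l1) l2 -> chain S tau x (l1 ++ l2).
Proof. revert x; induction l1; intros x; simpl; [easy|]. intros (?&?&?) ?. auto. Qed.

Lemma cend_app x l1 l2 : cend x (l1 ++ l2) = cend (cend x l1) l2.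
Proof. revert x; induction l1; intros x; simpl; auto. Qed.

Lemma chain_mono S S' tau x l : subset S S' -> chain S tau x l -> chain S' tau x l.
Proof. intros HS; revert x; induction l; intros x; simpl; [easy|]. intros (?&?&?). auto. Qed.

(** The margin [eta] is fixed before the mesh [tau], so that uniform constants on [deep eta W] can
    be chosen first and the chain fitted to them. *)
Definition linked (W : C -> Prop) (x x' : C) : Prop := exists eta, 0 < eta /\ deep eta W x /\
  forall tau, 0 < tau -> exists l, chain (deep eta W) tau x l /\ cend x l = x'.

Lemma linked_trans W x y z : linked W x y -> linked W y z -> linked W x z.
Proof.
  intros (e1 & E1 & D1 & K1) (e2 & E2 & D2 & K2). exists (Rmin e1 e2).
  assert (M1 : subset (deep e1 W) (deep (Rmin e1 e2) W)).
  { intros u Hu v Hv. apply Hu. unfold cdisk in *. eapply Rlt_le_trans; [exact Hv|apply Rmin_l]. }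
  assert (M2 : subset (deep e2 W) (deep (Rmin e1 e2) W)).
  { intros u Hu v Hv. apply Hu. unfold cdisk in *. eapply Rlt_le_trans; [exact Hv|apply Rmin_r]. }
  split; [now apply Rmin_pos|]. split; [now apply M1|]. intros tau Ht.
  destruct (K1 tau Ht) as [l1 [L1 F1]]. destruct (K2 tau Ht) as [l2 [L2 F2]]. exists (l1 ++ l2). split.
  - apply chain_app; [now apply (chain_mono _ _ _ _ _ M1)|]. rewrite F1. now apply (chain_mono _ _ _ _ _ M2).
  - now rewrite cend_app, F1.
Qed.

Lemma linked_disk W x x' r : 0 < r -> subset (cdisk x (2 * r)) W -> Cmod (x' - x) < r -> linked W x x' /\ linked W x' x.
Proof.
  intros Hr HS Hx'.
  assert (G : forall a b, Cmod (a - x) < r -> Cmod (b - x) < r -> linked W a b).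
  { intros a b Ha Hb. exists r. split; [easy|].
    assert (D : forall t, 0 <= t <= 1 -> deep r W (seg a b t)).
    { intros t Ht w Hw. apply HS. unfold cdisk in *. assert (X := cdisk_convex x r a b t Ha Hb Ht). unfold cdisk in X.
      assert (T := Cmod_tri w (seg a b t) x). lra. }
    split; [rewrite <- (seg_0 a b); apply D; lra|]. intros tau Ht.
    destruct (INR_unbounded (Cmod (b - a) / tau)) as [n0 Hn0]. set (n := S n0).
    assert (Hn1 : 0 < INR n) by (apply lt_0_INR; unfold n; lia).
    assert (Hn : Cmod (b - a) < INR n * tau).
    { apply Rle_lt_trans with (Cmod (b - a) / tau * tau); [right; field; lra|]. apply Rmult_lt_compat_r; [easy|]. unfold n. rewrite S_INR. lra. }
    assert (Q : forall k, (k <= n)%nat -> exists l, chain (deep r W) tau a l /\ cend a l = seg a b (INR k / INR n)).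
    { induction k as [|k IH]; intros Hk.
      - exists nil. split; [easy|]. simpl. unfold Rdiv. rewrite Rmult_0_l, seg_0. easy.
      - destruct (IH ltac:(lia)) as [l [L1 L2]]. exists (l ++ seg a b (INR (S k) / INR n) :: nil). split.
        + apply chain_app; [easy|]. rewrite L2. cbn [chain]. split; [|split; [|easy]].
          * apply D. split; [apply Rmult_le_pos; [apply pos_INR|now apply Rlt_le, Rinv_0_lt_compat]|].
            apply Rmult_le_reg_r with (INR n); [easy|]. unfold Rdiv. rewrite Rmult_assoc, Rinv_l, Rmult_1_r, Rmult_1_l by lra. apply le_INR. lia.
          * rewrite seg_dist. replace (INR (S k) / INR n - INR k / INR n) with (/ INR n) by (rewrite S_INR; field; lra).
            rewrite Rabs_pos_eq by (now apply Rlt_le, Rinv_0_lt_compat).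
            apply Rmult_lt_reg_l with (INR n); [easy|]. rewrite <- Rmult_assoc, Rinv_r, Rmult_1_l by lra. lra.
        + now rewrite cend_app, L2. }
    destruct (Q n (Nat.le_refl n)) as [l [L1 L2]]. exists l. split; [easy|]. rewrite L2. replace (INR n / INR n) with 1 by (field; lra). apply seg_1. }
  split; apply G; rewrite ?Cmod_diag; easy.
Qed.

Lemma connected_linked W x x' : c_open W -> c_connected W -> W x -> W x' -> linked W x x'.
Proof.
  intros HO HC Hx Hx'.
  assert (D : forall z, W z -> exists r, 0 < r /\ subset (cdisk z (2 * r)) W).
  { intros z Hz. destruct (HO z Hz) as [e [He Se]]. exists (e / 2). split; [lra|]. now replace (2 * (e / 2)) with e by field. }
  destruct (HC (fun z => W z /\ linked W x z) (fun z => W z /\ ~ linked W x z)) as [K|K].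
  - intros z [Hz HR]. destruct (D z Hz) as [r [Hr Sr]]. exists r. split; [easy|]. intros w Hw. split.
    + apply Sr. unfold cdisk in *. lra.
    + apply (linked_trans _ _ z); [easy|]. now apply (linked_disk W z w r).
  - intros z [Hz HR]. destruct (D z Hz) as [r [Hr Sr]]. exists r. split; [easy|]. intros w Hw. split.
    + apply Sr. unfold cdisk in *. lra.
    + intros K. apply HR. apply (linked_trans _ _ w); [easy|]. now apply (linked_disk W z w r).
  - intros z Hz. destruct (classic (linked W x z)); [left|right]; easy.
  - intros z (_ & [_ X] & [_ Y]). contradiction.
  - now apply K.
  - exfalso. destruct (K x Hx) as [_ Y]. apply Y. destruct (D x Hx) as [r [Hr Sr]]. apply (linked_disk W x x r); try easy. now rewrite Cmod_diag.
Qed.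

(** One number [r] serves as radius, as expansion factor and as covering factor; the condition is
    then inherited by smaller [r], as [compact_uniform] demands. *)
Definition locally_invertible (f : C -> C) (W : C -> Prop) (y : C) (r : R) : Prop :=
  subset (cdisk y r) W /\
  (forall a b, cdisk y r a -> cdisk y r b -> r * Cmod (a - b) <= Cmod (f a - f b)) /\
  (forall s y', 0 < s < r -> Cmod (y' - f y) <= r * s -> exists a, Cmod (a - y) <= s /\ f a = y').

Lemma uniformly_invertible f W N : c_open W -> hol f W -> c_compact N -> subset N W ->
  (forall z, N z -> Dv f z <> 0%C) -> exists r, 0 < r /\ forall y, N y -> locally_invertible f W y r.
Proof.
  intros HW Hf HN HS HD. apply (compact_uniform N (locally_invertible f W)); [easy| |].
  - intros y r r' (L1 & L2 & L3) Hr. split; [|split].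
    + intros z Hz. apply L1. unfold cdisk in *. lra.
    + intros a b Ha Hb. apply Rle_trans with (r * Cmod (a - b)); [apply Rmult_le_compat_r; [apply Cmod_ge_0|lra]|].
      apply L2; unfold cdisk in *; lra.
    + intros s y' Hs Hy. apply L3; [lra|]. apply Rle_trans with (r' * s); [easy|]. apply Rmult_le_compat_r; lra.
  - intros x Hx. destruct (HW x (HS x Hx)) as [R [HR SR]].
    destruct (local_near_linear f x R HR) as [s0 [Hs0 NL]]; [now apply (hol_sub f W)|auto|].
    set (lam := Dv f x) in *. assert (Hlam : 0 < Cmod lam) by (apply Cmod_gt_0; unfold lam; auto).
    set (r := Rmin (s0 / 2) (Cmod lam / 2)). assert (R1 : r <= s0 / 2) by apply Rmin_l. assert (R2 : r <= Cmod lam / 2) by apply Rmin_r.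
    assert (Hr : 0 < r) by (apply Rmin_pos; lra). exists r. split; [easy|]. intros y _ Hy.
    assert (In : forall a, cdisk y r a -> Cmod (a - x) <= s0) by (intros a Ha; unfold cdisk in Ha; assert (T := Cmod_tri a y x); lra).
    split; [|split].
    + intros a Ha. apply SR. unfold cdisk. specialize (In a Ha). lra.
    + intros a b Ha Hb. apply Rle_trans with (Cmod lam / 2 * Cmod (a - b)); [apply Rmult_le_compat_r; [apply Cmod_ge_0|easy]|].
      apply (near_linear_expand f lam x s0); auto.
    + intros s y' Hs Hy'. apply (near_linear_surj f lam y s y'); [lra| |easy|].
      * intros a b Ha Hb. apply NL; [assert (T := Cmod_tri a y x)|assert (T := Cmod_tri b y x)]; lra.
      * eapply Rle_trans; [exact Hy'|]. apply Rmult_le_compat_r; lra.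
Qed.

(** The lower left corner of a lattice square containing [y], since [up x - 1] is the floor of
    [x]. *)
Definition snap (h : R) (y : C) : Z * Z := ((up (Re y / h) - 1)%Z, (up (Im y / h) - 1)%Z).

Lemma snap_1d h a : 0 < h -> 0 <= a - IZR (up (a / h) - 1) * h <= h.
Proof.
  intros Hh. destruct (archimed (a / h)) as [A1 A2]. rewrite minus_IZR.
  assert (E : a = a / h * h) by (field; lra). set (q := a / h) in *. rewrite E.
  replace (q * h - (IZR (up q) - 1) * h) with ((q - IZR (up q) + 1) * h) by ring.
  split; [apply Rmult_le_pos; lra|]. rewrite <- (Rmult_1_l h) at 2. apply Rmult_le_compat_r; lra.
Qed.

Lemma snap_near h y : 0 < h -> Cmod (pt h (snap h y) - y) <= 2 * h.
Proof.
  intros Hh. eapply Rle_trans; [apply Cmod_le_ReIm|]. unfold pt, snap.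
  assert (X := snap_1d h (Re y) Hh). assert (Y := snap_1d h (Im y) Hh).
  change (Rabs (IZR (up (Re y / h) - 1) * h - Re y) + Rabs (IZR (up (Im y / h) - 1) * h - Im y) <= 2 * h).
  rewrite (Rabs_left1 (_ - Re y)), (Rabs_left1 (_ - Im y)); lra.
Qed.

Lemma snap_step h a b : 0 < h -> Rabs (a - b) < h -> (up (b / h) - 1 <= up (a / h) <= up (b / h) + 1)%Z.
Proof.
  intros Hh Hab. destruct (archimed (a / h)) as [A1 A2]. destruct (archimed (b / h)) as [B1 B2]. apply Rabs_def2 in Hab.
  assert (K : -1 < a / h - b / h < 1).
  { replace (a / h - b / h) with ((a - b) / h) by (field; lra). split; apply Rmult_lt_reg_r with h; try easy; unfold Rdiv; rewrite Rmult_assoc, Rinv_l by lra; lra. }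
  split; apply Z.lt_succ_r, lt_IZR; rewrite ?succ_IZR, ?plus_IZR, ?minus_IZR; lra.
Qed.

Section Injective.
Variables (f : C -> C) (U V : C -> Prop).
Hypothesis H : box_map f U V.
Notation K := (KJ f U).

(** Monodromy. The image of a fine chain from [x] to [x'] is followed by a lattice walk in the
    hole-free set [L], and the walk is closed because [f x = f x']. Its lift follows the chain,
    while by [closed_walk_lift] it ends where it started. *)
Theorem component_injective W W' : is_component (c_interior K) W -> is_component (c_interior K) W' ->
  (forall z, W z -> W' (f z)) -> (forall z, W z -> Dv f z <> 0%C) -> forall x x', W x -> W x' -> f x = f x' -> x = x'.
Proof.
  intros HW HW' HWW HD x x' Hx Hx' Exx.
  assert (Wo := component_open _ _ (c_interior_open K) HW). assert (Wo' := component_open _ _ (c_interior_open K) HW').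
  assert (WK : subset W K) by (intros z Hz; apply (c_interior_sub K); now apply HW).
  assert (WK' : subset W' K) by (intros z Hz; apply (c_interior_sub K); now apply HW').
  assert (WU : subset W U) by (intros z Hz; apply (KJ_U f U); auto).
  assert (Hhol : hol f W) by (apply (hol_sub f U); [apply H|easy]).
  destruct (compact_bounded _ (KJ_compact f U V H)) as [M HM].
  destruct (connected_linked W x x' Wo (proj1 (proj2 (proj2 HW))) Hx Hx') as (eta0 & He0 & Dx & Hchain).
  set (N0 := deep eta0 W).
  assert (N0W : subset N0 W) by now apply deep_sub.
  assert (N0c : c_compact N0) by (apply (compact_subset K); [apply (KJ_compact f U V H)|apply deep_closed|intros z Hz; auto]).
  assert (fN0 : c_compact (image f N0)) by (apply compact_image; [easy|intros z Hz; apply (hol_ccont f W); auto]).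
  destruct (compact_uniform (image f N0) (fun y r => subset (cdisk y r) W') fN0) as [e3 [He3 De3]].
  { intros y r r' Hs Hr z Hz. apply Hs. unfold cdisk in *. lra. }
  { intros y [z [Hz <-]]. destruct (Wo' (f z) (HWW z (N0W z Hz))) as [r [Hr Sr]]. exists (r / 2). split; [lra|].
    intros y' _ Hy' v Hv. apply Sr. unfold cdisk in *. assert (T := Cmod_tri v y' (f z)). lra. }
  (* The disks of radius [e3] about [f(N0)] lie in [W']. After erosion by a third of it, [L] still
     contains everything within [2 * eta] of [f(N0)], including the lattice edges used below. *)
  set (eta := e3 / 3). set (L := deep eta W').
  assert (Heta : 0 < eta) by (unfold eta; lra).
  assert (LW : subset L W') by now apply deep_sub.
  assert (Lnear : forall z y, N0 z -> Cmod (y - f z) <= 2 * eta -> L y).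
  { intros z y Hz Hy v Hv. apply (De3 (f z)); [now exists z|]. unfold cdisk in *. assert (T := Cmod_tri v y (f z)). unfold eta in *. lra. }
  assert (Lcl : cclosed L) by apply deep_closed.
  assert (Lb : c_bounded L) by (exists M; intros z Hz; apply HM; auto).
  assert (Lfull : forall O, c_bounded O -> c_open O -> subset (c_boundary O) L -> subset O L).
  { apply deep_full. intros O HOb HO. now apply (full_interior f U V H). }
  set (NN := fun z => W z /\ L (f z)).
  assert (NNc : c_compact NN).
  { apply (compact_subset K); [apply (KJ_compact f U V H)| |intros z [Hz _]; auto].
    intros z Hz.
    assert (Kz : K z) by (apply (KJ_closed f U V H); intros e He; destruct (Hz e He) as [v [[Hv _] Hd]]; exists v; auto).
    assert (Lz : L (f z)).
    { apply Lcl. intros e He. destruct (bm_cont f U V H z (KJ_U f U z Kz) e He) as [d [Hd Kd]].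
      destruct (Hz d Hd) as [v [[_ Hv] Hdv]]. exists (f v). split; [easy|]. now apply Kd. }
    split; [|easy]. apply (preimage_component f U V H W W' z HW HW' HWW Kz); [auto|].
    intros e He. destruct (Hz e He) as [v [[Hv _] Hd]]. now exists v. }
  destruct (uniformly_invertible f W NN Wo Hhol NNc) as [r0 [Hr0 Hinv]].
  { intros z [Hz _]; easy. } { intros z [Hz _]; auto. }
  (* [3 * eps < r0] puts the uniqueness radius inside the disk of injectivity, and [delta] is the
     covering radius for a displacement of [eps / 2]. *)
  set (eps := r0 / 4). set (delta := r0 * (eps / 2)).
  assert (Heps : 0 < eps) by (unfold eps; lra).
  assert (Hdelta : 0 < delta) by (unfold delta; apply Rmult_lt_0_compat; lra).
  assert (Hlift : forall x y, W x -> L (f x) -> Cmod (y - f x) < delta -> exists x', W x' /\ Cmod (x' - x) < eps /\ f x' = y).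
  { intros z y Hz HL Hy. destruct (Hinv z (conj Hz HL)) as (I1 & I2 & I3). destruct (I3 (eps / 2) y) as [a [Ha Ea]]; [unfold eps in *; lra|unfold delta in Hy; lra|].
    exists a. split; [apply I1; unfold cdisk, eps in *; lra|]. split; [lra|easy]. }
  assert (Huniq : forall x a b, W x -> L (f x) -> W a -> W b -> Cmod (a - x) < 3 * eps -> Cmod (b - x) < 3 * eps -> f a = f b -> a = b).
  { intros z a b Hz HL _ _ Ha Hb E. destruct (Hinv z (conj Hz HL)) as (I1 & I2 & I3).
    specialize (I2 a b ltac:(unfold cdisk, eps in *; lra) ltac:(unfold cdisk, eps in *; lra)). rewrite E, Cmod_diag in I2.
    apply NNPP. intros Hn. apply Cmod_neq_pos in Hn. assert (0 < r0 * Cmod (a - b)) by now apply Rmult_lt_0_compat. lra. }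
  set (h := Rmin (delta / 8) (eta / 8)).
  assert (Hh : 0 < h) by (apply Rmin_pos; lra). assert (Hh1 : h <= delta / 8) by apply Rmin_l. assert (Hh2 : h <= eta / 8) by apply Rmin_r.
  destruct (compact_uniform N0 (fun y r => forall y', N0 y' -> Cmod (y' - y) < r -> Cmod (f y' - f y) < h) N0c) as [tau0 [Ht0 Hunif]].
  { intros y r r' Hs Hr y' Hy' Hd. apply Hs; [easy|lra]. }
  { intros z Hz. destruct (hol_ccont f W z Hhol (N0W z Hz) (h / 2)) as [d [Hd Kd]]; [lra|]. exists (d / 2). split; [lra|].
    intros y Hy Hyz y' Hy' Hd'. assert (T := Cmod_tri y' y z). assert (K1 := Kd y ltac:(lra)). assert (K2 := Kd y' ltac:(lra)).
    assert (T2 := Cmod_tri (f y') (f z) (f y)). rewrite (Cmod_sym (f z)) in T2. lra. }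
  assert (Hd2h : 2 * h < delta) by lra.
  destruct (lattice_bound h L Hh Lb) as [B HB].
  set (tau := Rmin tau0 eps). assert (Ht : 0 < tau) by now apply Rmin_pos.
  assert (Ht1 : tau <= tau0) by apply Rmin_l. assert (Ht2 : tau <= eps) by apply Rmin_r.
  set (nxt := nx f W eps). set (p := fun z => pt h (snap h (f z))).
  assert (Lf : forall z, N0 z -> L (f z)) by (intros z Hz; apply (Lnear z); [easy|rewrite Cmod_diag; lra]).
  assert (Pn : forall z, Cmod (p z - f z) <= 2 * h) by (intros z; now apply snap_near).
  assert (Lp : forall z, N0 z -> L (p z)) by (intros z Hz; apply (Lnear z); [easy|specialize (Pn z); lra]).
  (* The lifted point is kept at the preimage near [z] of the lattice point [p z] next to [f z]. The
     walk between consecutive chain points has at most two edges. *)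
  assert (Track : forall l z, N0 z -> chain N0 tau z l -> exists lw, walk h L (snap h (f z)) lw /\
     endp (snap h (f z)) lw = snap h (f (cend z l)) /\ lift h f W eps (nxt z (p z)) lw = nxt (cend z l) (p (cend z l)) /\ N0 (cend z l)).
  { induction l as [|y l IH]; intros z Hz Hc; [now exists nil|]. destruct Hc as (Hy & Hd & Hc).
    destruct (IH y Hy Hc) as (lw & W1 & W2 & W3 & W4). simpl cend.
    assert (Hfd : Cmod (f y - f z) < h) by (apply Hunif; [easy|easy|lra]).
    assert (Wz := N0W z Hz). assert (Wy := N0W y Hy). assert (Lz := Lf z Hz). assert (Ly := Lf y Hy).
    assert (Py := Pn y). assert (Pz := Pn z).
    assert (PyZ : Cmod (p y - f z) <= 3 * h) by (assert (T := Cmod_tri (p y) (f y) (f z)); lra).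
    assert (Same : nxt z (p y) = nxt y (p y)).
    { symmetry. destruct (nx_spec L f W eps delta Hlift y (p y)) as (S1 & S2 & S3); [easy|easy|lra|].
      apply (nx_unique L f W eps delta Heps Hlift Huniq z); try easy; [lra|]. assert (T := Cmod_tri (nx f W eps y (p y)) y z). unfold nxt. lra. }
    assert (Tri : nxt (nxt z (p z)) (p y) = nxt z (p y)).
    { apply (nx_triangle L f W eps delta Heps Hlift Huniq); try easy; try lra; [now apply Lp|].
      assert (T := Cmod_tri (p y) (f z) (p z)). rewrite (Cmod_sym (f z)) in T. lra. }
    destruct (nx_spec L f W eps delta Hlift z (p z)) as (Z1 & Z2 & Z3); [easy|easy|lra|]. fold nxt in Z1, Z2, Z3.
    set (u := snap h (f z)) in *. set (u' := snap h (f y)) in *.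
    assert (Ure : (fst u - 1 <= fst u' <= fst u + 1)%Z).
    { assert (X := snap_step h (Re (f y)) (Re (f z)) Hh). assert (Y : Rabs (Re (f y) - Re (f z)) < h) by (eapply Rle_lt_trans; [apply (re_le_Cmod (f y - f z))|easy]).
      specialize (X Y). unfold u, u', snap; simpl. lia. }
    assert (Uim : (snd u - 1 <= snd u' <= snd u + 1)%Z).
    { assert (X := snap_step h (Im (f y)) (Im (f z)) Hh). assert (Y : Rabs (Im (f y) - Im (f z)) < h) by (eapply Rle_lt_trans; [apply (im_le_Cmod (f y - f z))|easy]).
      specialize (X Y). unfold u, u', snap; simpl. lia. }
    set (c := (fst u', snd u)).
    assert (Pc : Cmod (pt h c - f z) <= 3 * h).
    { unfold c. eapply Rle_trans; [apply Cmod_le_ReIm|]. unfold pt, u, u', snap. simpl fst. simpl snd.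
      assert (X := snap_1d h (Re (f y)) Hh). assert (Y := snap_1d h (Im (f z)) Hh).
      assert (Z := re_le_Cmod (f y - f z)). change (Re (f y - f z)) with (Re (f y) - Re (f z)) in Z. apply Rabs_le_between in Z.
      change (Rabs (IZR (up (Re (f y) / h) - 1) * h - Re (f z)) + Rabs (IZR (up (Im (f z) / h) - 1) * h - Im (f z)) <= 3 * h).
      rewrite (Rabs_left1 (_ - Im (f z))) by lra.
      assert (Rabs (IZR (up (Re (f y) / h) - 1) * h - Re (f z)) <= 2 * h) by (apply Rabs_le; lra). lra. }
    assert (GoodSeg : forall a b, Cmod (pt h a - f z) <= 3 * h -> Cmod (pt h b - f z) <= 3 * h -> adj a b -> good h L a b).
    { intros a b Ha Hb Hadj. split; [easy|]. intros t Ht3. apply (Lnear z); [easy|]. assert (X := seg_in_ball (f z) _ _ _ t Ha Hb Ht3). lra. }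
    assert (Pu : Cmod (pt h u - f z) <= 3 * h) by (change (pt h u) with (p z); lra).
    assert (Pu' : Cmod (pt h u' - f z) <= 3 * h) by exact PyZ.
    assert (Step : exists l0, walk h L u l0 /\ endp u l0 = u' /\ lift h f W eps (nxt z (p z)) l0 = nxt z (p y)).
    { destruct (Z.eq_dec (fst u) (fst u')) as [E1|E1]; destruct (Z.eq_dec (snd u) (snd u')) as [E2|E2].
      - assert (E : u = u') by (destruct u, u'; simpl in *; now subst). exists nil. split; [easy|]. split; [exact E|]. simpl. unfold p. fold u u'. now rewrite E.
      - exists (u' :: nil). split; [|split; [easy|exact Tri]]. split; [|easy]. apply GoodSeg; try easy. unfold adj. lia.
      - exists (u' :: nil). split; [|split; [easy|exact Tri]]. split; [|easy]. apply GoodSeg; try easy. unfold adj. lia.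
      - exists (c :: u' :: nil). split; [|split; [easy|]].
        + split; [apply GoodSeg; try easy; unfold adj, c; cbn [fst snd]; lia|]. split; [|easy]. apply GoodSeg; try easy; unfold adj, c; cbn [fst snd]; lia.
        + unfold lift. simpl. rewrite <- Tri. change (pt h u') with (p y).
          apply (nx_triangle L f W eps delta Heps Hlift Huniq); try easy; rewrite ?Z3.
          * now apply Lp.
          * apply (Lnear z); [easy|lra].
          * assert (T := Cmod_tri (pt h c) (f z) (p z)). rewrite (Cmod_sym (f z)) in T. lra.
          * assert (T := Cmod_tri (p y) (f z) (pt h c)). rewrite (Cmod_sym (f z)) in T. lra.
          * assert (T := Cmod_tri (p y) (f z) (p z)). rewrite (Cmod_sym (f z)) in T. lra. }
    destruct Step as (l0 & S1 & S2 & S3). exists (l0 ++ lw). split; [|split; [|split]].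
    - rewrite walk_app, S2. easy.
    - rewrite endp_app, S2. exact W2.
    - rewrite lift_app, S3, Same. exact W3.
    - exact W4. }
  destruct (Hchain tau Ht) as [l [Hl Hle]].
  destruct (Track l x Dx Hl) as (lw & W1 & W2 & W3 & W4). rewrite Hle in W2, W3, W4. rewrite <- Exx in W2.
  destruct (nx_spec L f W eps delta Hlift x (p x)) as (Z1 & Z2 & Z3); [easy|now apply Lf|specialize (Pn x); lra|]. fold nxt in Z1, Z2, Z3.
  assert (Closed := closed_walk_lift h L Hh Lcl Lfull f W eps delta Hd2h Heps Lb Hlift Huniq B HB _ (snap h (f x)) lw (Nat.le_refl _) W1 W2 (nxt x (p x)) Z1 Z3).
  rewrite Closed in W3.
  assert (Epp : p x' = p x) by (unfold p; now rewrite Exx).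
  assert (Bk : forall z, N0 z -> nxt (nxt z (p z)) (f z) = z).
  { intros z Hz. apply (nx_back h L Hh f W eps delta Hd2h Heps Hlift Huniq); [now apply N0W|now apply Lf|now apply Lp|specialize (Pn z); lra]. }
  rewrite <- (Bk x Dx), <- (Bk x' W4), <- W3, Exx. easy.
Qed.
End Injective.

(** * The transfer operator on quadratic differentials *)

Lemma cder_csum {A} (g : A -> C -> C) l z : (forall x, In x l -> exists m, cder (g x) z m) -> exists m, cder (fun y => csum (fun x => g x y) l) z m.
Proof.
  induction l as [|a l IH]; intros H; simpl.
  - eexists. apply cder_const.
  - destruct (H a (or_introl eq_refl)) as [m1 H1]. destruct IH as [m2 H2]; [intros x Hx; apply H; now right|].
    eexists. apply (cder_plus (g a)); eassumption.
Qed.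

Lemma csum_map {A B} (f : B -> C) (g : A -> B) l : csum f (map g l) = csum (fun a => f (g a)) l.
Proof. induction l; simpl; [easy|]. now rewrite IHl. Qed.

Lemma csum_mod_le {A} (f : A -> C) l M : (forall a, In a l -> Cmod (f a) <= M) -> Cmod (csum f l) <= INR (length l) * M.
Proof.
  induction l as [|a l IH]; intros H; [simpl; rewrite Cmod_0; lra|].
  simpl csum. eapply Rle_trans; [apply Cmod_triangle|]. change (length (a :: l)) with (S (length l)). rewrite S_INR.
  assert (X := H a (or_introl eq_refl)). assert (Y := IH (fun b Hb => H b (or_intror Hb))). lra.
Qed.

(** Four half-disks cover it, and consecutive ones share a point on a diagonal. *)
Lemma punctured_connected c r : 0 < r -> c_connected (fun z => 0 < Cmod (z - c) < r).
Proof.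
  intros Hr.
  set (Q := fun b : C => fun z : C => Cmod (z - c) < r /\ 0 < Re ((z - c) * Cconj b)).
  assert (Hcx : forall b, convex (Q b)).
  { intros b x y t [X1 X2] [Y1 Y2] Ht. split; [now apply (cdisk_convex c r)|].
    set (d := Rmin (Re ((x - c) * Cconj b)) (Re ((y - c) * Cconj b))).
    assert (Hd : 0 < d) by now apply Rmin_pos.
    apply Rlt_le_trans with d; [easy|]. apply (halfplane_convex c b d); [apply Rmin_l|apply Rmin_r|easy]. }
  assert (Pt : forall u v, 0 < Rabs u + Rabs v -> exists s, 0 < s /\ Cmod ((c + RtoC s * (u, v)) - c) < r).
  { intros u v _. set (k := Cmod (u, v) + 1). assert (Hk : 0 < k) by (unfold k; assert (X := Cmod_ge_0 (u, v)); lra).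
    exists (r / k / 2). assert (0 < r / k) by now apply Rdiv_lt_0_compat. split; [lra|].
    replace (c + RtoC (r / k / 2) * (u, v) - c)%C with (RtoC (r / k / 2) * (u, v))%C by ring.
    rewrite Cmod_mult, Cmod_RtoC_pos by lra. assert (r / k * k = r) by (field; lra). assert (X := Cmod_ge_0 (u, v)). unfold k in *. nra. }
  assert (ReQ : forall s u v x y, Re ((c + RtoC s * (u, v) - c) * Cconj (x, y)) = s * (u * x + v * y)).
  { intros s u v x y. destruct c as [c1 c2]. unfold RtoC, Cconj, Cplus, Cminus, Copp, Cmult, Re; simpl. ring. }
  set (b1 := (1, 0) : C). set (b2 := (0, 1) : C). set (b3 := (-1, 0) : C). set (b4 := (0, -1) : C).
  destruct (Pt 1 1) as [s1 [S1 T1]]; [rewrite !Rabs_R1; lra|].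
  destruct (Pt (-1) 1) as [s2 [S2 T2]]; [rewrite Rabs_R1; assert (X := Rabs_pos (-1)); lra|].
  destruct (Pt (-1) (-1)) as [s3 [S3 T3]]; [rewrite Rabs_left; lra|].
  assert (C12 : c_connected (fun w => Q b1 w \/ Q b2 w)).
  { apply (connected_union_point _ _ (c + RtoC s1 * (1, 1))%C); try (now apply convex_connected).
    - split; [easy|]. unfold b1. rewrite ReQ. lra.
    - split; [easy|]. unfold b2. rewrite ReQ. lra. }
  assert (C123 : c_connected (fun w => (Q b1 w \/ Q b2 w) \/ Q b3 w)).
  { apply (connected_union_point _ _ (c + RtoC s2 * (-1, 1))%C); try (now apply convex_connected); try easy.
    - right. split; [easy|]. unfold b2. rewrite ReQ. lra.
    - split; [easy|]. unfold b3. rewrite ReQ. lra. }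
  assert (CC : c_connected (fun w => ((Q b1 w \/ Q b2 w) \/ Q b3 w) \/ Q b4 w)).
  { apply (connected_union_point _ _ (c + RtoC s3 * (-1, -1))%C); try (now apply convex_connected); try easy.
    - right. split; [easy|]. unfold b3. rewrite ReQ. lra.
    - split; [easy|]. unfold b4. rewrite ReQ. lra. }
  assert (E : forall z, 0 < Cmod (z - c) < r <-> ((Q b1 z \/ Q b2 z) \/ Q b3 z) \/ Q b4 z).
  { intros z.
    assert (R1 : Re ((z - c) * Cconj b1) = Re (z - c)) by (destruct z, c; unfold b1, Cconj, Cminus, Cplus, Copp, Cmult, Re; simpl; ring).
    assert (R2 : Re ((z - c) * Cconj b2) = Im (z - c)) by (destruct z, c; unfold b2, Cconj, Cminus, Cplus, Copp, Cmult, Re, Im; simpl; ring).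
    assert (R3 : Re ((z - c) * Cconj b3) = - Re (z - c)) by (destruct z, c; unfold b3, Cconj, Cminus, Cplus, Copp, Cmult, Re; simpl; ring).
    assert (R4 : Re ((z - c) * Cconj b4) = - Im (z - c)) by (destruct z, c; unfold b4, Cconj, Cminus, Cplus, Copp, Cmult, Re, Im; simpl; ring).
    unfold Q. rewrite R1, R2, R3, R4. split.
    - intros [H1 H2]. destruct (Rtotal_order (Re (z - c)) 0) as [?|[E0|?]]; [left; right; split; lra| |left; left; left; split; lra].
      destruct (Rtotal_order (Im (z - c)) 0) as [?|[E1|?]]; [right; split; lra| |left; left; right; split; lra].
      exfalso. assert (X := Cmod_le_ReIm (z - c)). rewrite E0, E1, Rabs_R0 in X. lra.
    - assert (X := re_le_Cmod (z - c)). assert (Y := im_le_Cmod (z - c)). apply Rabs_le_between in X. apply Rabs_le_between in Y.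
      intros [[[[? ?]|[? ?]]|[? ?]]|[? ?]]; split; lra. }
  intros O1 O2 H1 H2 Hcov Hdis. destruct (CC O1 O2 H1 H2) as [K|K].
  - intros z Hz. apply Hcov. now apply E.
  - intros z (X & Y). apply (Hdis z). split; [now apply E|easy].
  - left. intros z Hz. apply K. now apply E.
  - right. intros z Hz. apply K. now apply E.
Qed.

Lemma list_far (l : list C) c : exists d, 0 < d /\ forall x, In x l -> x <> c -> d <= Cmod (x - c).
Proof.
  destruct (list_inf (filter (fun x => if C_dec x c then false else true) l) (fun x => Cmod (x - c))) as [m [Hm Hm2]].
  - intros x Hx. apply filter_In in Hx. destruct Hx as [_ Hx]. destruct (C_dec x c); [easy|]. now apply Cmod_neq_pos.
  - exists m. split; [easy|]. intros x Hx Hn. apply Hm2. apply filter_In. split; [easy|]. now destruct (C_dec x c).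
Qed.

(** Fills in the points of [l] one at a time; the limit condition is asked only off [l], where the
    values of [F] are meaningful. *)
Lemma extend_finite (l : list C) : forall A F, c_open A -> hol F (fun z => A z /\ ~ In z l) ->
  (forall c, In c l -> A c -> forall e, 0 < e -> exists d, 0 < d /\ forall z, 0 < Cmod (z - c) < d -> ~ In z l -> Cmod ((z - c) * F z) < e) ->
  exists G, hol G A /\ forall z, ~ In z l -> G z = F z.
Proof.
  induction l as [|c l IH]; intros A F HA HF Hlim.
  - exists F. split; [|easy]. apply (hol_sub _ _ _ HF). intros z Hz. split; [easy|intros []].
  - set (A' := fun z => A z /\ z <> c).
    assert (HA' : c_open A').
    { intros z [Az Nz]. destruct (HA z Az) as [e [He Se]]. assert (P := Cmod_neq_pos z c Nz).
      exists (Rmin e (Cmod (z - c))). split; [now apply Rmin_pos|]. intros w Hw. unfold cdisk in Hw. split.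
      - apply Se. unfold cdisk. eapply Rlt_le_trans; [exact Hw|apply Rmin_l].
      - intros ->. assert (X := Rmin_r e (Cmod (z - c))). rewrite Cmod_sym in Hw. lra. }
    destruct (IH A' F HA') as [G' [HG' EG']].
    { apply (hol_sub _ _ _ HF). intros z [[Az Nz] Hl]. split; [easy|]. intros [K|K]; [now apply Nz|contradiction]. }
    { intros x Hx [Ax Nx] e He. destruct (Hlim x (or_intror Hx) Ax e He) as [d [Hd K]].
      assert (P := Cmod_neq_pos x c Nx). exists (Rmin d (Cmod (x - c))). split; [now apply Rmin_pos|]. intros z Hz Hl.
      assert (X1 := Rmin_l d (Cmod (x - c))). assert (X2 := Rmin_r d (Cmod (x - c))). apply K; [lra|]. intros [<-|K2]; [|contradiction].
      rewrite Cmod_sym in Hz. lra. }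
    destruct (classic (A c)) as [Ac|Nc].
    2:{ exists G'. split.
        - apply (hol_sub _ _ _ HG'). intros z Az. split; [easy|]. intros ->. contradiction.
        - intros z Hz. apply EG'. intros K. apply Hz. now right. }
    destruct (HA c Ac) as [R [HR SR]].
    destruct (list_far l c) as [d0 [Hd0 Hfar]].
    assert (Near : forall z, 0 < Cmod (z - c) < d0 -> ~ In z (c :: l)).
    { intros z Hz [<-|Hl]; [rewrite Cmod_diag in Hz; lra|]. assert (Nz : z <> c) by (apply Cmod_pos_neq; easy). specialize (Hfar z Hl Nz). lra. }
    destruct (removable G' c R HR) as [F1 [HF1 EF1]].
    { apply (hol_sub _ _ _ HG'). intros z [Hz Nz]. split; [now apply SR|easy]. }
    { intros e He. destruct (Hlim c (or_introl eq_refl) Ac e He) as [d [Hd K]]. exists (Rmin d d0). split; [now apply Rmin_pos|].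
      intros z Hz. assert (X1 := Rmin_l d d0). assert (X2 := Rmin_r d d0). assert (Nz := Near z ltac:(lra)).
      rewrite EG'; [apply K; [lra|easy]|]. intros K2. apply Nz. now right. }
    set (G := fun z => if C_dec z c then F1 c else G' z).
    assert (EG : forall z, z <> c -> G z = G' z) by (intros z Hz; unfold G; destruct (C_dec z c); easy).
    assert (EGF : forall z, G z = F1 z) by (intros z; unfold G; destruct (C_dec z c) as [->|Hn]; [easy|now rewrite EF1]).
    exists G. split.
    + intros z Az. destruct (C_dec z c) as [->|Hn].
      * destruct (HF1 c (cdisk_center c R HR)) as [m Hm]. exists m. apply (cder_ext F1); [intros; now rewrite EGF|easy].
      * destruct (HG' z (conj Az Hn)) as [m Hm]. exists m. apply (cder_ext_loc G'); [|easy].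
        exists (Cmod (z - c)). split; [now apply Cmod_neq_pos|]. intros w Hw. symmetry. apply EG. intros ->. rewrite Cmod_sym in Hw. lra.
    + intros z Hz. rewrite EG by (intros ->; apply Hz; now left). apply EG'. intros K. apply Hz. now right.
Qed.

Definition roots_poly (rl : list C) (z : C) : C := fold_right (fun c s => ((z - c) * s)%C) (RtoC 1) rl.

Lemma hol_roots_poly rl A : hol (roots_poly rl) A.
Proof.
  induction rl as [|c rl IH]; [apply hol_const|].
  apply (hol_mult (fun z => z - c)%C (roots_poly rl)); [|easy]. apply hol_minus; [apply hol_id|apply hol_const].
Qed.

Lemma roots_poly_app l1 l2 z : roots_poly (l1 ++ l2) z = (roots_poly l1 z * roots_poly l2 z)%C.
Proof. induction l1 as [|c l1 IH]; simpl; [ring|]. unfold roots_poly in *. rewrite IH. ring. Qed.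

Lemma roots_poly_repeat c n z : roots_poly (repeat c n) z = Cpow (z - c) n.
Proof. induction n as [|n IH]; [easy|]. simpl. unfold roots_poly in *. now rewrite IH. Qed.

Section Transfer.
Variables (f : C -> C) (U V : C -> Prop).
Hypothesis H : box_map f U V.
Notation K := (KJ f U).

Definition CV y := exists c, U c /\ Dv f c = 0%C /\ f c = y.

Lemma CV_list : exists l : list C, forall y, In y l <-> CV y.
Proof.
  destruct (crit_finite f U V H) as [l [_ Hl]]. exists (map f l). intros y. rewrite in_map_iff. split.
  - intros [c [E Hc]]. apply Hl in Hc. exists c. tauto.
  - intros [c (U1 & D1 & E)]. exists c. split; [easy|]. now apply Hl.
Qed.

Lemma CV_K y : CV y -> K y.
Proof. intros (c & Uc & Dc & <-). apply (KJ_f f U). now apply (bm_crit _ _ _ H). Qed.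

Lemma fib_exists y : V y -> ~ CV y -> exists l : list C, NoDup l /\ forall x, In x l <-> U x /\ f x = y.
Proof.
  intros Vy Hcv. apply (isolated_finite (fun x => U x /\ f x = y)); [now apply (fiber_compact f U V H)|easy|].
  intros x [Ux Ex]. destruct (U_disk f U V H x Ux) as [R [HR SR]].
  destruct (local_near_linear f x R HR) as [s [Hs NL]].
  - apply (hol_sub f U); [apply H|easy].
  - intros K0. apply Hcv. now exists x.
  - exists s. split; [lra|]. intros w [Uw Ew] Hw.
    assert (X := near_linear_expand f _ x s w x NL ltac:(lra) ltac:(rewrite Cmod_diag; lra)).
    rewrite Ew, Ex, Cmod_diag in X. apply NNPP. intros Hn. apply Cmod_neq_pos in Hn.
    assert (Hl : 0 < Cmod (Dv f x)). { apply Cmod_gt_0. intros K0. apply Hcv. now exists x. }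
    assert (0 < Cmod (Dv f x) / 2 * Cmod (w - x)) by (apply Rmult_lt_0_compat; lra). lra.
Qed.

(** For [y] in [V] that is not a critical value this lists the fibre; elsewhere nothing is claimed
    about it. *)
Definition fib y : list C := epsilon (inhabits nil) (fun l => NoDup l /\ forall x, In x l <-> U x /\ f x = y).

Lemma fib_spec y : V y -> ~ CV y -> NoDup (fib y) /\ forall x, In x (fib y) <-> U x /\ f x = y.
Proof. intros. unfold fib. apply epsilon_spec. now apply fib_exists. Qed.

(** The local inverse branch of [f] near [x]. *)
Definition sec s x y : C := epsilon (inhabits x) (fun a => Cmod (a - x) <= s /\ f a = y).

Lemma expand_not_crit c r : 0 < r -> U c -> (forall b, Cmod (b - c) < r -> r * Cmod (b - c) <= Cmod (f b - f c)) -> Dv f c <> 0%C.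
Proof.
  intros Hr Uc Hexp E. assert (D := f_cder f U V H c Uc). rewrite E in D.
  destruct (D (r / 2)) as [d [Hd Kd]]; [lra|]. set (t := Rmin d r / 2).
  assert (X1 := Rmin_l d r). assert (X2 := Rmin_r d r). assert (X3 : 0 < Rmin d r) by now apply Rmin_pos.
  set (b := (c + RtoC t)%C). assert (Eb : Cmod (b - c) = t).
  { unfold b. replace (c + RtoC t - c)%C with (RtoC t) by ring. apply Cmod_RtoC_pos. unfold t; lra. }
  specialize (Kd b ltac:(rewrite Eb; unfold t; lra)). specialize (Hexp b ltac:(rewrite Eb; unfold t; lra)).
  replace (f b - f c - 0 * (b - c))%C with (f b - f c)%C in Kd by ring. rewrite Eb in *.
  assert (0 < r * t) by (apply Rmult_lt_0_compat; unfold t; lra). lra.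
Qed.

(** Even covering off the critical values: local inverses give the sections, and properness excludes
    further preimages. *)
Lemma fiber_local y0 : V y0 -> ~ CV y0 -> exists d s, 0 < d /\ 0 < s /\
  (forall y, Cmod (y - y0) < d -> V y /\ ~ CV y /\ Permutation (fib y) (map (fun x => sec s x y) (fib y0))) /\
  forall x, In x (fib y0) -> sec s x y0 = x /\ ccont (sec s x) y0 /\
    forall y, Cmod (y - y0) < d -> U (sec s x y) /\ f (sec s x y) = y.
Proof.
  intros V0 N0. destruct (fib_spec y0 V0 N0) as [Nd Hfib].
  destruct (uniformly_invertible f U (fun x => U x /\ f x = y0)) as [r0 [Hr0 Hinv]].
  - apply H. - apply H. - now apply (fiber_compact f U V H). - intros x [Ux _]; exact Ux.
  - intros x [Ux Ex] E. apply N0. now exists x.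
  - set (s := r0 / 4).
    destruct (bm_Vopen _ _ _ H y0 V0) as [rho0 [Hrho0 Srho0]].
    set (rho := rho0 / 2).
    assert (Xc := bm_proper _ _ _ H _ (closed_ball_compact y0 rho)).
    assert (Xc1 : c_compact (fun z => U z /\ Cmod (f z - y0) <= rho)).
    { apply Xc. intros z Hz. apply Srho0. unfold cdisk, rho in *. lra. }
    (* Preimages of a neighbourhood that stay away from the fibre form a compact set, on which [f]
       keeps a distance [m] from [y0]. Closer values have all their preimages near the fibre. *)
    set (X' := fun z => (U z /\ Cmod (f z - y0) <= rho) /\ forall x, In x (fib y0) -> r0 <= Cmod (z - x)).
    assert (X'c : c_compact X').
    { apply (compact_subset _ _ Xc1); [|intros z Hz; apply Hz]. intros z Hz. split.
      - apply (compact_closed _ Xc1). intros e He. destruct (Hz e He) as [w [[Hw _] Hd]]. now exists w.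
      - intros x Hx. apply le_epsilon. intros e He. destruct (Hz e He) as [w [[_ Hw] Hd]]. specialize (Hw x Hx).
        assert (T := Cmod_tri w z x). lra. }
    assert (Hm : exists m, 0 < m /\ forall z, X' z -> m <= Cmod (f z - y0)).
    { destruct (classic (exists z, X' z)) as [Hne|Hno]; [|exists 1; split; [lra|intros z Hz; exfalso; apply Hno; now exists z]].
      destruct (compact_max X' (fun z => - Cmod (f z - y0)) X'c Hne) as [z [Hz Hmax]].
      { intros x [[Ux _] _] e He. destruct (bm_cont f U V H x Ux e He) as [d [Hd Kd]]. exists d. split; [easy|]. intros y _ Hy. specialize (Kd y Hy).
        assert (T := Cmod_tri (f x) (f y) y0). rewrite (Cmod_sym (f x) (f y)) in T. lra. }
      exists (Cmod (f z - y0)). split; [|intros y Hy; specialize (Hmax y Hy); lra].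
      apply Cmod_neq_pos. intros E. destruct Hz as [[Uz _] Hz2]. specialize (Hz2 z (proj2 (Hfib z) (conj Uz E))). rewrite Cmod_diag in Hz2. lra. }
    destruct Hm as [m [Hm Hm2]].
    set (d := Rmin (Rmin rho m) (r0 * s)).
    assert (D1 := Rmin_l (Rmin rho m) (r0 * s)). assert (D2 := Rmin_r (Rmin rho m) (r0 * s)). fold d in D1, D2.
    assert (D3 := Rmin_l rho m). assert (D4 := Rmin_r rho m).
    assert (Hs : 0 < s) by (unfold s; lra).
    assert (Hd : 0 < d) by (unfold d; repeat apply Rmin_pos; try lra; [unfold rho; lra|now apply Rmult_lt_0_compat]).
    assert (Cover : forall y a, Cmod (y - y0) < d -> U a -> f a = y -> exists x, In x (fib y0) /\ Cmod (a - x) < r0).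
    { intros y a Hy Ua Ea. apply NNPP. intros Hno. assert (Xa : X' a).
      { split; [split; [easy|rewrite Ea; lra]|]. intros x Hx. apply Rnot_lt_le. intros K0. apply Hno. now exists x. }
      specialize (Hm2 a Xa). rewrite Ea in Hm2. lra. }
    assert (Sec : forall x y, In x (fib y0) -> Cmod (y - y0) < d -> Cmod (sec s x y - x) <= s /\ f (sec s x y) = y).
    { intros x y Hx Hy. unfold sec. apply epsilon_spec. apply Hfib in Hx. destruct (Hinv x Hx) as (I1 & I2 & I3).
      apply I3; [unfold s; lra|]. rewrite (proj2 Hx). lra. }
    assert (SecU : forall x y, In x (fib y0) -> Cmod (y - y0) < d -> cdisk x r0 (sec s x y)).
    { intros x y Hx Hy. unfold cdisk. destruct (Sec x y Hx Hy). unfold s in *. lra. }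
    assert (Sep : forall x a b, In x (fib y0) -> cdisk x r0 a -> cdisk x r0 b -> f a = f b -> a = b).
    { intros x a b Hx Ha Hb E. apply Hfib in Hx. destruct (Hinv x Hx) as (I1 & I2 & I3). specialize (I2 a b Ha Hb). rewrite E, Cmod_diag in I2.
      apply NNPP. intros Hn. apply Cmod_neq_pos in Hn. assert (0 < r0 * Cmod (a - b)) by now apply Rmult_lt_0_compat. lra. }
    exists d, s. split; [easy|]. split; [easy|]. split.
    + intros y Hy. assert (Vy : V y) by (apply Srho0; unfold cdisk, rho in *; lra).
      assert (Ny : ~ CV y).
      { intros (c & Uc & Dc & Ec). destruct (Cover y c Hy Uc Ec) as [x [Hx Hxc]]. apply Hfib in Hx. destruct (Hinv x Hx) as (I1 & I2 & I3).
        apply (expand_not_crit c (Rmin r0 (r0 - Cmod (c - x)))); [apply Rmin_pos; lra|easy| |easy]. intros b Hb.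
        assert (X1 := Rmin_l r0 (r0 - Cmod (c - x))). assert (X2 := Rmin_r r0 (r0 - Cmod (c - x))).
        apply Rle_trans with (r0 * Cmod (b - c)); [apply Rmult_le_compat_r; [apply Cmod_ge_0|easy]|].
        apply I2; [|exact Hxc]. unfold cdisk. assert (T := Cmod_tri b c x). lra. }
      split; [easy|]. split; [easy|]. destruct (fib_spec y Vy Ny) as [Nd2 Hfib2]. apply NoDup_Permutation; [easy| |].
      * assert (G : forall l, NoDup l -> incl l (fib y0) -> NoDup (map (fun x => sec s x y) l)).
        { induction 1 as [|x l Hx Hl IH]; intros Hi; simpl; [constructor|]. constructor.
          - intros Hin. apply in_map_iff in Hin. destruct Hin as [x' [E Hx']].
            assert (Hx0 := Hi x (or_introl eq_refl)). assert (Hx0' := Hi x' (or_intror Hx')).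
            destruct (Sec x y Hx0 Hy) as [A1 _]. destruct (Sec x' y Hx0' Hy) as [A2 _]. rewrite E in A2.
            assert (T := Cmod_tri x' (sec s x y) x). rewrite (Cmod_sym x' (sec s x y)) in T.
            assert (Exx : x' = x).
            { apply (Sep x); [easy|unfold cdisk, s in *; lra|now apply cdisk_center|]. apply Hfib in Hx0, Hx0'. destruct Hx0 as [_ ->], Hx0' as [_ ->]. easy. }
            subst x'. contradiction.
          - apply IH. intros z Hz. apply Hi. now right. }
        apply G; [easy|apply incl_refl].
      * intros a. rewrite Hfib2, in_map_iff. split.
        -- intros [Ua Ea]. destruct (Cover y a Hy Ua Ea) as [x [Hx Hxa]]. exists x. split; [|easy]. destruct (Sec x y Hx Hy) as [_ A2].
           apply (Sep x); [easy|now apply SecU|exact Hxa|congruence].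
        -- intros [x [<- Hx]]. split; [|now apply Sec]. assert (Hx2 := proj1 (Hfib x) Hx). destruct (Hinv x Hx2) as (I1 & _). apply I1. now apply SecU.
    + intros x Hx. assert (Hx2 := proj1 (Hfib x) Hx). destruct (Hinv x Hx2) as (I1 & I2 & I3).
      assert (H00 : Cmod (y0 - y0) < d) by (rewrite Cmod_diag; easy).
      assert (E0 : sec s x y0 = x).
      { apply (Sep x); [easy|now apply SecU|now apply cdisk_center|]. destruct (Sec x y0 Hx H00) as [_ ->]. now symmetry. }
      split; [easy|]. split.
      * intros e He. exists (Rmin d (r0 * e)). split; [apply Rmin_pos; [easy|now apply Rmult_lt_0_compat]|]. intros y Hy.
        assert (X1 := Rlt_le_trans _ _ _ Hy (Rmin_l _ _)). assert (X2 := Rlt_le_trans _ _ _ Hy (Rmin_r _ _)).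
        specialize (I2 _ _ (SecU x y Hx X1) (SecU x y0 Hx H00)).
        rewrite (proj2 (Sec x y Hx X1)), (proj2 (Sec x y0 Hx H00)) in I2. apply Rmult_lt_reg_l with r0; [easy|]. lra.
      * intros y Hy. split; [apply I1; now apply SecU|now apply Sec].
Qed.

(** Applied to [q / f'^2] this is the push-forward [f_*] of the quadratic differential [q]. *)
Definition trace (Q : C -> C) (y : C) : C := csum Q (fib y).

Lemma trace_der Q y : V y -> ~ CV y -> (forall x, U x -> f x = y -> exists m, cder Q x m) -> exists m, cder (trace Q) y m.
Proof.
  intros Vy Ny HQ. destruct (fiber_local y Vy Ny) as (d & s & Hd & Hs & Hloc & Hsec).
  destruct (cder_csum (fun x w => Q (sec s x w)) (fib y) y) as [m Hm].
  - intros x Hx. destruct (Hsec x Hx) as (E0 & Hc & Hy). assert (Hx2 := proj1 (proj2 (fib_spec y Vy Ny) x) Hx). destruct Hx2 as [Ux Ex].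
    assert (Dx : Dv f x <> 0%C) by (intros E; apply Ny; now exists x).
    destruct (HQ x Ux Ex) as [m Hm]. exists (m * (1 / Dv f x))%C. apply (cder_comp Q (sec s x)).
    + apply (cder_lift f (sec s x) (fun w => w)); [easy| |apply cder_id|rewrite E0; now apply (f_cder f U V H)|easy].
      exists d. split; [easy|]. intros w Hw. now apply Hy.
    + now rewrite E0.
  - exists m. apply (cder_ext_loc (fun w => csum (fun x => Q (sec s x w)) (fib y))); [|easy]. exists d. split; [easy|]. intros w Hw.
    destruct (Hloc w Hw) as (_ & _ & Hp). unfold trace. rewrite (csum_perm Q _ _ Hp), csum_map. easy.
Qed.

Lemma CV_isolated y : exists r, 0 < r /\ forall w, 0 < Cmod (w - y) < r -> ~ CV w.
Proof.
  destruct CV_list as [l Hl]. destruct (list_far l y) as [d [Hd Hfar]]. exists d. split; [easy|]. intros w Hw Hc. apply Hl in Hc.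
  assert (Nw : w <> y) by (apply Cmod_pos_neq; easy). specialize (Hfar w Hc Nw). lra.
Qed.

(** Around a critical value the count is locally constant on a punctured disk, which is connected,
    so one reference point [y1] determines it. *)
Lemma count_bound_local y0 : V y0 -> exists r N, 0 < r /\ forall y, Cmod (y - y0) < r -> V y /\ (~ CV y -> (length (fib y) <= N)%nat).
Proof.
  intros V0. destruct (classic (CV y0)) as [Hc|Hc].
  - destruct (CV_isolated y0) as [r1 [Hr1 Hn]]. destruct (bm_Vopen _ _ _ H y0 V0) as [r2 [Hr2 S2]].
    set (r := Rmin r1 r2). assert (R1 : r <= r1) by apply Rmin_l. assert (R2 : r <= r2) by apply Rmin_r. assert (Hr : 0 < r) by now apply Rmin_pos.
    set (P := fun z => 0 < Cmod (z - y0) < r).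
    assert (PV : forall z, P z -> V z /\ ~ CV z).
    { intros z [Z1 Z2]. split; [apply S2; unfold cdisk; lra|apply Hn; lra]. }
    set (y1 := (y0 + RtoC (r / 2))%C). assert (P1 : P y1).
    { unfold P, y1. replace (y0 + RtoC (r / 2) - y0)%C with (RtoC (r / 2)) by ring. rewrite Cmod_RtoC_pos; lra. }
    exists r, (length (fib y1)). split; [easy|]. intros y Hy. split; [apply S2; unfold cdisk; lra|]. intros Ny.
    assert (Py : P y). { split; [|easy]. apply Cmod_neq_pos. intros ->. contradiction. }
    assert (Loc : forall z, P z -> exists d, 0 < d /\ forall w, Cmod (w - z) < d -> length (fib w) = length (fib z)).
    { intros z Pz. destruct (PV z Pz) as [Vz Nz]. destruct (fiber_local z Vz Nz) as (d & s & Hd & Hs & Hloc & _). exists d. split; [easy|].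
      intros w Hw. destruct (Hloc w Hw) as (_ & _ & Hp). rewrite (Permutation_length Hp), length_map. easy. }
    assert (Op : forall Q : nat -> Prop, c_open (fun z => P z /\ Q (length (fib z)))).
    { intros Q z [Pz Qz]. destruct (Loc z Pz) as [d [Hd Kd]].
      set (e := Rmin d (Rmin (Cmod (z - y0)) (r - Cmod (z - y0)))). destruct Pz as [Z1 Z2].
      assert (E1 := Rmin_l d (Rmin (Cmod (z - y0)) (r - Cmod (z - y0)))). assert (E2 := Rmin_r d (Rmin (Cmod (z - y0)) (r - Cmod (z - y0)))).
      assert (E3 := Rmin_l (Cmod (z - y0)) (r - Cmod (z - y0))). assert (E4 := Rmin_r (Cmod (z - y0)) (r - Cmod (z - y0))). fold e in E1, E2.
      exists e. split; [unfold e; repeat apply Rmin_pos; lra|]. intros w Hw. unfold cdisk in Hw. split.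
      - split; [assert (T := Cmod_tri z w y0); rewrite (Cmod_sym z w) in T; lra|assert (T := Cmod_tri w z y0); lra].
      - rewrite Kd; [easy|lra]. }
    destruct (punctured_connected y0 r Hr _ _ (Op (fun k => k = length (fib y1))) (Op (fun k => k <> length (fib y1)))) as [K0|K0].
    + intros z Pz. destruct (Nat.eq_dec (length (fib z)) (length (fib y1))); [left|right]; easy.
    + intros z (_ & [_ X] & [_ Y]). contradiction.
    + destruct (K0 y Py) as [_ E]. lia.
    + destruct (K0 y1 P1) as [_ E]. contradiction.
  - destruct (fiber_local y0 V0 Hc) as (d & s & Hd & Hs & Hloc & _). exists d, (length (fib y0)). split; [easy|]. intros y Hy.
    destruct (Hloc y Hy) as (Vy & _ & Hp). split; [easy|]. intros _. rewrite (Permutation_length Hp), length_map. easy.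
Qed.

(** The bound is sought as [/ r], so that [compact_uniform] applies. *)
Lemma count_bound : exists N, 0 <= N /\ forall y, c_closure U y -> ~ CV y -> INR (length (fib y)) <= N.
Proof.
  destruct (compact_uniform (c_closure U) (fun y r => ~ CV y -> INR (length (fib y)) * r <= 1) (bm_Ucomp _ _ _ H)) as [r [Hr Hb]].
  - intros y r r' Hy Hr Ny. eapply Rle_trans; [|apply (Hy Ny)]. apply Rmult_le_compat_l; [apply pos_INR|lra].
  - intros x Hx. destruct (count_bound_local x (bm_UV _ _ _ H x Hx)) as (r & N & Hr & Hb).
    assert (HN : 0 < INR N + 1) by (assert (X := pos_INR N); lra).
    exists (Rmin r (/ (INR N + 1))). split; [apply Rmin_pos; [easy|now apply Rinv_0_lt_compat]|]. intros y _ Hy Ny.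
    destruct (Hb y) as [_ Hl]; [eapply Rlt_le_trans; [exact Hy|apply Rmin_l]|]. specialize (Hl Ny). apply le_INR in Hl.
    apply Rle_trans with ((INR N + 1) * / (INR N + 1)); [|right; field; lra].
    apply Rmult_le_compat; [apply pos_INR| |lra|apply Rmin_r]. apply Rlt_le, Rmin_pos; [easy|now apply Rinv_0_lt_compat].
  - exists (/ r). split; [now apply Rlt_le, Rinv_0_lt_compat|]. intros y Hy Ny. specialize (Hb y Hy Ny).
    apply Rmult_le_reg_r with r; [easy|]. rewrite Rinv_l by lra. easy.
Qed.

(** A compact neighbourhood of [K] that contains all preimages of points of [U]; sup norms are taken
    on it. *)
Definition C1 := fun z => U z /\ c_closure U (f z).

Lemma C1_compact : c_compact C1.
Proof. apply (Ck_compact f U V H 1). Qed.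

Lemma K_C1 : subset K C1.
Proof. exact (KJ_Ck f U 1). Qed.

Lemma C1_bounded_fun q : (forall z, C1 z -> ccont q z) -> exists B, 0 < B /\ forall z, C1 z -> Cmod (q z) <= B.
Proof.
  intros Hq. destruct (compact_bounded _ (compact_image C1 q C1_compact Hq)) as [B HB]. exists (Rmax B 1).
  split; [eapply Rlt_le_trans; [|apply Rmax_r]; lra|]. intros z Hz. eapply Rle_trans; [apply HB; now exists z|apply Rmax_l].
Qed.

(* Multiplication by the polynomial with these roots cancels the poles of [1/f'^2]. *)
Lemma denominators : exists rl B, 0 < B /\ (forall c, In c rl -> U c /\ Dv f c = 0%C) /\
  forall z, C1 z -> Dv f z <> 0%C -> Cmod (roots_poly rl z) <= B * (Cmod (Dv f z) * Cmod (Dv f z)).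
Proof.
  destruct (crit_finite f U V H) as [cl [_ Hcl]].
  assert (HD : hol (Dv f) U) by (apply hol_Dv; apply H).
  assert (Ord : forall c, U c -> exists (n : nat) s k, 0 < s /\ 0 < k /\ forall z, Cmod (z - c) < s -> Cmod (z - c) ^ n * k <= Cmod (Dv f z)).
  { intros c Uc. destruct (U_disk f U V H c Uc) as [R [HR SR]].
    destruct (isolated_zeros (Dv f) c R HR) as [Hz|(n & G & HG & HG0 & E)].
    - now apply (hol_sub _ U).
    - exfalso. destruct (crit_isolated f U V H c Uc) as [s [Hs Hs2]]. set (t := Rmin R s / 2).
      assert (X1 := Rmin_l R s). assert (X2 := Rmin_r R s). assert (X3 : 0 < Rmin R s) by now apply Rmin_pos.
      assert (Et : Cmod (c + RtoC t - c) = t) by (replace (c + RtoC t - c)%C with (RtoC t) by ring; apply Cmod_RtoC_pos; unfold t; lra).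
      apply (Hs2 (c + RtoC t)%C); [rewrite Et; unfold t; lra|]. apply Hz. unfold cdisk. rewrite Et. unfold t; lra.
    - assert (Hp := proj1 (Cmod_gt_0 _) HG0).
      destruct (hol_ccont G _ c HG (cdisk_center c R HR) (Cmod (G c) / 2)) as [d [Hd Kd]]; [lra|].
      exists n, d, (Cmod (G c) / 2). split; [easy|]. split; [lra|]. intros z Hz. rewrite E, Cmod_mult, Cmod_pow.
      apply Rmult_le_compat_l; [apply pow_le, Cmod_ge_0|]. specialize (Kd z Hz). assert (T := Cmod_ge_sub (G c) (G z)). rewrite Cmod_sym in T. lra. }
  assert (Build : forall l, (forall c, In c l -> In c cl) -> exists rl, (forall c, In c rl -> In c cl) /\
     forall c, In c l -> exists s B, 0 < s /\ 0 < B /\ forall z, Cmod (z - c) < s -> Cmod (roots_poly rl z) <= B * (Cmod (Dv f z) * Cmod (Dv f z))).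
  { induction l as [|c l IH]; intros Hl.
    - exists nil. split; [easy|]. intros c [].
    - destruct IH as [rl [I1 I2]]; [intros x Hx; apply Hl; now right|].
      assert (Hc : In c cl) by (apply Hl; now left).
      destruct (Ord c) as (n & s & k & Hs & Hk & Hord); [now apply Hcl|].
      (* [f'] vanishes at [c] to order at most [n], so a factor of multiplicity [2 * n] is dominated
         by [|f'|^2]. *)
      exists (repeat c (n + n) ++ rl). split.
      + intros x Hx. apply in_app_iff in Hx. destruct Hx as [Hx|Hx]; [|auto]. apply repeat_spec in Hx. now subst.
      + intros x [<-|Hx].
        * destruct (ccont_mod (roots_poly rl) c (hol_ccont _ (fun _ => True) c (hol_roots_poly rl _) I) 1 Rlt_0_1) as [d [Hd Kd]].
          assert (Hpc := Cmod_ge_0 (roots_poly rl c)).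
          exists (Rmin s d), ((Cmod (roots_poly rl c) + 1) / (k * k)). split; [now apply Rmin_pos|].
          assert (Hkk : 0 < k * k) by now apply Rmult_lt_0_compat.
          split; [apply Rdiv_lt_0_compat; lra|]. intros z Hz.
          specialize (Hord z (Rlt_le_trans _ _ _ Hz (Rmin_l _ _))). specialize (Kd z (Rlt_le_trans _ _ _ Hz (Rmin_r _ _))).
          rewrite roots_poly_app, roots_poly_repeat, Cmod_mult, Cmod_pow, pow_add.
          set (q := Cmod (z - c) ^ n) in *. assert (Hq : 0 <= q) by apply pow_le, Cmod_ge_0.
          apply Rle_trans with (q * q * (Cmod (roots_poly rl c) + 1)); [apply Rmult_le_compat_l; [nra|lra]|].
          replace (q * q * (Cmod (roots_poly rl c) + 1)) with ((Cmod (roots_poly rl c) + 1) / (k * k) * ((q * k) * (q * k))) by (field; lra).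
          apply Rmult_le_compat_l; [apply Rlt_le, Rdiv_lt_0_compat; lra|]. assert (0 <= q * k) by (apply Rmult_le_pos; lra). apply Rmult_le_compat; lra.
        * destruct (I2 x Hx) as (s' & B & Hs' & HB & Hb).
          destruct (ccont_mod (roots_poly (repeat c (n + n))) x (hol_ccont _ (fun _ => True) x (hol_roots_poly _ _) I) 1 Rlt_0_1) as [d [Hd Kd]].
          assert (Hpc := Cmod_ge_0 (roots_poly (repeat c (n + n)) x)).
          exists (Rmin s' d), ((Cmod (roots_poly (repeat c (n + n)) x) + 1) * B). split; [now apply Rmin_pos|]. split; [apply Rmult_lt_0_compat; lra|]. intros z Hz.
          specialize (Hb z (Rlt_le_trans _ _ _ Hz (Rmin_l _ _))). specialize (Kd z (Rlt_le_trans _ _ _ Hz (Rmin_r _ _))).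
          rewrite roots_poly_app, Cmod_mult, Rmult_assoc. apply Rmult_le_compat; try apply Cmod_ge_0; lra. }
  destruct (Build cl (fun c Hc => Hc)) as [rl [R1 R2]].
  destruct (compact_uniform C1 (fun z r => Dv f z <> 0%C -> Cmod (roots_poly rl z) * r <= Cmod (Dv f z) * Cmod (Dv f z)) C1_compact) as [r [Hr Hb]].
  - intros z r r' Hz Hr Hn. eapply Rle_trans; [|apply (Hz Hn)]. apply Rmult_le_compat_l; [apply Cmod_ge_0|lra].
  - intros x [Ux _]. destruct (classic (Dv f x = 0%C)) as [E|E].
    + destruct (R2 x) as (s & B & Hs & HB & Hbb); [now apply Hcl|]. exists (Rmin s (/ B)). split; [apply Rmin_pos; [easy|now apply Rinv_0_lt_compat]|].
      intros y _ Hy _. specialize (Hbb y (Rlt_le_trans _ _ _ Hy (Rmin_l _ _))).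
      apply Rle_trans with (Cmod (roots_poly rl y) * / B); [apply Rmult_le_compat_l; [apply Cmod_ge_0|apply Rmin_r]|].
      apply Rmult_le_reg_r with B; [easy|]. rewrite Rmult_assoc, Rinv_l by lra. lra.
    + assert (Hp := proj1 (Cmod_gt_0 _) E).
      destruct (hol_ccont _ _ x HD Ux (Cmod (Dv f x) / 2)) as [d1 [Hd1 K1]]; [lra|].
      destruct (ccont_mod (roots_poly rl) x (hol_ccont _ (fun _ => True) x (hol_roots_poly rl _) I) 1 Rlt_0_1) as [d2 [Hd2 K2]].
      assert (Hpc := Cmod_ge_0 (roots_poly rl x)).
      set (r := Cmod (Dv f x) / 2 * (Cmod (Dv f x) / 2) / (Cmod (roots_poly rl x) + 1)).
      assert (Hr : 0 < r) by (apply Rdiv_lt_0_compat; [apply Rmult_lt_0_compat; lra|lra]).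
      exists (Rmin r (Rmin d1 d2)). split; [repeat apply Rmin_pos; easy|]. intros y _ Hy _.
      assert (A1 := Rmin_l r (Rmin d1 d2)). assert (A2 := Rmin_r r (Rmin d1 d2)). assert (A3 := Rmin_l d1 d2). assert (A4 := Rmin_r d1 d2).
      specialize (K1 y ltac:(lra)). specialize (K2 y ltac:(lra)).
      apply Rle_trans with ((Cmod (roots_poly rl x) + 1) * r).
      * apply Rmult_le_compat; [apply Cmod_ge_0| |lra|easy]. apply Rlt_le. repeat apply Rmin_pos; easy.
      * unfold r. replace ((Cmod (roots_poly rl x) + 1) * (Cmod (Dv f x) / 2 * (Cmod (Dv f x) / 2) / (Cmod (roots_poly rl x) + 1))) with (Cmod (Dv f x) / 2 * (Cmod (Dv f x) / 2)) by (field; lra).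
        assert (T := Cmod_ge_sub (Dv f x) (Dv f y)). rewrite Cmod_sym in T. apply Rmult_le_compat; lra.
  - exists rl, (/ r). split; [now apply Rinv_0_lt_compat|]. split; [intros c Hc; apply Hcl; auto|]. intros z Hz Hn.
    specialize (Hb z Hz Hn). apply Rmult_le_reg_l with r; [easy|]. rewrite <- Rmult_assoc, Rinv_r by lra. lra.
Qed.

(** Division with remainder by the polynomial with roots [rl]. The Newton basis of the remainder is
    independent of [q], so that [m] kills all remainders is a finite set of conditions. *)
Lemma newton_division rl q B : c_open B -> (forall c, In c rl -> B c) -> hol q B ->
  exists q' (k : nat -> C), hol q' B /\ forall z, q z = (csum (fun i => k i * roots_poly (firstn i rl) z) (seq 0 (length rl)) + roots_poly rl z * q' z)%C.
Proof.
  intros HB. revert q. induction rl as [|c rl IH]; intros q Hrl Hq.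
  - exists q, (fun _ => RtoC 0). split; [easy|]. intros z. simpl. ring.
  - destruct (IH (dq q (Dv q c) c)) as (q' & k & Hq' & E); [intros x Hx; apply Hrl; now right|apply hol_dq; try easy; apply Hrl; now left|].
    exists q', (fun i => match i with O => q c | S i => k i end). split; [easy|]. intros z.
    rewrite (dq_mult q (Dv q c) c z), (E z). simpl length. simpl seq. rewrite <- seq_shift. cbn [csum]. rewrite csum_map.
    simpl roots_poly. rewrite Cmult_plus_distr_l, <- csum_scal.
    rewrite (csum_ext (fun a => (z - c) * (k a * roots_poly (firstn a rl) z))%C (fun a => k a * ((z - c) * roots_poly (firstn a rl) z))%C) by (intros; ring).
    unfold roots_poly. simpl. ring.
Qed.

(** At distance at least [s] from the root the quotient is bounded directly, nearer by the maximum
    principle; [D] does not depend on [q]. *)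
Lemma newton_division_bound rl : (forall c, In c rl -> K c) -> exists D, 0 < D /\ forall q M, hol q U -> (forall z, C1 z -> Cmod (q z) <= M) ->
  exists q' (k : nat -> C), hol q' U /\ (forall z, C1 z -> Cmod (q' z) <= D * M) /\
   forall z, q z = (csum (fun i => k i * roots_poly (firstn i rl) z) (seq 0 (length rl)) + roots_poly rl z * q' z)%C.
Proof.
  induction rl as [|c rl IH]; intros Hrl.
  - exists 1. split; [lra|]. intros q M Hq HM. exists q, (fun _ => RtoC 0). split; [easy|]. split; [intros z Hz; rewrite Rmult_1_l; auto|]. intros z. simpl. ring.
  - destruct IH as (D & HD & IH); [intros x Hx; apply Hrl; now right|].
    assert (Kc : K c) by (apply Hrl; now left). assert (Uc := KJ_U f U c Kc).
    assert (Hs : exists s, 0 < s /\ forall z, Cmod (z - c) <= s -> C1 z).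
    { destruct (U_disk f U V H c Uc) as [r1 [Hr1 S1]]. destruct (U_disk f U V H (f c)) as [r2 [Hr2 S2]]; [apply (KJ_U f U), (KJ_f f U), Kc|].
      destruct (bm_cont f U V H c Uc r2 Hr2) as [d [Hd Kd]]. assert (X1 := Rmin_l d r1). assert (X2 := Rmin_r d r1). assert (X3 : 0 < Rmin d r1) by now apply Rmin_pos.
      exists (Rmin d r1 / 2). split; [lra|]. intros z Hz. split; [apply S1; unfold cdisk; lra|]. apply subset_closure, S2, Kd. lra. }
    destruct Hs as [s [Hs Hsub]]. exists (D * (2 / s)). split; [apply Rmult_lt_0_compat; [easy|apply Rdiv_lt_0_compat; lra]|].
    intros q M Hq HM. set (q1 := dq q (Dv q c) c).
    assert (Hq1 : hol q1 U) by (apply hol_dq; try easy; apply H).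
    assert (Out : forall z, C1 z -> s <= Cmod (z - c) -> Cmod (q1 z) <= 2 / s * M).
    { intros z Hz Hzc. assert (Hn : z <> c) by (apply Cmod_pos_neq; lra). unfold q1. rewrite dq_neq, Cmod_div by (easy || now apply sub_neq_0).
      assert (T := Cmod_sub_le (q z) (q c)). assert (A1 := HM z Hz). assert (A2 := HM c (Hsub c ltac:(rewrite Cmod_diag; lra))).
      apply Rmult_le_reg_r with (Cmod (z - c)); [lra|]. unfold Rdiv at 1. rewrite Rmult_assoc, Rinv_l, Rmult_1_r by lra.
      apply Rle_trans with (2 * M); [lra|]. replace (2 * M) with (2 / s * M * s) by (field; lra).
      apply Rmult_le_compat_l; [|easy]. apply Rmult_le_pos; [apply Rlt_le, Rdiv_lt_0_compat; lra|]. eapply Rle_trans; [apply Cmod_ge_0|exact A1]. }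
    assert (All : forall z, C1 z -> Cmod (q1 z) <= 2 / s * M).
    { intros z Hz. destruct (Rle_dec s (Cmod (z - c))); [now apply Out|].
      apply (max_modulus_disk q1 c s); [easy| | |lra].
      - apply (hol_sub q1 U); [easy|]. intros w Hw. now apply Hsub.
      - intros w Hw. apply Out; [apply Hsub|]; lra. }
    destruct (IH q1 (2 / s * M) Hq1 All) as (q' & k & Hq' & Bq' & E).
    exists q', (fun i => match i with O => q c | S i => k i end). split; [easy|]. split; [intros z Hz; rewrite Rmult_assoc; auto|]. intros z.
    rewrite (dq_mult q (Dv q c) c z). fold q1. rewrite (E z). simpl length. simpl seq. rewrite <- seq_shift. cbn [csum]. rewrite csum_map.
    simpl roots_poly. rewrite Cmult_plus_distr_l, <- csum_scal.
    rewrite (csum_ext (fun a => (z - c) * (k a * roots_poly (firstn a rl) z))%C (fun a => k a * ((z - c) * roots_poly (firstn a rl) z))%C) by (intros; ring).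
    unfold roots_poly. simpl. ring.
Qed.

Section Weight.
Variables (rl : list C) (Bphi : R).
Hypothesis HBphi : 0 < Bphi.
Hypothesis Hrl : forall z, C1 z -> Dv f z <> 0%C -> Cmod (roots_poly rl z) <= Bphi * (Cmod (Dv f z) * Cmod (Dv f z)).

(** The factor [roots_poly rl] offsets the poles of [1 / f'^2], so the trace stays bounded near the
    critical values. *)
Definition weighted (q : C -> C) (x : C) : C := (roots_poly rl x * q x / (Dv f x * Dv f x))%C.

Lemma weighted_bound q x M : C1 x -> Dv f x <> 0%C -> Cmod (q x) <= M -> Cmod (weighted q x) <= Bphi * M.
Proof.
  intros Cx Dx Hq. unfold weighted. assert (Hp := proj1 (Cmod_gt_0 _) Dx).
  assert (HH := Hrl x Cx Dx). rewrite Cmod_div by now apply Cmult_neq_0. rewrite !Cmod_mult.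
  assert (Hpp : 0 < Cmod (Dv f x) * Cmod (Dv f x)) by now apply Rmult_lt_0_compat.
  apply Rmult_le_reg_r with (Cmod (Dv f x) * Cmod (Dv f x)); [easy|]. unfold Rdiv. rewrite Rmult_assoc, Rinv_l, Rmult_1_r by lra.
  replace (Bphi * M * (Cmod (Dv f x) * Cmod (Dv f x))) with (Bphi * (Cmod (Dv f x) * Cmod (Dv f x)) * M) by ring.
  apply Rmult_le_compat; try apply Cmod_ge_0; easy.
Qed.

Lemma trace_bound q y M N : 0 <= M -> c_closure U y -> ~ CV y -> INR (length (fib y)) <= N ->
  (forall x, U x -> f x = y -> Cmod (q x) <= M) -> Cmod (trace (weighted q) y) <= N * (Bphi * M).
Proof.
  intros HM Hy Ny HN Hq. assert (Vy := bm_UV _ _ _ H y Hy).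
  eapply Rle_trans; [apply (csum_mod_le _ _ (Bphi * M))|].
  - intros x Hx. apply (fib_spec y Vy Ny) in Hx. destruct Hx as [Ux Ex]. apply weighted_bound; [|intros E; apply Ny; now exists x|now apply Hq].
    split; [easy|]. now rewrite Ex.
  - apply Rmult_le_compat_r; [apply Rmult_le_pos; lra|easy].
Qed.

(** The trace is holomorphic off the critical values and bounded near them, so these are removable.
    A small [A] gives the version for differentials defined only near [K]. *)
Lemma transfer_step A q : c_open A -> subset A V -> hol q (fun z => U z /\ A (f z)) ->
  exists G, hol G A /\ forall y, A y -> ~ CV y -> G y = trace (weighted q) y.
Proof.
  intros HA HAV Hq. destruct CV_list as [l Hl].
  assert (HD : hol (Dv f) U) by (apply hol_Dv; apply H).
  destruct (extend_finite l A (trace (weighted q)) HA) as [G [HG EG]].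
  - intros y [Ay Ny]. apply trace_der; [auto|intros Hc; apply Ny; now apply Hl|]. intros x Ux Ex.
    assert (Dx : Dv f x <> 0%C) by (intros E; apply Ny, Hl; now exists x).
    destruct (hol_roots_poly rl (fun _ => True) x I) as [m1 H1]. destruct (Hq x) as [m2 H2]; [rewrite Ex; easy|]. destruct (HD x Ux) as [m3 H3].
    eexists. apply (cder_mult (fun x => roots_poly rl x * q x)%C (fun x => / (Dv f x * Dv f x))%C); [apply cder_mult; eassumption|].
    apply (cder_inv (fun x => Dv f x * Dv f x)%C); [apply cder_mult; eassumption|now apply Cmult_neq_0].
  - intros c Hc Ac e He. assert (Kc : K c) by (apply CV_K, Hl, Hc).
    destruct (count_bound_local c (HAV c Ac)) as (r1 & N & Hr1 & HN). destruct (HA c Ac) as [r2 [Hr2 S2]].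
    destruct (U_disk f U V H c (KJ_U f U c Kc)) as [r3 [Hr3 S3]].
    set (r := Rmin r1 (Rmin r2 r3) / 2). assert (A1 := Rmin_l r1 (Rmin r2 r3)). assert (A2 := Rmin_r r1 (Rmin r2 r3)).
    assert (A3 := Rmin_l r2 r3). assert (A4 := Rmin_r r2 r3). assert (Hr : 0 < r) by (unfold r; assert (0 < Rmin r1 (Rmin r2 r3)) by (repeat apply Rmin_pos; easy); lra).
    assert (Xc : c_compact (fun z => U z /\ Cmod (f z - c) <= r)).
    { apply (bm_proper _ _ _ H _ (closed_ball_compact c r)). intros z Hz. apply HAV, S2. unfold cdisk, r in *. lra. }
    assert (Qc : forall z, U z /\ Cmod (f z - c) <= r -> ccont q z).
    { intros z [Uz Hz]. apply (hol_ccont q _ z Hq). split; [easy|]. apply S2. unfold cdisk, r in *. lra. }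
    destruct (compact_bounded _ (compact_image _ q Xc Qc)) as [M HM].
    set (M' := Rmax M 0). assert (HM' : 0 <= M') by apply Rmax_r.
    set (B := INR N * (Bphi * M')). assert (HB : 0 <= B) by (unfold B; repeat apply Rmult_le_pos; try lra; apply pos_INR).
    exists (Rmin r (e / (B + 1))). split; [apply Rmin_pos; [easy|apply Rdiv_lt_0_compat; lra]|]. intros z Hz Nz.
    assert (Z1 := Rlt_le_trans _ _ _ (proj2 Hz) (Rmin_l _ _)). assert (Z2 := Rlt_le_trans _ _ _ (proj2 Hz) (Rmin_r _ _)).
    assert (Ncv : ~ CV z) by (intros K0; now apply Nz, Hl).
    assert (Bd : Cmod (trace (weighted q) z) <= B).
    { apply trace_bound; [easy|apply subset_closure, S3; unfold cdisk, r in *; lra|easy| |].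
      - apply le_INR. apply (HN z); [unfold r in *; lra|easy].
      - intros x Ux Ex. eapply Rle_trans; [|apply Rmax_l]. apply HM. exists x. split; [|easy]. split; [easy|]. rewrite Ex. lra. }
    rewrite Cmod_mult. apply Rle_lt_trans with (Cmod (z - c) * B); [apply Rmult_le_compat_l; [lra|easy]|].
    apply Rle_lt_trans with (Cmod (z - c) * (B + 1)); [apply Rmult_le_compat_l; lra|].
    apply Rlt_le_trans with (e / (B + 1) * (B + 1)); [apply Rmult_lt_compat_r; lra|right; field; lra].
  - exists G. split; [easy|]. intros y _ Ny. apply EG. intros K0. apply Ny. now apply Hl.
Qed.

(** Critical values are isolated, so the bound passes to them by continuity. *)
Lemma bound_at_CV G M y : U y -> ccont G y -> (forall w, U w -> ~ CV w -> Cmod (G w) <= M) -> Cmod (G y) <= M.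
Proof.
  intros Uy Hc HM. apply le_epsilon. intros e He. destruct (Hc e He) as [d [Hd Kd]]. destruct (U_disk f U V H y Uy) as [r [Hr Sr]].
  destruct (CV_isolated y) as [r2 [Hr2 Hn]]. set (t := Rmin d (Rmin r r2) / 2).
  assert (A1 := Rmin_l d (Rmin r r2)). assert (A2 := Rmin_r d (Rmin r r2)). assert (A3 := Rmin_l r r2). assert (A4 := Rmin_r r r2).
  assert (Ht : 0 < Rmin d (Rmin r r2)) by (repeat apply Rmin_pos; easy).
  set (w := (y + RtoC t)%C). assert (Ew : Cmod (w - y) = t).
  { unfold w. replace (y + RtoC t - y)%C with (RtoC t) by ring. apply Cmod_RtoC_pos. unfold t; lra. }
  specialize (Kd w ltac:(rewrite Ew; unfold t; lra)). specialize (HM w ltac:(apply Sr; unfold cdisk; rewrite Ew; unfold t; lra) ltac:(apply Hn; rewrite Ew; unfold t; lra)).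
  assert (T := Cmod_ge_sub (G y) (G w)). rewrite Cmod_sym in T. lra.
Qed.
End Weight.

(** Open sets shrinking to [K]. [Un 1] is [U], and [transfer_step] leads from [Un (S n)] back to
    [Un n]. *)
Fixpoint Un (n : nat) : C -> Prop := match n with O => V | S n => fun z => U z /\ Un n (f z) end.

Lemma Un_open n : c_open (Un n) /\ subset (Un n) V.
Proof.
  induction n as [|n [I1 I2]]; simpl; [split; [apply H|easy]|]. split.
  - intros z [Uz Hz]. destruct (I1 _ Hz) as [e [He Se]]. destruct (bm_cont f U V H z Uz e He) as [d [Hd Kd]].
    destruct (U_disk f U V H z Uz) as [r [Hr Sr]]. exists (Rmin d r). split; [now apply Rmin_pos|]. intros w Hw. unfold cdisk in Hw. split.
    + apply Sr. unfold cdisk. eapply Rlt_le_trans; [exact Hw|apply Rmin_r].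
    + apply Se, Kd. eapply Rlt_le_trans; [exact Hw|apply Rmin_l].
  - intros z [Uz _]. now apply (V_of_U f U V H).
Qed.

Lemma K_Un n : subset K (Un n).
Proof.
  induction n as [|n IH]; intros z Kz; simpl; [now apply (V_of_U f U V H), (KJ_U f U)|].
  split; [now apply (KJ_U f U)|]. now apply IH, (KJ_f f U).
Qed.

Lemma not_K_Un a : ~ K a -> exists n, ~ Un (S n) a.
Proof.
  intros Na. apply NNPP. intros Hno. apply Na.
  assert (Ha : forall n, Un (S n) a) by (intros n; apply NNPP; intros K0; apply Hno; now exists n).
  split; [apply (Ha 0%nat)|]. intros n. specialize (Ha n). clear Hno Na. revert a Ha. induction n as [|n IH]; intros a Ha; [apply Ha|].
  rewrite iter_succ. apply IH. apply Ha.
Qed.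

Definition Bd (q : C -> C) := exists B, 0 <= B /\ forall z, K z -> Cmod (q z) <= B.

Lemma hol_Bd q A : subset K A -> hol q A -> Bd q.
Proof.
  intros HS Hq. destruct (compact_bounded _ (compact_image K q (KJ_compact f U V H) (fun z Hz => hol_ccont q A z Hq (HS z Hz)))) as [B HB].
  exists (Rmax B 0). split; [apply Rmax_r|]. intros z Hz. eapply Rle_trans; [apply HB; now exists z|apply Rmax_l].
Qed.

(* [m] is integration of quadratic differentials against an [f]-invariant Beltrami differential carried by [X];
   the last clause is its invariance [m (Q) = m (f_* Q)]. *)
Record invariant_functional (m : (C -> C) -> C) (X : C -> Prop) (mu : R) : Prop := {
  if_carrier : forall z, X z -> K z /\ ~ CV z;
  if_ext : forall q q', (forall z, X z -> q z = q' z) -> m q = m q';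
  if_plus : forall q q', Bd q -> Bd q' -> m (fun z => q z + q' z)%C = (m q + m q')%C;
  if_scal : forall k q, Bd q -> m (fun z => k * q z)%C = (k * m q)%C;
  if_bound : forall q B, (forall z, K z -> Cmod (q z) <= B) -> Cmod (m q) <= mu * B;
  if_push : forall Q G, Bd Q -> Bd G -> (forall y, X y -> G y = trace (fun x => Q x / (Dv f x * Dv f x))%C y) -> m Q = m G
}.

Lemma if_sum m X mu (Hm : invariant_functional m X mu) (k : nat -> C) (q : nat -> C -> C) l : (forall i, In i l -> Bd (q i)) -> (forall i, In i l -> m (q i) = 0%C) ->
  Bd (fun z => csum (fun i => k i * q i z)%C l) /\ m (fun z => csum (fun i => k i * q i z)%C l) = 0%C.
Proof.
  induction l as [|i l IH]; intros HB H0; simpl.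
  - assert (B0 : Bd (fun _ => RtoC 0)) by (exists 0; split; [lra|intros; rewrite Cmod_0; lra]). split; [easy|].
    rewrite (if_ext _ _ _ Hm _ (fun z => 0 * 0)%C) by (intros; ring). rewrite (if_scal _ _ _ Hm 0%C (fun _ => 0%C) B0). ring.
  - destruct IH as [I1 I2]; [intros j Hj; apply HB; now right|intros j Hj; apply H0; now right|].
    assert (Bi := HB i (or_introl eq_refl)). assert (Bk : Bd (fun z => k i * q i z)%C).
    { destruct Bi as [B [HB0 HB1]]. exists (Cmod (k i) * B). split; [apply Rmult_le_pos; [apply Cmod_ge_0|easy]|]. intros z Hz. rewrite Cmod_mult. apply Rmult_le_compat_l; [apply Cmod_ge_0|auto]. }
    split.
    + destruct I1 as [B1 [X1 Y1]]. destruct Bk as [B2 [X2 Y2]]. exists (B2 + B1). split; [lra|]. intros z Hz. eapply Rle_trans; [apply Cmod_triangle|]. specialize (Y1 z Hz). specialize (Y2 z Hz). lra.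
    + rewrite (if_plus _ _ _ Hm (fun z => k i * q i z)%C (fun z => csum (fun i => k i * q i z)%C l) Bk I1), I2, (if_scal _ _ _ Hm _ _ Bi), (H0 i (or_introl eq_refl)). ring.
Qed.

(** [Test] holds the Newton basis, which disposes of remainders, and a finite net of a precompact
    family containing the push-forwards of the unit ball. Both are chosen before [m]. *)
Theorem transfer_kill : exists Test : list (C -> C), (forall t, In t Test -> Bd t) /\
  forall m X mu, 0 <= mu -> invariant_functional m X mu -> (forall t, In t Test -> m t = 0%C) ->
  forall a, ~ K a -> m (fun z => / (z - a))%C = 0%C.
Proof.
  destruct denominators as (rl & Bphi & HBphi & Hcrit & Hrl).
  assert (rlK : forall c, In c rl -> K c) by (intros c Hc; destruct (Hcrit c Hc); now apply (bm_crit _ _ _ H)).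
  destruct (newton_division_bound rl rlK) as (D & HD & Hdiv).
  destruct count_bound as (N & HN0 & HN).
  destruct (compact_uniform C1 (fun z r => subset (cdisk z r) U) C1_compact) as [rho [Hrho Srho]].
  { intros y r r' Hs Hr z Hz. apply Hs. unfold cdisk in *. lra. }
  { intros x [Ux _]. destruct (U_disk f U V H x Ux) as [r [Hr Sr]]. exists (r / 2). split; [lra|]. intros y _ Hy w Hw. apply Sr. unfold cdisk in *. assert (T := Cmod_tri w y x). lra. }
  set (C2 := N * (Bphi * D)). assert (HC2 : 0 <= C2) by (unfold C2; repeat apply Rmult_le_pos; lra).
  (* [Fam] contains the image of the unit ball under the transfer operator, and is precompact on [C1]. *)
  set (Fam := fun G : C -> C => hol G V /\ (forall z, U z -> Cmod (G z) <= C2)).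
  (* Members of [Fam] vary by at most [4 * C2 / rho * d], hence by at most [/ 8], over distance [d]
     from a point of [C1]. Together with the error [/ 8] at the points [xs] this stays below
     [/ 2]. *)
  set (d := Rmin (rho / 2) (rho / (32 * (C2 + 1)))).
  assert (Hd : 0 < d) by (apply Rmin_pos; [lra|apply Rdiv_lt_0_compat; lra]).
  assert (Hd1 : d <= rho / 2) by apply Rmin_l. assert (Hd2 : d <= rho / (32 * (C2 + 1))) by apply Rmin_r.
  destruct (finite_cover_disks C1 d C1_compact Hd) as [xs [Xs1 Xs2]].
  destruct (function_net xs C2 (/ 8)) with (Fam := Fam) as [Fs [Fs1 Fs2]]; [lra|intros F x [_ HF] Hx; apply HF; now apply Xs1|].
  assert (Net : forall G, Fam G -> exists G', In G' Fs /\ forall z, C1 z -> Cmod (G z - G' z) <= / 2).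
  { intros G HG. destruct (Fs2 G HG) as [G' [HG' Hclose]]. exists G'. split; [easy|]. intros z Hz.
    destruct (Xs2 z Hz) as [x [Hx Hzx]]. assert (Cx := Xs1 x Hx).
    assert (Lip : forall F, Fam F -> Cmod (F z - F x) <= / 8).
    { intros F [F1 F2]. eapply Rle_trans; [apply (hol_lipschitz F x rho C2); [easy| | |lra]|].
      - apply (hol_sub F V); [easy|]. intros w Hw. apply (V_of_U f U V H). now apply (Srho x).
      - intros w Hw. apply F2. now apply (Srho x).
      - apply Rle_trans with (4 * C2 / rho * (rho / (32 * (C2 + 1)))).
        + apply Rmult_le_compat_l; [|lra]. apply Rmult_le_pos; [lra|now apply Rlt_le, Rinv_0_lt_compat].
        + apply Rmult_le_reg_r with (32 * (C2 + 1)); [lra|]. replace (4 * C2 / rho * (rho / (32 * (C2 + 1))) * (32 * (C2 + 1))) with (4 * C2) by (field; lra). lra. }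
    assert (L1 := Lip G HG). assert (L2 := Lip G' (Fs1 G' HG')). specialize (Hclose x Hx).
    assert (T1 := Cmod_tri (G z) (G x) (G' z)). assert (T2 := Cmod_tri (G x) (G' x) (G' z)). rewrite (Cmod_sym (G' x)) in T2. lra. }
  set (Nw := map (fun i => roots_poly (firstn i rl)) (seq 0 (length rl))).
  exists (Nw ++ Fs).
  assert (BdU : forall q, hol q U -> Bd q) by (intros q Hq; apply (hol_Bd q U); [apply KJ_U|easy]).
  assert (BdT : forall t, In t (Nw ++ Fs) -> Bd t).
  { intros t Ht. apply in_app_iff in Ht. destruct Ht as [Ht|Ht].
    - apply in_map_iff in Ht. destruct Ht as [i [<- _]]. apply BdU, hol_roots_poly.
    - destruct (Fs1 t Ht) as [F1 _]. apply BdU. apply (hol_sub t V); [easy|]. intros z Hz. now apply (V_of_U f U V H). }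
  split; [easy|]. intros m X mu Hmu Hm Htest.
  assert (Red : forall A q q' (k : nat -> C), subset K A -> hol q' A ->
    (forall z, q z = (csum (fun i => k i * roots_poly (firstn i rl) z) (seq 0 (length rl)) + roots_poly rl z * q' z)%C) -> m q = m (fun z => roots_poly rl z * q' z)%C).
  { intros A q q' k HA Hq' E. rewrite (if_ext _ _ _ Hm q _ (fun z _ => E z)).
    destruct (if_sum m X mu Hm k (fun i => roots_poly (firstn i rl)) (seq 0 (length rl))) as [S1 S2].
    - intros i Hi. apply BdU, hol_roots_poly.
    - intros i Hi. apply Htest, in_app_iff. left. apply in_map_iff. now exists i.
    - rewrite (if_plus _ _ _ Hm _ (fun z => roots_poly rl z * q' z)%C S1), S2; [ring|].
      apply (hol_Bd _ A HA). apply hol_mult; [apply hol_roots_poly|easy]. }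
  assert (Push : forall A q' G, c_open A -> subset K A -> hol q' (fun z => U z /\ A (f z)) -> hol G A -> (forall y, A y -> ~ CV y -> G y = trace (weighted rl q') y) -> m (fun z => roots_poly rl z * q' z)%C = m G).
  { intros A q' G HA HKA Hq' HG E. apply (if_push _ _ _ Hm).
    - apply (hol_Bd _ (fun z => U z /\ A (f z))).
      + intros z Hz. split; [now apply (KJ_U f U)|now apply HKA, (KJ_f f U)].
      + apply hol_mult; [apply hol_roots_poly|easy].
    - now apply (hol_Bd G A).
    - intros y Xy. destruct (if_carrier _ _ _ Hm y Xy) as [Ky Ny]. rewrite E; [easy|now apply HKA|easy]. }
  assert (KV : subset K V) by exact (K_Un 0).
  (* Up to terms killed by [m], [q] is replaced by its push-forward [G], and [G] by its difference
     from a net member, which is at most [/ 2] on [C1]; doubling it returns to the unit ball. *)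
  assert (Unit : forall n q, hol q U -> (forall z, C1 z -> Cmod (q z) <= 1) -> Cmod (m q) <= mu / 2 ^ n).
  { induction n as [|n IH]; intros q Hq Hq1.
    - replace (mu / 2 ^ 0) with (mu * 1) by (simpl; field). apply (if_bound _ _ _ Hm). intros z Hz. now apply Hq1, K_C1.
    - destruct (Hdiv q 1 Hq Hq1) as (q' & k & Hq' & Bq' & E). rewrite Rmult_1_r in Bq'.
      rewrite (Red U q q' k (KJ_U f U) Hq' E).
      assert (Hq'V : hol q' (fun z => U z /\ V (f z))) by (apply (hol_sub q' U); [easy|intros z [Hz _]; exact Hz]).
      destruct (transfer_step rl Bphi HBphi Hrl V q' (bm_Vopen _ _ _ H) (fun z Hz => Hz) Hq'V) as [G [HG EG]].
      rewrite (Push V q' G (bm_Vopen _ _ _ H) KV Hq'V HG EG).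
      assert (HGU : hol G U) by (apply (hol_sub G V); [easy|intros z Hz; now apply (V_of_U f U V H)]).
      assert (FG : Fam G).
      { split; [easy|]. intros z Uz. apply (bound_at_CV G C2 z Uz); [now apply (hol_ccont G U)|]. intros w Uw Nw'.
        rewrite EG by (try easy; now apply (V_of_U f U V H)). unfold C2.
        apply (trace_bound rl Bphi HBphi Hrl q' w D N); [lra|now apply subset_closure|easy|apply HN; [now apply subset_closure|easy]|].
        intros x Ux Ex. apply Bq'. split; [easy|]. rewrite Ex. now apply subset_closure. }
      destruct (Net G FG) as [G' [HG' Hclose]].
      assert (HG'U : hol G' U) by (destruct (Fs1 G' HG') as [F1 _]; apply (hol_sub G' V); [easy|intros z Hz; now apply (V_of_U f U V H)]).
      assert (HDf : hol (fun z => 2 * (G z - G' z))%C U) by (apply hol_mult; [apply hol_const|now apply hol_minus]).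
      assert (E1 : m G = (RtoC (/ 2) * m (fun z => 2 * (G z - G' z))%C + m G')%C).
      { rewrite <- (if_scal _ _ _ Hm (RtoC (/ 2)) _ (BdU _ HDf)).
        rewrite <- (if_plus _ _ _ Hm (fun z => RtoC (/ 2) * (2 * (G z - G' z)))%C G').
        - apply (if_ext _ _ _ Hm). intros z _. rewrite RtoC_inv by lra. field.
        - apply BdU. apply hol_mult; [apply hol_const|easy].
        - now apply BdU. }
      rewrite E1, (Htest G') by (apply in_app_iff; now right). rewrite Cplus_0_r, Cmod_mult, Cmod_RtoC_pos by lra.
      assert (X2 := IH _ HDf). replace (mu / 2 ^ S n) with (/ 2 * (mu / 2 ^ n)) by (simpl; field; apply pow_nonzero; lra).
      apply Rmult_le_compat_l; [lra|]. apply X2. intros z Hz. specialize (Hclose z Hz). rewrite Cmod_mult, Cmod_RtoC_pos by lra. lra. }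
  assert (Zero1 : forall q, hol q U -> m q = 0%C).
  { intros q Hq. destruct (C1_bounded_fun q) as [B [HB HB2]]; [intros z [Hz _]; now apply (hol_ccont q U)|].
    assert (Hs : m (fun z => RtoC (/ B) * q z)%C = 0%C).
    { apply Cmod_eq_of_small. intros e He. destruct (half_pow_small mu e He) as [n Hn]. replace (m (fun z => RtoC (/ B) * q z)%C - 0)%C with (m (fun z => RtoC (/ B) * q z)%C) by ring.
      eapply Rle_trans; [apply (Unit n)|lra].
      - apply hol_mult; [apply hol_const|easy].
      - intros z Hz. rewrite Cmod_mult, Cmod_RtoC_pos by now apply Rlt_le, Rinv_0_lt_compat.
        apply Rmult_le_reg_l with B; [easy|]. rewrite <- Rmult_assoc, Rinv_r by lra. specialize (HB2 z Hz). lra. }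
    rewrite (if_scal _ _ _ Hm _ _ (BdU q Hq)) in Hs.
    replace (m q) with (RtoC B * (RtoC (/ B) * m q))%C; [rewrite Hs; ring|]. rewrite RtoC_inv by lra. field. intros K0. apply RtoC_inj in K0. lra. }
  (* Each push-forward enlarges the domain of holomorphy by one level until [U] is reached. *)
  assert (ZeroN : forall n q, hol q (Un (S n)) -> m q = 0%C).
  { induction n as [|n IH]; intros q Hq.
    - apply Zero1. apply (hol_sub q (Un 1)); [easy|]. intros z Uz. split; [easy|]. now apply (bm_map _ _ _ H).
    - destruct (newton_division rl q (Un (S (S n)))) as (q' & k & Hq' & E); [apply Un_open|intros c Hc; apply K_Un; auto|easy|].
      rewrite (Red (Un (S (S n))) q q' k (K_Un _) Hq' E).
      destruct (transfer_step rl Bphi HBphi Hrl (Un (S n)) q') as [G [HG EG]]; [apply Un_open|apply Un_open|exact Hq'|].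
      rewrite (Push (Un (S n)) q' G); [now apply IH|apply Un_open|apply K_Un|exact Hq'|easy|easy]. }
  intros a Na. destruct (not_K_Un a Na) as [n Hn]. apply (ZeroN n). apply hol_inv.
  - apply hol_minus; [apply hol_id|apply hol_const].
  - intros z Hz. apply sub_neq_0. intros ->. contradiction.
Qed.
End Transfer.

(** * Branches of the inverse along a grand orbit *)

Section Lifting.
Variables (f : C -> C) (U V : C -> Prop).
Hypothesis H : box_map f U V.
Notation K := (KJ f U).
Notation CV := (CV f U).

(** The disk is contracted to [w] along segments and the homotopy lifted in [n] short steps. The
    expansion inequality carried along makes each stage continuous. *)
Lemma disk_lift G c r r' w p : 0 < r < r' -> hol G (cdisk c r') -> (forall z, cdisk c r' z -> V (G z) /\ ~ CV (G z)) ->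
  cdisk c r w -> U p -> f p = G w ->
  exists g, hol g (cdisk c r) /\ g w = p /\ forall z, cdisk c r z -> U (g z) /\ f (g z) = G z.
Proof.
  intros Hr HG HGV Hw Up Ep. set (ball := fun z => Cmod (z - c) <= r).
  assert (Bs : forall z, ball z -> cdisk c r' z) by (intros z Hz; unfold ball, cdisk in *; lra).
  assert (Bw : ball w) by (unfold ball, cdisk in *; lra).
  assert (Bseg : forall z t, ball z -> 0 <= t <= 1 -> ball (seg w z t)) by (intros z t Hz Ht; now apply seg_in_ball).
  assert (Gc : forall z, ball z -> ccont G z) by (intros z Hz; apply (hol_ccont G (cdisk c r')); auto).
  assert (Mc := compact_image ball G (closed_ball_compact c r) Gc).
  destruct (uniformly_invertible f U (fun z => U z /\ image G ball (f z))) as [r0 [Hr0 Hinv]].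
  { apply H. } { apply H. }
  { apply (bm_proper _ _ _ H _ Mc). intros y [z [Hz <-]]. now apply HGV, Bs. }
  { intros z [Uz _]. exact Uz. }
  { intros z [Uz [x [Hx Ex]]] E. apply (HGV x); [now apply Bs|]. now exists z. }
  set (s := r0 / 4). assert (Hs : 0 < r0 * s) by (apply Rmult_lt_0_compat; unfold s; lra).
  destruct (compact_uniform ball (fun y r => forall y', ball y' -> Cmod (y' - y) < r -> Cmod (G y' - G y) < r0 * s) (closed_ball_compact c r)) as [d [Hd Hunif]].
  { intros y a b Ha Hab y' Hy' Hyy. apply Ha; [easy|lra]. }
  { intros x Hx. destruct (Gc x Hx (r0 * s / 2)) as [d [Hd Kd]]; [lra|]. exists (d / 2). split; [lra|].
    intros y Hy Hyx y' Hy' Hyy. assert (T := Cmod_tri y' y x). assert (K1 := Kd y ltac:(lra)). assert (K2 := Kd y' ltac:(lra)).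
    assert (T2 := Cmod_tri (G y') (G x) (G y)). rewrite (Cmod_sym (G x)) in T2. lra. }
  destruct (INR_unbounded (2 * r / d)) as [n0 Hn0]. set (n := S n0).
  assert (Hn : 0 < INR n) by (apply lt_0_INR; unfold n; lia).
  assert (Hnd : 2 * r < INR n * d).
  { apply Rle_lt_trans with (2 * r / d * d); [right; field; lra|]. apply Rmult_lt_compat_r; [easy|]. unfold n. rewrite S_INR. lra. }
  assert (Frac : forall k, (k <= n)%nat -> 0 <= INR k / INR n <= 1).
  { intros k Hk. split; [apply Rmult_le_pos; [apply pos_INR|now apply Rlt_le, Rinv_0_lt_compat]|].
    apply Rmult_le_reg_r with (INR n); [easy|]. unfold Rdiv. rewrite Rmult_assoc, Rinv_l, Rmult_1_r, Rmult_1_l by lra. now apply le_INR. }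
  assert (Close : forall z z' t, ball z -> ball z' -> 0 <= t <= 1 -> Cmod (z - z') < d -> Cmod (G (seg w z t) - G (seg w z' t)) < r0 * s).
  { intros z z' t Hz Hz' Ht Hd'. apply Hunif; auto. replace (seg w z t - seg w z' t)%C with (RtoC t * (z - z'))%C by (unfold seg; ring).
    rewrite Cmod_mult, Cmod_RtoC_pos by lra. assert (X := Cmod_ge_0 (z - z')). nra. }
  assert (Q : forall k, (k <= n)%nat -> exists g, g w = p /\ (forall z, ball z -> U (g z) /\ f (g z) = G (seg w z (INR k / INR n))) /\
     forall z z', ball z -> ball z' -> Cmod (z - z') < d -> r0 * Cmod (g z - g z') <= Cmod (G (seg w z (INR k / INR n)) - G (seg w z' (INR k / INR n)))).
  { induction k as [|k IH]; intros Hk.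
    - exists (fun _ => p). split; [easy|]. split.
      + intros z Hz. split; [easy|]. unfold Rdiv. simpl INR. now rewrite Rmult_0_l, seg_0.
      + intros z z' _ _ _. rewrite Cmod_diag, Rmult_0_r. apply Cmod_ge_0.
    - destruct (IH ltac:(lia)) as (g & Gw & Gf & Gl). assert (F1 := Frac k ltac:(lia)). assert (F2 := Frac (S k) Hk).
      set (t := INR k / INR n) in *. set (t' := INR (S k) / INR n) in *.
      assert (Ht : Rabs (t' - t) = / INR n).
      { unfold t, t'. replace (INR (S k) / INR n - INR k / INR n) with (/ INR n) by (rewrite S_INR; field; lra). apply Rabs_pos_eq. now apply Rlt_le, Rinv_0_lt_compat. }
      set (g' := fun z => epsilon (inhabits p) (fun a => Cmod (a - g z) <= s /\ f a = G (seg w z t'))).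
      assert (Inv : forall z, ball z -> locally_invertible f U (g z) r0).
      { intros z Hz. apply Hinv. destruct (Gf z Hz) as [G1 G2]. split; [easy|]. rewrite G2. exists (seg w z t). split; [|easy]. now apply Bseg. }
      assert (Spec : forall z, ball z -> Cmod (g' z - g z) <= s /\ f (g' z) = G (seg w z t')).
      { intros z Hz. unfold g'. apply epsilon_spec. destruct (Inv z Hz) as (_ & _ & I3). apply I3; [unfold s; lra|].
        rewrite (proj2 (Gf z Hz)). apply Rlt_le, Hunif; auto. rewrite seg_dist, Ht.
        assert (T := Cmod_tri z c w). rewrite (Cmod_sym c w) in T. unfold ball in *.
        apply Rmult_lt_reg_l with (INR n); [easy|]. rewrite <- Rmult_assoc, Rinv_r, Rmult_1_l by lra. lra. }
      exists g'. split; [|split].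
      + destruct (Spec w Bw) as [S1 S2]. destruct (Inv w Bw) as (_ & I2 & _). rewrite Gw in *.
        assert (Ew : seg w w t' = w) by (unfold seg; ring). rewrite Ew in S2.
        specialize (I2 (g' w) p). rewrite S2, Ep, Cmod_diag in I2. apply NNPP. intros Hne. apply Cmod_neq_pos in Hne.
        assert (X : r0 * Cmod (g' w - p) <= 0) by (apply I2; [unfold cdisk, s in *; lra|now apply cdisk_center]).
        assert (0 < r0 * Cmod (g' w - p)) by now apply Rmult_lt_0_compat. lra.
      + intros z Hz. destruct (Spec z Hz) as [S1 S2]. split; [|easy]. apply (Inv z Hz). unfold cdisk, s in *. lra.
      + intros z z' Hz Hz' Hzz. destruct (Spec z Hz) as [S1 S2]. destruct (Spec z' Hz') as [S1' S2']. rewrite <- S2, <- S2'.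
        assert (X : Cmod (g z - g z') < s).
        { apply Rmult_lt_reg_l with r0; [easy|]. eapply Rle_lt_trans; [now apply Gl|]. now apply Close. }
        destruct (Inv z Hz) as (_ & I2 & _). assert (T := Cmod_tri (g' z') (g z') (g z)). rewrite (Cmod_sym (g z')) in T.
        apply I2; unfold cdisk, s in *; lra. }
  destruct (Q n (Nat.le_refl n)) as (g & Gw & Gf & Gl). replace (INR n / INR n) with 1 in Gf, Gl by (field; lra).
  assert (Gf1 : forall z, ball z -> U (g z) /\ f (g z) = G z) by (intros z Hz; destruct (Gf z Hz) as [G1 G2]; now rewrite seg_1 in G2).
  assert (Sub : forall z, cdisk c r z -> ball z) by (intros z Hz; unfold ball, cdisk in *; lra).
  exists g. split; [|split; [easy|auto]]. intros z Hz. destruct (Gf1 z (Sub z Hz)) as [Uz Ez].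
  destruct (cdisk_open c r z Hz) as [e [He Se]]. destruct (HG z (Bs z (Sub z Hz))) as [m Hm].
  exists (m / Dv f (g z))%C. apply (cder_lift f g G); [|exists e; split; [easy|]; intros x Hx; now apply Gf1, Sub, Se|easy|now apply (f_cder f U V H)|].
  - intros e' He'. destruct (Gc z (Sub z Hz) (r0 * e')) as [d1 [Hd1 Kd]]; [now apply Rmult_lt_0_compat|].
    exists (Rmin e (Rmin d d1)). split; [repeat apply Rmin_pos; easy|]. intros x Hx.
    assert (A1 := Rmin_l e (Rmin d d1)). assert (A2 := Rmin_r e (Rmin d d1)). assert (A3 := Rmin_l d d1). assert (A4 := Rmin_r d d1).
    specialize (Gl x z (Sub x (Se x ltac:(unfold cdisk; lra))) (Sub z Hz) ltac:(lra)). rewrite !seg_1 in Gl. specialize (Kd x ltac:(lra)).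
    apply Rmult_lt_reg_l with r0; [easy|]. lra.
  - intros E. apply (HGV z); [now apply Bs, Sub|]. now exists (g z).
Qed.

(** Agreement is an open condition by local injectivity of [f], disagreement by continuity. *)
Lemma lift_unique_step D g g' x0 : c_open D -> c_connected D -> (forall x, D x -> ccont g x) -> (forall x, D x -> ccont g' x) ->
  (forall x, D x -> U (g x) /\ Dv f (g x) <> 0%C) -> (forall x, D x -> f (g x) = f (g' x)) -> D x0 -> g x0 = g' x0 ->
  forall x, D x -> g x = g' x.
Proof.
  intros HD HC Gc Gc' HU E D0 E0 x Dx.
  destruct (HC (fun x => D x /\ g x = g' x) (fun x => D x /\ g x <> g' x)) as [K0|K0].
  - intros z [Dz Ez]. destruct (HU z Dz) as [Uz Nz]. destruct (U_disk f U V H _ Uz) as [R [HR SR]].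
    destruct (local_near_linear f (g z) R HR) as [s [Hs NL]]; [apply (hol_sub f U); [apply H|easy]|easy|].
    destruct (HD z Dz) as [e [He Se]]. destruct (Gc z Dz s ltac:(lra)) as [d1 [Hd1 K1]]. destruct (Gc' z Dz s ltac:(lra)) as [d2 [Hd2 K2]].
    exists (Rmin e (Rmin d1 d2)). split; [repeat apply Rmin_pos; easy|]. intros y Hy. unfold cdisk in Hy.
    assert (A1 := Rmin_l e (Rmin d1 d2)). assert (A2 := Rmin_r e (Rmin d1 d2)). assert (A3 := Rmin_l d1 d2). assert (A4 := Rmin_r d1 d2).
    assert (Dy : D y) by (apply Se; unfold cdisk; lra). split; [easy|].
    assert (X := near_linear_expand f _ (g z) s (g y) (g' y) NL). specialize (K1 y ltac:(lra)). specialize (K2 y ltac:(lra)). rewrite <- Ez in K2.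
    specialize (X ltac:(lra) ltac:(lra)). rewrite (E y Dy), Cmod_diag in X. apply NNPP. intros Hn. apply Cmod_neq_pos in Hn.
    assert (Hp := proj1 (Cmod_gt_0 _) Nz). assert (0 < Cmod (Dv f (g z)) / 2 * Cmod (g y - g' y)) by (apply Rmult_lt_0_compat; lra). lra.
  - intros z [Dz Nz]. assert (Hp := Cmod_neq_pos _ _ Nz). set (q := Cmod (g z - g' z)) in *.
    destruct (HD z Dz) as [e [He Se]]. destruct (Gc z Dz (q / 2) ltac:(lra)) as [d1 [Hd1 K1]]. destruct (Gc' z Dz (q / 2) ltac:(lra)) as [d2 [Hd2 K2]].
    exists (Rmin e (Rmin d1 d2)). split; [repeat apply Rmin_pos; easy|]. intros y Hy. unfold cdisk in Hy.
    assert (A1 := Rmin_l e (Rmin d1 d2)). assert (A2 := Rmin_r e (Rmin d1 d2)). assert (A3 := Rmin_l d1 d2). assert (A4 := Rmin_r d1 d2).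
    split; [apply Se; unfold cdisk; lra|]. intros Ey. specialize (K1 y ltac:(lra)). specialize (K2 y ltac:(lra)).
    rewrite <- Ey in K2. assert (T := Cmod_tri (g z) (g y) (g' z)). rewrite (Cmod_sym (g z) (g y)) in T. fold q in T. lra.
  - intros z Dz. destruct (classic (g z = g' z)); [left|right]; easy.
  - intros z (_ & [_ X] & [_ Y]). contradiction.
  - now apply K0.
  - exfalso. now destruct (K0 x0 D0).
Qed.

Lemma lift_unique_iter n : forall D g g' x0, c_open D -> c_connected D -> (forall x, D x -> ccont g x) -> (forall x, D x -> ccont g' x) ->
  (forall x, D x -> K (g x)) -> (forall x, D x -> K (g' x)) -> (forall i x, D x -> (i < n)%nat -> Dv f (Nat.iter i f (g x)) <> 0%C) ->
  (forall x, D x -> Nat.iter n f (g x) = Nat.iter n f (g' x)) -> D x0 -> g x0 = g' x0 ->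
  forall x, D x -> g x = g' x.
Proof.
  induction n as [|n IH]; intros D g g' x0 HD HC Gc Gc' GK GK' GD E D0 E0; [exact E|].
  apply (lift_unique_step D g g' x0); try easy.
  - intros x Dx. split; [now apply (KJ_U f U), GK|]. apply (GD 0%nat x Dx). lia.
  - apply (IH D (fun x => f (g x)) (fun x => f (g' x)) x0); try easy.
    + intros x Dx. apply (ccont_comp f g); [auto|]. now apply (bm_cont f U V H), (KJ_U f U), GK.
    + intros x Dx. apply (ccont_comp f g'); [auto|]. now apply (bm_cont f U V H), (KJ_U f U), GK'.
    + intros x Dx. now apply (KJ_f f U), GK.
    + intros x Dx. now apply (KJ_f f U), GK'.
    + intros i x Dx Hi. rewrite <- iter_succ. apply GD; [easy|lia].
    + intros x Dx. rewrite <- !iter_succ. auto.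
    + now rewrite E0.
Qed.

Lemma iter_plus a b z : Nat.iter (a + b) f z = Nat.iter a f (Nat.iter b f z).
Proof. induction a as [|a IH]; [easy|]. simpl. now rewrite IH. Qed.

Variable W : nat -> C -> Prop.
Hypothesis HW : forall n, is_component (c_interior K) (W n).
Hypothesis HWf : forall n z, W n z -> W (S n) (f z).
Hypothesis HWd : forall i j z, W i z -> W j z -> i = j.
Hypothesis HWc : forall n z, W n z -> Dv f z <> 0%C.

Lemma W_K n : subset (W n) K.
Proof. intros z Hz. apply (c_interior_sub K). now apply HW in Hz. Qed.

Lemma W_open n : c_open (W n).
Proof. apply (component_open _ _ (c_interior_open K) (HW n)). Qed.

Lemma W_iter n j z : W n z -> W (j + n) (Nat.iter j f z).
Proof. intros Hz. induction j as [|j IH]; [easy|]. simpl. now apply HWf. Qed.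

Lemma W_inj j : forall n x x', W n x -> W n x' -> Nat.iter j f x = Nat.iter j f x' -> x = x'.
Proof.
  induction j as [|j IH]; intros n x x' Hx Hx' E; [easy|]. rewrite !iter_succ in E.
  apply (component_injective f U V H (W n) (W (S n))); try easy; [apply HWf|apply HWc|]. apply (IH (S n)); auto.
Qed.

(** Excludes the critical orbits from time 1 on. Then no inverse branch met while pulling back the
    orbit of [z] runs into a critical point. *)
Definition free z := forall j i c, U c -> Dv f c = 0%C -> Nat.iter j f z <> Nat.iter (S i) f c.

(** Disjointness of the [W n] equates the two total times, and injectivity of the iterates on [W 0]
    does the rest: each critical orbit excludes at most one point. *)
Lemma bad_unique c z z' j i j' i' : W 0%nat z -> W 0%nat z' -> Nat.iter j f z = Nat.iter i f c -> Nat.iter j' f z' = Nat.iter i' f c -> z = z'.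
Proof.
  intros Hz Hz' E E'.
  assert (Q : Nat.iter (i' + j) f z = Nat.iter (i + j') f z') by (rewrite !iter_plus, E, E', <- !iter_plus; f_equal; lia).
  assert (X := W_iter 0 (i' + j) z Hz). assert (Y := W_iter 0 (i + j') z' Hz'). rewrite Q in X. assert (Z := HWd _ _ _ X Y).
  apply (W_inj (i' + j) 0); try easy. rewrite Q. f_equal. lia.
Qed.

Lemma free_disk : exists w0 R, 0 < R /\ forall z, cdisk w0 (2 * R) z -> W 0%nat z /\ free z.
Proof.
  destruct (crit_finite f U V H) as [cl [_ Hcl]].
  assert (Bad : forall l, exists Z : list C, forall z j i c, W 0%nat z -> In c l -> Nat.iter j f z = Nat.iter (S i) f c -> In z Z).
  { induction l as [|c l [Z HZ]]; [exists nil; intros ? ? ? ? ? []|].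
    destruct (classic (exists x j i, W 0%nat x /\ Nat.iter j f x = Nat.iter (S i) f c)) as [(x & j0 & i0 & Hx & Ex)|Hno].
    - exists (x :: Z). intros z j i c' Hz [<-|Hc] E; [left|right; now apply (HZ z j i c')].
      now apply (bad_unique c x z j0 (S i0) j (S i)).
    - exists Z. intros z j i c' Hz [<-|Hc] E; [exfalso; apply Hno; now exists z, j, i|now apply (HZ z j i c')]. }
  destruct (Bad cl) as [Z HZ]. destruct (HW 0) as [[a Ha] _]. destruct (W_open 0 a Ha) as [r [Hr Sr]].
  destruct (list_far Z a) as [d [Hd Hfar]].
  (* The disk of radius [t / 2] about [a + t] avoids [a], which may itself be excluded, and stays
     within distance [d] of [a], where no other excluded point lies. *)
  set (t := Rmin r d / 2). assert (A1 := Rmin_l r d). assert (A2 := Rmin_r r d). assert (A3 : 0 < Rmin r d) by now apply Rmin_pos.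
  assert (Ht : 0 < t) by (unfold t; lra).
  exists (a + RtoC t)%C, (t / 4). split; [lra|]. intros z Hz. unfold cdisk in Hz.
  assert (E : Cmod (a + RtoC t - a) = t) by (replace (a + RtoC t - a)%C with (RtoC t) by ring; apply Cmod_RtoC_pos; lra).
  assert (T1 := Cmod_tri z (a + RtoC t) a). assert (T2 := Cmod_tri (a + RtoC t) z a). rewrite (Cmod_sym (a + RtoC t) z) in T2.
  assert (Wz : W 0%nat z) by (apply Sr; unfold cdisk, t in *; lra). split; [easy|].
  intros j i c Uc Dc E2. assert (Hz2 := HZ z j i c Wz (proj2 (Hcl c) (conj Uc Dc)) E2).
  assert (Nz : z <> a) by (apply Cmod_pos_neq; lra). specialize (Hfar z Hz2 Nz). unfold t in *. lra.
Qed.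

Lemma orbit_regular z k j p : W 0%nat z -> free z -> U p -> Nat.iter k f p = Nat.iter j f z -> Dv f p <> 0%C /\ ~ CV p.
Proof.
  intros Wz Fz Up E. split.
  - intros D. destruct k as [|k]; [|now apply (Fz j k p)]. simpl in E. subst p. now apply (HWc _ _ (W_iter 0 j z Wz)).
  - intros (c & Uc & Dc & Ec). apply (Fz j k c Uc Dc). now rewrite iter_succ, Ec.
Qed.

(** * Inverse branches on a disk and their Koebe estimates *)

Variables (w0 : C) (R : R).
Hypothesis HR : 0 < R.
Hypothesis Hfree : forall z, cdisk w0 (2 * R) z -> W 0%nat z /\ free z.
Notation D := (cdisk w0 R).

Definition lifting r (g : C -> C) k j := hol g (cdisk w0 r) /\ forall z, cdisk w0 r z -> K (g z) /\ Nat.iter k f (g z) = Nat.iter j f z.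

Lemma D_free z : D z -> W 0%nat z /\ free z.
Proof. intros Hz. apply Hfree. unfold cdisk in *. lra. Qed.

Lemma hol_iter j : hol (Nat.iter j f) (W 0%nat).
Proof.
  induction j as [|j IH]; [apply hol_id|]. apply (hol_comp f (Nat.iter j f) _ U); [easy|apply H|].
  intros z Hz. now apply (KJ_U f U), (W_K (j + 0)), W_iter.
Qed.

(** Each use of [disk_lift] loses a little radius, hence the claim for all [r < 2 * R] and the
    intermediate radius half-way to [2 * R]. *)
Lemma lifting_exists k : forall p j, K p -> Nat.iter k f p = Nat.iter j f w0 -> forall r, 0 < r < 2 * R -> exists g, lifting r g k j /\ g w0 = p.
Proof.
  induction k as [|k IH]; intros p j Kp E r Hr.
  - assert (S0 : subset (cdisk w0 r) (W 0%nat)) by (intros z Hz; apply Hfree; unfold cdisk in *; lra).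
    exists (Nat.iter j f). split; [|now symmetry]. split; [apply (hol_sub _ (W 0%nat)); [apply hol_iter|easy]|].
    intros z Hz. split; [|easy]. apply iter_KJ, (W_K 0), S0, Hz.
  - rewrite iter_succ in E. destruct (IH (f p) j (KJ_f f U p Kp) E ((r + 2 * R) / 2) ltac:(lra)) as (G & [HG1 HG2] & EG).
    destruct (disk_lift G w0 r ((r + 2 * R) / 2) w0 p) as (g & Hg & Eg & Hfg); [lra|easy| |apply cdisk_center; lra|now apply (KJ_U f U)|now symmetry|].
    + intros z Hz. destruct (HG2 z Hz) as [Kz Ez]. destruct (Hfree z) as [Wz Fz]; [unfold cdisk in *; lra|].
      split; [now apply (V_of_U f U V H), (KJ_U f U)|]. apply (orbit_regular z k j (G z) Wz Fz); [now apply (KJ_U f U)|easy].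
    + exists g. split; [|easy]. split; [easy|]. intros z Hz. destruct (Hfg z Hz) as [Uz Ez].
      destruct (HG2 z) as [Kz E2]; [unfold cdisk in *; lra|]. split; [apply KJ_iff; split; [easy|now rewrite Ez]|]. now rewrite iter_succ, Ez.
Qed.

(** A common value of two branches forces [k' + j = k + j'], because the [W n] are disjoint;
    injectivity of the iterate then gives [z = z'], and unique lifting the rest. So distinct
    branches have disjoint images. *)
Lemma lifting_unique g g' k j k' j' z z' : lifting R g k j -> lifting R g' k' j' -> D z -> D z' -> g z = g' z' ->
  z = z' /\ forall x, D x -> g x = g' x.
Proof.
  intros [L1 L2] [L1' L2'] Hz Hz' E.
  assert (A : forall x, D x -> Nat.iter (k' + k) f (g x) = Nat.iter (k' + j) f x) by (intros x Hx; rewrite !iter_plus; now rewrite (proj2 (L2 x Hx))).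
  assert (B : forall x, D x -> Nat.iter (k' + k) f (g' x) = Nat.iter (k + j') f x).
  { intros x Hx. rewrite Nat.add_comm, !iter_plus. now rewrite (proj2 (L2' x Hx)). }
  assert (Q : Nat.iter (k' + j) f z = Nat.iter (k + j') f z') by (rewrite <- A, <- B, E by easy; easy).
  assert (X := W_iter 0 (k' + j) z (proj1 (D_free z Hz))). assert (Y := W_iter 0 (k + j') z' (proj1 (D_free z' Hz'))). rewrite Q in X.
  assert (N : (k' + j = k + j')%nat) by (assert (X2 := HWd _ _ _ X Y); lia). rewrite <- N in Q, B.
  assert (Ez : z = z') by (apply (W_inj (k' + j) 0); try easy; now apply D_free). split; [easy|]. subst z'.
  apply (lift_unique_iter (k' + k) D g g' z); try easy; [apply cdisk_open|apply convex_connected, cdisk_convex| | | | | |].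
  - intros x Hx. now apply (hol_ccont g D).
  - intros x Hx. now apply (hol_ccont g' D).
  - intros x Hx. now apply L2.
  - intros x Hx. now apply L2'.
  - intros i x Hx Hi. destruct (D_free x Hx) as [Wx Fx].
    apply (orbit_regular x (k' + k - i) (k' + j) (Nat.iter i f (g x)) Wx Fx); [now apply (KJ_U f U), iter_KJ, L2|].
    rewrite <- iter_plus, <- A by easy. f_equal. lia.
  - intros x Hx. now rewrite A, B.
Qed.

(* [Om] is the grand orbit of [w0], and [lf p] is the branch of [f^-k o f^j] on [D] sending [w0] to [p]. *)
Definition Om p := K p /\ exists k j, Nat.iter k f p = Nat.iter j f w0.

Definition lf (p : C) : C -> C := epsilon (inhabits (fun z : C => z)) (fun g => (exists k j, lifting R g k j) /\ g w0 = p).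

Lemma lf_spec p : Om p -> (exists k j, lifting R (lf p) k j) /\ lf p w0 = p.
Proof.
  intros (Kp & k & j & E). unfold lf. apply epsilon_spec. destruct (lifting_exists k p j Kp E R ltac:(lra)) as (g & Hg & Eg).
  exists g. split; [now exists k, j|easy].
Qed.

Lemma lf_hol p : Om p -> hol (lf p) D.
Proof. intros Hp. destruct (lf_spec p Hp) as [(k & j & L & _) _]. exact L. Qed.

Lemma lf_K p z : Om p -> D z -> K (lf p z).
Proof. intros Hp Hz. destruct (lf_spec p Hp) as [(k & j & _ & L) _]. now apply L. Qed.

Lemma lf_regular p z : Om p -> D z -> Dv f (lf p z) <> 0%C /\ ~ CV (lf p z).
Proof.
  intros Hp Hz. destruct (lf_spec p Hp) as [(k & j & _ & L) _]. destruct (D_free z Hz). destruct (L z Hz).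
  apply (orbit_regular z k j); try easy. now apply (KJ_U f U).
Qed.

Lemma w0_D : D w0.
Proof. now apply cdisk_center. Qed.

Lemma lf_inj p p' z z' : Om p -> Om p' -> D z -> D z' -> lf p z = lf p' z' -> p = p' /\ z = z'.
Proof.
  intros Hp Hp' Hz Hz' E. destruct (lf_spec p Hp) as [(k & j & L) P]. destruct (lf_spec p' Hp') as [(k' & j' & L') P'].
  destruct (lifting_unique _ _ _ _ _ _ _ _ L L' Hz Hz' E) as [A B]. split; [|easy]. rewrite <- P, <- P'. apply B, w0_D.
Qed.

Lemma lf_agree p g k j z : Om p -> lifting R g k j -> D z -> g z = lf p z -> forall x, D x -> g x = lf p x.
Proof.
  intros Hp Lg Hz E. destruct (lf_spec p Hp) as [(k' & j' & L) _]. now apply (lifting_unique _ _ _ _ _ _ _ _ Lg L Hz Hz E).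
Qed.

Lemma Om_f p : Om p -> Om (f p).
Proof.
  intros (Kp & k & j & E). split; [now apply (KJ_f f U)|]. exists k, (S j). rewrite <- iter_succ. simpl. now rewrite E.
Qed.

Lemma lf_f p z : Om p -> D z -> f (lf p z) = lf (f p) z.
Proof.
  intros Hp. destruct (lf_spec p Hp) as [(k & j & L1 & L2) P]. revert z.
  apply (lf_agree (f p) (fun z => f (lf p z)) k (S j) w0 (Om_f p Hp)); [|apply w0_D|now rewrite P, (proj2 (lf_spec _ (Om_f p Hp)))].
  split.
  - apply (hol_comp f (lf p) _ U); [easy|apply H|]. intros z Hz. now apply (KJ_U f U), L2.
  - intros z Hz. destruct (L2 z Hz) as [A B]. split; [now apply (KJ_f f U)|]. rewrite <- iter_succ. simpl. now rewrite B.
Qed.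

Lemma Om_w0 : Om w0.
Proof. split; [apply (W_K 0), D_free, w0_D|]. now exists O, O. Qed.

Lemma lf_w0 z : D z -> lf w0 z = z.
Proof.
  intros Hz. symmetry. revert z Hz. apply (lf_agree w0 (fun z => z) 0 0 w0 Om_w0); [|apply w0_D|now rewrite (proj2 (lf_spec _ Om_w0))].
  split; [apply hol_id|]. intros z Hz. split; [now apply (W_K 0), D_free|easy].
Qed.

Lemma lf_W p z : Om p -> D z -> W 0%nat (lf p z) -> p = w0.
Proof.
  intros Hp Hz Hw. destruct (lf_spec p Hp) as [(k & j & L1 & L2) P]. destruct (L2 z Hz) as [_ E].
  assert (Wz := proj1 (D_free z Hz)). assert (X := W_iter 0 k _ Hw). assert (Y := W_iter 0 j _ Wz). rewrite E in X.
  assert (N := HWd _ _ _ X Y). assert (k = j) by lia. subst k. apply (W_inj j 0) in E; try easy.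
  apply (lf_inj p w0 z z Hp Om_w0 Hz Hz). now rewrite E, lf_w0.
Qed.

Lemma lf_interior p z : Om p -> D z -> c_interior K (lf p z).
Proof.
  intros Hp Hz. destruct (cdisk_open w0 R z Hz) as [r [Hr Sr]].
  destruct (open_mapping (lf p) z r Hr) as [d [Hd Kd]].
  - apply (hol_sub _ D); [now apply lf_hol|easy].
  - intros Hc. set (z' := (z + RtoC (r / 2))%C).
    assert (E : Cmod (z' - z) = r / 2) by (unfold z'; replace (z + RtoC (r / 2) - z)%C with (RtoC (r / 2)) by ring; apply Cmod_RtoC_pos; lra).
    assert (Z : z' = z). { apply (lf_inj p p z' z); try easy; [apply Sr|apply Hc]; unfold cdisk; lra. }
    rewrite Z, Cmod_diag in E. lra.
  - exists d. split; [easy|]. intros y Hy. destruct (Kd y Hy) as [x [Hx <-]]. apply lf_K; auto.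
Qed.

(** The value lies in the interior of [K], so being in the closure of [W 0] puts it in [W 0]. Hence
    only the branch of [w0] creates poles on that closure. *)
Lemma lf_closure p z : Om p -> D z -> c_closure (W 0%nat) (lf p z) -> p = w0.
Proof.
  intros Hp Hz Hc. destruct (c_interior_open K _ (lf_interior p z Hp Hz)) as [r [Hr Sr]]. destruct (Hc r Hr) as [v [Hv Hd]].
  apply (lf_W p z Hp Hz). apply (component_absorb _ _ (cdisk (lf p z) r) v (HW 0)); try easy; [apply convex_connected, cdisk_convex|now apply cdisk_center].
Qed.

(** Every preimage of a branch value is again a branch value; this identifies the fibre sum in the
    trace with a part of the orbit sum. *)
Lemma lf_fiber q z x : Om q -> D z -> U x -> f x = lf q z -> exists p, Om p /\ f p = q /\ lf p z = x.
Proof.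
  intros Hq Hz Ux Ex. assert (Hq0 := Hq). destruct Hq as (Kq & k & j & E).
  (* Radius [3 / 2 * R] leaves the room beyond [R] that [disk_lift] uses up. *)
  destruct (lifting_exists k q j Kq E (3 / 2 * R) ltac:(lra)) as (G & [G1 G2] & EG).
  assert (LG : lifting R G k j).
  { split; [apply (hol_sub _ _ _ G1); intros v Hv; unfold cdisk in *; lra|]. intros v Hv. apply G2. unfold cdisk in *; lra. }
  assert (Eq : forall v, D v -> G v = lf q v).
  { apply (lf_agree q G k j w0 Hq0 LG w0_D). now rewrite EG, (proj2 (lf_spec q Hq0)). }
  destruct (disk_lift G w0 R (3 / 2 * R) z x) as (g & Hg & Eg & Hfg); [lra|easy| |easy|easy|now rewrite Eq|].
  - intros v Hv. destruct (G2 v Hv) as [Kv Ev]. destruct (Hfree v) as [Wv Fv]; [unfold cdisk in *; lra|].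
    split; [now apply (V_of_U f U V H), (KJ_U f U)|]. apply (orbit_regular v k j (G v) Wv Fv); [now apply (KJ_U f U)|easy].
  - assert (Lg : lifting R g (S k) j).
    { split; [easy|]. intros v Hv. destruct (Hfg v Hv) as [Uv Ev]. destruct (proj2 LG v Hv) as [Kv E2].
      split; [apply KJ_iff; split; [easy|now rewrite Ev]|]. now rewrite iter_succ, Ev. }
    assert (Hp : Om (g w0)) by (split; [now apply Lg, w0_D|]; exists (S k), j; now apply Lg, w0_D).
    exists (g w0). split; [easy|]. split.
    + rewrite (proj2 (Hfg w0 w0_D)). now rewrite EG.
    + rewrite <- Eg. symmetry. apply (lf_agree (g w0) g (S k) j w0 Hp Lg w0_D); [|easy]. now rewrite (proj2 (lf_spec _ Hp)).
Qed.

Notation E := (cdisk w0 (R / 2)).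
Notation D1 p w := (Dv (lf p) w).
Notation rad w := (fun p => R / 1024 * Cmod (D1 p w)).

Lemma E_D w : E w -> D w.
Proof. unfold cdisk. lra. Qed.

Lemma lf_cder p w : Om p -> E w -> cder (lf p) w (D1 p w).
Proof. intros Hp Hw. apply Dv_spec. now apply lf_hol, E_D. Qed.

(** About each [w] in the half disk there is a disk of radius [R / 2] in [D]; [koebe] with
    [rho = R / 4] gives [1024 = 4 * 256]. *)
Lemma lf_koebe p w a : Om p -> E w -> (forall z, D z -> lf p z <> a) -> R / 1024 * Cmod (D1 p w) <= Cmod (lf p w - a).
Proof.
  intros Hp Hw Ha.
  assert (S : subset (cdisk w (R / 2)) D) by (intros z Hz; unfold cdisk in *; assert (T := Cmod_tri z w w0); lra).
  assert (X := koebe (lf p) w (R / 2) (R / 4) a ltac:(lra) (hol_sub _ _ _ (lf_hol p Hp) S)).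
  assert (Y : R / 4 * Cmod (D1 p w) <= 256 * Cmod (lf p w - a)); [|lra].
  apply X; [|intros z Hz; now apply Ha, S]. intros x y Hx Hy Exy. apply (lf_inj p p x y); auto.
Qed.

Lemma iter_cder j z : W 0%nat z -> exists l : C, l <> 0%C /\ cder (Nat.iter j f) z l.
Proof.
  intros Hz. induction j as [|j [l [Hl IH]]]; [exists (RtoC 1); split; [intros K0; apply RtoC_inj in K0; lra|apply cder_id]|].
  assert (Wj := W_iter 0 j z Hz). exists (Dv f (Nat.iter j f z) * l)%C. split; [apply Cmult_neq_0; [now apply (HWc _ _ Wj)|easy]|].
  apply (cder_comp f (Nat.iter j f)); [easy|]. now apply (f_cder f U V H), (KJ_U f U), (W_K _ _ Wj).
Qed.

Lemma iter_der_exists k z : K z -> exists l, cder (Nat.iter k f) z l.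
Proof.
  intros Hz. induction k as [|k [l IH]]; [exists (RtoC 1); apply cder_id|]. exists (Dv f (Nat.iter k f z) * l)%C.
  apply (cder_comp f (Nat.iter k f)); [easy|]. now apply (f_cder f U V H), (KJ_U f U), iter_KJ.
Qed.

(** The chain rule for [f^k o lf p = f^j], whose right side has nonzero derivative on the wandering
    component. *)
Lemma D1_neq p w : Om p -> E w -> D1 p w <> 0%C.
Proof.
  intros Hp Hw E0. destruct (lf_spec p Hp) as [(k & j & L1 & L2) P].
  destruct (iter_cder j w (proj1 (D_free w (E_D w Hw)))) as [l [Hl Dl]].
  destruct (iter_der_exists k (lf p w) (lf_K p w Hp (E_D w Hw))) as [l' Dl'].
  apply Hl. apply (cder_unique (Nat.iter j f) w); [easy|]. apply (cder_val _ _ (l' * D1 p w)%C); [rewrite E0; ring|].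
  apply (cder_ext_loc (fun z => Nat.iter k f (lf p z))); [|apply (cder_comp (Nat.iter k f) (lf p)); [now apply lf_cder|easy]].
  destruct (cdisk_open w0 R w (E_D w Hw)) as [d [Hd Sd]]. exists d. split; [easy|]. intros x Hx. now apply L2, Sd.
Qed.

Lemma D1_f p w : Om p -> E w -> D1 (f p) w = (Dv f (lf p w) * D1 p w)%C.
Proof.
  intros Hp Hw. apply Dv_eq. apply (cder_ext_loc (fun z => f (lf p z))).
  - destruct (cdisk_open w0 R w (E_D w Hw)) as [d [Hd Sd]]. exists d. split; [easy|]. intros x Hx. now apply lf_f, Sd.
  - apply (cder_comp f (lf p)); [now apply lf_cder|]. now apply (f_cder f U V H), (KJ_U f U), lf_K, E_D.
Qed.

Lemma D1_w0 w : E w -> D1 w0 w = 1%C.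
Proof.
  intros Hw. apply Dv_eq. apply (cder_ext_loc (fun z => z)); [|apply cder_id].
  destruct (cdisk_open w0 R w (E_D w Hw)) as [d [Hd Sd]]. exists d. split; [easy|]. intros x Hx. symmetry. now apply lf_w0, Sd.
Qed.

Lemma rad_pos w p : E w -> Om p -> 0 < rad w p.
Proof. intros Hw Hp. apply Rmult_lt_0_compat; [lra|]. now apply Cmod_gt_0, D1_neq. Qed.

(** A quarter theorem with a worse constant: an omitted point of the disk would contradict
    [lf_koebe]. *)
Lemma rad_image w p z : E w -> Om p -> cdisk (lf p w) (rad w p) z -> exists x, D x /\ lf p x = z.
Proof.
  intros Hw Hp Hz. apply NNPP. intros Hno. unfold cdisk in Hz. rewrite Cmod_sym in Hz.
  assert (X := lf_koebe p w z Hp Hw). cbv beta in Hz. apply (Rlt_irrefl (R / 1024 * Cmod (D1 p w))).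
  eapply Rle_lt_trans; [apply X|exact Hz]. intros x Hx Ex. apply Hno. now exists x.
Qed.

Lemma lf_disks w l : E w -> fin Om l -> disjoint_disks l (fun p => lf p w) (rad w).
Proof.
  intros Hw [_ Hl] i j z Hi Hj Hn Z1 Z2. destruct (rad_image w i z Hw (Hl i Hi) Z1) as [x [Hx Ex]].
  destruct (rad_image w j z Hw (Hl j Hj) Z2) as [y [Hy Ey]]. apply Hn. apply (lf_inj i j x y); auto. congruence.
Qed.

Lemma lf_packing : exists B, 0 < B /\ forall w l, E w -> fin Om l -> rsum (fun p => rad w p * rad w p) l <= B.
Proof.
  destruct (compact_bounded _ (KJ_compact f U V H)) as [M HM].
  assert (M0 : 0 <= M) by (eapply Rle_trans; [apply Cmod_ge_0|apply (HM w0), Om_w0]).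
  exists (36 * ((M + 1) * (M + 1))). split; [nra|]. intros w l Hw Hl.
  apply (packing l (fun p => lf p w) (rad w) 0%C (M + 1)); [lra|apply Hl|intros i Hi; now apply rad_pos, Hl|now apply lf_disks|].
  intros i Hi z Hz. destruct (rad_image w i z Hw) as [x [Hx <-]]; [now apply Hl|easy|]. unfold cdisk.
  replace (lf i x - 0)%C with (lf i x) by ring. assert (X := HM _ (lf_K i x (proj2 Hl i Hi) Hx)). lra.
Qed.

(** [l0] is chosen from the sum of squares alone, before [a], which gives the uniformity needed at
    the boundary. With [d = e / 1152] the first term of [tail_bound] is [e / 2]. *)
Lemma lf_tail w e : E w -> 0 < e -> exists l0, fin Om l0 /\ forall a l, ~ K a -> fin Om l -> (forall x, In x l -> ~ In x l0) ->
  rsum (fun p => rad w p * rad w p / Cmod (lf p w - a)) l <= e.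
Proof.
  intros Hw He. destruct lf_packing as (B & _ & HB). set (d := e / 1152). assert (Hd : 0 < d) by (unfold d; lra).
  destruct (tail_small Om (fun p => rad w p * rad w p) B) with (e := d * (e / 2)) as [l0 [F0 Hl0]].
  - intros x Hx. apply Rlt_le, Rmult_lt_0_compat; now apply rad_pos.
  - intros l Hl. now apply HB.
  - apply Rmult_lt_0_compat; lra.
  - exists l0. split; [easy|]. intros a l Ha Hl Hdis. specialize (Hl0 l Hl Hdis).
    assert (X := tail_bound l (fun p => lf p w) (rad w) a d Hd (proj1 Hl)).
    eapply Rle_trans; [apply X|].
    + intros i Hi. split; [now apply rad_pos, Hl|]. apply lf_koebe; [now apply Hl|easy|]. intros z Hz Ez. apply Ha. rewrite <- Ez. now apply lf_K; [apply Hl|].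
    + now apply lf_disks.
    + assert (Y : rsum (fun i => rad w i * rad w i) l / d <= e / 2).
      { apply Rmult_le_reg_r with d; [easy|]. unfold Rdiv at 1. rewrite Rmult_assoc, Rinv_l by lra. lra. }
      unfold d in *. lra.
Qed.

Definition term w (q : C -> C) p := (D1 p w * D1 p w * q (lf p w))%C.

Lemma term_mod w q p : Cmod (term w q p) = (1024 / R) * (1024 / R) * (rad w p * rad w p * Cmod (q (lf p w))).
Proof. unfold term. rewrite !Cmod_mult. field. lra. Qed.

Lemma term_bound : exists mu, 0 <= mu /\ forall w q B l, E w -> (forall z, K z -> Cmod (q z) <= B) -> fin Om l -> rsum (fun p => Cmod (term w q p)) l <= mu * B.
Proof.
  destruct lf_packing as (P & HP0 & HP). set (k := (1024 / R) * (1024 / R)). assert (Hk : 0 < k) by (assert (0 < 1024 / R) by (apply Rdiv_lt_0_compat; lra); unfold k; nra).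
  exists (k * P). split; [nra|]. intros w q B l Hw HB Hl.
  assert (B0 : 0 <= B) by (eapply Rle_trans; [apply Cmod_ge_0|apply (HB w0), Om_w0]).
  apply Rle_trans with (rsum (fun p => k * B * (rad w p * rad w p)) l).
  - apply rsum_le. intros p Hp. rewrite term_mod. fold k. set (x := R / 1024 * Cmod (D1 p w)). replace (k * B * (x * x)) with (k * (x * x * B)) by ring.
    apply Rmult_le_compat_l; [lra|]. apply Rmult_le_compat_l; [apply Rle_0_sqr|]. apply HB, lf_K; [now apply Hl|now apply E_D].
  - rewrite rsum_scal. replace (k * P * B) with (k * B * P) by ring. apply Rmult_le_compat_l; [nra|]. now apply HP.
Qed.

(* The masses [(g_p'(w))^2] at the points [g_p(w)], with [g_p = lf p], form an [f]-invariant infinitesimal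
   deformation supported on the grand orbit of [w]. *)
Definition beltrami w q : C := epsilon (inhabits (RtoC 0)) (usum Om (term w q)).

Lemma beltrami_spec w q : E w -> Bd f U q -> usum Om (term w q) (beltrami w q).
Proof.
  intros Hw [B [HB0 HB]]. unfold beltrami. apply epsilon_spec. destruct term_bound as (mu & _ & Hmu).
  apply (usum_exists Om _ (mu * B)). intros l Hl. now apply Hmu.
Qed.

Lemma fib_Om y : Om y -> NoDup (fib f U y) /\ forall x, In x (fib f U y) <-> Om x /\ f x = y.
Proof.
  intros Hy. assert (Ky := proj1 Hy). assert (Ny := proj2 (lf_regular y w0 Hy w0_D)). rewrite (proj2 (lf_spec y Hy)) in Ny.
  destruct (fib_spec f U V H y (V_of_U f U V H _ (KJ_U f U y Ky)) Ny) as [N1 N2]. split; [easy|]. intros x. rewrite N2. split.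
  - intros [Ux Ex]. split; [|easy]. split; [apply KJ_iff; now rewrite Ex|]. destruct Hy as (_ & k & j & E0). exists (S k), j. now rewrite iter_succ, Ex.
  - intros [Hx Ex]. split; [now apply (KJ_U f U), Hx|easy].
Qed.

Lemma fib_lf y w : Om y -> E w -> Permutation (fib f U (lf y w)) (map (fun p => lf p w) (fib f U y)).
Proof.
  intros Hy Hw. assert (Hd := E_D w Hw). destruct (fib_Om y Hy) as [N1 N2].
  destruct (fib_spec f U V H (lf y w)) as [M1 M2]; [now apply (V_of_U f U V H), (KJ_U f U), lf_K|now apply lf_regular|].
  apply NoDup_Permutation; [easy| |].
  - apply NoDup_map_NoDup_ForallPairs; [|easy]. intros a b Ha Hb Eab. apply N2 in Ha, Hb. now apply (lf_inj a b w w).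
  - intros x. rewrite M2, in_map_iff. split.
    + intros [Ux Ex]. destruct (lf_fiber y w x Hy Hd Ux Ex) as (p & Hp & Ep & Elp). exists p. split; [easy|]. now apply N2.
    + intros [p [<- Hp]]. apply N2 in Hp. destruct Hp as [Hp Ep]. split; [now apply (KJ_U f U), lf_K|]. now rewrite lf_f, Ep.
Qed.

Lemma beltrami_invariant : exists mu, 0 <= mu /\ forall w, E w -> invariant_functional f U (beltrami w) (fun z => exists p, Om p /\ lf p w = z) mu.
Proof.
  destruct term_bound as (mu & Hmu0 & Hmu). exists mu. split; [easy|]. intros w Hw. assert (Hd := E_D w Hw). split.
  - intros z (p & Hp & <-). split; [now apply lf_K|now apply lf_regular].
  - intros q q' E0. unfold beltrami. f_equal. apply functional_extensionality. intros L. apply propositional_extensionality.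
    split; apply usum_ext; intros p Hp; unfold term; rewrite E0; try easy; now exists p.
  - intros q q' Hq Hq'. apply (usum_unique Om (term w (fun z => q z + q' z)%C)).
    + apply beltrami_spec; [easy|]. destruct Hq as [B [HB HB1]], Hq' as [B' [HB' HB1']]. exists (B + B'). split; [lra|].
      intros z Hz. eapply Rle_trans; [apply Cmod_triangle|]. apply Rplus_le_compat; auto.
    + apply (usum_ext _ (fun p => term w q p + term w q' p)%C); [intros p _; unfold term; ring|]. apply usum_plus; now apply beltrami_spec.
  - intros k q Hq. apply (usum_unique Om (term w (fun z => k * q z)%C)).
    + apply beltrami_spec; [easy|]. destruct Hq as [B [HB HB1]]. exists (Cmod k * B). split; [apply Rmult_le_pos; [apply Cmod_ge_0|easy]|].
      intros z Hz. rewrite Cmod_mult. apply Rmult_le_compat_l; [apply Cmod_ge_0|auto].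
    + apply (usum_ext _ (fun p => k * term w q p)%C); [intros p _; unfold term; ring|]. apply usum_scal; now apply beltrami_spec.
  - intros q B HB. apply (usum_bound Om (term w q)); [intros l Hl; now apply Hmu|]. apply beltrami_spec; [easy|].
    exists B. split; [|easy]. eapply Rle_trans; [apply Cmod_ge_0|apply (HB w0), Om_w0].
  (* Regrouping the sum by fibres and applying the chain rule [D1_f] turns it into the sum of
     traces; the squares of the derivatives match the factor [1 / f'^2]. *)
  - intros Q G HQ HG E0. apply (usum_unique Om (term w G)); [|now apply beltrami_spec].
    apply (usum_ext _ (fun y => csum (term w Q) (fib f U y))); [|apply (usum_fiber Om f); [apply Om_f|apply fib_Om|now apply beltrami_spec]].
    intros y Hy. unfold term at 2. rewrite (E0 (lf y w)) by now exists y. unfold trace. rewrite (csum_perm _ _ _ (fib_lf y w Hy Hw)), csum_map, <- csum_scal.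
    apply csum_ext. intros p Hp. apply (fib_Om y Hy) in Hp. destruct Hp as [Hp <-]. rewrite D1_f by easy. unfold term. field. now apply lf_regular.
Qed.

Lemma beltrami_tail w e : E w -> 0 < e -> exists l0, fin Om l0 /\ forall a l, ~ K a -> fin Om l -> incl l0 l ->
  Cmod (csum (term w (fun z => / (z - a))%C) l - beltrami w (fun z => / (z - a))%C) <= e.
Proof.
  intros Hw He. set (k := (1024 / R) * (1024 / R)). assert (Hk : 0 < k) by (assert (0 < 1024 / R) by (apply Rdiv_lt_0_compat; lra); unfold k; nra).
  destruct (lf_tail w (e / k) Hw) as [l0 [F0 Hl0]]; [now apply Rdiv_lt_0_compat|]. exists l0. split; [easy|]. intros a l Ha Hl Hi.
  assert (HB : Bd f U (fun z => / (z - a))%C).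
  { apply (hol_Bd f U V H _ K); [easy|]. apply hol_inv; [apply hol_minus; [apply hol_id|apply hol_const]|]. intros z Hz. apply sub_neq_0. now intros ->. }
  apply le_epsilon. intros d Hd. destruct (beltrami_spec w _ Hw HB d Hd) as [l1 [F1 Hl1]].
  destruct (fin_union Om l l1 Hl F1) as [l2 [F2 [I1 I2]]]. specialize (Hl1 l2 F2 I2).
  eapply Rle_trans; [apply (Cmod_tri _ (csum (term w (fun z => / (z - a))%C) l2))|]. apply Rplus_le_compat; [|lra].
  eapply Rle_trans; [apply (csum_diff Om); easy|].
  assert (Z : minus_list l l2 = nil).
  { destruct (minus_list l l2) as [|x q] eqn:Eq; [easy|]. assert (X : In x (minus_list l l2)) by (rewrite Eq; now left).
    apply minus_list_in in X. destruct X as [X1 X2]. exfalso. apply X2, I1, X1. }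
  rewrite Z. simpl rsum at 1. rewrite Rplus_0_l.
  apply Rle_trans with (rsum (fun p => k * (rad w p * rad w p / Cmod (lf p w - a))) (minus_list l2 l)).
  - apply rsum_le. intros p Hp. apply minus_list_in in Hp. destruct Hp as [Hp _]. rewrite term_mod. fold k. right. f_equal. rewrite Cmod_inv; [easy|].
    apply sub_neq_0. intros Ea. apply Ha. rewrite <- Ea. apply lf_K; [now apply F2|now apply E_D].
  - rewrite rsum_scal. assert (X : rsum (fun p => rad w p * rad w p / Cmod (lf p w - a)) (minus_list l2 l) <= e / k).
    { apply Hl0; [easy|now apply fin_minus|]. intros x Hx Hx0. apply minus_list_in in Hx. now apply (proj2 Hx), Hi. }
    apply Rle_trans with (k * (e / k)); [apply Rmult_le_compat_l; lra|right; field; lra].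
Qed.

(** * The contradiction at the boundary of the component *)

Lemma distinct_points n : exists ws : list C, NoDup ws /\ length ws = n /\ forall w, In w ws -> E w.
Proof.
  set (g := fun k : nat => (w0 + RtoC (R / 4 / (INR k + 1)))%C).
  assert (P : forall k : nat, 0 < R / 4 / (INR k + 1) <= R / 4).
  { intros k. assert (X := pos_INR k). split; [apply Rdiv_lt_0_compat; lra|]. apply Rmult_le_reg_r with (INR k + 1); [lra|].
    unfold Rdiv. rewrite Rmult_assoc, Rinv_l by lra. nra. }
  exists (map g (seq 0 n)). split; [|split; [now rewrite length_map, length_seq|]].
  - apply Injective_map_NoDup; [|apply seq_NoDup]. intros i j Eq. unfold g in Eq.
    assert (X : R / 4 / (INR i + 1) = R / 4 / (INR j + 1)) by (apply RtoC_inj; now apply (f_equal (fun z => z - w0)%C) in Eq; ring_simplify in Eq).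
    assert (Xi := pos_INR i). assert (Xj := pos_INR j). apply INR_eq. apply (f_equal (fun x => R / 4 / x)) in X. field_simplify in X; lra.
  - intros w Hw. apply in_map_iff in Hw. destruct Hw as [k [<- _]]. unfold cdisk, g. specialize (P k).
    replace (w0 + RtoC (R / 4 / (INR k + 1)) - w0)%C with (RtoC (R / 4 / (INR k + 1))) by ring. rewrite Cmod_RtoC_pos; lra.
Qed.

Lemma hol_csum {A} (g : A -> C -> C) O l : (forall x, In x l -> hol (g x) O) -> hol (fun y => csum (fun x => g x y) l) O.
Proof. intros Hg z Hz. apply cder_csum. intros x Hx. now apply Hg. Qed.

Lemma csum_invariant (c : C -> C) mu ws : 0 <= mu -> (forall w, In w ws -> E w) ->
  (forall w, E w -> invariant_functional f U (beltrami w) (fun z => exists p, Om p /\ lf p w = z) mu) ->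
  invariant_functional f U (fun q => csum (fun w => c w * beltrami w q)%C ws) (fun z => exists p w, In w ws /\ Om p /\ lf p w = z) (rsum (fun w => Cmod (c w) * mu) ws).
Proof.
  intros Hmu Hws Hinv. split.
  - intros z (p & w & Hw & Hp & <-). apply (if_carrier _ _ _ _ _ (Hinv w (Hws w Hw))). now exists p.
  - intros q q' Eq. apply csum_ext. intros w Hw. f_equal. apply (if_ext _ _ _ _ _ (Hinv w (Hws w Hw))). intros z [p [Hp Ez]]. apply Eq. now exists p, w.
  - intros q q' Hq Hq'. rewrite <- csum_plus. apply csum_ext. intros w Hw. rewrite (if_plus _ _ _ _ _ (Hinv w (Hws w Hw)) q q' Hq Hq'). ring.
  - intros k q Hq. rewrite <- csum_scal. apply csum_ext. intros w Hw. rewrite (if_scal _ _ _ _ _ (Hinv w (Hws w Hw)) k q Hq). ring.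
  - intros q B HB. eapply Rle_trans; [apply csum_mod|]. rewrite Rmult_comm, <- rsum_scal. apply rsum_le. intros w Hw. rewrite Cmod_mult.
    replace (B * (Cmod (c w) * mu)) with (Cmod (c w) * (mu * B)) by ring. apply Rmult_le_compat_l; [apply Cmod_ge_0|].
    now apply (if_bound _ _ _ _ _ (Hinv w (Hws w Hw))).
  - intros Q G HQ HG Eq. apply csum_ext. intros w Hw. f_equal. apply (if_push _ _ _ _ _ (Hinv w (Hws w Hw))); [easy|easy|].
    intros y (p & Hp & Ey). apply Eq. now exists p, w.
Qed.

Lemma csum_tail (c : C -> C) ws : (forall w, In w ws -> E w) -> forall e, 0 < e -> exists l0, fin Om l0 /\ forall a l, ~ K a -> fin Om l -> incl l0 l ->
  Cmod (csum (fun w => c w * csum (term w (fun z => / (z - a))%C) l)%C ws - csum (fun w => c w * beltrami w (fun z => / (z - a))%C)%C ws) <= e.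
Proof.
  induction ws as [|w ws IH]; intros Hws e He.
  - exists nil. split; [apply fin_nil|]. intros a l _ _ _. simpl. rewrite Cmod_diag. lra.
  - destruct (IH (fun v Hv => Hws v (or_intror Hv)) (e / 2)) as [l1 [F1 H1]]; [lra|]. assert (Hc := Cmod_ge_0 (c w)).
    destruct (beltrami_tail w (e / 2 / (Cmod (c w) + 1)) (Hws w (or_introl eq_refl))) as [l2 [F2 H2]]; [apply Rdiv_lt_0_compat; lra|].
    destruct (fin_union Om l1 l2 F1 F2) as [l0 [F0 [I1 I2]]]. exists l0. split; [easy|]. intros a l Ha Hl Hi.
    specialize (H1 a l Ha Hl (fun x Hx => Hi x (I1 x Hx))). specialize (H2 a l Ha Hl (fun x Hx => Hi x (I2 x Hx))). cbn [csum].
    set (q := fun z => (/ (z - a))%C) in *. set (S := csum (fun w => c w * csum (term w q) l)%C ws) in *. set (S' := csum (fun w => c w * beltrami w q)%C ws) in *.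
    replace (c w * csum (term w q) l + S - (c w * beltrami w q + S'))%C with (c w * (csum (term w q) l - beltrami w q) + (S - S'))%C by ring.
    eapply Rle_trans; [apply Cmod_triangle|]. rewrite Cmod_mult.
    assert (X : Cmod (c w) * Cmod (csum (term w q) l - beltrami w q) <= e / 2); [|lra].
    apply Rle_trans with ((Cmod (c w) + 1) * (e / 2 / (Cmod (c w) + 1))); [|right; field; lra]. apply Rmult_le_compat; try easy; try apply Cmod_ge_0; lra.
Qed.

(** If a disk about a boundary point were inside [K], the component would absorb it. *)
Lemma boundary_not_K b e : c_boundary (W 0%nat) b -> 0 < e -> exists a, Cmod (a - b) < e /\ ~ K a.
Proof.
  intros [B1 B2] He. apply NNPP. intros Hno. apply B2.
  assert (S : subset (cdisk b e) (c_interior K)).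
  { intros z Hz. destruct (cdisk_open b e z Hz) as [r [Hr Sr]]. exists r. split; [easy|]. intros y Hy. apply NNPP. intros Ny. apply Hno. exists y. split; [now apply Sr|easy]. }
  destruct (B1 e He) as [v [Hv Hd]]. exists e. split; [easy|].
  apply (component_absorb _ _ (cdisk b e) v (HW 0)); [apply convex_connected, cdisk_convex|easy|easy|exact Hd].
Qed.

Lemma roots_poly_remove ws w a : NoDup ws -> In w ws -> roots_poly ws a = ((a - w) * roots_poly (remove C_dec w ws) a)%C.
Proof.
  induction 1 as [|x ws Hx Hn IH]; [intros []|]. intros [->|Hw]; simpl remove.
  - destruct (C_dec w w); [|easy]. now rewrite notin_remove.
  - destruct (C_dec w x) as [->|Hne]; [contradiction|]. unfold roots_poly in *. simpl. rewrite (IH Hw). ring.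
Qed.

Lemma roots_poly_root ws a : roots_poly ws a = 0%C <-> In a ws.
Proof.
  induction ws as [|x ws IH]; unfold roots_poly in *; simpl; [split; [intros E0; apply RtoC_inj in E0; lra|easy]|]. split.
  - intros E0. destruct (classic (x = a)) as [?|Hn]; [now left|right]. apply IH. apply NNPP. intros Hz. revert E0. apply Cmult_neq_0; [|easy].
    apply sub_neq_0. now intros ->.
  - intros [->|Ha]; [|apply IH in Ha; rewrite Ha]; ring.
Qed.

(* The potential of the combined deformation vanishes off [K], so by the maximum principle it is small on the
   component containing the points of [ws], although it has poles there. *)
Theorem wandering_disk_false : False.
Proof.
  destruct (transfer_kill f U V H) as (Test & TB & Kill). destruct beltrami_invariant as (mu & Hmu & Hinv).
  destruct (distinct_points (S (length Test))) as (ws & Nws & Lws & Ews).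
  destruct (underdetermined (map (fun t w => beltrami w t) Test) ws Nws) as (c & (w1 & Hw1 & Hc1) & Hc); [rewrite length_map; lia|].
  assert (Zero : forall a, ~ K a -> csum (fun w => c w * beltrami w (fun z => / (z - a))%C)%C ws = 0%C).
  { apply (Kill (fun q => csum (fun w => c w * beltrami w q)%C ws) (fun z => exists p w, In w ws /\ Om p /\ lf p w = z) (rsum (fun w => Cmod (c w) * mu) ws)).
    - apply rsum_nonneg. intros w _. apply Rmult_le_pos; [apply Cmod_ge_0|easy].
    - now apply csum_invariant.
    - intros t Ht. apply (Hc (fun w => beltrami w t)). now apply (in_map (fun t w => beltrami w t)). }
  assert (Ew : forall w, In w ws -> W 0%nat w) by (intros w Hw; now apply D_free, E_D, Ews).
  assert (WB : c_bounded (W 0%nat)) by (destruct (compact_bounded _ (KJ_compact f U V H)) as [M HM]; exists M; intros z Hz; apply HM, (W_K 0), Hz).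
  assert (Wcl := closure_compact _ WB).
  destruct (compact_bounded _ (compact_image _ (roots_poly ws) Wcl (fun z _ => hol_ccont _ (fun _ => True) z (hol_roots_poly ws _) I))) as [M HM].
  assert (HM1 : forall z, c_closure (W 0%nat) z -> Cmod (roots_poly ws z) <= M) by (intros z Hz; apply HM; now exists z).
  (* The numerator of the rational function [Rat] over the common denominator [roots_poly ws]; at
     [w1] only the term of [w1] survives. *)
  set (Q := fun a => csum (fun w => - c w * roots_poly (remove C_dec w ws) a)%C ws).
  assert (HQ : hol Q (fun _ => True)).
  { apply (hol_csum (fun w a => - c w * roots_poly (remove C_dec w ws) a)%C). intros w _. apply hol_mult; [apply hol_const|apply hol_roots_poly]. }
  assert (Q1 : Q w1 = (- c w1 * roots_poly (remove C_dec w1 ws) w1)%C).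
  { unfold Q. destruct (in_split w1 ws Hw1) as (l1 & l2 & E0). rewrite E0 at 1. rewrite csum_app. cbn [csum].
    rewrite (csum_0 _ l1), (csum_0 _ l2); [ring| |]; intros w Hw; replace (roots_poly (remove C_dec w ws) w1) with (RtoC 0); try ring;
      symmetry; apply roots_poly_root, in_in_remove; try easy; intros <-; rewrite E0 in Nws; apply NoDup_remove_2 in Nws; apply Nws, in_app_iff; tauto. }
  assert (Q1n : Q w1 <> 0%C).
  { rewrite Q1. apply Cmult_neq_0; [intros E0; apply Hc1; replace (c w1) with (- (- c w1))%C by ring; rewrite E0; ring|].
    intros E0. apply roots_poly_root in E0. now apply (remove_In C_dec ws w1). }
  apply Q1n. apply Cmod_eq_of_small. intros e He. replace (Q w1 - 0)%C with (Q w1) by ring.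
  assert (M0 : 0 <= M) by (eapply Rle_trans; [apply Cmod_ge_0|apply (HM1 w0), subset_closure, D_free, w0_D]).
  destruct (csum_tail c ws Ews (e / (M + 1))) as [l0 [F0 Hl0]]; [apply Rdiv_lt_0_compat; lra|].
  set (e' := e / (M + 1)) in *. assert (He' : 0 < e') by (apply Rdiv_lt_0_compat; lra).
  (* The orbit point [w0] is split off: its branch is the identity and gives the poles [Rat], while
     the other branches give [F], holomorphic on the closure of [W 0]. *)
  set (l := minus_list l0 (w0 :: nil)).
  assert (Fl : fin Om (w0 :: l)).
  { destruct (fin_minus Om l0 (w0 :: nil) F0) as [X1 X2]. split.
    - constructor; [|easy]. intros K0. apply minus_list_in in K0. apply (proj2 K0). now left.
    - intros x [<-|Hx]; [apply Om_w0|now apply X2]. }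
  assert (Il : incl l0 (w0 :: l)).
  { intros x Hx. destruct (C_dec w0 x) as [->|Hn]; [now left|right]. apply minus_list_in. split; [easy|]. intros [K0|[]]. contradiction. }
  assert (Ol : forall p, In p l -> Om p) by (intros p Hp; apply Fl; now right).
  assert (Nl : forall p, In p l -> p <> w0) by (intros p Hp ->; apply minus_list_in in Hp; apply (proj2 Hp); now left).
  set (F := fun a => csum (fun w => c w * csum (term w (fun z => / (z - a))%C) l)%C ws).
  assert (HF : hol F (c_closure (W 0%nat))).
  { apply (hol_csum (fun w a => c w * csum (term w (fun z => / (z - a))%C) l)%C). intros w Hw. apply hol_mult; [apply hol_const|].
    apply (hol_csum (fun p a => term w (fun z => / (z - a))%C p)). intros p Hp. apply hol_mult; [apply hol_const|].
    apply hol_inv; [apply hol_minus; [apply hol_const|apply hol_id]|]. intros a Ha. apply sub_neq_0. intros <-.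
    apply (Nl p Hp). apply (lf_closure p w); [now apply Ol|now apply E_D, Ews|easy]. }
  set (Rat := fun a => csum (fun w => c w * / (w - a))%C ws).
  assert (Val : forall a, csum (fun w => c w * csum (term w (fun z => / (z - a))%C) (w0 :: l))%C ws = (F a + Rat a)%C).
  { intros a. unfold F, Rat. rewrite <- csum_plus. apply csum_ext. intros w Hw. cbn [csum]. unfold term at 1.
    rewrite (D1_w0 w (Ews w Hw)), (lf_w0 w (E_D w (Ews w Hw))). ring. }
  assert (Bnd : forall b, c_boundary (W 0%nat) b -> Cmod (F b + Rat b) <= e').
  { intros b Hb. assert (Nb : ~ W 0%nat b) by (intros K0; apply Hb; now apply (W_open 0)).
    assert (Cb : ccont (fun a => F a + Rat a)%C b).
    { apply ccont_plus; [apply (hol_ccont F _ b HF), Hb|]. apply (hol_ccont Rat (fun a => a = b)); [|easy].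
      apply (hol_csum (fun w a => c w * / (w - a))%C). intros w Hw. apply hol_mult; [apply hol_const|].
      apply hol_inv; [apply hol_minus; [apply hol_const|apply hol_id]|]. intros a ->. apply sub_neq_0. intros ->. now apply Nb, Ew. }
    apply le_epsilon. intros d Hd. destruct (Cb d Hd) as [r [Hr Kr]]. destruct (boundary_not_K b r Hb Hr) as [a [Hab Na]].
    specialize (Kr a Hab). specialize (Hl0 a _ Na Fl Il). rewrite Val, (Zero a Na) in Hl0.
    replace (F a + Rat a - 0)%C with (F a + Rat a)%C in Hl0 by ring.
    assert (T := Cmod_ge_sub (F b + Rat b) (F a + Rat a)). rewrite Cmod_sym in T. lra. }
  assert (HH : hol (fun a => F a * roots_poly ws a + Q a)%C (c_closure (W 0%nat))).
  { apply hol_plus; [apply hol_mult; [easy|apply hol_roots_poly]|now apply (hol_sub Q (fun _ => True))]. }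
  (* On the boundary the function equals [roots_poly ws * (F + Rat)], which is small; at [w1] the
     first summand vanishes and only [Q w1] is left. *)
  assert (Max := max_modulus (fun a => F a * roots_poly ws a + Q a)%C (W 0%nat) (M * e') WB (W_open 0) (hol_sub _ _ _ HH (subset_closure _)) (fun z Hz => hol_ccont _ _ z HH Hz)).
  assert (X : Cmod (F w1 * roots_poly ws w1 + Q w1) <= M * e').
  { apply Max; [|now apply Ew]. intros b Hb. assert (Nb : ~ W 0%nat b) by (intros K0; apply Hb; now apply (W_open 0)).
    assert (EQ : Q b = (Rat b * roots_poly ws b)%C).
    { unfold Rat. rewrite Cmult_comm, <- csum_scal. apply csum_ext. intros w Hw. rewrite (roots_poly_remove ws w b Nws Hw). field.
      apply sub_neq_0. intros ->. now apply Nb, Ew. }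
    rewrite EQ. replace (F b * roots_poly ws b + Rat b * roots_poly ws b)%C with (roots_poly ws b * (F b + Rat b))%C by ring. rewrite Cmod_mult.
    apply Rmult_le_compat; try apply Cmod_ge_0; [apply HM1, Hb|now apply Bnd]. }
  rewrite (proj2 (roots_poly_root ws w1) Hw1) in X. replace (F w1 * 0 + Q w1)%C with (Q w1) in X by ring.
  eapply Rle_trans; [exact X|]. unfold e'. apply Rle_trans with ((M + 1) * (e / (M + 1))); [|right; field; lra].
  apply Rmult_le_compat_r; [now apply Rlt_le|lra].
Qed.
End Lifting.

Theorem no_wandering_sequence f U V (W : nat -> C -> Prop) : box_map f U V ->
  (forall n, is_component (c_interior (KJ f U)) (W n)) -> (forall n z, W n z -> W (S n) (f z)) ->
  (forall i j z, W i z -> W j z -> i = j) -> False.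
Proof.
  intros H HW HWf HWd. destruct (crit_finite f U V H) as [cl [_ Hcl]].
  (* A critical point lies in at most one [W n], so from some [N] on the [W n] contain none. *)
  assert (Late : forall l : list C, exists N, forall c n, In c l -> (N <= n)%nat -> ~ W n c).
  { induction l as [|c l [N HN]]; [exists O; intros c n []|].
    destruct (classic (exists n, W n c)) as [[k Hk]|Hno].
    - exists (Nat.max N (S k)). intros c' n [<-|Hc] Hn; [|apply HN; [easy|lia]]. intros Hw. assert (X := HWd _ _ _ Hk Hw). lia.
    - exists N. intros c' n [<-|Hc] Hn; [|now apply HN]. intros Hw. apply Hno. now exists n. }
  destruct (Late cl) as [N HN]. set (W' := fun n => W (N + n)%nat).
  assert (A1 : forall n, is_component (c_interior (KJ f U)) (W' n)) by (intros n; apply HW).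
  assert (A2 : forall n z, W' n z -> W' (S n) (f z)) by (intros n z Hz; unfold W'; rewrite Nat.add_succ_r; now apply HWf).
  assert (A3 : forall i j z, W' i z -> W' j z -> i = j) by (intros i j z X Y; assert (Z := HWd _ _ _ X Y); lia).
  assert (A4 : forall n z, W' n z -> Dv f z <> 0%C).
  { intros n z Hz D. apply (HN z (N + n)%nat); [|lia|exact Hz]. apply Hcl. split; [|easy]. apply (KJ_U f U), (c_interior_sub (KJ f U)).
    now apply (proj1 (proj2 (HW (N + n)%nat))). }
  destruct (free_disk f U V H W' A1 A2 A3 A4) as (w0 & R & HR & Hfree).
  exact (wandering_disk_false f U V H W' A1 A2 A3 A4 w0 R HR Hfree).
Qed.

(** * Jordan domains *)

Lemma jordan_curve_continuum J : jordan_curve J -> c_compact J /\ c_connected J /\ exists z, J z.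
Proof.
  intros (g & Hg & _ & _ & HJ). set (I := fun z : C => Im z = 0 /\ 0 <= Re z <= 1). set (G := fun z : C => g (Re z)).
  assert (GC : forall z, I z -> ccont G z).
  { intros z _ e He. destruct (Hg (Re z) e He) as [d [Hd Kd]]. exists d. split; [easy|]. intros w Hw. apply Kd.
    eapply Rle_lt_trans; [apply (re_le_Cmod (w - z))|easy]. }
  assert (EJ : J = image G I).
  { apply functional_extensionality. intros z. apply propositional_extensionality. eapply iff_trans; [apply HJ|]. split.
    - intros [t [Ht <-]]. exists (t, 0). now split.
    - intros [w [[_ Hw] <-]]. now exists (Re w). }
  assert (Dst : forall z w : C, Rabs (Re z - Re w) <= Cmod (z - w) /\ Rabs (Im z - Im w) <= Cmod (z - w)).
  { intros z w. split; [apply (re_le_Cmod (z - w))|apply (im_le_Cmod (z - w))]. }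
  assert (IC : c_compact I).
  { apply heine_borel.
    - assert (X : forall z, (forall e, 0 < e -> exists w, I w /\ Cmod (w - z) < e) -> forall e, 0 < e -> Rabs (Im z) < e /\ - e < Re z < 1 + e).
      { intros z Hz e He. destruct (Hz e He) as [w [[W1 W2] Hd]]. destruct (Dst w z) as [D1 D2]. apply Rabs_le_between in D1, D2. rewrite W1 in D2.
        split; [apply Rabs_def1|]; lra. }
      intros z Hz. specialize (X z Hz). split.
      + apply Rabs_eq_0. apply Rle_antisym; [|apply Rabs_pos]. apply le_epsilon. intros e He. destruct (X e He). lra.
      + split; apply le_epsilon; intros e He; destruct (X e He); lra.
    - exists 1. intros z [Z1 Z2]. eapply Rle_trans; [apply Cmod_le_ReIm|]. rewrite Z1, Rabs_R0, Rabs_pos_eq; lra. }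
  assert (IX : convex I).
  { intros a b t [A1 A2] [B1 B2] Ht. unfold I in *. destruct a as [a1 a2], b as [b1 b2]. unfold seg, RtoC, Cplus, Cminus, Copp, Cmult, Re, Im in *. simpl in *. subst. split; [ring|]. nra. }
  rewrite EJ. split; [now apply compact_image|]. split; [apply image_connected; [easy|now apply convex_connected]|].
  exists (G 0%C), 0%C. split; [|easy]. unfold I. simpl. lra.
Qed.

(** The complement of [D] is the curve together with the other components of its complement. Each of
    these accumulates on the curve, since otherwise it would be clopen, so the connected curve holds
    them all together. *)
Lemma jordan_domain_piece D : jordan_domain D -> c_open D /\ c_connected (fun z => ~ D z) /\ ~ c_bounded (fun z => ~ D z).
Proof.
  intros (J & HJ & [M HM] & HD). destruct (jordan_curve_continuum J HJ) as (Jc & Jcon & [j0 Hj0]).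
  assert (JO : c_open (fun z => ~ J z)) by now apply closed_compl_open, compact_closed.
  assert (DO := component_open _ _ JO HD). split; [easy|]. split.
  - assert (Side : forall O1 O2, c_open O1 -> c_open O2 -> subset (fun z => ~ D z) (fun z => O1 z \/ O2 z) -> (forall z, ~ (~ D z /\ O1 z /\ O2 z)) ->
      subset J O1 -> subset (fun z => ~ D z) O1).
    { intros O1 O2 H1 H2 Hcov Hdis HJ1 x Hx. apply NNPP. intros Nx.
      assert (Nj : ~ J x) by (intros K; apply Nx; now apply HJ1).
      destruct (component_exists (fun z => ~ J z) x Nj) as [P [HP Px]].
      assert (PD : forall z, P z -> ~ D z) by (intros z Pz Dz; apply Hx; now apply (component_eq _ P D z HP HD Pz Dz)).
      assert (P2 : subset P O2).
      { destruct (proj1 (proj2 (proj2 HP)) O1 O2 H1 H2) as [K|K]; [intros z Hz; apply Hcov; auto|intros z (X & Y); apply (Hdis z); auto|exfalso; now apply Nx, K|easy]. }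
      assert (PO := component_open _ _ JO HP).
      assert (PC : c_open (fun z => ~ P z)).
      { apply closed_compl_open. intros y Hy. destruct (classic (J y)) as [Jy|Jy].
        - exfalso. destruct (H1 y (HJ1 y Jy)) as [e [He Se]]. destruct (Hy e He) as [v [Pv Hv]]. apply (Hdis v). split; [auto|]. split; [now apply Se|auto].
        - destruct (JO y Jy) as [e [He Se]]. destruct (Hy e He) as [v [Pv Hv]].
          apply (component_absorb _ _ (cdisk y e) v HP); [apply convex_connected, cdisk_convex|easy|easy|exact Hv|now apply cdisk_center]. }
      destruct (convex_connected (fun _ => True) (fun _ _ _ _ _ _ => I) P (fun z => ~ P z) PO PC) as [K|K].
      - intros z _. apply classic.
      - intros z (_ & X & Y). contradiction.
      - assert (X := K j0 I). now apply (proj1 (proj2 HP)) in X.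
      - now apply (K x I). }
    intros O1 O2 H1 H2 Hcov Hdis.
    assert (JD : forall z, J z -> ~ D z) by (intros z Jz Dz; now apply (proj1 (proj2 HD)) in Dz).
    destruct (Jcon O1 O2 H1 H2) as [K|K]; [intros z Hz; apply Hcov; auto|intros z (X & Y); apply (Hdis z); auto| |].
    + left. now apply (Side O1 O2).
    + right. apply (Side O2 O1); try easy; [intros z Hz; destruct (Hcov z Hz); [now right|now left]|]. intros z (X & Y & Z). now apply (Hdis z).
  - intros [M' HM']. set (z := RtoC (Rmax 0 (Rmax M M') + 1)).
    assert (X1 := Rmax_l 0 (Rmax M M')). assert (X2 := Rmax_r 0 (Rmax M M')). assert (X3 := Rmax_l M M'). assert (X4 := Rmax_r M M').
    assert (E : Cmod z = Rmax 0 (Rmax M M') + 1) by (apply Cmod_RtoC_pos; lra).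
    destruct (classic (D z)) as [K|K]; [assert (Y := HM z K)|assert (Y := HM' z K)]; lra.
Qed.

Lemma union_below_open n (W : nat -> C -> Prop) : (forall i, (i < n)%nat -> c_open (W i)) -> c_open (union_below n W).
Proof. intros HW z [i [Hi Hz]]. destruct (HW i Hi z Hz) as [e [He Se]]. exists e. split; [easy|]. intros y Hy. exists i. auto. Qed.

Theorem theorem2p2
  (n m : nat) (V U : nat -> C -> Prop) (f : C -> C)
  (* V = disjoint union of n Jordan domains with pairwise disjoint quasicircle boundaries *)
  (HVj : forall i, (i < n)%nat -> jordan_domain (V i) /\ quasicircle (c_boundary (V i)))
  (HVd : forall i j, (i < n)%nat -> (j < n)%nat -> i <> j ->
           forall z, ~ (V i z /\ V j z))
  (HVb : forall i j, (i < n)%nat -> (j < n)%nat -> i <> j ->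
           forall z, ~ (c_boundary (V i) z /\ c_boundary (V j) z))
  (* U = union of m Jordan domains with pairwise disjoint closures *)
  (HUj : forall j, (j < m)%nat -> jordan_domain (U j))
  (HUd : forall i j, (i < m)%nat -> (j < m)%nat -> i <> j ->
           forall z, ~ (c_closure (U i) z /\ c_closure (U j) z))
  (* U compactly contained in V *)
  (HUV : c_compact (c_closure (union_below m U)) /\
         subset (c_closure (union_below m U)) (union_below n V))
  (* f : U -> V proper holomorphic *)
  (Hhol : holomorphic_on f (union_below m U))
  (Hprop : proper_map f (union_below m U) (union_below n V))
  (* all critical points lie in K_f *)
  (Hcrit : forall z, critical_point f (union_below m U) z ->
             filled_julia f (union_below m U) z)
  (* each V_i contains at most one component of K_f containing critical points *)
  (Hone : forall i, (i < n)%nat -> forall K1 K2 : C -> Prop,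
     is_component (filled_julia f (union_below m U)) K1 ->
     is_component (filled_julia f (union_below m U)) K2 ->
     subset K1 (V i) -> subset K2 (V i) ->
     (exists c, K1 c /\ critical_point f (union_below m U) c) ->
     (exists c, K2 c /\ critical_point f (union_below m U) c) ->
     same_set K1 K2)
  (* f maps each component of int K_f onto a component of int K_f *)
  (Hint : forall K : C -> Prop,
     is_component (c_interior (filled_julia f (union_below m U))) K ->
     is_component (c_interior (filled_julia f (union_below m U))) (image f K)) :
  ~ (exists K : C -> Prop,
       is_component (c_interior (filled_julia f (union_below m U))) K /\
       forall i j : nat, i <> j ->
         forall w, ~ (image (Nat.iter i f) K w /\ image (Nat.iter j f) K w)).
Proof.
  intros [K [HK Hdis]].
  assert (Uo : c_open (union_below m U)) by (apply union_below_open; intros i Hi; now apply jordan_domain_piece, HUj).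
  assert (Hh : hol f (union_below m U)) by (intros z Hz; destruct (Hhol z Hz) as [l Hl]; exists l; now apply C_deriv_cder).
  assert (Hbox : box_map f (union_below m U) (union_below n V)).
  { split; try easy.
    - apply union_below_open. intros i Hi. now apply jordan_domain_piece, HVj.
    - apply Hprop.
    - apply Hprop.
    - intros z [i [Hi Hz]]. destruct (jordan_domain_piece _ (HUj i Hi)) as (P1 & P2 & P3). exists (U i). split; [easy|].
      split; [intros w Hw; now exists i|]. split; [easy|]. split; [|easy].
      (* Disjoint closures separate the pieces, so [U] minus one piece is open. *)
      intros w [[j [Hj Hw]] Hn]. destruct (proj1 (jordan_domain_piece _ (HUj j Hj)) w Hw) as [e [He Se]]. exists e. split; [easy|].
      intros y Hy. split; [exists j; auto|]. intros Hy2. apply (HUd i j Hi Hj) with (z := y); [intros ->; contradiction|].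
      split; apply subset_closure; auto.
    - intros z Uz Dz. apply Hcrit. split; [easy|]. apply C_deriv_cder. rewrite <- Dz. apply Dv_spec. now apply Hh. }
  apply (no_wandering_sequence f _ _ (fun i => image (Nat.iter i f) K) Hbox).
  - induction n0 as [|i IH].
    + replace (image (Nat.iter 0 f) K) with K; [exact HK|]. apply functional_extensionality. intros z. apply propositional_extensionality.
      split; [intros Hz; now exists z|intros [w [Hw <-]]; exact Hw].
    + replace (image (Nat.iter (S i) f) K) with (image f (image (Nat.iter i f) K)); [now apply Hint|].
      apply functional_extensionality. intros z. apply propositional_extensionality. split.
      * intros [w [[v [Hv <-]] <-]]. now exists v.
      * intros [v [Hv <-]]. exists (Nat.iter i f v). split; [now exists v|easy].
  - intros i z [w [Hw <-]]. now exists w.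
  - intros i j z X Y. apply NNPP. intros Hn. now apply (Hdis i j Hn z).
Qed.
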